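(* Let $\Omega\subseteq\mathbb{R}^d$ be open, $1<p<\infty$, $p'=p/(p-1)$, and let $\vec a:\Omega\times\mathbb{R}^d\to\mathbb{R}^d$ and $\mathcal{A}:\Omega\times\mathbb{R}^d\to\mathbb{R}$ be Carathéodory functions such that, for a.e. $x\in\Omega$ and all $\xi,\xi_1,\xi_2\in\mathbb{R}^d$, $$\vec a(x,0)=0,$$ $$|\vec a(x,\xi)|\le a_0(x)|\xi|^{p-1}+a_1(x),$$ $$\vec a(x,\xi)\cdot\xi\ge\eta|\xi|^p-a_2(x),$$ $$(\vec a(x,\xi_1)-\vec a(x,\xi_2))\cdot(\xi_1-\xi_2)\ge0,$$ $$\nabla_\xi\mathcal{A}(x,\xi)=\vec a(x,\xi),$$ where $a_0\in L^\infty(\Omega)$, $a_1\in L^{p'}(\Omega)$, $a_2\in L^p(\Omega)$ and $\eta>0$ is a constant. Let $\phi:\mathbb{R}\to\mathbb{R}$ be locally Lipschitz continuous, strictly increasing and surjective with $\phi(0)=0$. Let $A=\partial\mathcal{E}\cap\big(L^{1\cap\infty}\times L^{1\cap\infty}\big)$, with $L^{1\cap\infty}:=L^1(\Omega)\cap L^\infty(\Omega)$, be the part in $L^{1\cap\infty}$ of the subgradient $\partial\mathcal{E}(u)=-\operatorname{div}(\vec a(\cdot,\nabla u))$ in $L^2(\Omega)$ equipped with homogeneous Dirichlet boundary conditions. Then the domain $D(A\phi)$ is dense in $L^1(\Omega)$.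
   Context: $\Omega$ carries Lebesgue measure. $W^{1,(2,p)}_0(\Omega)$ denotes the completion of $C_c^\infty(\Omega)$ with respect to the norm $\|u\|_{L^2(\Omega)}+\||\nabla u|\|_{L^p(\Omega)}$. The functional $\mathcal{E}:L^2(\Omega)\to(-\infty,+\infty]$ is $\mathcal{E}(u)=\int_\Omega\mathcal{A}(x,\nabla u)\,dx$ if $u\in W^{1,(2,p)}_0(\Omega)$ and $\mathcal{E}(u)=+\infty$ otherwise. Its subgradient $\partial\mathcal{E}$ in $L^2(\Omega)$, i.e. the realization of $-\operatorname{div}(\vec a(x,\nabla u))$ with homogeneous Dirichlet boundary conditions, is the single-valued operator given as follows: $u\in D(\partial\mathcal{E})$ and $\partial\mathcal{E}(u)=v$ if and only if $u\in W^{1,(2,p)}_0(\Omega)$, $v\in L^2(\Omega)$ and $$\int_\Omega\vec a(x,\nabla u)\cdot\nabla\xi\,dx=\int_\Omega v\,\xi\,dx\qquad\text{for every }\xi\in W^{1,(2,p)}_0(\Omega).$$ Operators are identified with their graphs, so $A$ consists of the pairs $(u,v)$ with $u,v\in L^1(\Omega)\cap L^\infty(\Omega)$, $u\in D(\partial\mathcal{E})$ and $v=\partial\mathcal{E}(u)$; $D(A)$ is the set of first components of $A$. The composed operator $A\phi$ in $L^1(\Omega)$ is $$A\phi=\{(u,v)\in L^1(\Omega)\times L^1(\Omega):\ \phi(u)\in D(A)\ \text{and}\ v\in A(\phi(u))\},$$ where $\phi(u)(x)=\phi(u(x))$ for a.e. $x$, and $D(A\phi)$ is the set of $u$ for which there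 exists $v$ with $(u,v)\in A\phi$. *)

(* Defs.v *)
From HB Require Import structures.
From mathcomp Require Import all_boot all_order all_algebra.
From mathcomp Require Import all_classical all_reals all_analysis.

Set Implicit Arguments.
Unset Strict Implicit.
Unset Printing Implicit Defensive.
Import Order.TTheory GRing.Theory Num.Theory.
Import numFieldNormedType.Exports.

Local Open Scope classical_set_scope.
Local Open Scope ring_scope.

(* The dimension is written d.+1, so that 'rV[R]_d.+1 ranges over the R^d with
   d >= 1. The canonical norm of 'rV is the sup norm; it is used here only
   through its topology. Lengths of vectors are Euclidean ([enorm]). *)

Section euclidean.
Context {R : realType} {d : nat}.
Implicit Types u v : 'rV[R]_d.+1.

Definition dot u v : R := \sum_i u 0 i * v 0 i.

Definition enorm u : R := Num.sqrt (dot u u).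

Definition box u v : set 'rV[R]_d.+1 :=
  [set x | forall i, u 0 i <= x 0 i < v 0 i].

Definition box_vol u v : R := \prod_i Num.max 0 (v 0 i - u 0 i).

End euclidean.

Section lebesgue.
Context (R : realType) (d : nat).
Local Open Scope ereal_scope.
Notation V := 'rV[R]_d.+1.

(* The Lebesgue outer measure: the infimum of the total volume of the countable
   covers by boxes. *)
Definition leb_outer (A : set V) : \bar R :=
  ereal_inf [set \sum_(k <oo) (box_vol (ab k).1 (ab k).2)%:E |
    ab in [set ab : nat -> V * V | A `<=` \bigcup_k box (ab k).1 (ab k).2]].

Let vol (ab : V * V) : \bar R := (box_vol ab.1 ab.2)%:E.

Let vol_ge0 ab : 0 <= vol ab.
Proof. by rewrite lee_fin; apply: prodr_ge0 => i _; rewrite le_max lexx. Qed.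

Let leb_outer_ge0 A : 0 <= leb_outer A.
Proof.
by apply: le_ereal_inf_tmp => _ [ab _ <-]; apply: nneseries_ge0 => k _ _;
  exact: vol_ge0.
Qed.

Let le_leb_outer : {homo leb_outer : A B / A `<=` B >-> A <= B}.
Proof.
move=> A B AB; apply: ereal_inf_le_tmp => _ [ab Bab <-].
by exists ab => //; exact: subset_trans AB Bab.
Qed.

Let leb_outer0 : leb_outer set0 = 0.
Proof.
apply/eqP; rewrite eq_le leb_outer_ge0 andbT.
apply: ereal_inf_lbound; exists (fun=> (0, 0)%R); first exact: sub0set.
apply: eseries0 => k _ _ /=.
by rewrite /box_vol big_ord_recl subrr maxxx mul0r.
Qed.

Let leb_outer_sigma_subadditive : sigma_subadditive leb_outer.
Proof.
move=> A; have [[i ioo]|] := pselect (exists i, leb_outer (A i) = +oo).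
  by rewrite (eseries_pinfty _ _ ioo) ?leey// => n _; rewrite -ltNye
    (lt_le_trans _ (leb_outer_ge0 _)).
rewrite -forallNE => Aoo.
suff add2e (e : {posnum R}) : leb_outer (\bigcup_n A n) <=
    \sum_(i <oo) leb_outer (A i) + e%:num%:E.
  by apply/lee_addgt0Pr => _/posnumP[].
rewrite (le_trans _ (epsilon_trick _ _ _))//.
pose P n (ab : nat -> V * V) :=
  A n `<=` \bigcup_k box (ab k).1 (ab k).2 /\
  \sum_(k <oo) vol (ab k) <= leb_outer (A n) + (e%:num / (2 ^ n.+1)%:R)%:E.
have [G PG] : {G : nat -> nat -> V * V & forall n, P n (G n)}.
  apply: (@choice _ _ P) => n; rewrite /P /leb_outer.
  set S := (X in ereal_inf X); move infS : (ereal_inf S) => iS.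
  case: iS infS => [r Sr|Soo|Soo].
  - have en1 : (0 < e%:num / (2 ^ n.+1)%:R)%R by [].
    have /(lb_ereal_inf_adherent en1) : ereal_inf S \is a fin_num by rewrite Sr.
    move=> [x [ab Aab volx] xS].
    by exists ab; split => //; rewrite volx -Sr; exact/ltW.
  - by have := Aoo n; rewrite /leb_outer Soo.
  - by have := leb_outer_ge0 (A n); rewrite /leb_outer Soo.
have volG_ge0 x : 0 <= (vol \o uncurry G) x by exact: vol_ge0.
apply: (@le_trans _ _ (\esum_(i in setT) (vol \o uncurry G) i)).
  apply: ereal_inf_lbound => /=.
  have /card_esym/ppcard_eqP[f] := card_nat2.
  exists (uncurry G \o f).
    move=> t [i _ /(PG i).1 [j _ Gt]]; exists (f^-1%FUN (i, j)) => //=.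
    by rewrite invK ?inE.
  rewrite -(esum_pred_image (vol \o uncurry G) _ xpredT) ?[fun=> _]set_true//.
  by rewrite image_eq.
rewrite (_ : esum _ _ = \sum_(i <oo) \sum_(j <oo) vol (G i j)); last first.
  pose J : nat -> set (nat * nat) := fun i => [set (i, j) | j in setT].
  rewrite (_ : setT = \bigcup_k J k); last first.
    by rewrite predeqE => -[a b]; split => // _; exists a => //; exists b.
  rewrite esum_bigcupT /=; last 2 first.
    - apply/trivIsetP => i j _ _ ij.
      rewrite predeqE => -[n m] /=; split => //= -[] [_] _ [<-{n} _].
      by move=> [m' _] [] /esym/eqP; rewrite (negbTE ij).
    - by move=> /= [n m]; exact: volG_ge0 (n, m).
  rewrite -(image_id [set: nat]) -fun_true esum_pred_image//; last first.
    by move=> n _; exact: esum_ge0.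
  apply: eq_eseriesr => /= j _.
  rewrite -(esum_pred_image (vol \o uncurry G) (pair j) predT)//=; last first.
    by move=> ? ? _ _; exact: (@can_inj _ _ _ snd).
  by congr esum; rewrite predeqE => -[a b]; split; move=> [i _ <-]; exists i.
apply: lee_lim.
- by apply: is_cvg_nneseries => n *; apply: nneseries_ge0 => m *; exact: vol_ge0.
- by apply: is_cvg_nneseries => n *; apply: adde_ge0.
- by near=> n; apply: lee_sum => i _; exact: (PG i).2.
Unshelve. all: by end_near. Qed.

HB.instance Definition _ := isOuterMeasure.Build R V leb_outer
  leb_outer0 leb_outer_ge0 le_leb_outer leb_outer_sigma_subadditive.

End lebesgue.

(* R^d with its Lebesgue (i.e. Caratheodory-measurable, hence complete)
   sigma-algebra, and the Lebesgue measure on it. *)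
Notation lebRV R d := (caratheodory_type (@leb_outer R d)).

Definition leb {R : realType} {d : nat} : set (lebRV R d) -> \bar R :=
  @leb_outer R d.

HB.instance Definition _ (R : realType) (d : nat) :=
  isMeasure.Build _ (lebRV R d) R (@leb R d)
    (@caratheodory_measure0 _ _ (@leb_outer R d))
    (@caratheodory_measure_ge0 _ _ (@leb_outer R d))
    (@caratheodory_measure_sigma_additive _ _ (@leb_outer R d)).

Section lebesgue_spaces.
Context {R : realType} {d : nat}.
Notation V := 'rV[R]_d.+1.
Implicit Types (Omega : set V) (f g u v : V -> R) (F G : V -> V) (q : \bar R).

(* Functions on Omega are represented by functions on V, of which only the
   values on Omega matter: f \_ Omega is f extended by 0. Elements of L^q(Omega)
   are represented by functions, not by classes. *)
Definition Lnorm_on Omega q f : \bar R :=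
  ('N[leb]_q[EFin \o (f \_ Omega : lebRV R d -> R)])%E.

Definition inLp Omega q f : Prop :=
  (f \_ Omega : lebRV R d -> R) \in Lfun leb q.

Definition inLp_vec Omega q F : Prop :=
  (forall i, measurable_fun (Omega : set (lebRV R d)) (fun x => F x 0 i)) /\
  inLp Omega q (fun x => enorm (F x)).

Definition inL1oo Omega f : Prop := inLp Omega 1%E f /\ inLp Omega +oo%E f.

Definition caratheodory_fun Omega (h : V -> V -> R) : Prop :=
  (forall xi, measurable_fun (Omega : set (lebRV R d)) (h ^~ xi)) /\
  {ae leb, forall x : lebRV R d, Omega x -> continuous (h x)}.

Definition dense_in_L1 Omega (D : set (V -> R)) : Prop :=
  forall f, inLp Omega 1%E f -> forall eps : R, 0 < eps ->
    exists2 u, D u & (Lnorm_on Omega 1%E (f \- u)%R < eps%:E)%E.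

End lebesgue_spaces.

Section sobolev.
Context {R : realType} {d : nat}.
Notation V := 'rV[R]_d.+1.
Implicit Types (Omega : set V) (f u : V -> R) (G : V -> V).

Definition partial (i : 'I_d.+1) f : V -> R := fun x => 'D_(delta_mx 0 i) f x.

Definition gradient f : V -> V := fun x => \row_i partial i f x.

Definition smooth f : Prop := forall s : seq 'I_d.+1,
  continuous (foldr partial f s) /\
  forall x i, derivable (foldr partial f s) x (delta_mx 0 i).

Definition Cc_infty Omega f : Prop :=
  let supp := closure [set x | f x != 0] in
  [/\ smooth f, compact supp & supp `<=` Omega].

(* "u is in W_0^{1,(2,p)}(Omega) and has gradient G": the completion of
   C_c^infty(Omega) for |u|_2 + |grad u|_p is realized as the closure of
   {(f, grad f)} in L^2(Omega) x L^p(Omega)^d. Since the gradient is closable, u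
   determines G up to a null set. *)
Definition W0_grad Omega (p : R) u G : Prop :=
  [/\ inLp Omega 2%:E u, inLp_vec Omega p%:E G &
  exists f_ : nat -> V -> R, [/\ forall n, Cc_infty Omega (f_ n),
    Lnorm_on Omega 2%:E (u \- f_ n) @[n --> \oo] --> 0%E &
    Lnorm_on Omega p%:E (fun x => enorm (G x - gradient (f_ n) x))
      @[n --> \oo] --> 0%E]].

End sobolev.

Section operators.
Context {R : realType} {d : nat}.
Notation V := 'rV[R]_d.+1.
Implicit Types (Omega : set V) (p : R) (a : V -> V -> V) (phi : R -> R)
  (u v w z : V -> R) (G H : V -> V).

(* The graph of the subgradient of the energy in L^2(Omega), i.e. of
   u |-> - div (a (., grad u)) with homogeneous Dirichlet conditions. *)
Definition subgrad Omega p a u v : Prop :=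
  exists G, [/\ W0_grad Omega p u G, inLp Omega 2%:E v &
    forall z H, W0_grad Omega p z H ->
      \int[leb]_(x in Omega) dot (a x (G x)) (H x) =
      \int[leb]_(x in Omega) (v x * z x)].

Definition opA Omega p a u v : Prop :=
  [/\ inL1oo Omega u, inL1oo Omega v & subgrad Omega p a u v].

Definition opAphi Omega p a phi u v : Prop :=
  [/\ inLp Omega 1%E u, inLp Omega 1%E v & opA Omega p a (phi \o u) v].

Definition dom_Aphi Omega p a phi : set (V -> R) :=
  [set u | exists v, opAphi Omega p a phi u v].

End operators.

Definition locally_lipschitz {R : realType} (phi : R -> R) : Prop :=
  forall x : R, exists2 U : set R, nbhs x U & [lipschitz phi y | y in U].

(* Main.v *)
(** Let [psi] be the inverse of [phi]. Every [f] in [L^1] is a limit of functions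
    [psi o g] with [g] in [C_c^infty], so it suffices to find [w] in [D(A)] with
    [psi o w] close to [psi o g] in [L^1]. The resolvent [(I + lam dE)^-1 g] need
    not be integrable, since Omega may have infinite measure. Instead, let
    [K = {g <> 0}] and minimize
      [lam E(u) + 1/2 int u^2 - int g u + int_{K^c} |u|].
    The minimizer satisfies [lam dE(w) = g - w - 1_{K^c} s] with [s] in [sign(w)].
    The penalty gives [|{w <> 0} - K| <= int_K |w - g|], and comparison with [g]
    gives [int (w - g)^2 <= 2 lam E(g)]. Hence [w] and [dE(w)] are bounded and
    integrable, and [w] tends to [g] as [lam] tends to 0.

    Two devices keep the existence proof elementary. Elements of the Sobolev space
    are pairs (function, gradient) in the closure of the graph of the gradient on
    [C_c^infty], so that the uniqueness of the gradient is never used. Weak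
    compactness is replaced by uniform convexity: the penalty is smoothed into
    [sqrt(u^2 + del^2) - del], the term [eps |grad u|^p] is added, and the minimal
    values are monotone in [del], then the gradient terms in [eps], which makes the
    minimizers Cauchy sequences. *)

Require Import Defs.
From mathcomp Require Import all_boot all_order all_algebra.
From mathcomp Require Import all_classical all_reals all_analysis.
From mathcomp Require Import measurable_realfun lra ring.
Import Order.TTheory GRing.Theory Num.Theory.
Import numFieldNormedType.Exports.

Local Open Scope classical_set_scope.
Local Open Scope ring_scope.

Set Implicit Arguments.
Unset Strict Implicit.
Unset Printing Implicit Defensive.

(** The flux is merely monotone, and [a2] lies in $L^p$ but perhaps not in $L^1$, so the coercivity
    bound cannot be integrated over a set of infinite measure. This fixes the order of the limits.
    For fixed [eps], [del] tends to 0 first: only then is the measure of $\{u \ne 0\}$ under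
    control, and testing the equation with the pair $(0, 1_{u=0}\nabla u)$ shows that the gradient
    component vanishes a.e. where [u] does. Coercivity is then needed only on a set of finite
    measure, where $a_2 \le 1 + |a_2|^p$; this bounds the gradient terms uniformly in [eps], and
    being monotone they converge. A diagonal sequence of genuine minimizers carries the
    Euler-Lagrange equation to the limit by dominated convergence. The derivatives of the smoothed
    penalty need not converge on $\{u = 0\}$; for them a weak limit is enough, since the equation
    itself shows that their pairings with test functions converge. The smoothing also keeps the
    penalty finite on $L^2$, where $|u|$ need not be integrable. *)

Section limn_einf_bounds.
Context {R : realType}.
Implicit Types u : (\bar R)^nat.
Local Open Scope ereal_scope.

Lemma limn_einf_ge0 u : (forall n, 0 <= u n) -> 0 <= limn_einf u.
Proof.
move=> u0; rewrite limn_einf_lim; apply: lime_ge; first exact: is_cvg_einfs.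
by apply: nearW => n; apply: le_ereal_inf_tmp => _ [k _ <-].
Qed.

Lemma limn_einf_leC u (C : \bar R) : (forall n, u n <= C) -> limn_einf u <= C.
Proof.
move=> uC; rewrite limn_einf_lim; apply: lime_le; first exact: is_cvg_einfs.
apply: nearW => n; apply: le_trans (uC n).
by apply: ereal_inf_lbound; exists n => //=.
Qed.

End limn_einf_bounds.

(** * Integrals of real functions for a complete measure *)

Section real_integrals.
Context d (T : measurableType d) (R : realType).
Variable mu : {measure set T -> \bar R}.
Hypothesis cmu : measure_is_complete mu.
Implicit Types f g h : T -> R.

Definition itg f : Prop := mu.-integrable setT (EFin \o f).

Local Notation mf f := (measurable_fun [set: T] f).
Local Notation I f := (Rintegral mu setT f).

Lemma itg_mf f : itg f -> mf f.
Proof. by move=> /(measurable_int mu)/measurable_EFinP. Qed.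

Lemma ae_mf f g : (\forall x \ae mu, f x = g x) -> mf f -> mf g.
Proof.
move=> fg /measurable_EFinP mf; apply/measurable_EFinP.
apply: (ae_measurable_fun cmu) mf.
by apply: filterS fg => x fgx _ /=; rewrite fgx.
Qed.

(** Off a measurable null set the convergence holds everywhere; completeness of the measure absorbs
    the values on that set. *)
Lemma mf_cvg (F : nat -> T -> R) f : (forall n, mf (F n)) ->
  (\forall x \ae mu, F ^~ x @ \oo --> f x) -> mf f.
Proof.
move=> mF [N [mN N0 Ncvg]].
apply: (@ae_mf (f \_ (~` N))).
  exists N; split => // x; apply: contra_notP => Nx.
  by rewrite /= patchE ifT// inE.
apply: (@measurable_fun_cvg _ _ _ _ (fun n => (F n) \_ (~` N))).
  move=> n; apply/(measurable_restrictT _ _).1; first exact: measurableC.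
  exact: measurable_funTS.
move=> x _; rewrite patchE; case: ifPn => [|].
  rewrite inE => Nx; under eq_fun do rewrite patchE mem_set//.
  by apply: contrapT => h; apply: Nx; exact: Ncvg.
move=> xN; under eq_fun do rewrite patchE (negbTE xN); exact: cvg_cst.
Qed.

Lemma itgD f g : itg f -> itg g -> itg (fun x => f x + g x).
Proof. by move=> If Ig; exact: (integrableD measurableT If Ig). Qed.

Lemma itgZ (k : R) f : itg f -> itg (fun x => k * f x).
Proof. by move=> If; exact: (integrableZl measurableT k If). Qed.

Lemma itgN f : itg f -> itg (fun x => - f x).
Proof. by move=> If; exact: (integrableN If). Qed.

Lemma itgB f g : itg f -> itg g -> itg (fun x => f x - g x).
Proof. by move=> If Ig; exact/itgD/itgN. Qed.

Lemma itg0 : itg (fun=> 0).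
Proof. exact: integrable0. Qed.

Lemma itg_sum (J : Type) (s : seq J) (P : pred J) (F : J -> T -> R) :
  (forall j, P j -> itg (F j)) -> itg (fun x => \sum_(j <- s | P j) F j x).
Proof.
move=> h; elim: s => [|j s ih].
  by under eq_fun do rewrite big_nil; exact: itg0.
under eq_fun do rewrite big_cons.
by have [Pj|//] := boolP (P j); exact: itgD (h _ Pj) ih.
Qed.

Lemma itg_norm f : itg f -> itg (fun x => `|f x|).
Proof. exact: integrable_norm. Qed.

Lemma itg_le f g : mf f -> (\forall x \ae mu, `|f x| <= g x) -> itg g -> itg f.
Proof.
move=> mf fg ig; apply/integrableP; split; first exact/measurable_EFinP.
apply: (@le_lt_trans _ _ (\int[mu]_x `|(g x)%:E|)%E).
  apply: ae_ge0_le_integral => //.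
  - by apply: measurableT_comp => //; exact/measurable_EFinP.
  - by apply: measurableT_comp => //; exact/measurable_EFinP/itg_mf.
  - apply: filterS fg => x fgx _ /=; rewrite lee_fin.
    by rewrite (le_trans fgx)// ler_norm.
by move: ig => /integrableP[].
Qed.

Lemma eq_itg f g : itg f -> f =1 g -> itg g.
Proof. by move=> + /funext <-. Qed.

Lemma eq_I f g : f =1 g -> I f = I g.
Proof. by move=> fg; congr (I _); exact/funext. Qed.

Lemma I_ae f g : (\forall x \ae mu, f x = g x) -> mf f -> I f = I g.
Proof.
move=> fg mf; congr fine; apply: ae_eq_integral => //.
- exact/measurable_EFinP.
- by apply/measurable_EFinP; exact: ae_mf fg mf.
- by apply: filterS fg => x + _ /= => ->.
Qed.

Lemma ID f g : itg f -> itg g -> I (fun x => f x + g x) = I f + I g.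
Proof. by move=> If Ig; rewrite RintegralD. Qed.

Lemma IB f g : itg f -> itg g -> I (fun x => f x - g x) = I f - I g.
Proof. by move=> If Ig; rewrite RintegralB. Qed.

Lemma IZ (k : R) f : itg f -> I (fun x => k * f x) = k * I f.
Proof. by move=> If; rewrite RintegralZl. Qed.

Lemma I0 : I (fun=> 0) = 0.
Proof. by rewrite /Rintegral integral0. Qed.

Lemma I_sum (J : Type) (s : seq J) (P : pred J) (F : J -> T -> R) :
  (forall j, P j -> itg (F j)) ->
  I (fun x => \sum_(j <- s | P j) F j x) = \sum_(j <- s | P j) I (F j).
Proof.
move=> h; elim: s => [|j s ih].
  by under eq_fun do rewrite big_nil; rewrite I0 big_nil.
under eq_fun do rewrite big_cons; rewrite big_cons.
have [Pj|//] := boolP (P j); rewrite ID ?ih//; first exact: h.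
exact: itg_sum.
Qed.

Lemma I_ge0 f : (\forall x \ae mu, 0 <= f x) -> mf f -> 0 <= I f.
Proof.
move=> f0 mf; have h : \forall x \ae mu, f x = `|f x|.
  by apply: filterS f0 => x fx; rewrite ger0_norm.
by rewrite (I_ae h mf); exact: Rintegral_ge0.
Qed.

Lemma I_le f g : (\forall x \ae mu, f x <= g x) -> itg f -> itg g -> I f <= I g.
Proof.
move=> fg If Ig; rewrite -subr_ge0 -IB//; apply: I_ge0; last first.
  exact/itg_mf/itgB.
by apply: filterS fg => x; rewrite subr_ge0.
Qed.

(** Turns an integral identity with nonnegative integrand into a pointwise one; the maximum
    principle and the vanishing of gradients on zero sets both rest on it. *)
Lemma I_eq0 f : (\forall x \ae mu, 0 <= f x) -> itg f -> I f <= 0 ->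
  \forall x \ae mu, f x = 0.
Proof.
move=> f0 If I0; have mf := itg_mf If.
have h : \forall x \ae mu, f x = `|f x|.
  by apply: filterS f0 => x fx; rewrite ger0_norm.
have : (\int[mu]_x `|(f x)%:E| = 0)%E.
  have ifn := integrable_fin_num measurableT (itg_norm If).
  rewrite -[LHS](fineK ifn); congr EFin.
  apply/eqP; rewrite eq_le; apply/andP; split.
    by move: I0; rewrite (I_ae h mf).
  exact: Rintegral_ge0.
have emf : measurable_fun setT (EFin \o f) by exact/measurable_EFinP.
move/(ae_eq_integral_abs mu measurableT emf).1.
by apply: filterS => x /(_ Logic.I) [].
Qed.

Lemma DCT (F : nat -> T -> R) f g : (forall n, mf (F n)) ->
  (\forall x \ae mu, F ^~ x @ \oo --> f x) -> itg g ->
  (\forall x \ae mu, forall n, `|F n x| <= g x) ->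
  itg f /\ I (F n) @[n --> \oo] --> I f.
Proof.
move=> mF Ff ig Fg; have mf := mf_cvg mF Ff.
have [||||i _ c] := @dominated_convergence _ T R mu setT measurableT
  (fun n x => (F n x)%:E) (EFin \o f) (EFin \o g) _ _ _ ig.
- by move=> n; exact/measurable_EFinP.
- exact/measurable_EFinP.
- apply: filterS Ff => x Fx _; apply: cvg_EFin => //; first exact: nearW.
- by apply: filterS Fg => x Fx n _ /=; rewrite lee_fin.
split => //; apply: fine_cvg; rewrite /= fineK//.
exact: integrable_fin_num.
Qed.

(** [Rintegral] takes a default value on functions of infinite integral, so the bound on [I f] is
    meaningful only together with the integrability of the limit, which the uniform bound [C]
    provides. *)
Lemma Fatou (F : nat -> T -> R) f (C : R) : (forall n, itg (F n)) ->
  (forall n, \forall x \ae mu, 0 <= F n x) ->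
  (\forall x \ae mu, F ^~ x @ \oo --> f x) -> (forall n, I (F n) <= C) ->
  itg f /\ I f <= C.
Proof.
move=> iF F0 Ff FC.
have mf : mf f by apply: mf_cvg Ff => n; exact: itg_mf.
have f0 : \forall x \ae mu, f x = `|f x|.
  have /ae_foralln F0' := F0.
  near=> x; rewrite ger0_norm//.
  have Ffx : F ^~ x @ \oo --> f x by near: x.
  have F0x : forall n, 0 <= F n x by near: x.
  rewrite -(cvg_lim _ Ffx)//; apply: limr_ge; last exact: nearW.
  by apply/cvg_ex; exists (f x).
have IFn n : I (F n) = fine (\int[mu]_x `|F n x|%:E)%E.
  have h : \forall x \ae mu, F n x = `|F n x|.
    by apply: filterS (F0 n) => x fx; rewrite ger0_norm.
  by rewrite (I_ae h (itg_mf (iF n))).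
have key : (\int[mu]_x `|f x|%:E <= C%:E)%E.
  apply: (@le_trans _ _ (\int[mu]_x limn_einf (fun n => `|F n x|%:E))%E).
    have aeE : \forall x \ae mu, limn_einf (fun n => `|F n x|%:E) = `|f x|%:E.
      apply: filterS Ff => x Fx; apply: (cvg_limn_einf_sup _).1.
      by apply: cvg_EFin; [exact: nearW|apply: cvg_norm].
    have mnf : measurable_fun setT (fun x => `|f x|%:E).
      by apply/measurable_EFinP; exact: measurableT_comp.
    apply: ae_ge0_le_integral => //.
    - by move=> x _; apply: limn_einf_ge0.
    - by apply: (ae_measurable_fun cmu) mnf; apply: filterS aeE => x ->.
    - by apply: filterS aeE => x ->.
  apply: le_trans (fatou mu measurableT _ _) _.
  - by move=> n; apply/measurable_EFinP; apply: measurableT_comp => //; exact: itg_mf.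
  - by [].
  apply: limn_einf_leC => n.
  have := FC n; rewrite IFn -lee_fin fineK//.
  exact: (integrable_fin_num measurableT (itg_norm (iF n))).
have If : itg f.
  apply/integrableP; split; first exact/measurable_EFinP.
  by apply: le_lt_trans key _; rewrite ltry.
split => //; rewrite (I_ae f0 mf) -lee_fin fineK//.
exact: (integrable_fin_num measurableT (itg_norm If)).
Unshelve. all: by end_near. Qed.

(** The weighted functions $2^n r_n$ have integrals at most $2^{-n}$, so their sum [S] is integrable
    and dominates each of them. A rate in the mean becomes a pointwise rate with a single integrable
    majorant. *)
Lemma itg_series (r : nat -> T -> R) : (forall n, itg (r n)) ->
  (forall n x, 0 <= r n x) -> (forall n, I (r n) <= (1 / 4) ^+ n) ->
  exists2 S, itg S & \forall x \ae mu, forall n, r n x <= (1 / 2) ^+ n * S x.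
Proof.
move=> ir r0 Ir.
pose F n x := 2 ^+ n * r n x; pose S N x := \sum_(n < N) F n x.
have F0 n x : 0 <= F n x by rewrite mulr_ge0// exprn_ge0.
have iF n : itg (F n) by exact: itgZ.
have iS N : itg (S N) by apply: itg_sum.
have IF n : (\int[mu]_x (F n x)%:E <= ((1 / 2) ^+ n)%:E)%E.
  rewrite -[leLHS]fineK; last exact: (integrable_fin_num measurableT (iF n)).
  rewrite lee_fin -/(I (F n)) IZ//.
  have := Ir n; rewrite -(ler_pM2l (_ : 0 < 2 ^+ n :> R)) ?exprn_gt0//.
  by move=> /le_trans; apply; rewrite -exprMn (_ : 2 * (1 / 4) = 1 / 2 :> R) //; field.
have key : (\int[mu]_x (\sum_(n <oo) (F n x)%:E) < +oo)%E.
  rewrite integral_nneseries//; last 2 first.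
    by move=> n; exact/measurable_EFinP/itg_mf.
    by move=> n x _; rewrite lee_fin.
  apply: (@le_lt_trans _ _ (\sum_(n <oo) ((1 / 2) ^+ n)%:E)%E).
    apply: lee_nneseries => //.
    by move=> n _ _; apply: integral_ge0 => x _; rewrite lee_fin.
  have h : [sequence (\sum_(0 <= k < n) ((1 / 2) ^+ k)%:E)%E]_n =
      (EFin \o series (geometric 1 (1 / 2 : R))).
    apply/funext => n /=; rewrite sumEFin; congr EFin; apply: eq_bigr => k _.
    by rewrite /geometric/= [RHS]mul1r.
  have c : series (geometric 1 (1 / 2 : R)) x @[x --> \oo] --> 1 / (1 - 1 / 2 : R).
    by apply: cvg_geometric_series; rewrite ger0_norm; lra.
  have c2 : [sequence (\sum_(0 <= k < n) ((1 / 2) ^+ k)%:E)%E]_n @ \oo --> (1 / (1 - 1 / 2 : R))%:E.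
    by rewrite h; apply: cvg_EFin => //; exact: nearW.
  by rewrite (cvg_lim _ c2)// ltry.
pose E x := (\sum_(n <oo) (F n x)%:E)%E.
have E0 x : (0 <= E x)%E by apply: nneseries_ge0 => n _ _; rewrite lee_fin.
have mE : measurable_fun setT E.
  apply: ge0_emeasurable_sum => //.
    by move=> n x _ _; rewrite lee_fin.
  by move=> n _; exact/measurable_EFinP/itg_mf.
have iE : mu.-integrable setT E.
  apply/integrableP; split => //.
  by under eq_integral do rewrite gee0_abs//.
exists (fun x => fine (E x)).
  apply: (le_integrable measurableT _ _ iE).
    apply/measurable_EFinP; apply: measurableT_comp mE.
    exact: fine_measurable.
  by move=> x _ /=; case: (E x) => [r'| |] //=; rewrite ?normr0 ?leey.
apply: filterS (integrable_ae measurableT iE) => x /(_ Logic.I) fx n.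
have : ((F n x)%:E <= E x)%E.
  have h k : true -> (0 <= (F k x)%:E)%E by rewrite lee_fin.
  rewrite /E (nneseriesD1 h (isT : xpredT n)).
  by rewrite leeDl// nneseries_ge0// => k _ _; rewrite lee_fin.
rewrite -(fineK fx) lee_fin /F => h.
rewrite -(ler_pM2l (_ : 0 < 2 ^+ n :> R)) ?exprn_gt0//.
by rewrite mulrA -exprMn (_ : 2 * (1 / 2) = 1 :> R) ?expr1n ?mul1r//; field.
Qed.

End real_integrals.

(** * Powers and their uniform convexity *)

Section convex_powers.
Context {R : realType}.
Implicit Types (q s t : R).

Definition apow q s : R := `|s| `^ q.

(** The derivative of [apow q] for [q > 1]. *)
Definition dpow q s : R := q * `|s| `^ (q - 1) * Num.sg s.

Lemma apow_ge0 q s : 0 <= apow q s.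
Proof. exact: powR_ge0. Qed.

Lemma apow0 q : q != 0 -> apow q 0 = 0.
Proof. by move=> q0; rewrite /apow normr0 powR0. Qed.

Lemma apowN q s : apow q (- s) = apow q s.
Proof. by rewrite /apow normrN. Qed.

Lemma apowM q s t : apow q (s * t) = apow q s * apow q t.
Proof. by rewrite /apow normrM powRM. Qed.

Lemma apow2 s : apow 2 s = s ^+ 2.
Proof. by rewrite /apow powR_mulrn// -normrX ger0_norm// sqr_ge0. Qed.

Lemma dpowN q s : dpow q (- s) = - dpow q s.
Proof. by rewrite /dpow normrN sgrN mulrN. Qed.

Lemma dpow_mul q s : 0 < q -> dpow q s * s = q * apow q s.
Proof.
move=> q0; rewrite /dpow /apow -!mulrA -normrEsg.
by rewrite [X in q * X = _]mulrC mulr_powRB1.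
Qed.

Lemma le_apow q s t : 0 <= q -> `|s| <= `|t| -> apow q s <= apow q t.
Proof. by move=> q0 st; apply: ge0_ler_powR => //; rewrite nnegrE. Qed.

(** Mean value theorem between [s] and [t]: strict growth of $x^{q-1}$ makes the tangent inequality
    strict. The point [t = 0] is separate because the power is differentiated at positive points
    only. *)
Let pos_tangent q s t : 1 < q -> 0 < s -> 0 <= t -> t != s ->
  s `^ q + q * s `^ (q - 1) * (t - s) < t `^ q.
Proof.
move=> q1 s0 t0 ts; have q0 : 0 < q by lra.
have sE : s * s `^ (q - 1) = s `^ q by rewrite mulr_powRB1// ltW.
have [t00|tn0] := eqVneq t 0.
  rewrite t00 powR0 ?gt_eqF// sub0r mulrN -mulrA [_ * s]mulrC sE.
  have := powR_gt0 q s0; nra.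
have {t0 tn0} t0 : 0 < t by rewrite lt_neqAle eq_sym tn0.
have mono x y : 0 < x -> x < y -> x `^ (q - 1) < y `^ (q - 1).
  move=> x0 xy; apply: gt0_ltr_powR => //; rewrite ?nnegrE ?ltW//; lra.
have mvt x y : 0 < x -> x < y -> exists2 c, x < c < y &
    y `^ q - x `^ q = q * c `^ (q - 1) * (y - x).
  move=> x0 xy.
  have [||c] := @MVT R (@powR R ^~ q) (fun c => q * c `^ (q - 1)) x y xy.
  - by move=> z; rewrite in_itv/= => /andP[xz _]; apply: is_derive1_powR; exact: lt_trans xz.
  - apply: derivable_within_continuous => z; rewrite in_itv/= => /andP[xz _].
    have z0 : 0 < z by exact: lt_le_trans xz.
    by have [] := is_derive1_powR q z0.
  by rewrite in_itv/= => xcy e; exists c.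
move: ts; rewrite neq_lt => /orP[ts|st].
- have [c /andP[tc cs] e] := mvt _ _ t0 ts.
  have := mono c s (lt_trans t0 tc) cs.
  set X := c `^ _ in e *; set Y := s `^ (q - 1) => XY.
  have : q * (s - t) * X < q * (s - t) * Y by rewrite ltr_pM2l// mulr_gt0// subr_gt0.
  nra.
- have [c /andP[sc ct] e] := mvt _ _ s0 st.
  have := mono s c s0 sc.
  set X := c `^ _ in e *; set Y := s `^ (q - 1) => XY.
  have : q * (t - s) * Y < q * (t - s) * X by rewrite ltr_pM2l// mulr_gt0// subr_gt0.
  nra.
Qed.

Let apow_tangent_ge0 q s t : 1 < q -> 0 <= s -> t != s ->
  apow q s + dpow q s * (t - s) < apow q t.
Proof.
move=> q1; have q0 : 0 < q by lra.
rewrite le_eqVlt => /predU1P[<-|s0] ts.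
  rewrite /dpow sgr0 mulr0 mul0r addr0 apow0 ?gt_eqF//.
  by rewrite /apow powR_gt0// normr_gt0.
rewrite /apow /dpow (gtr0_norm s0) (gtr0_sg s0) mulr1.
have [t0|t0] := leP 0 t; first by rewrite ger0_norm// pos_tangent.
(* For [t < 0] the tangent line at [s > 0] is already negative. *)
have : 0 < `|t| `^ q by rewrite powR_gt0// normr_gt0 lt_eqF.
have sE : s * s `^ (q - 1) = s `^ q by rewrite mulr_powRB1// ltW.
have := powR_gt0 (q - 1) s0; rewrite -sE; set Y := s `^ (q - 1); set Z := _ `^ q.
move=> Y0 Z0; have : q * Y * t < 0 by rewrite pmulr_rlt0// mulr_gt0.
have : 0 < (q - 1) * (s * Y) by rewrite !mulr_gt0// subr_gt0.
nra.
Qed.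

Lemma apow_tangent_lt q s t : 1 < q -> t != s ->
  apow q s + dpow q s * (t - s) < apow q t.
Proof.
move=> q1 ts; have [s0|s0] := leP 0 s; first exact: apow_tangent_ge0.
have := @apow_tangent_ge0 q (- s) (- t) q1.
rewrite !apowN dpowN oppr_ge0 (ltW s0) eqr_opp => /(_ isT ts).
by rewrite (_ : - dpow q s * (- t - - s) = dpow q s * (t - s))//; ring.
Qed.

Lemma apow_tangent q s t : 1 < q -> apow q s + dpow q s * (t - s) <= apow q t.
Proof.
move=> q1; have [->|ts] := eqVneq t s; first by rewrite subrr mulr0 addr0.
exact/ltW/apow_tangent_lt.
Qed.

Lemma continuous_apow q : 0 < q -> continuous (apow q).
Proof.
move=> q0 t; have [->|t0] := eqVneq t 0; last first.
  apply: (cvg_comp Num.norm (@powR R ^~ q)); first by apply: cvg_norm; exact: cvg_id.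
  have nt0 : 0 < `|t| by rewrite normr_gt0.
  suff : {for `|t|, continuous (@powR R ^~ q)} by [].
  apply: differentiable_continuous; apply/derivable1_diffP.
  by have [] := is_derive1_powR q nt0.
apply/cvgrPdist_le => /= e e0; near=> x.
rewrite apow0 ?gt_eqF// sub0r normrN /apow ger0_norm ?powR_ge0//.
have -> : e = (e `^ q^-1) `^ q by rewrite -powRrM mulVf ?gt_eqF// powRr1// ltW.
apply: ge0_ler_powR; rewrite ?nnegrE ?powR_ge0//; first exact: ltW.
near: x; exists (e `^ q^-1); first exact: powR_gt0.
by move=> y /=; rewrite sub0r normrN => /ltW.
Unshelve. all: by end_near. Qed.

Lemma apowD q s t : 0 <= q ->
  apow q (s + t) <= 2 `^ q * (apow q s + apow q t).
Proof.
move=> q0; wlog st : s t / `|s| <= `|t|.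
  move=> h; have [st|/ltW ts] := leP `|s| `|t|; first exact: h.
  by rewrite addrC [apow q s + _]addrC h.
apply: (@le_trans _ _ (apow q (2 * t))).
  apply: le_apow => //; rewrite normrM ger0_norm// (le_trans (ler_normD _ _))//.
  by rewrite mulr2n mulrDl mul1r lerD2r.
rewrite apowM {1}/apow ger0_norm// ler_wpM2l ?powR_ge0// lerDr.
exact: apow_ge0.
Qed.

(** The defect of midpoint convexity of $|\cdot|^q$. Near-minimality of an energy makes it small,
    and [apow_uniform_convex] turns it into a bound on distances. *)
Definition pgap q s t : R := (apow q s + apow q t) / 2 - apow q ((s + t) / 2).

Lemma pgap_gt0 q s t : 1 < q -> s != t -> 0 < pgap q s t.
Proof.
move=> q1 st; rewrite /pgap; set m := (s + t) / 2.
have sm : s != m.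
  by apply: contra st => /eqP sm; apply/eqP; rewrite /m in sm; lra.
have tm : t != m.
  by apply: contra st => /eqP tm; apply/eqP; rewrite /m in tm; lra.
have := apow_tangent_lt q1 sm; have := apow_tangent_lt q1 tm.
have -> : t - m = - (s - m) by rewrite /m; field.
rewrite mulrN; lra.
Qed.

Lemma pgap_ge0 q s t : 1 < q -> 0 <= pgap q s t.
Proof.
move=> q1; have [->|st] := eqVneq s t; last exact/ltW/pgap_gt0.
by rewrite /pgap (_ : (t + t) / 2 = t); [lra|field].
Qed.

Lemma pgapM q s t k : pgap q (k * s) (k * t) = apow q k * pgap q s t.
Proof.
rewrite /pgap -mulrDr -mulrA !apowM; ring.
Qed.

Lemma pgapC q s t : pgap q s t = pgap q t s.
Proof. by rewrite /pgap [s + t]addrC [apow q s + _]addrC. Qed.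

(** On $[-1,1]$ the gap between [y] and 1 vanishes only at [y = 1]. Away from 1 it has a positive
    minimum by compactness; near 1 the left side itself is at most [tau]. *)
Let pgap1_ctrl q tau : 1 < q -> 0 < tau -> exists2 C, 0 <= C &
  forall y, `|y| <= 1 -> apow q (y - 1) <= C * pgap q y 1 + tau.
Proof.
move=> q1 tau0; have q0 : 0 < q by lra.
(* The threshold at which $|1-b|^q$ equals [tau]. *)
pose b := 1 - tau `^ q^-1.
have tb : apow q (1 - b) = tau.
  rewrite /b opprB addrC subrK /apow ger0_norm ?powR_ge0//.
  by rewrite -powRrM mulVf ?gt_eqF// powRr1// ltW.
have [b1|b1] := leP b (-1).
  exists 0 => // y y1; rewrite mul0r add0r -tb.
  move: y1; rewrite ler_norml => /andP[y1 y2].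
  apply: le_apow; first exact: ltW.
  by rewrite distrC ger0_norm ?subr_ge0// ger0_norm; lra.
have blt : b < 1 by rewrite /b ltrBlDr ltrDl powR_gt0.
have cont : continuous (fun y => pgap q y 1).
  move=> y; rewrite /pgap; apply: cvgB.
    apply: cvgM; last exact: cvg_cst.
    by apply: cvgD; [exact: continuous_apow|exact: cvg_cst].
  apply: (cvg_comp (fun y => (y + 1) / 2) (apow q)); last exact: continuous_apow.
  by apply: cvgM; [apply: cvgD; [exact: cvg_id|exact: cvg_cst]|exact: cvg_cst].
have [c cin cmin] := @EVT_min R (fun y => pgap q y 1) (-1) b (ltW b1)
  (continuous_subspaceT cont).
have m0 : 0 < pgap q c 1.
  apply: pgap_gt0 => //; move: cin; rewrite in_itv/= => /andP[_ cb].
  by rewrite lt_eqF// (le_lt_trans cb).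
exists (2 `^ q / pgap q c 1); first by rewrite divr_ge0 ?powR_ge0// ltW.
move=> y; rewrite ler_norml => /andP[y1 y2]; have [yb|yb] := leP y b.
  have h : pgap q c 1 <= pgap q y 1 by apply: cmin; rewrite in_itv/= y1 yb.
  apply: (@le_trans _ _ (2 `^ q)).
    rewrite (_ : 2 `^ q = apow q 2); last by rewrite /apow ger0_norm.
    apply: le_apow; first exact: ltW.
    by rewrite [leRHS]ger0_norm// ler_norml; lra.
  rewrite -[leLHS]addr0 lerD//; last exact: ltW.
  rewrite -mulrA -[leLHS]mulr1 ler_wpM2l ?powR_ge0//.
  by rewrite mulrC ler_pdivlMr// mul1r.
rewrite -[leLHS]add0r lerD//.
  by rewrite mulr_ge0 ?pgap_ge0// divr_ge0 ?powR_ge0// ltW.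
rewrite -tb; apply: le_apow; first exact: ltW.
by rewrite distrC ger0_norm ?subr_ge0// ger0_norm; lra.
Qed.

(* Uniform convexity of [|.|^q], by homogeneity and compactness of [-1, 1]. *)
Lemma apow_uniform_convex q tau : 1 < q -> 0 < tau -> exists2 C, 0 <= C &
  forall s t, apow q (s - t) <= C * pgap q s t + tau * (apow q s + apow q t).
Proof.
move=> q1 tau0; have q0 : 0 < q by lra.
have [C C0 CP] := pgap1_ctrl q1 tau0; exists C => // s t.
wlog st : s t / `|s| <= `|t|.
  move=> h; have [st|/ltW ts] := leP `|s| `|t|; first exact: h.
  by rewrite -opprB apowN pgapC [apow q s + _]addrC h.
have [t0|t0] := eqVneq t 0.
  move: st; rewrite t0 normr0 normr_le0 => /eqP ->.
  rewrite subrr apow0 ?gt_eqF// addr0 mulr0 addr0.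
  by rewrite mulr_ge0// pgap_ge0.
have -> : s = t * (s / t) by rewrite mulrC divfK.
have y1 : `|s / t| <= 1 by rewrite normrM normfV ler_pdivrMr ?normr_gt0// mul1r.
move: (s / t) y1 => y y1.
have -> : apow q (t * y - t) = apow q t * apow q (y - 1).
  by rewrite -apowM; congr apow; ring.
have -> : pgap q (t * y) t = apow q t * pgap q y 1.
  by rewrite -pgapM mulr1.
apply: (@le_trans _ _ (apow q t * (C * pgap q y 1 + tau))).
  by rewrite ler_wpM2l ?apow_ge0// CP.
rewrite apowM mulrDr lerD//; first by rewrite mulrCA.
rewrite mulrC ler_wpM2l//; first exact: ltW.
by rewrite lerDr mulr_ge0// apow_ge0.
Qed.

End convex_powers.

(** Summing the thresholds [N 0, ..., N n] and adding [n] gives a nondecreasing index that lies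
    beyond all thresholds so far. *)
Lemma sub_index (P : nat -> nat -> Prop) :
  (forall n, exists N, forall m, (N <= m)%N -> P n m) ->
  exists phi : nat -> nat, [/\ forall n, (n <= phi n)%N,
    forall n, (phi n <= phi n.+1)%N & forall n m, (phi n <= m)%N -> P n m].
Proof.
move=> /choice[N PN]; exists (fun n => \sum_(k < n.+1) N k + n)%N.
split=> [n|n|n m]; first exact: leq_addl.
- by rewrite [leqRHS]addnS leqW// leq_add2r [leqRHS]big_ord_recr/= leq_addr.
- move=> h; apply: PN; apply: leq_trans h.
  by rewrite big_ord_recr/= [X in (_ <= X + _)%N]addnC -addnA leq_addr.
Qed.

(** * Real sequences: geometric rates and limits *)

Section sequences.
Context {R : realType}.

Lemma geometric_cauchy (x : nat -> R) (c r : R) : 0 <= r < 1 ->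
  (forall n, `|x n.+1 - x n| <= c * r ^+ n) ->
  exists l, forall n, `|x n - l| <= c / (1 - r) * r ^+ n.
Proof.
move=> /andP[r0 r1] xc; have c0 : 0 <= c.
  by have := xc 0%N; rewrite expr0 mulr1; apply: le_trans.
have r1' : 0 < 1 - r by lra.
(* The partial geometric sum is kept in closed form, so that the induction on [k] closes. *)
have step n k : `|x (n + k)%N - x n| <= c / (1 - r) * r ^+ n * (1 - r ^+ k).
  elim: k => [|k ih]; first by rewrite addn0 subrr normr0 expr0 subrr mulr0.
  rewrite addnS (_ : x (n + k).+1 - x n = (x (n + k).+1 - x (n + k)%N) + (x (n + k)%N - x n)); last by ring.
  apply: le_trans (ler_normD _ _) _.
  apply: le_trans (lerD (xc _) ih) _.
  rewrite exprD exprS; set a := r ^+ n; set b := r ^+ k.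
  rewrite [leLHS](_ : _ = c / (1 - r) * a * (1 - r * b))//.
  by field; rewrite gt_eqF.
have step' n m : (n <= m)%N -> `|x n - x m| <= c / (1 - r) * r ^+ n.
  move=> nm; rewrite distrC -(subnKC nm); apply: le_trans (step _ _) _.
  rewrite -[leRHS]mulr1 ler_wpM2l//; first by rewrite !mulr_ge0 ?exprn_ge0// invr_ge0 ltW.
  by rewrite lerBlDr lerDl exprn_ge0.
have rn : (fun n => c / (1 - r) * r ^+ n) @ \oo --> (0 : R).
  rewrite -(mulr0 (c / (1 - r))); apply: cvgM; first exact: cvg_cst.
  by apply: cvg_expr; rewrite ger0_norm.
have cx : cvgn x.
  apply: cauchy_cvg.
  apply: cauchy_exP => e e0.
  have /cvgrPdist_lt/(_ e e0)[N _ hN] := rn.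
  exists (x N); exists N => // m /= Nm.
  rewrite /ball/=; apply: le_lt_trans (step' _ _ Nm) _.
  by have := hN N (leqnn N); rewrite /= sub0r normrN; apply: le_lt_trans; exact: ler_norm.
exists (limn x) => n.
have h : (fun m => `|x n - x m|) @ \oo --> `|x n - limn x|.
  by apply: cvg_norm; apply: cvgB => //; exact: cvg_cst.
rewrite -(cvg_lim _ h)//; apply: limr_le; first by apply/cvg_ex; eexists; exact: h.
by exists n => // m /= nm; exact: step'.
Qed.

Lemma cvg_half (c : R) : (fun n => c * (1 / 2) ^+ n) @ \oo --> (0 : R).
Proof.
rewrite -(mulr0 c); apply: cvgM; first exact: cvg_cst.
by apply: cvg_expr; rewrite ger0_norm; lra.
Qed.

Lemma apow_cvg0 (q : R) (x : nat -> R) : 0 < q ->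
  (fun n => apow q (x n)) @ \oo --> (0 : R) -> x @ \oo --> (0 : R).
Proof.
move=> q0 xq; apply/cvgrPdist_lt => e e0.
have eq0 : 0 < e `^ q by exact: powR_gt0.
have /cvgrPdist_lt/(_ _ eq0) := xq; apply: filterS => n.
rewrite !sub0r !normrN ger0_norm ?apow_ge0// => h.
rewrite ltNge; apply/negP => xe; move: h; rewrite ltNge => /negP; apply.
by rewrite -[e](gtr0_norm e0); apply: le_apow; rewrite ?(gtr0_norm e0)// ltW.
Qed.

Lemma cvg_sumr (A : Type) (s : seq A) (F : A -> nat -> R) (l : A -> R) :
  (forall i, F i @ \oo --> l i) ->
  (fun n => \sum_(i <- s) F i n) @ \oo --> \sum_(i <- s) l i.
Proof.
move=> Fl; elim: s => [|i s ih].
  by rewrite big_nil; under eq_fun do rewrite big_nil; exact: cvg_cst.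
by rewrite big_cons; under eq_fun do rewrite big_cons; exact: cvgD.
Qed.

Lemma powRX (a q : R) n : 0 <= a -> (a ^+ n) `^ q = (a `^ q) ^+ n.
Proof.
by move=> a0; elim: n => [|n ih]; rewrite ?expr0 ?powR1// !exprS powRM ?exprn_ge0// ih.
Qed.

End sequences.

(** * Modular convergence *)

Section modular.
Context d (T : measurableType d) (R : realType).
Variable mu : {measure set T -> \bar R}.
Hypothesis cmu : measure_is_complete mu.
Context (J : finType) (q : J -> R).
Hypothesis q_gt1 : forall i, 1 < q i.

Local Notation mf f := (measurable_fun [set: T] f).
Local Notation I f := (Rintegral mu setT f).
Local Notation itg := (itg mu).
Implicit Types (U V Z : J -> T -> R) (xi zeta : J -> R) (W : set (J -> T -> R)).

Let q_gt0 i : 0 < q i. Proof. exact: lt_trans (q_gt1 i). Qed.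
Let q_ge0 i : 0 <= q i. Proof. exact: ltW. Qed.

(** Modulars replace norms: the exponent depends on the component, and powers without roots can be
    added and integrated directly. *)
Definition pmod xi : R := \sum_i apow (q i) (xi i).

Lemma pmod_ge0 xi : 0 <= pmod xi.
Proof. by apply: sumr_ge0 => i _; exact: apow_ge0. Qed.

Lemma apow_le_pmod xi i : apow (q i) (xi i) <= pmod xi.
Proof.
rewrite /pmod (bigD1 i)//= lerDl sumr_ge0// => j _; exact: apow_ge0.
Qed.

Definition inLq U : Prop :=
  forall i, mf (U i) /\ itg (fun x => apow (q i) (U i x)).

Definition mconv (U_ : nat -> J -> T -> R) U : Prop :=
  forall i, (fun n => I (fun x => apow (q i) (U_ n i x - U i x))) @ \oo --> (0 : R).

(** Fast convergence: pointwise, with a geometric rate and one integrable majorant [S]. Every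
    modularly convergent sequence has such a subsequence, and dominated convergence then applies to
    all integrands of matching growth. *)
Definition fconv (U_ : nat -> J -> T -> R) U : Prop :=
  exists2 S, itg S & \forall x \ae mu, forall n i,
    apow (q i) (U_ n i x - U i x) <= (1 / 2) ^+ n * S x.

Lemma mf_apow (r : R) (f : T -> R) : mf f -> mf (fun x => apow r (f x)).
Proof.
move=> mf; apply: (@measurableT_comp _ _ _ _ _ _ (@powR R ^~ r)).
  exact: measurable_powR.
exact: measurableT_comp.
Qed.

Lemma itg_apowD (r : R) (f g : T -> R) : 0 < r -> mf f -> mf g ->
  itg (fun x => apow r (f x)) -> itg (fun x => apow r (g x)) ->
  itg (fun x => apow r (f x + g x)).
Proof.
move=> r0 mf mg If Ig.
apply: (itg_le (g := fun x => 2 `^ r * (apow r (f x) + apow r (g x)))).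
- by apply: mf_apow; exact: measurable_funD.
- by apply: aeW => x; rewrite ger0_norm ?apow_ge0// apowD// ltW.
- by apply: itgZ; exact: itgD.
Qed.

Lemma itg_apowZ (r k : R) (f : T -> R) :
  itg (fun x => apow r (f x)) -> itg (fun x => apow r (k * f x)).
Proof. by move=> If; under eq_fun do rewrite apowM; exact: itgZ. Qed.

Lemma inLq_lin (a b : R) U V : inLq U -> inLq V ->
  inLq (fun i x => a * U i x + b * V i x).
Proof.
move=> HU HV i; have [mU iU] := HU i; have [mV iV] := HV i; split.
  by apply: measurable_funD; exact: measurable_funM.
by apply: itg_apowD => //; [exact: measurable_funM|exact: measurable_funM|exact: itg_apowZ|exact: itg_apowZ].
Qed.

Lemma inLqB U V : inLq U -> inLq V -> inLq (fun i x => U i x - V i x).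
Proof.
move=> HU HV; have := @inLq_lin 1 (-1) U V HU HV.
by under eq_fun => i do under eq_fun => x do rewrite mul1r mulN1r.
Qed.

Lemma itg_pmod U : inLq U -> itg (fun x => pmod (U^~ x)).
Proof. by move=> HU; apply: itg_sum => i _; have [] := HU i. Qed.

Lemma fconv_ae (U_ : nat -> J -> T -> R) U : fconv U_ U ->
  \forall x \ae mu, forall i, (fun n => U_ n i x) @ \oo --> U i x.
Proof.
move=> [S _]; apply: filterS => x h i.
apply/subr_cvg0 => /=; apply: (apow_cvg0 (q_gt0 i)).
apply: (@squeeze_cvgr _ _ _ _ (cst 0) (fun n => S x * (1 / 2) ^+ n)); last 2 first.
- exact: cvg_cst.
- exact: cvg_half.
- by apply: nearW => n; rewrite apow_ge0/= mulrC; exact: h.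
Qed.

Lemma mconv_fconv (U_ : nat -> J -> T -> R) U : (forall n, inLq (U_ n)) -> inLq U -> mconv U_ U ->
  exists2 phi : nat -> nat, (forall n, (n <= phi n)%N) & fconv (U_ \o phi) U.
Proof.
move=> HU_ HU cU.
pose r n x := pmod (fun i => U_ n i x - U i x).
have ir n : itg (r n) by apply: (@itg_pmod (fun i x => U_ n i x - U i x)); exact: inLqB.
have Ir0 : (fun n => I (r n)) @ \oo --> (0 : R).
  rewrite (_ : (fun n => _) = (fun n => \sum_i I (fun x => apow (q i) (U_ n i x - U i x)))).
    rewrite [X in _ --> X](_ : _ = \sum_(i : J) (0 : R)); last by rewrite big1.
    exact: cvg_sumr.
  apply/funext => n; rewrite /r I_sum// => i _.
  by have [] := inLqB (HU_ n) HU i.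
have [|phi [phi_ge _ phiP]] := sub_index (P := fun n m => I (r m) <= (1 / 4) ^+ n).
  move=> n; have e0 : 0 < (1 / 4) ^+ n :> R by rewrite exprn_gt0//; lra.
  have /cvgrPdist_le/(_ _ e0)[N _ hN] := Ir0.
  exists N => m Nm; have := hN m Nm; rewrite /= sub0r normrN.
  by apply: le_trans; exact: ler_norm.
exists phi => //.
have [||S iS hS] := itg_series (fun n => ir (phi n)).
- by move=> n x; exact: pmod_ge0.
- by move=> n; exact: phiP.
exists S => //; apply: filterS hS => x hx n i; apply: le_trans (hx n).
exact: (apow_le_pmod (fun i => U_ (phi n) i x - U i x)).
Qed.

Lemma fconv_mconv (U_ : nat -> J -> T -> R) U : (forall n, inLq (U_ n)) -> inLq U -> fconv U_ U -> mconv U_ U.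
Proof.
move=> HU_ HU [S iS hS] i.
have S0 : \forall x \ae mu, 0 <= S x.
  by apply: filterS hS => x /(_ 0%N i); rewrite expr0 mul1r; apply: le_trans; exact: apow_ge0.
apply: (@squeeze_cvgr _ _ _ _ (cst 0) (fun n => I S * (1 / 2) ^+ n)); last 2 first.
- exact: cvg_cst.
- exact: cvg_half.
apply: nearW => n; have [mU iU] := inLqB (HU_ n) HU i.
rewrite (I_ge0 cmu)//=; last 2 first.
- by apply: aeW => x; exact: apow_ge0.
- exact: mf_apow.
rewrite mulrC -IZ//; apply: (I_le cmu) => //; last exact: itgZ.
by apply: filterS hS.
Qed.

(** Continuity of superposition operators. Along a fast sequence $|U_n|^q$ is at most a constant
    times $S + |U|^q$ in each component, which provides the majorant for dominated convergence. *)
Lemma growth_cvg (U_ : nat -> J -> T -> R) U (F : nat -> T -> R) f (b : T -> R) (C : R) :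
  inLq U -> fconv U_ U -> 0 <= C ->
  (forall n, mf (F n)) -> (\forall x \ae mu, F ^~ x @ \oo --> f x) ->
  itg b -> (\forall x \ae mu, forall n, `|F n x| <= C * pmod ((U_ n)^~ x) + b x) ->
  itg f /\ (fun n => I (F n)) @ \oo --> I f.
Proof.
move=> HU [S iS hS] C0 mF Ff ib Fb.
pose K := \sum_i 2 `^ (q i).
have K0 : 0 <= K by apply: sumr_ge0 => i _; exact: powR_ge0.
pose g x := C * (K * (#|J|%:R * S x + pmod (U^~ x))) + b x.
apply: (DCT cmu (g := g)) => //.
  apply: itgD => //; apply: itgZ; apply: itgZ; apply: itgD; first exact: itgZ.
  exact: itg_pmod.
apply: filterS2 hS Fb => x hx Fx n; apply: le_trans (Fx n) _.
rewrite lerD2r ler_wpM2l//.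
have Kle i : 2 `^ (q i) <= K.
  by rewrite /K (bigD1 i)//= lerDl sumr_ge0// => j _; exact: powR_ge0.
have h i : apow (q i) (U_ n i x) <= K * (S x + apow (q i) (U i x)).
  rewrite -[U_ n i x](subrK (U i x)); apply: le_trans (apowD _ _ (q_ge0 i)) _.
  apply: ler_pM; rewrite ?powR_ge0 ?addr_ge0 ?apow_ge0//.
  rewrite lerD2r; apply: le_trans (hx n i) _.
  have Sx : 0 <= S x.
    by have := hx 0%N i; rewrite expr0 mul1r; apply: le_trans; exact: apow_ge0.
  by rewrite -[leRHS]mul1r ler_wpM2r// exprn_ile1//; lra.
apply: (@le_trans _ _ (\sum_i K * (S x + apow (q i) (U i x)))); first exact: ler_sum.
by rewrite -mulr_sumr big_split/= sumr_const -[S x *+ _]mulr_natl.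
Qed.

(** Completeness in the Riesz-Fischer manner: a subsequence with summable increments converges
    pointwise at a geometric rate. *)
Lemma mcauchy_fconv (U_ : nat -> J -> T -> R) : (forall n, inLq (U_ n)) ->
  (forall e, 0 < e -> exists N, forall m n, (N <= m)%N -> (N <= n)%N ->
    forall i, I (fun x => apow (q i) (U_ m i x - U_ n i x)) <= e) ->
  exists phi U, [/\ forall n, (n <= phi n)%N, inLq U & fconv (U_ \o phi) U].
Proof.
move=> HU_ cU.
have [|phi [phi_ge phi_le phiP]] := @sub_index
    (fun n m => forall k, (m <= k)%N -> I (fun x => pmod (fun i => U_ k i x - U_ m i x)) <= (1 / 4) ^+ n).
  move=> n; have e0 : 0 < (1 / 4) ^+ n / (#|J|%:R + 1) :> R.
    by rewrite divr_gt0// ?exprn_gt0//; lra.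
  have [N hN] := cU _ e0; exists N => m Nm k mk.
  rewrite I_sum; last by move=> i _; have [] := inLqB (HU_ k) (HU_ m) i.
  apply: (@le_trans _ _ (\sum_(i : J) (1 / 4) ^+ n / (#|J|%:R + 1))).
    by apply: ler_sum => i _; apply: hN => //; exact: leq_trans mk.
  rewrite sumr_const -[leLHS]mulr_natl mulrA ler_pdivrMr ?ltr_wpDl// mulrC.
  by rewrite ler_wpM2l ?exprn_ge0//; lra.
pose r n x := pmod (fun i => U_ (phi n.+1) i x - U_ (phi n) i x).
have ir n : itg (r n).
  by apply: (@itg_pmod (fun i x => U_ (phi n.+1) i x - U_ (phi n) i x)); exact: inLqB.
have [||S iS hS] := itg_series ir.
- by move=> n x; exact: pmod_ge0.
- by move=> n; apply: phiP => //.
(* The [q i]-th powers of the increments decay with ratio 1/2, hence the increments themselves with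
   its [q i]-th root. *)
pose rho i := (1 / 2 : R) `^ (q i)^-1.
have rho01 i : 0 <= rho i < 1.
  rewrite powR_ge0/= /rho [X in _ < X](_ : _ = 1 `^ (q i)^-1); last by rewrite powR1.
  by apply: gt0_ltr_powR; rewrite ?invr_gt0// ?nnegrE; lra.
have rhoq i n : apow (q i) (rho i ^+ n) = (1 / 2) ^+ n.
  rewrite /apow ger0_norm ?exprn_ge0 ?powR_ge0// powRX ?powR_ge0//.
  by rewrite -powRrM mulVf ?gt_eqF// powRr1//; lra.
(* Each summand is the [q i]-th power of the constant $1/(1-\rho_i)$ from [geometric_cauchy]; their
   sum serves all components at once. *)
pose K := \sum_i apow (q i) (1 - rho i)^-1.
have hlim : \forall x \ae mu, exists xi : J -> R, forall n i,
    apow (q i) (U_ (phi n) i x - xi i) <= (1 / 2) ^+ n * (K * S x).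
  apply: filterS hS => x hx.
  suff /choice[xi hxi] : forall i, exists l, forall n,
      apow (q i) (U_ (phi n) i x - l) <= (1 / 2) ^+ n * (K * S x) by exists xi.
  move=> i.
  have Sx : 0 <= S x.
    by have := hx 0%N; rewrite expr0 mul1r; apply: le_trans; exact: pmod_ge0.
  have SE : apow (q i) (S x `^ (q i)^-1) = S x.
    by rewrite /apow ger0_norm ?powR_ge0// -powRrM mulVf ?gt_eqF// powRr1.
  have [|l hl] := @geometric_cauchy _ (fun n => U_ (phi n) i x) (S x `^ (q i)^-1) (rho i) (rho01 i).
    move=> n; rewrite leNgt; apply/negP => h.
    have := apow_le_pmod (fun i => U_ (phi n.+1) i x - U_ (phi n) i x) i.
    move=> /le_trans/(_ (hx n)); rewrite -(rhoq i) -{1}SE -apowM leNgt => /negP; apply.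
    rewrite /apow; apply: gt0_ltr_powR; rewrite ?nnegrE//.
    by rewrite ger0_norm ?mulr_ge0 ?exprn_ge0 ?powR_ge0// mulrC.
  exists l => n; rewrite -(rhoq i).
  have [r0 r1] := andP (rho01 i).
  apply: (@le_trans _ _ (apow (q i) (S x `^ (q i)^-1 / (1 - rho i) * rho i ^+ n))).
    apply: le_apow => //; apply: le_trans (hl n) _; exact: ler_norm.
  rewrite 2!apowM SE mulrC ler_wpM2l ?apow_ge0// mulrC ler_wpM2r//.
  by rewrite /K (bigD1 i)//= lerDl sumr_ge0// => j _; exact: apow_ge0.
pose U i x := limn (fun n => U_ (phi n) i x).
have UE : \forall x \ae mu, forall n i,
    apow (q i) (U_ (phi n) i x - U i x) <= (1 / 2) ^+ n * (K * S x).
  apply: filterS hlim => x [xi hxi] n i; suff -> : U i x = xi i by [].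
  apply/cvg_lim => //; apply/subr_cvg0 => /=; apply: (apow_cvg0 (q_gt0 i)).
  apply: (@squeeze_cvgr _ _ _ _ (cst 0) (fun n => (K * S x) * (1 / 2) ^+ n)); last 2 first.
  - exact: cvg_cst.
  - exact: cvg_half.
  - by apply: nearW => m; rewrite apow_ge0/= mulrC; exact: hxi.
have fU : fconv (U_ \o phi) U by exists (fun x => K * S x) => //; exact: itgZ.
exists phi, U; split => // i.
have mU : mf (U i).
  apply: (mf_cvg cmu (F := fun n => U_ (phi n) i)).
    by move=> n; have [] := HU_ (phi n) i.
  by apply: filterS (fconv_ae fU) => x; apply.
split => //; have [mU0 iU0] := HU_ (phi 0%N) i.
(* Integrability of the limit is inherited from the first term of the subsequence. *)
have -> : (fun x => apow (q i) (U i x)) =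
    (fun x => apow (q i) (U_ (phi 0%N) i x + - (U_ (phi 0%N) i x - U i x))).
  by apply/funext => x; congr apow; ring.
apply: itg_apowD => //; first by apply: measurableT_comp => //; exact: measurable_funB.
under eq_fun do rewrite apowN.
apply: (itg_le (g := fun x => K * S x)).
- by apply: mf_apow; exact: measurable_funB.
- apply: filterS UE => x /(_ 0%N i); rewrite expr0 mul1r.
  by rewrite ger0_norm ?apow_ge0.
- exact: itgZ.
Qed.

(** Uniform convexity under the integral: small midpoint gaps give small distances once all modulars
    obey a common bound. *)
Lemma gap_cauchy (U_ : nat -> J -> T -> R) (K : R) : (forall n, inLq (U_ n)) ->
  (forall n i, I (fun x => apow (q i) (U_ n i x)) <= K) ->
  (forall e, 0 < e -> exists N, forall m n, (N <= m)%N -> (N <= n)%N ->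
    forall i, I (fun x => pgap (q i) (U_ m i x) (U_ n i x)) <= e) ->
  (forall e, 0 < e -> exists N, forall m n, (N <= m)%N -> (N <= n)%N ->
    forall i, I (fun x => apow (q i) (U_ m i x - U_ n i x)) <= e).
Proof.
move=> HU_ KU gU e e0.
have [K' K'0 KK'] : exists2 K', 0 < K' & K <= K'.
  by exists (Num.max K 1); rewrite ?lt_max ?ltr01 ?orbT// le_max lexx.
(* With this choice [tau * (K' + K')] uses up one half of [e]; the gap term receives the other
   half. *)
pose tau := e / (4 * K').
have tau0 : 0 < tau by rewrite divr_gt0// mulr_gt0.
have /all_sig2_cond : forall i, i \in J -> exists2 C, 0 <= C & forall s t,
   apow (q i) (s - t) <= C * pgap (q i) s t + tau * (apow (q i) s + apow (q i) t).
  by move=> i _; exact: apow_uniform_convex.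
have /choice[C hC] : forall i, exists C, 0 <= C /\ forall s t,
   apow (q i) (s - t) <= C * pgap (q i) s t + tau * (apow (q i) s + apow (q i) t).
  by move=> i; have [C ? ?] := apow_uniform_convex (q_gt1 i) tau0; exists C.
move=> _; pose CC := \sum_i C i + 1.
have CC0 : 0 < CC by rewrite ltr_wpDl// sumr_ge0// => i _; exact: (hC i).1.
have [|N hN] := gU (e / (2 * CC)); first by rewrite divr_gt0// mulr_gt0.
exists N => m n Nm Nn i.
have [mm im] := HU_ m i; have [mn iN] := HU_ n i.
have ig : itg (fun x => pgap (q i) (U_ m i x) (U_ n i x)).
  rewrite /pgap; apply: itgB.
    by under eq_fun do rewrite mulrC; apply: itgZ; exact: itgD.
  under eq_fun do rewrite mulrC; apply: itg_apowZ; exact: itg_apowD.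
apply: (@le_trans _ _ (I (fun x => C i * pgap (q i) (U_ m i x) (U_ n i x) +
    tau * (apow (q i) (U_ m i x) + apow (q i) (U_ n i x))))).
  apply: (I_le cmu).
  - by apply: aeW => x; exact: (hC i).2.
  - by have [] := inLqB (HU_ m) (HU_ n) i.
  - by apply: itgD; [exact: itgZ|apply: itgZ; exact: itgD].
rewrite ID; [|exact: itgZ|by apply: itgZ; exact: itgD].
rewrite IZ// IZ; last exact: itgD.
rewrite ID//.
have h1 : C i * I (fun x => pgap (q i) (U_ m i x) (U_ n i x)) <= e / 2.
  apply: (@le_trans _ _ (C i * (e / (2 * CC)))).
    by rewrite ler_wpM2l ?(hC i).1//; exact: hN.
  apply: (@le_trans _ _ (CC * (e / (2 * CC)))).
    rewrite ler_wpM2r//; first by apply: divr_ge0; [exact: ltW|apply: mulr_ge0 => //; exact: ltW].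
    rewrite /CC (bigD1 i)//= -addrA lerDl.
    by rewrite addr_ge0// sumr_ge0// => j _; exact: (hC j).1.
  by rewrite le_eqVlt; apply/orP; left; apply/eqP; field; rewrite gt_eqF.
have h2 : tau * (I (fun x => apow (q i) (U_ m i x)) + I (fun x => apow (q i) (U_ n i x))) <= e / 2.
  apply: (@le_trans _ _ (tau * (K' + K'))).
    by apply: ler_wpM2l; [exact: ltW|apply: lerD; apply: le_trans (KU _ _) KK'].
  by rewrite le_eqVlt; apply/orP; left; apply/eqP; rewrite /tau; field; rewrite gt_eqF.
by rewrite [e](_ : _ = e / 2 + e / 2) ?lerD//; field.
Qed.

End modular.

(** * Minimization of uniformly convex integrals *)

Section minimization.
Context d (T : measurableType d) (R : realType).
Variable mu : {measure set T -> \bar R}.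
Hypothesis cmu : measure_is_complete mu.
Context (J : finType) (q : J -> R).
Hypothesis q_gt1 : forall i, 1 < q i.

Local Notation mf f := (measurable_fun [set: T] f).
Local Notation I f := (Rintegral mu setT f).
Local Notation itg := (itg mu).
Local Notation pmod := (pmod q).
Local Notation inLq := (inLq mu q).
Local Notation fconv := (fconv mu q).
Local Notation mconv := (mconv mu q).

Let q_gt0 i : 0 < q i. Proof. exact: lt_trans (q_gt1 i). Qed.
Let q_ge0 i : 0 <= q i. Proof. exact: ltW. Qed.

(** The Caratheodory property in the form in which it is used: measurability along measurable
    arguments and, for a.e. [x], sequential continuity in the coordinates. *)
Definition superposable (f : T -> (J -> R) -> R) : Prop :=
  (forall U : J -> T -> R, (forall i, mf (U i)) -> mf (fun x => f x (U^~ x))) /\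
  \forall x \ae mu, forall (xi_ : nat -> J -> R) xi,
    (forall i, (fun n => xi_ n i) @ \oo --> xi i) ->
    (fun n => f x (xi_ n)) @ \oo --> f x xi.

(** [df] is tied to [f] by the tangent inequality [ci_grad] alone: it is a continuous selection of
    subgradients. [ci_mid] is uniform convexity with weight [w i] on component [i]; the growth
    bounds make the integrals finite and continuous, and [ci_coer] bounds minimizing sequences. *)
Record cvx_integrand (f : T -> (J -> R) -> R) (df : T -> (J -> R) -> J -> R)
    (w : J -> R) (k C : R) (b : T -> R) : Prop := CvxIntegrand {
  ci_sup : superposable f;
  ci_dsup : forall i, superposable (fun x xi => df x xi i);
  ci_w : forall i, 0 < w i;
  ci_k : 0 < k;
  ci_C : 0 <= C;
  ci_b : itg b;
  ci_grad : \forall x \ae mu, forall xi zeta,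
    f x xi + \sum_i df x xi i * (zeta i - xi i) <= f x zeta;
  ci_mid : \forall x \ae mu, forall xi zeta,
    f x (fun i => (xi i + zeta i) / 2) + \sum_i w i * pgap (q i) (xi i) (zeta i)
      <= (f x xi + f x zeta) / 2;
  ci_growth : \forall x \ae mu, forall xi, `|f x xi| <= C * pmod xi + b x;
  ci_coer : \forall x \ae mu, forall xi, k * pmod xi - b x <= f x xi;
  ci_dgrowth : \forall x \ae mu, forall xi i t,
    `|df x xi i * t| <= C * (pmod xi + apow (q i) t) + b x }.

Variable W : set (J -> T -> R).
Hypothesis W_Lq : forall U, W U -> inLq U.
Hypothesis W_lin : forall (a b : R) U V, W U -> W V ->
  W (fun i x => a * U i x + b * V i x).
Hypothesis W_closed : forall U_ U, (forall n, W (U_ n)) -> inLq U ->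
  mconv U_ U -> W U.

Section integrand.
Variables (f : T -> (J -> R) -> R) (df : T -> (J -> R) -> J -> R).
Variables (w : J -> R) (k C : R) (b : T -> R).
Hypothesis fP : cvx_integrand f df w k C b.

Let F U := I (fun x => f x (U^~ x)).

Lemma itg_integrand U : inLq U -> itg (fun x => f x (U^~ x)).
Proof.
move=> HU; apply: (itg_le (g := fun x => C * pmod (U^~ x) + b x)).
- by apply: (ci_sup fP).1 => i; have [] := HU i.
- by apply: filterS (ci_growth fP) => x; exact.
- by apply: itgD (ci_b fP); apply: itgZ; exact: itg_pmod.
Qed.

Lemma itg_dintegrand U Z : inLq U -> inLq Z ->
  itg (fun x => \sum_i df x (U^~ x) i * Z i x).
Proof.
move=> HU HZ; apply: itg_sum => i _; have [mZ iZ] := HZ i.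
apply: (itg_le (g := fun x => C * (pmod (U^~ x) + apow (q i) (Z i x)) + b x)).
- apply: measurable_funM => //.
  by apply: (ci_dsup fP i).1 => j; have [] := HU j.
- by apply: filterS (ci_dgrowth fP) => x; exact.
- by apply: itgD (ci_b fP); apply: itgZ; apply: itgD => //; exact: itg_pmod.
Qed.

Lemma integrand_cvg U_ U : (forall n, inLq (U_ n)) -> inLq U -> fconv U_ U ->
  (fun n => F (U_ n)) @ \oo --> F U.
Proof.
move=> HU_ HU cU.
have [] // := growth_cvg cmu q_gt1 HU cU (ci_C fP) _ _ (ci_b fP)
  (F := fun n x => f x ((U_ n)^~ x)) (f := fun x => f x (U^~ x)).
- by move=> n; apply: (ci_sup fP).1 => i; have [] := HU_ n i.
- apply: filterS2 (fconv_ae q_gt1 cU) (ci_sup fP).2 => x h1 h2.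
  exact: h2.
- by apply: filterS (ci_growth fP) => x h n; exact: h.
Qed.

Lemma itg_pgap U V i : inLq U -> inLq V ->
  itg (fun x => pgap (q i) (U i x) (V i x)).
Proof.
move=> HU HV; have [mU iU] := HU i; have [mV iV] := HV i.
rewrite /pgap; apply: itgB.
  by under eq_fun do rewrite mulrC; apply: itgZ; exact: itgD.
by under eq_fun do rewrite mulrC; apply: itg_apowZ; exact: itg_apowD.
Qed.

Lemma I_pgap_ge0 U V i : inLq U -> inLq V ->
  0 <= I (fun x => pgap (q i) (U i x) (V i x)).
Proof.
move=> HU HV; apply: (I_ge0 cmu); last exact: itg_mf (itg_pgap _ _ _).
by apply: aeW => x; exact: pgap_ge0.
Qed.

Lemma mid_gap U V : inLq U -> inLq V ->
  F (fun i x => (U i x + V i x) / 2) +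
    \sum_i w i * I (fun x => pgap (q i) (U i x) (V i x)) <= (F U + F V) / 2.
Proof.
move=> HU HV; have fU := itg_integrand HU; have fV := itg_integrand HV.
have HM : inLq (fun i x => (U i x + V i x) / 2).
  have := inLq_lin q_gt1 (1 / 2) (1 / 2) HU HV.
  by under eq_fun => i do under eq_fun => x do
    rewrite -mulrDr mul1r mulrC.
have fM := itg_integrand HM.
have ig i : itg (fun x => pgap (q i) (U i x) (V i x)) by exact: itg_pgap.
rewrite /F (eq_bigr (fun i => I (fun x => w i * pgap (q i) (U i x) (V i x)))); last first.
  by move=> i _; rewrite IZ.
rewrite -I_sum; last by move=> i _; exact: itgZ.
rewrite -ID//; last by apply: itg_sum => i _; exact: itgZ.
rewrite -ID// mulrC -IZ; last exact: itgD.
apply: (I_le cmu).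
- by apply: filterS (ci_mid fP) => x h; rewrite [leRHS]mulrC; exact: h.
- by apply: itgD => //; apply: itg_sum => i _; exact: itgZ.
- by apply: itgZ; exact: itgD.
Qed.

Lemma integrand_coercive U : inLq U ->
  k * I (fun x => pmod (U^~ x)) <= F U + I b.
Proof.
move=> HU; have ip := itg_pmod HU; have ib := ci_b fP.
rewrite -lerBlDr /F -IZ// -IB//; last exact: itgZ.
apply: (I_le cmu); first by apply: filterS (ci_coer fP) => x; exact.
- by apply: itgB => //; exact: itgZ.
- exact: itg_integrand.
Qed.

Lemma W_mid U V : W U -> W V -> W (fun i x => (U i x + V i x) / 2).
Proof.
move=> WU WV; have := W_lin (1 / 2) (1 / 2) WU WV.
by under eq_fun => i do under eq_fun => x do rewrite -mulrDr mul1r mulrC.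
Qed.

(** The midpoint is admissible, hence costs at least [F U]; what convexity gains at the midpoint is
    therefore at most half the excess of [V]. *)
Lemma minimizer_gap U V i : W U -> W V -> (forall Z, W Z -> F U <= F Z) ->
  w i * I (fun x => pgap (q i) (U i x) (V i x)) <= (F V - F U) / 2.
Proof.
move=> WU WV Umin; have := mid_gap (W_Lq WU) (W_Lq WV).
have := Umin _ (W_mid WU WV); set A := F (fun _ _ => _).
rewrite (bigD1 i)//=; set S := \sum_(_ | _) _.
have : 0 <= S.
  apply: sumr_ge0 => j _; rewrite mulr_ge0 ?I_pgap_ge0//; [exact: ltW (ci_w fP j)|exact: W_Lq|exact: W_Lq].
set X := w i * _; lra.
Qed.

Lemma I_apow_le_pmod U i : inLq U ->
  I (fun x => apow (q i) (U i x)) <= I (fun x => pmod (U^~ x)).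
Proof.
move=> HU; apply: (I_le cmu); [|by have [] := HU i|exact: itg_pmod].
by apply: aeW => x; exact: (apow_le_pmod _ (U^~ x)).
Qed.

(** The direct method with strong convergence: two nearly minimal elements have a small midpoint
    gap, so a minimizing sequence is Cauchy. *)
Lemma minimizer_exists : W !=set0 ->
  exists2 U, W U & forall V, W V -> F U <= F V.
Proof.
move=> [U0 WU0]; have k0 := ci_k fP.
pose E := [set F U | U in W].
have E0 : has_inf E.
  split; first by exists (F U0); exists U0.
  exists (- I b) => _ [U WU <-]; have := integrand_coercive (W_Lq WU).
  have : 0 <= k * I (fun x => pmod (U^~ x)).
    rewrite mulr_ge0 ?(ltW k0)//; apply: (I_ge0 cmu); last exact: itg_mf (itg_pmod (W_Lq WU)).
    by apply: aeW => x; exact: pmod_ge0.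
  lra.
pose m := inf E.
have mF U : W U -> m <= F U by move=> WU; apply: ge_inf; [exact: E0.2|exists U].
have /choice[U_ hU_] : forall n, exists U, W U /\ F U < m + (1 / 2) ^+ n.
  move=> n; have e0 : 0 < (1 / 2) ^+ n :> R by rewrite exprn_gt0//; lra.
  by have [_ [U WU <-] ?] := inf_adherent e0 E0; exists U.
have HU_ n : inLq (U_ n) by apply: W_Lq; exact: (hU_ n).1.
have half1 n : (1 / 2) ^+ n <= 1 :> R by rewrite exprn_ile1//; lra.
have := @mcauchy_fconv _ _ _ mu cmu _ _ q_gt1 U_ HU_.
case.
  apply: (gap_cauchy cmu q_gt1 HU_ (K := (m + 1 + I b) / k)).
    move=> n i; apply: le_trans (I_apow_le_pmod i (HU_ n)) _.
    rewrite ler_pdivlMr// mulrC; apply: le_trans (integrand_coercive (HU_ n)) _.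
    by rewrite lerD2r; apply: le_trans (ltW (hU_ n).2) _; rewrite lerD2l.
  move=> e e0.
  (* A positive lower bound for finitely many weights, written as the inverse of a sum so that an
     empty index set needs no separate case. *)
  have wmin : exists2 w0, 0 < w0 & forall i, w0 <= w i.
    pose S := \sum_i (w i)^-1 + 1.
    have S0 : 0 < S by rewrite ltr_wpDl// sumr_ge0// => i _; rewrite invr_ge0 (ltW (ci_w fP i)).
    exists S^-1; first by rewrite invr_gt0.
    move=> i; rewrite -[leRHS]invrK lef_pV2 ?posrE ?invr_gt0 ?(ci_w fP)//.
    rewrite /S (bigD1 i)//= -addrA lerDl addr_ge0// sumr_ge0// => j _.
    by rewrite invr_ge0 (ltW (ci_w fP j)).
  have [w0 w00 w0w] := wmin.
  have ew : 0 < w0 * e by rewrite mulr_gt0.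
  have /cvgrPdist_le/(_ _ ew)[N _ hN] := cvg_half (1 : R).
  exists N => n n' Nn Nn' i.
  have := mid_gap (HU_ n) (HU_ n').
  have := mF _ (W_mid (hU_ n).1 (hU_ n').1); set A := F (fun _ _ => _).
  rewrite (bigD1 i)//=; set S := \sum_(_ | _) _.
  have : 0 <= S.
    by apply: sumr_ge0 => j _; rewrite mulr_ge0 ?I_pgap_ge0// (ltW (ci_w fP j)).
  have := (hU_ n).2; have := (hU_ n').2.
  have := hN _ Nn; have := hN _ Nn'; rewrite /= !sub0r !normrN !mul1r.
  rewrite !ger0_norm ?exprn_ge0//.
  set X := I _ => h1 h2 h3 h4 h5 h6 h7.
  rewrite -(ler_pM2l w00); apply: le_trans (_ : w i * X <= _); last lra.
  by rewrite ler_wpM2r// I_pgap_ge0.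
move=> phi [U [phi_ge HU cU]]; exists U.
  apply: (W_closed (U_ := U_ \o phi)) => //.
    by move=> n; exact: (hU_ _).1.
  by apply: (fconv_mconv cmu q_gt1) => // n; exact: HU_.
move=> V WV; apply: le_trans (mF V WV).
have cF : (fun n => F (U_ (phi n))) @ \oo --> F U.
  by apply: (@integrand_cvg (U_ \o phi)) => // n; exact: HU_.
apply/ler_addgt0Pr => e e0.
have /cvgrPdist_le/(_ _ e0)[N _ hN] := cvg_half (1 : R).
rewrite -(cvg_lim _ cF)//; apply: limr_le; first by apply/cvg_ex; eexists; exact: cF.
exists N => // n Nn; apply: le_trans (ltW (hU_ _).2) _; rewrite lerD2l.
have := hN (phi n) (leq_trans Nn (phi_ge n)); rewrite /= sub0r normrN mul1r.
by apply: le_trans; exact: ler_norm.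
Qed.

(** No difference quotient is formed. The tangent inequality at $U + 2^{-n}V$, evaluated at [U],
    together with minimality gives $0 \le \int df(U+2^{-n}V)\cdot V$, and continuity of [df] lets
    [n] tend to infinity. Linearity in [V] gives the reverse inequality. *)
Lemma euler_lagrange U Z : W U -> (forall V, W V -> F U <= F V) -> W Z ->
  I (fun x => \sum_i df x (U^~ x) i * Z i x) = 0.
Proof.
move=> WU Umin; suff key V : W V -> 0 <= I (fun x => \sum_i df x (U^~ x) i * V i x).
  move=> WZ; apply/eqP; rewrite eq_le key// andbT.
  (* The opposite of [Z], written as a combination of two terms to match the closure hypothesis on
     [W]. *)
  have WN : W (fun i x => (-1) * Z i x + 0 * Z i x) by exact: W_lin.
  have IE : I (fun x => \sum_i df x (U^~ x) i * (-1 * Z i x + 0 * Z i x)) =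
      - I (fun x => \sum_i df x (U^~ x) i * Z i x).
    rewrite -[RHS]mulN1r -IZ; last by apply: itg_dintegrand; exact: W_Lq.
    apply: eq_I => x; rewrite mulr_sumr; apply: eq_bigr => i _; ring.
  by have := key _ WN; rewrite IE oppr_ge0.
move=> WV.
have HU := W_Lq WU; have HV := W_Lq WV.
pose U_ n : J -> T -> R := fun i x => 1 * U i x + (1 / 2) ^+ n * V i x.
have WU_ n : W (U_ n) by exact: W_lin.
have HU_ n := W_Lq (WU_ n).
have t0 n : 0 < (1 / 2) ^+ n :> R by rewrite exprn_gt0//; lra.
have t1 n : (1 / 2) ^+ n <= 1 :> R by rewrite exprn_ile1//; lra.
pose G n x := \sum_i df x ((U_ n)^~ x) i * V i x.
have IG n : 0 <= I (G n).
  have : F U - F (U_ n) <= 0 by rewrite subr_le0; exact: Umin.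
  rewrite -(pmulr_rge0 _ (t0 n)) -IZ; last exact: itg_dintegrand.
  move=> h; apply: le_trans (_ : F (U_ n) - F U <= _); first by rewrite -opprB oppr_ge0.
  rewrite /F -IB; [|exact: itg_integrand|exact: itg_integrand].
  apply: (I_le cmu); last 2 first.
  - by apply: itgB; exact: itg_integrand.
  - by apply: itgZ; exact: itg_dintegrand.
  apply: filterS (ci_grad fP) => x /(_ ((U_ n)^~ x) (U^~ x)).
  rewrite /G mulr_sumr.
  rewrite (eq_bigr (fun i => - ((1 / 2) ^+ n * (df x ((U_ n)^~ x) i * V i x)))); last first.
    by move=> i _; rewrite /U_; ring.
  rewrite sumrN; lra.
(* Since $q_i > 1$, $(2^{-n})^{q_i} \le 2^{-n}$, and the modular of [V] is a majorant. *)
have cU : fconv U_ U.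
  exists (fun x => pmod (V^~ x)); first exact: itg_pmod.
  apply: aeW => x n i; rewrite /U_ mul1r addrAC subrr add0r apowM.
  apply: ler_pM; rewrite ?apow_ge0//; last exact: (apow_le_pmod q (V^~ x)).
  rewrite /apow ger0_norm ?(ltW (t0 n))//.
  by apply: ge1r_powR; rewrite ?t0 ?t1// ltW.
have [|||_ cG] := growth_cvg cmu q_gt1 HU cU (C := C * #|J|%:R)
  (b := fun x => C * pmod (V^~ x) + #|J|%:R * b x)
  (F := G) (f := fun x => \sum_i df x (U^~ x) i * V i x) (mulr_ge0 (ci_C fP) (ler0n _ _))
  (fun n => itg_mf (itg_dintegrand (HU_ n) HV)) _ _ _.
- have hsup : \forall x \ae mu, forall i, forall (xi_ : nat -> J -> R) xi,
      (forall i, (fun n => xi_ n i) @ \oo --> xi i) ->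
      (fun n => df x (xi_ n) i) @ \oo --> df x xi i.
    by apply: filter_forall => i; exact: (ci_dsup fP i).2.
  apply: filterS2 (fconv_ae q_gt1 cU) hsup => x h1 h2.
  apply: cvg_sumr => i; apply: cvgM; last exact: cvg_cst.
  exact: (h2 i (fun n => (U_ n)^~ x)).
- apply: itgD; first by apply: itgZ; exact: itg_pmod.
  by apply: itgZ; exact: ci_b fP.
- apply: filterS (ci_dgrowth fP) => x h n; rewrite /G.
  apply: le_trans (ler_norm_sum _ _ _) _.
  apply: (@le_trans _ _ (\sum_i (C * (pmod ((U_ n)^~ x) + apow (q i) (V i x)) + b x))).
    by apply: ler_sum => i _; exact: h.
  rewrite big_split/= -mulr_sumr big_split/= !sumr_const.
  rewrite -[pmod _ *+ _]mulr_natl -[b x *+ _]mulr_natl -/(pmod (V^~ x)).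
  by rewrite le_eqVlt; apply/orP; left; apply/eqP; ring.
rewrite -(cvg_lim _ cG)//; apply: limr_ge; last exact: nearW.
by apply/cvg_ex; eexists; exact: cG.
Qed.

End integrand.
End minimization.

Lemma big_option (V : nmodType) (D : finType) (F : option D -> V) :
  \sum_i F i = F None + \sum_i F (Some i).
Proof.
rewrite (bigD1 None)//=; congr (_ + _).
rewrite (reindex_omap Some id)//=; last by case.
by apply: eq_bigl => i; rewrite eqxx.
Qed.

(** * Flat exponentials *)

Section flat_exponential.
Context {R : realType}.
Implicit Types (x y s t : R).

(* [eflat q x = q.[1/x] exp(-1/x)] for [x > 0], extended by zero: the class of
   these functions is stable under differentiation. *)
Definition eflat (q : {poly R}) x : R :=
  if 0 < x then q.[x^-1] * expR (- x^-1) else 0.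

(** With $y = 1/x$, differentiating $q(y)e^{-y}$ in [x] replaces $q(y)$ by $y^2(q(y) - q'(y))$. *)
Definition eflat' (q : {poly R}) : {poly R} := ('X ^+ 2) * (q - q^`()).

Lemma exprn_expR_le n y : 0 <= y -> y ^+ n * expR (- y) <= n`!%:R.
Proof.
move=> y0; rewrite expRN ler_pdivrMr ?expR_gt0//.
case: n => [|n].
  by rewrite expr0 fact0 mul1r -expR0 ler_expR.
have := expR_ge1Dxn n y0; rewrite -ler_pdivrMl ?ltr0n ?fact_gt0// mulrC.
by apply: le_trans; rewrite lerDr.
Qed.

Lemma horner_expR_le (q : {poly R}) : exists2 K, 0 <= K &
  forall y, 0 <= y -> `|q.[y] * expR (- y)| <= K.
Proof.
exists (\sum_(i < size q) `|q`_i| * i`!%:R).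
  by apply: sumr_ge0 => i _; rewrite mulr_ge0.
move=> y y0; rewrite horner_coef mulr_suml.
apply: le_trans (ler_norm_sum _ _ _) _; apply: ler_sum => i _.
rewrite -mulrA normrM ler_wpM2l// ger0_norm ?exprn_expR_le//.
by rewrite mulr_ge0 ?exprn_ge0 ?expR_ge0.
Qed.

Lemma eflat_le0 q x : x <= 0 -> eflat q x = 0.
Proof. by move=> x0; rewrite /eflat ltNge x0. Qed.

Lemma eflat_gt0 q x : 0 < x -> eflat q x = q.[x^-1] * expR (- x^-1).
Proof. by move=> x0; rewrite /eflat x0. Qed.

Lemma eflat_bounded q : exists2 K, 0 <= K & forall x, `|eflat q x| <= K.
Proof.
have [K K0 hK] := horner_expR_le q; exists K => // x.
have [x0|x0] := leP x 0; first by rewrite eflat_le0// normr0.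
by rewrite eflat_gt0// hK// invr_ge0 ltW.
Qed.

(** Boundedness for the polynomial $X^2 q$ is quadratic decay at 0 for [q], which is what
    differentiability at 0 requires. *)
Lemma eflat_flat q : exists2 K, 0 <= K & forall x, `|eflat q x| <= K * x ^+ 2.
Proof.
have [K K0 hK] := horner_expR_le ('X ^+ 2 * q); exists K => // x.
have [x0|x0] := leP x 0; first by rewrite eflat_le0// normr0 mulr_ge0// sqr_ge0.
have xi : 0 <= x^-1 by rewrite invr_ge0 ltW.
rewrite eflat_gt0//; have := hK _ xi; rewrite hornerM hornerXn -mulrA normrM.
rewrite (ger0_norm (exprn_ge0 2 xi)) exprVn mulrC -ler_pdivlMr ?invr_gt0 ?exprn_gt0//.
by rewrite invrK.
Qed.

Lemma is_derive_flat0 (f : R -> R) K : (forall x, `|f x| <= K * x ^+ 2) ->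
  is_derive (0 : R) (1 : R) f 0.
Proof.
move=> fK; have K0 : 0 <= K by have := fK 1; rewrite expr1n mulr1; exact: le_trans.
have f0 : f 0 = 0.
  by have := fK 0; rewrite expr0n mulr0 normr_le0 => /eqP.
have h : (fun h => h^-1 *: ((f \o shift 0) (h *: (1 : R)) - f 0)) @ 0^' --> (0 : R).
  apply/cvgr0Pnorm_lt => e e0 /=; near=> h.
  have h0 : h != 0 by near: h; exact: nbhs_dnbhs_neq.
  rewrite f0 subr0 addr0 /GRing.scale/= mulr1 normrM normfV.
  rewrite ltr_pdivrMl ?normr_gt0// (le_lt_trans (fK h))//.
  rewrite -real_normK ?num_real// expr2 mulrCA ltr_pM2l ?normr_gt0//.
  apply: (@le_lt_trans _ _ ((K + 1) * `|h|)); first by rewrite ler_wpM2r// lerDl.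
  rewrite mulrC -ltr_pdivlMr ?ltr_wpDl//.
  near: h; apply: cvg_within; exists (e / (K + 1)); first by rewrite /= divr_gt0// ltr_wpDl.
  by move=> y /=; rewrite sub0r normrN.
split; first by apply/cvg_ex; exists 0.
exact/cvg_lim.
Unshelve. all: by end_near. Qed.

Lemma is_derive_eflat q x : is_derive x (1 : R) (eflat q) (eflat (eflat' q) x).
Proof.
have [x0|x0|->] := ltgtP x 0.
- rewrite (eflat_le0 _ (ltW x0)).
  have d0 : is_derive x (1 : R) (cst (0 : R)) 0 by exact: is_derive_cst.
  apply: near_eq_is_derive d0.
  near=> y; rewrite eflat_le0//; apply: ltW.
  by near: y; exact: lt_nbhsl.
- rewrite (eflat_gt0 _ x0).
  apply: (near_eq_is_derive (f := fun y => q.[y^-1] * expR (- y^-1))).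
    near=> y; rewrite eflat_gt0//.
    by near: y; exact: lt_nbhsr.
  have dV : is_derive x (1 : R) (fun y => y^-1) (- x ^- 2).
    have := @is_deriveV R id x 1 1 _ (is_derive_id _ _).
    by rewrite /GRing.scale/= mulr1; apply; rewrite gt_eqF.
  have d1 := is_derive1_comp (is_derive_poly q x^-1) dV.
  have dN : is_derive x (1 : R) (fun y => - y^-1) (- - x ^- 2) := is_deriveN dV.
  have d2 := @is_derive1_comp R expR (fun y => - y^-1) x _ _
    (is_derive_expR (- x^-1)) dN.
  have d := is_deriveM d1 d2.
  apply: is_derive_eq d _; rewrite /= /GRing.scale/=.
  rewrite /eflat' hornerM hornerXn hornerD hornerN exprVn; ring.
- rewrite (eflat_le0 _ (lexx 0)).
  by have [K _ hK] := eflat_flat q; exact: is_derive_flat0 hK.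
Unshelve. all: by end_near. Qed.

Lemma continuous_eflat q : continuous (eflat q).
Proof.
move=> x; apply: differentiable_continuous; apply/derivable1_diffP.
by have [] := is_derive_eflat q x.
Qed.

(** $e^{-1/x}$ on the positive half-line, with values in $[0,1]$; its derivative is
    $x^{-2}e^{-1/x}$, named next. Translates and dilates of it play the roles of positive parts,
    signs and indicator functions while keeping compositions with test functions smooth. *)
Definition ebump := eflat 1.
Definition debump := eflat ('X ^+ 2).

Lemma is_derive_ebump x : is_derive x (1 : R) ebump (debump x).
Proof.
have := is_derive_eflat 1 x; rewrite /eflat' derivC subr0 mulr1.
exact.
Qed.

Lemma ebumpE x : 0 < x -> ebump x = expR (- x^-1).
Proof. by move=> x0; rewrite /ebump eflat_gt0// hornerC mul1r. Qed.

Lemma ebump_ge0 x : 0 <= ebump x.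
Proof.
have [x0|x0] := leP x 0; first by rewrite /ebump eflat_le0.
by rewrite ebumpE// expR_ge0.
Qed.

Lemma ebump_gt0 x : 0 < x -> 0 < ebump x.
Proof. by move=> x0; rewrite ebumpE// expR_gt0. Qed.

Lemma ebump_le1 x : ebump x <= 1.
Proof.
have [x0|x0] := leP x 0; first by rewrite /ebump eflat_le0.
by rewrite ebumpE// -expR0 ler_expR oppr_le0 invr_ge0 ltW.
Qed.

Lemma debump_ge0 x : 0 <= debump x.
Proof.
have [x0|x0] := leP x 0; first by rewrite /debump eflat_le0.
by rewrite /debump eflat_gt0// hornerXn mulr_ge0 ?expR_ge0 ?exprn_ge0// invr_ge0 ltW.
Qed.

Lemma debump_gt0 x : 0 < x -> 0 < debump x.
Proof.
by move=> x0; rewrite /debump eflat_gt0// hornerXn mulr_gt0 ?expR_gt0 ?exprn_gt0// invr_gt0.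
Qed.

Lemma debump_decay x : debump x * `|x| <= 1.
Proof.
have [x0|x0] := leP x 0; first by rewrite /debump eflat_le0 ?mul0r.
rewrite /debump eflat_gt0// hornerXn gtr0_norm// mulrAC expr2 mulfVK ?gt_eqF//.
have := @exprn_expR_le 1 x^-1; rewrite expr1; apply.
by rewrite invr_ge0 ltW.
Qed.

Lemma ebump_lipschitz : exists2 L, 0 <= L &
  forall s t, `|ebump s - ebump t| <= L * `|s - t|.
Proof.
have [L L0 hL] := eflat_bounded ('X ^+ 2); exists L => // s t.
wlog st : s t / t < s.
  move=> h; have [st|st|->] := ltgtP s t; last by rewrite !subrr normr0 mulr0.
    by rewrite distrC [`|s - t|]distrC h.
  exact: h.
have [||c _ ->] := @MVT R ebump debump t s st.
- by move=> x _; exact: is_derive_ebump.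
- by apply: continuous_subspaceT; exact: continuous_eflat.
by rewrite normrM ler_wpM2r.
Qed.

Lemma ebump_cvg1 s : 0 < s -> (fun n => ebump (2 ^+ n * s)) @ \oo --> (1 : R).
Proof.
move=> s0; apply: (@squeeze_cvgr _ _ _ _ (fun n => 1 - s^-1 * (1 / 2) ^+ n) (cst 1)); last 2 first.
- rewrite -[X in _ --> X](subr0 1); apply: cvgB; first exact: cvg_cst.
  exact: cvg_half.
- exact: cvg_cst.
apply: nearW => n; rewrite ebump_le1 andbT ebumpE ?mulr_gt0 ?exprn_gt0//.
apply: le_trans (expR_ge1Dx _); rewrite lerD2l lerN2 invfM mulrC.
by rewrite ler_wpM2l ?invr_ge0 ?(ltW s0)// div1r exprVn.
Qed.

(** An odd smooth approximation of the sign; being assembled from [ebump], it yields admissible test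
    functions when composed with a Sobolev function. *)
Definition sgbump n s : R := ebump (2 ^+ n * s) - ebump (- (2 ^+ n * s)).

Lemma sgbump_cvg s : (fun n => sgbump n s) @ \oo --> (Num.sg s : R).
Proof.
have [s0|s0|->] := ltgtP s 0.
- have h : (fun n => ebump (2 ^+ n * s)) = cst 0.
    by apply/funext => n; rewrite /ebump eflat_le0// pmulr_rle0 ?exprn_gt0// ltW.
  rewrite ltr0_sg// -[-1]sub0r; apply: cvgB; first by rewrite h; exact: cvg_cst.
  by under eq_fun do rewrite -mulrN; apply: ebump_cvg1; rewrite oppr_gt0.
- have h : (fun n => ebump (- (2 ^+ n * s))) = cst 0.
    apply/funext => n; rewrite /ebump eflat_le0// oppr_le0 mulr_ge0 ?exprn_ge0//.
    exact: ltW.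
  rewrite gtr0_sg// -[1]subr0; apply: cvgB; last by rewrite h; exact: cvg_cst.
  exact: ebump_cvg1.
- rewrite sgr0 /sgbump; under eq_fun do rewrite mulr0 oppr0 subrr; exact: cvg_cst.
Qed.

Lemma sgbump_mul_ge0 n s : 0 <= s * sgbump n s.
Proof.
have p2 : 0 < 2 ^+ n :> R by rewrite exprn_gt0.
rewrite /sgbump; have [s0|s0|->] := ltgtP s 0.
- rewrite [X in _ * (X - _)]/ebump eflat_le0 ?pmulr_rle0// ?(ltW s0)// sub0r mulrN oppr_ge0.
  by rewrite mulr_le0_ge0 ?ebump_ge0// ltW.
- rewrite [X in _ * (_ - X)]/ebump eflat_le0 ?oppr_le0 ?pmulr_rge0// ?(ltW s0)// subr0.
  exact: ebump_ge0.
- by rewrite mul0r.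
Qed.

Lemma sgbump_le1 n s : `|sgbump n s| <= 1.
Proof.
rewrite /sgbump ler_norml; have := ebump_ge0 (2 ^+ n * s); have := ebump_ge0 (- (2 ^+ n * s)).
have := ebump_le1 (2 ^+ n * s); have := ebump_le1 (- (2 ^+ n * s)); lra.
Qed.

(** [debump] decays like the inverse of its argument, which grows like $2^n|s|$. At [s = 0] the
    value remains [debump 1]; this contrast is what isolates the zero set of a function. *)
Lemma debump_vanish s : s != 0 -> (fun n => debump (2 ^+ n * s + 1)) @ \oo --> (0 : R).
Proof.
move=> s0; have ns : 0 < `|s| by rewrite normr_gt0.
apply: (@squeeze_cvgr _ _ _ _ (cst 0) (fun n => 2 / `|s| * (1 / 2) ^+ n)); last 2 first.
- exact: cvg_cst.
- exact: cvg_half.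
have e0 : 0 < `|s| / 2 by rewrite divr_gt0.
have /cvgrPdist_le/(_ _ e0)[N _ hN] := cvg_half (1 : R).
exists N => // n /hN /=; rewrite sub0r normrN mul1r div1r exprVn ger0_norm ?invr_ge0 ?exprn_ge0//.
have p2 : 0 < 2 ^+ n :> R by rewrite exprn_gt0.
rewrite -[(2 ^+ n)^-1]mul1r ler_pdivrMr// => h.
rewrite debump_ge0/=.
have big : 2 ^+ n * `|s| / 2 <= `|2 ^+ n * s + 1|.
  have := lerB_normD (2 ^+ n * s) 1; rewrite normrM (gtr0_norm p2) normr1; lra.
have pos : 0 < 2 ^+ n * `|s| / 2 by rewrite divr_gt0// mulr_gt0.
have := debump_decay (2 ^+ n * s + 1).
move=> /(le_trans (ler_wpM2l (debump_ge0 _) big)).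
rewrite -ler_pdivlMr// => /le_trans; apply.
by rewrite le_eqVlt; apply/orP; left; apply/eqP; field; rewrite !gt_eqF.
Qed.

End flat_exponential.

(** * The smoothed absolute value and its derivative *)

Section smoothed_abs.
Context {R : realType}.
Implicit Types (del s t : R).

(** Subtracting [del] makes it vanish at 0, where it is quadratic: it is at most $s^2/\delta$, hence
    integrable along functions that lie in $L^2$ but perhaps not in $L^1$. *)
Definition sabs del s : R := Num.sqrt (s ^+ 2 + del ^+ 2) - del.

Definition ssgn del s : R := s / Num.sqrt (s ^+ 2 + del ^+ 2).

Let sq_gt0 del s : 0 < del -> 0 < s ^+ 2 + del ^+ 2.
Proof. by move=> d0; rewrite ltr_wpDl ?sqr_ge0// exprn_gt0. Qed.

Let rt_gt0 del s : 0 < del -> 0 < Num.sqrt (s ^+ 2 + del ^+ 2).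
Proof. by move=> d0; rewrite sqrtr_gt0 sq_gt0. Qed.

Let rtK del s : 0 < del -> Num.sqrt (s ^+ 2 + del ^+ 2) ^+ 2 = s ^+ 2 + del ^+ 2.
Proof. by move=> d0; rewrite sqr_sqrtr// ltW// sq_gt0. Qed.

Lemma sabs_tangent del s t : 0 < del ->
  sabs del s + ssgn del s * (t - s) <= sabs del t.
Proof.
move=> d0; rewrite /sabs /ssgn; have := rt_gt0 s d0; have := rt_gt0 t d0.
have := rtK s d0; have := rtK t d0.
set S := Num.sqrt (s ^+ 2 + _); set X := Num.sqrt _ => XE SE X0 S0.
suff : S + s / S * (t - s) <= X by lra.
rewrite -(ler_pM2r S0) mulrDl (_ : s / S * (t - s) * S = s * (t - s)); last first.
  by field; rewrite gt_eqF.
(* Cauchy-Schwarz for the plane vectors $(s,\delta)$ and $(t,\delta)$. *)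
have h : (s * t + del ^+ 2) ^+ 2 <= (X * S) ^+ 2.
  rewrite exprMn XE SE; have := sqr_ge0 (s - t); nra.
have : s * t + del ^+ 2 <= X * S.
  rewrite leNgt; apply/negP => lt; move: h; rewrite leNgt => /negP; apply.
  by rewrite ltr_pXn2r// nnegrE ?ltW// ?mulr_gt0// (lt_trans _ lt)// mulr_gt0.
by apply: le_trans; rewrite -expr2 SE; nra.
Qed.

Lemma sabs_ge0 del s : 0 < del -> 0 <= sabs del s.
Proof.
move=> d0; rewrite /sabs subr_ge0 -[leLHS](gtr0_norm d0) -sqrtr_sqr.
by rewrite ler_wsqrtr// lerDr sqr_ge0.
Qed.

Lemma sabs_le del s : 0 < del -> sabs del s <= s ^+ 2 / del.
Proof.
move=> d0; rewrite /sabs; have := rt_gt0 s d0; have := rtK s d0; have := sabs_ge0 s d0.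
rewrite /sabs; set S := Num.sqrt _ => S1 SE S0; rewrite ler_pdivlMr//; nra.
Qed.

Lemma sabs0 del : 0 < del -> sabs del 0 = 0.
Proof. by move=> d0; rewrite /sabs expr0n add0r sqrtr_sqr gtr0_norm// subrr. Qed.

Lemma sabs_mono del del' s : 0 < del' -> del' <= del -> sabs del s <= sabs del' s.
Proof.
move=> d0 dd; have d1 := lt_le_trans d0 dd; rewrite /sabs.
have := rt_gt0 s d0; have := rtK s d0; have := rt_gt0 s d1; have := rtK s d1.
have := sabs_ge0 s d0; have := sabs_ge0 s d1; rewrite /sabs.
set S := Num.sqrt (_ + del ^+ 2); set X := Num.sqrt _ => S1 X1 SE S0 XE X0.
have [//|h] := leP (S - del) (X - del').
(* Both products equal $s^2$, whereas under [h] both factors on the left would exceed those on the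
   right. *)
have e : (S - del) * (S + del) = (X - del') * (X + del') by rewrite -!subr_sqr SE XE; ring.
exfalso; nra.
Qed.

Lemma ssgn_le1 del s : 0 < del -> `|ssgn del s| <= 1.
Proof.
move=> d0; rewrite /ssgn normrM normfV (gtr0_norm (rt_gt0 s d0)).
rewrite ler_pdivrMr ?rt_gt0// mul1r -sqrtr_sqr ler_wsqrtr// lerDl sqr_ge0//.
Qed.

Lemma ssgn_le del s : 0 < del -> `|ssgn del s| <= `|s| / del.
Proof.
move=> d0; rewrite /ssgn normrM normfV (gtr0_norm (rt_gt0 s d0)).
rewrite ler_wpM2l// lef_pV2 ?posrE ?rt_gt0// -[leLHS](gtr0_norm d0) -sqrtr_sqr.
by rewrite ler_wsqrtr// lerDr sqr_ge0.
Qed.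

Lemma ssgn_sg del s : 0 < del -> ssgn del s * Num.sg s = `|ssgn del s|.
Proof.
move=> d0; rewrite /ssgn normrM normfV (gtr0_norm (rt_gt0 s d0)) normrEsg.
by rewrite mulrAC [_ * s]mulrC.
Qed.

Lemma ssgn_ge0 del s t : 0 < del -> 0 <= s * t -> 0 <= ssgn del s * t.
Proof.
by move=> d0 st; rewrite /ssgn mulrAC divr_ge0// sqrtr_ge0.
Qed.

Lemma continuous_sabs del : continuous (sabs del).
Proof.
move=> s; rewrite /sabs; apply: cvgB; last exact: cvg_cst.
apply: (cvg_comp (fun x => x ^+ 2 + del ^+ 2) Num.sqrt); last exact: sqrt_continuous.
by apply: cvgD; [exact: exprn_continuous|exact: cvg_cst].
Qed.

Lemma continuous_ssgn del : 0 < del -> continuous (ssgn del).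
Proof.
move=> d0 s; rewrite /ssgn; apply: cvgM; first exact: cvg_id.
apply: cvgV; first by rewrite gt_eqF// rt_gt0.
apply: (cvg_comp (fun x => x ^+ 2 + del ^+ 2) Num.sqrt); last exact: sqrt_continuous.
by apply: cvgD; [exact: exprn_continuous|exact: cvg_cst].
Qed.

(** The argument and the smoothing parameter move together. At a zero of the limit the quotient may
    behave arbitrarily, so later estimates carry a factor [Num.sg] of the limit. *)
Lemma ssgn_cvg (del_ s_ : nat -> R) s : (forall n, 0 < del_ n) ->
  del_ @ \oo --> (0 : R) -> s_ @ \oo --> s -> s != 0 ->
  (fun n => `|ssgn (del_ n) (s_ n)|) @ \oo --> (1 : R).
Proof.
move=> d0 dcv scv s0; rewrite -[X in _ --> X](_ : `|s / Num.sqrt (s ^+ 2 + 0 ^+ 2)| = 1); last first.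
  rewrite expr0n addr0 sqrtr_sqr normrM normfV normr_id divff// normr_eq0//.
apply: cvg_norm; rewrite /ssgn; apply: cvgM => //; apply: cvgV.
  by rewrite expr0n addr0 sqrtr_sqr normr_eq0.
apply: (cvg_comp (fun n => s_ n ^+ 2 + del_ n ^+ 2) Num.sqrt); last exact: sqrt_continuous.
by apply: cvgD; [under eq_fun do rewrite expr2; exact: cvgM|under eq_fun do rewrite expr2; rewrite expr2; exact: cvgM].
Qed.

End smoothed_abs.

(** * Growth and continuity of the derivative of a power *)

Section dpow_growth.
Context {R : realType}.
Implicit Types (q s t : R).

Lemma dpow_growth q s t : 1 < q ->
  `|dpow q s * t| <= q * (apow q s + apow q t).
Proof.
move=> q1; have q0 : 0 < q by lra.
rewrite /dpow !normrM (gtr0_norm q0) -!mulrA ler_wpM2l ?(ltW q0)//.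
rewrite [`|_ `^ _|]ger0_norm ?powR_ge0//.
apply: (@le_trans _ _ (`|s| `^ (q - 1) * `|t|)).
  rewrite ler_wpM2l ?powR_ge0// -[leRHS]mul1r ler_wpM2r// normr_sg.
  by case: (_ != _) => /=.
have h x : 0 <= x -> x `^ (q - 1) * x = x `^ q by move=> x0; rewrite mulrC mulr_powRB1.
have [st|/ltW ts] := leP `|s| `|t|.
  apply: (@le_trans _ _ (`|t| `^ (q - 1) * `|t|)).
    by rewrite ler_wpM2r// ge0_ler_powR ?nnegrE//; lra.
  by rewrite h// lerDr apow_ge0.
apply: (@le_trans _ _ (`|s| `^ (q - 1) * `|s|)); first by rewrite ler_wpM2l ?powR_ge0.
by rewrite h// lerDl apow_ge0.
Qed.

(** The sign is discontinuous, so the function is rewritten through positive and negative parts as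
    $q((s^+)^{q-1} - (s^-)^{q-1})$. *)
Lemma continuous_dpow q : 1 < q -> continuous (dpow q).
Proof.
move=> q1; have q10 : 0 < q - 1 by lra.
have -> : dpow q = fun s => q * (apow (q - 1) ((`|s| + s) / 2) - apow (q - 1) ((`|s| - s) / 2)).
  apply/funext => s; rewrite /dpow -mulrA; congr (q * _).
  have [s0|s0|->] := ltgtP s 0.
  - rewrite ltr0_sg// ltr0_norm// addNr mul0r apow0 ?gt_eqF//.
    by rewrite (_ : (- s - s) / 2 = - s) ?apowN /apow ?ltr0_norm//; [ring|field].
  - rewrite gtr0_sg// gtr0_norm// subrr mul0r apow0 ?gt_eqF//.
    by rewrite (_ : (s + s) / 2 = s) /apow ?gtr0_norm//; [ring|field].
  - by rewrite sgr0 addr0 subr0 subrr mulr0.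
move=> s; apply: cvgM; first exact: cvg_cst.
apply: cvgB.
  apply: (cvg_comp (fun s => (`|s| + s) / 2) (apow (q - 1))); last exact: continuous_apow.
  by apply: cvgM; [apply: cvgD; [apply: cvg_norm|]; exact: cvg_id|exact: cvg_cst].
apply: (cvg_comp (fun s => (`|s| - s) / 2) (apow (q - 1))); last exact: continuous_apow.
by apply: cvgM; [apply: cvgB; [apply: cvg_norm|]; exact: cvg_id|exact: cvg_cst].
Qed.

End dpow_growth.

(** * Closure rules for superposition operators *)

Section superposition.
Context d (T : measurableType d) (R : realType).
Variable mu : {measure set T -> \bar R}.
Local Notation mf f := (measurable_fun [set: T] f).

Section index.
Context (J : finType).
Local Notation sup := (@superposable _ T R mu J).

Lemma sup_add f g : sup f -> sup g -> sup (fun x xi => f x xi + g x xi).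
Proof.
move=> [mf cf] [mg cg]; split=> [U mU|].
  by apply: measurable_funD; [exact: mf|exact: mg].
by apply: filterS2 cf cg => x hf hg xi_ xi h; apply: cvgD; [exact: hf|exact: hg].
Qed.

Lemma sup_mul f g : sup f -> sup g -> sup (fun x xi => f x xi * g x xi).
Proof.
move=> [mf cf] [mg cg]; split=> [U mU|].
  by apply: measurable_funM; [exact: mf|exact: mg].
by apply: filterS2 cf cg => x hf hg xi_ xi h; apply: cvgM; [exact: hf|exact: hg].
Qed.

Lemma sup_fun (g : T -> R) : mf g -> sup (fun x _ => g x).
Proof. by move=> mg; split=> [//|]; apply: aeW => x *; exact: cvg_cst. Qed.

Lemma sup_cst (c : R) : sup (fun _ _ => c).
Proof. exact: sup_fun. Qed.

Lemma sup_coord (h : R -> R) i : continuous h -> sup (fun x xi => h (xi i)).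
Proof.
move=> ch; split=> [U mU|].
  exact: measurableT_comp (continuous_measurable_fun ch) (mU i).
apply: aeW => x xi_ xi hxi; apply: (cvg_comp (fun n => xi_ n i) h) (ch _).
exact: hxi.
Qed.

Lemma sup_sum (A : Type) (s : seq A) (F : A -> T -> (J -> R) -> R) :
  (forall i, sup (F i)) -> sup (fun x xi => \sum_(i <- s) F i x xi).
Proof.
move=> hF; elim: s => [|i s ih].
  by under eq_fun do under eq_fun do rewrite big_nil; exact: sup_cst.
by under eq_fun do under eq_fun do rewrite big_cons; exact: sup_add.
Qed.

End index.

Lemma sup_some (D : finType) (f : T -> (D -> R) -> R) : superposable mu f ->
  superposable mu (fun x (xi : option D -> R) => f x (fun i => xi (Some i))).
Proof.
move=> [mf cf]; split=> [U mU|].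
  by apply: (mf (fun i => U (Some i))) => i; exact: mU.
by apply: filterS cf => x h xi_ xi hxi; apply: h => i; exact: hxi.
Qed.

End superposition.

(** * The regularized functional *)

Section regularized_problem.
Context d (T : measurableType d) (R : realType).
Variable mu : {measure set T -> \bar R}.
Hypothesis cmu : measure_is_complete mu.
Context (D : finType) (p : R).
Hypothesis p_gt1 : 1 < p.

Let p_gt0 : 0 < p. Proof. exact: lt_trans p_gt1. Qed.
Let p_ge0 : 0 <= p. Proof. exact: ltW. Qed.

Local Notation mf f := (measurable_fun [set: T] f).
Local Notation I f := (Rintegral mu setT f).
Local Notation itg := (itg mu).
Local Notation J := (option D).

(* Index [None] carries the function, index [Some i] its i-th partial derivative. *)
Definition w1exp (i : J) : R := if i is Some _ then p else 2.

Local Notation pmod := (pmod w1exp).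
Local Notation inLq := (inLq mu w1exp).
Local Notation fconv := (fconv mu w1exp).
Local Notation mconv := (mconv mu w1exp).

Definition gpow (xi : D -> R) : R := \sum_i apow p (xi i).

Definition grad_of (U : J -> T -> R) (x : T) : D -> R := fun i => U (Some i) x.

Lemma w1exp_gt1 i : 1 < w1exp i.
Proof. by case: i => [i|]//=; lra. Qed.

Lemma gpow_ge0 xi : 0 <= gpow xi.
Proof. by apply: sumr_ge0 => i _; exact: apow_ge0. Qed.

Lemma gpow0 : gpow (fun=> 0) = 0.
Proof. by rewrite /gpow big1// => i _; rewrite apow0// gt_eqF. Qed.

Lemma apow_le_gpow xi i : apow p (xi i) <= gpow xi.
Proof. by rewrite /gpow (bigD1 i)//= lerDl sumr_ge0// => j _; exact: apow_ge0. Qed.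

Lemma pmodE xi : pmod xi = xi None ^+ 2 + gpow (fun i => xi (Some i)).
Proof. by rewrite /pmod big_option/= apow2. Qed.

Lemma gpow_le_pmod xi : gpow (fun i => xi (Some i)) <= pmod xi.
Proof. by rewrite pmodE lerDr sqr_ge0. Qed.

(** The potential [B] is normalized to vanish at 0 and is tied to [a] by the tangent inequality.
    Bounding the products [a x xi i * t] absorbs the duality of $L^{p'}$ and $L^p$ into one
    integrable function [ba]. *)
Record structure_conditions (a : T -> (D -> R) -> D -> R) (B : T -> (D -> R) -> R)
    (Ca : R) (ba : T -> R) : Prop := StructureConditions {
  sc_a_sup : forall i, superposable mu (fun x xi => a x xi i);
  sc_B_sup : superposable mu B;
  sc_B_grad : \forall x \ae mu, forall xi zeta,
    B x xi + \sum_i a x xi i * (zeta i - xi i) <= B x zeta;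
  sc_B_ge0 : \forall x \ae mu, forall xi, 0 <= B x xi;
  sc_B_0 : \forall x \ae mu, B x (fun=> 0) = 0;
  sc_Ca_ge0 : 0 <= Ca;
  sc_ba_itg : itg ba;
  sc_a_growth : \forall x \ae mu, forall xi i t,
    `|a x xi i * t| <= Ca * (gpow xi + apow p t) + ba x;
  sc_B_growth : \forall x \ae mu, forall xi, B x xi <= Ca * gpow xi + ba x }.

Variables (a : T -> (D -> R) -> D -> R) (B : T -> (D -> R) -> R).
Variables (Ca : R) (ba g kap : T -> R) (lam : R).
Hypothesis aB : structure_conditions a B Ca ba.
Let a_sup := sc_a_sup aB.
Let B_sup := sc_B_sup aB.
Let B_grad := sc_B_grad aB.
Let B_ge0 := sc_B_ge0 aB.
Let B_0 := sc_B_0 aB.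
Let Ca_ge0 := sc_Ca_ge0 aB.
Let ba_itg := sc_ba_itg aB.
Let a_growth := sc_a_growth aB.
Let B_growth := sc_B_growth aB.
Hypothesis g_mf : mf g.
Hypothesis g2_itg : itg (fun x => g x ^+ 2).
Hypothesis kap_mf : mf kap.
Hypothesis kap01 : forall x, 0 <= kap x <= 1.
Hypothesis lam_gt0 : 0 < lam.

Let chi x := 1 - kap x.

Let chi01 x : 0 <= chi x <= 1.
Proof. by have := kap01 x; rewrite /chi; lra. Qed.

Let chi_mf : mf chi.
Proof. exact: measurable_funB. Qed.

Lemma ba_ge0 : \forall x \ae mu, 0 <= ba x.
Proof.
apply: filterS2 B_0 B_growth => x h0 /(_ (fun=> 0)).
by rewrite h0 gpow0 mulr0 add0r.
Qed.

Lemma a_grad_ge0 : \forall x \ae mu, forall xi, 0 <= \sum_i a x xi i * xi i.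
Proof.
apply: filterS3 B_grad B_ge0 B_0 => x hg h0 hz xi.
have := hg xi (fun=> 0); rewrite hz.
rewrite (eq_bigr (fun i => - (a x xi i * xi i))); last by move=> i _; ring.
by rewrite sumrN; have := h0 xi; lra.
Qed.

(** The factor [chi x = 1 - kap x] confines the penalty to the complement of $K$; the term in [eps]
    supplies the uniform convexity in the gradient that [B] may lack. *)
Definition energy (eps del : R) (x : T) (xi : J -> R) : R :=
  lam * B x (fun i => xi (Some i)) + eps * gpow (fun i => xi (Some i)) +
  (xi None ^+ 2 / 2 - g x * xi None + chi x * sabs del (xi None)).

Definition denergy (eps del : R) (x : T) (xi : J -> R) (i : J) : R :=
  if i is Some j then lam * a x (fun i => xi (Some i)) j + eps * dpow p (xi (Some j))
  else xi None - g x + chi x * ssgn del (xi None).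

Definition ew (eps : R) (i : J) : R := if i is Some _ then eps else 1 / 2.

Definition eb (x : T) : R := lam * ba x + g x ^+ 2.

(** The coercivity constant degenerates with [eps] and the growth constant with [del]. Bounds
    uniform in both parameters are therefore derived afterwards, from test functions and
    comparison. *)
Lemma energy_integrand eps del : 0 < eps -> eps <= 1 -> 0 < del ->
  cvx_integrand mu w1exp (energy eps del) (denergy eps del) (ew eps)
    (eps / 4) (lam * Ca + p + 3 + del^-1) eb.
Proof.
move=> e0 e1 d0; have di : 0 <= del^-1 by rewrite invr_ge0 ltW.
have lC : 0 <= lam * Ca by rewrite mulr_ge0// ltW.
have p1 := p_gt1; have lam0 := lam_gt0.
split.
- rewrite /energy; apply: sup_add.
    apply: sup_add; apply: sup_mul; [exact: sup_cst|exact: sup_some|exact: sup_cst|].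
    rewrite /gpow; apply: sup_sum => i.
    apply: (sup_coord mu (Some i) (h := apow p)).
    exact: continuous_apow.
  apply: sup_add; last first.
    by apply: sup_mul; [exact: sup_fun|exact: (sup_coord mu None (@continuous_sabs R del))].
  apply: sup_add.
    apply: (sup_coord mu None (h := fun s => s ^+ 2 / 2)) => s.
    by apply: cvgM; [exact: exprn_continuous|exact: cvg_cst].
  have -> : (fun x (xi : J -> R) => - (g x * xi None)) = (fun x xi => (-1 * g x) * xi None).
    by apply/funext => x; apply/funext => xi; ring.
  apply: sup_mul; first by apply: sup_fun; exact: measurable_funM.
  by apply: (sup_coord mu None (h := id)) => s; exact: cvg_id.
- case=> [j|] /=.
    apply: sup_add.
      by apply: (sup_mul (f := fun _ _ => lam)); [exact: sup_cst|exact: (sup_some (a_sup j))].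
    apply: (sup_mul (f := fun _ _ => eps)); first exact: sup_cst.
    by apply: (sup_coord mu (Some j) (h := dpow p)); exact: continuous_dpow.
  apply: sup_add; last first.
    by apply: sup_mul; [exact: sup_fun|exact: (sup_coord mu None (@continuous_ssgn R del d0))].
  apply: sup_add; first by apply: (sup_coord mu None (h := id)) => s; exact: cvg_id.
  by apply: sup_fun; apply: measurableT_comp.
- by case=> [j|]//=; lra.
- lra.
- lra.
- by apply: itgD => //; exact: itgZ.
- apply: filterS B_grad => x hB xi zeta; rewrite big_option/=.
  have := hB (fun i => xi (Some i)) (fun i => zeta (Some i)).
  set S := \sum_i _ => h1.
  have h2 : gpow (fun i => xi (Some i)) +
      \sum_i dpow p (xi (Some i)) * (zeta (Some i) - xi (Some i)) <= gpow (fun i => zeta (Some i)).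
    rewrite /gpow -big_split/=; apply: ler_sum => i _; exact: apow_tangent.
  rewrite (eq_bigr (fun i => lam * (a x (fun i => xi (Some i)) i * (zeta (Some i) - xi (Some i))) +
     eps * (dpow p (xi (Some i)) * (zeta (Some i) - xi (Some i))))); last by move=> i _; ring.
  rewrite big_split/= -!mulr_sumr -/S; set S2 := \sum_i _ in h2 *.
  have h3 := sabs_tangent (xi None) (zeta None) d0.
  have [c0 _] := andP (chi01 x).
  rewrite /energy; set s := xi None in h3 *; set t := zeta None in h3 *.
  have {}h1 := ler_wpM2l (ltW lam_gt0) h1.
  have {}h2 := ler_wpM2l (ltW e0) h2.
  have {}h3 := ler_wpM2l c0 h3.
  have := sqr_ge0 (s - t); nra.
- apply: filterS B_grad => x hB xi zeta; rewrite big_option/= /energy.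
  have hmid : B x (fun i => (xi (Some i) + zeta (Some i)) / 2) <=
     (B x (fun i => xi (Some i)) + B x (fun i => zeta (Some i))) / 2.
    have := hB (fun i => (xi (Some i) + zeta (Some i)) / 2) (fun i => xi (Some i)).
    have := hB (fun i => (xi (Some i) + zeta (Some i)) / 2) (fun i => zeta (Some i)).
    set A := a x _.
    rewrite [X in _ + X <= _ -> _ + _ <= _ -> _](eq_bigr (fun i => - (A i * (xi (Some i) - (xi (Some i) + zeta (Some i)) / 2)))); last first.
      by move=> i _; field.
    rewrite sumrN; lra.
  have hs : sabs del ((xi None + zeta None) / 2) <= (sabs del (xi None) + sabs del (zeta None)) / 2.
    have := sabs_tangent ((xi None + zeta None) / 2) (xi None) d0.
    have := sabs_tangent ((xi None + zeta None) / 2) (zeta None) d0.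
    set A := ssgn _ _; nra.
  have hp : gpow (fun i => (xi (Some i) + zeta (Some i)) / 2) +
      \sum_i pgap p (xi (Some i)) (zeta (Some i)) =
      (gpow (fun i => xi (Some i)) + gpow (fun i => zeta (Some i))) / 2.
    rewrite /gpow -!big_split/= mulr_suml; apply: eq_bigr => i _.
    by rewrite /pgap addrCA subrr addr0.
  rewrite -mulr_sumr /pgap !apow2.
  have [c0 _] := andP (chi01 x).
  have {}hmid := ler_wpM2l (ltW lam_gt0) hmid.
  have {}hs := ler_wpM2l c0 hs.
  move: hp => /(congr1 (fun r => eps * r)).
  rewrite /pgap.
  set s := xi None in hs *; set t := zeta None in hs *.
  set G1 := gpow _; set G2 := gpow _; set G3 := gpow _; set S := \sum_i _.
  move=> hp; nra.
- apply: filterS3 B_ge0 B_growth ba_ge0 => x h0 hg hb xi; rewrite pmodE /energy /eb.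
  set s := xi None; set G := gpow _; set BB := B x _.
  have B0 : 0 <= BB by exact: h0.
  have B1 : BB <= Ca * G + ba x by exact: hg.
  have G0 : 0 <= G by exact: gpow_ge0.
  have [c0 c1] := andP (chi01 x).
  have j0 := sabs_ge0 s d0; have j1 := sabs_le s d0.
  set j := sabs del s in j0 j1 *.
  have jj : 0 <= chi x * j <= s ^+ 2 * del^-1.
    by rewrite mulr_ge0//= (le_trans _ j1)// -[leRHS]mul1r ler_wpM2r.
  have lB : lam * BB <= lam * Ca * G + lam * ba x.
    by rewrite -mulrA -mulrDr ler_wpM2l// ltW.
  have lB0 : 0 <= lam * BB by rewrite mulr_ge0// ltW.
  have s2 := sqr_ge0 s; have g2 := sqr_ge0 (g x).
  have q1 := sqr_ge0 (s - g x); have q2 := sqr_ge0 (s + g x).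
  have eG : 0 <= eps * G <= G by rewrite mulr_ge0 ?(ltW e0)//= -[leRHS]mul1r ler_wpM2r.
  have lCs : 0 <= lam * Ca * s ^+ 2 by rewrite mulr_ge0.
  have pG : 0 <= p * G by rewrite mulr_ge0.
  have ps : 0 <= p * s ^+ 2 by rewrite mulr_ge0.
  have dG : 0 <= del^-1 * G by rewrite mulr_ge0.
  rewrite ler_norml; apply/andP; split; nra.
- apply: filterS2 B_ge0 ba_ge0 => x h0 hb xi; rewrite pmodE /energy /eb.
  set s := xi None; set G := gpow _; set BB := B x _.
  have lB0 : 0 <= lam * BB by rewrite mulr_ge0 ?(ltW lam_gt0)//; exact: h0.
  have G0 : 0 <= eps * G by rewrite mulr_ge0 ?(ltW e0)//; exact: gpow_ge0.
  have [c0 c1] := andP (chi01 x).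
  have jj : 0 <= chi x * sabs del s by rewrite mulr_ge0// sabs_ge0.
  have lb : 0 <= lam * ba x by rewrite mulr_ge0// ltW.
  (* Gives $s^2/2 - gs \ge s^2/4 - g^2$; with [eps <= 1] this quarter is the origin of the constant
     [eps / 4]. *)
  have q2 := sqr_ge0 (s / 2 - g x).
  have es : eps * s ^+ 2 <= s ^+ 2 by rewrite -[leRHS]mul1r ler_wpM2r// sqr_ge0.
  nra.
- apply: filterS2 a_growth ba_ge0 => x ha hb xi [j|] t /=; rewrite pmodE /eb.
    set s := xi None; set A := a x _ j; set G := gpow _; set r := xi (Some j).
    have h1 : `|A * t| <= Ca * (G + apow p t) + ba x by exact: ha.
    have h2 := dpow_growth r t p_gt1.
    have h3 : apow p r <= G by exact: (apow_le_gpow (fun i => xi (Some i)) j).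
    have t0 := apow_ge0 p t; have g2 := sqr_ge0 (g x); have s2 := sqr_ge0 s.
    have r0 := apow_ge0 p r.
    set X := apow p t in h1 h2 t0 *; set Y := apow p r in h2 h3 r0 *.
    rewrite mulrDl; apply: le_trans (ler_normD _ _) _.
    rewrite -[lam * A * t]mulrA -[eps * _ * t]mulrA [`|lam * _|]normrM [`|eps * _|]normrM.
    rewrite (gtr0_norm lam_gt0) (gtr0_norm e0).
    have {}h1 := ler_wpM2l (ltW lam_gt0) h1.
    have {}h2 : eps * `|dpow p r * t| <= p * (Y + X).
      by apply: le_trans h2; rewrite -[leRHS]mul1r ler_wpM2r.
    have h4 : p * Y <= p * G by rewrite ler_wpM2l.
    have lCs : 0 <= lam * Ca * s ^+ 2 by rewrite mulr_ge0.
    have ps : 0 <= p * s ^+ 2 by rewrite mulr_ge0.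
    have k1 : 0 <= del^-1 * (s ^+ 2 + G + X) by rewrite mulr_ge0//; lra.
    nra.
  set s := xi None; set G := gpow _; rewrite apow2.
  have G0 : 0 <= G by exact: gpow_ge0.
  have [c0 c1] := andP (chi01 x).
  have h1 : `|(s - g x) * t| <= s ^+ 2 + g x ^+ 2 + t ^+ 2.
    have := sqr_ge0 (s - t); have := sqr_ge0 (s + t); have := sqr_ge0 (g x - t).
    have := sqr_ge0 (g x + t); have := sqr_ge0 t; have := sqr_ge0 s; have := sqr_ge0 (g x).
    by rewrite ler_norml; nra.
  (* The smoothed sign is bounded by $|s|/\delta$ rather than by 1, because [t] is controlled only
     through its square. *)
  have h2 : `|chi x * ssgn del s * t| <= (s ^+ 2 + t ^+ 2) * del^-1.
    rewrite normrM [`|chi x * _|]normrM (ger0_norm c0).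
    apply: (@le_trans _ _ (`|s| * del^-1 * `|t|)).
      by rewrite ler_wpM2r// -[leRHS]mul1r ler_pM// ssgn_le.
    rewrite mulrAC ler_wpM2r// -[s ^+ 2]real_normK ?num_real// -[t ^+ 2]real_normK ?num_real//.
    have := sqr_ge0 (`|s| - `|t|); have := sqr_ge0 `|s|; have := sqr_ge0 `|t|; nra.
  rewrite mulrDl; apply: le_trans (ler_normD _ _) _; apply: le_trans (lerD h1 h2) _.
  have lb : 0 <= lam * ba x by rewrite mulr_ge0// ltW.
  have s2 := sqr_ge0 s; have t2 := sqr_ge0 t.
  have k1 : 0 <= (lam * Ca) * (s ^+ 2 + G + t ^+ 2) by rewrite mulr_ge0//; lra.
  have k2 : 0 <= p * (s ^+ 2 + G + t ^+ 2) by rewrite mulr_ge0//; lra.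
  have k3 : 0 <= del^-1 * G by rewrite mulr_ge0.
  nra.
Qed.

End regularized_problem.

(** * Subsequences and completeness for modular convergence *)

Section modular_complements.
Context d (T : measurableType d) (R : realType).
Variable mu : {measure set T -> \bar R}.
Hypothesis cmu : measure_is_complete mu.
Context (J : finType) (q : J -> R).
Hypothesis q_gt1 : forall i, 1 < q i.

Local Notation mf f := (measurable_fun [set: T] f).
Local Notation I f := (Rintegral mu setT f).
Local Notation itg := (itg mu).
Local Notation inLq := (inLq mu q).
Local Notation fconv := (fconv mu q).
Local Notation mconv := (mconv mu q).
Implicit Types (U V Z : J -> T -> R).

Let q_gt0 i : 0 < q i. Proof. exact: lt_trans (q_gt1 i). Qed.

Lemma cvg_sub (u : nat -> R) (l : R) (phi : nat -> nat) : (forall n, (n <= phi n)%N) ->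
  u @ \oo --> l -> (fun n => u (phi n)) @ \oo --> l.
Proof.
move=> phi_ge ul; apply: (cvg_comp phi u) ul.
move=> A [N _ hN]; exists N => // n /= Nn; apply: hN.
exact: leq_trans Nn (phi_ge n).
Qed.

Lemma mconv_sub (U_ : nat -> J -> T -> R) U (phi : nat -> nat) :
  (forall n, (n <= phi n)%N) -> mconv U_ U -> mconv (U_ \o phi) U.
Proof. by move=> phi_ge cU i; exact: (cvg_sub phi_ge (cU i)). Qed.

Lemma fconv_sub (U_ : nat -> J -> T -> R) U (phi : nat -> nat) :
  (forall n, (n <= phi n)%N) -> fconv U_ U -> fconv (U_ \o phi) U.
Proof.
move=> phi_ge [S iS hS]; exists S => //.
apply: filterS hS => x h n i /=; apply: le_trans (h (phi n) i) _.
have S0 : 0 <= S x.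
  by have := h 0%N i; rewrite expr0 mul1r; apply: le_trans; exact: apow_ge0.
rewrite ler_wpM2r// -(subnKC (phi_ge n)) exprD -[leRHS]mulr1 ler_wpM2l//.
by rewrite exprn_ile1//; lra.
Qed.

Lemma I_apow_ge0 (r : R) (f : T -> R) : mf f -> 0 <= I (fun x => apow r (f x)).
Proof.
move=> mf; apply: (I_ge0 cmu); last exact: mf_apow.
by apply: aeW => x; exact: apow_ge0.
Qed.

Lemma I_apow_triangle U V Z i : inLq U -> inLq V -> inLq Z ->
  I (fun x => apow (q i) (U i x - Z i x)) <= 2 `^ (q i) *
  (I (fun x => apow (q i) (U i x - V i x)) + I (fun x => apow (q i) (V i x - Z i x))).
Proof.
move=> HU HV HZ; have [_ i1] := inLqB q_gt1 HU HV i; have [_ i2] := inLqB q_gt1 HV HZ i.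
have [_ i3] := inLqB q_gt1 HU HZ i.
rewrite -ID// -IZ; last exact: itgD.
apply: (I_le cmu) => //; last by apply: itgZ; exact: itgD.
apply: aeW => x; rewrite (_ : U i x - Z i x = (U i x - V i x) + (V i x - Z i x)); last by ring.
by apply: apowD; exact: ltW.
Qed.

(** The whole sequence converges, by comparison with the extracted one through the quasi-triangle
    inequality of the modular. *)
Lemma mcauchy_mconv (U_ : nat -> J -> T -> R) : (forall n, inLq (U_ n)) ->
  (forall e, 0 < e -> exists N, forall m n, (N <= m)%N -> (N <= n)%N ->
    forall i, I (fun x => apow (q i) (U_ m i x - U_ n i x)) <= e) ->
  exists U, inLq U /\ mconv U_ U.
Proof.
move=> HU_ cU; have [phi [U [phi_ge HU fU]]] := mcauchy_fconv cmu q_gt1 HU_ cU.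
exists U; split => // i.
have mU := fconv_mconv cmu q_gt1 (fun n => HU_ (phi n)) HU fU i.
have K0 : 0 < 2 `^ (q i) :> R by exact: powR_gt0.
apply/cvgrPdist_le => e e0.
have e'0 : 0 < e / (2 * 2 `^ (q i)) by rewrite divr_gt0// mulr_gt0.
have [N hN] := cU _ e'0.
have /cvgrPdist_le/(_ _ e'0)[N' _ hN'] := mU.
exists N => // n /= Nn; rewrite sub0r normrN ger0_norm; last first.
  by apply: I_apow_ge0; have [] := inLqB q_gt1 (HU_ n) HU i.
pose m := maxn N N'.
apply: le_trans (I_apow_triangle i (HU_ n) (HU_ (phi m)) HU) _.
have h1 := hN n (phi m) Nn (leq_trans (leq_maxl N N') (phi_ge m)) i.
have := hN' m (leq_maxr N N'); rewrite /= sub0r normrN ger0_norm; last first.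
  by apply: I_apow_ge0; have [] := inLqB q_gt1 (HU_ (phi m)) HU i.
move=> h2; apply: (@le_trans _ _ (2 `^ (q i) * (e / (2 * 2 `^ (q i)) + e / (2 * 2 `^ (q i))))).
  by apply: ler_wpM2l; [exact: ltW|exact: (lerD h1 h2)].
by rewrite le_eqVlt; apply/orP; left; apply/eqP; field; rewrite gt_eqF.
Qed.

End modular_complements.

(** * Weak limits by midpoint averaging *)

Section weak_limit.
Context d (T : measurableType d) (R : realType).
Variable mu : {measure set T -> \bar R}.
Hypothesis cmu : measure_is_complete mu.
Local Notation mf f := (measurable_fun [set: T] f).
Local Notation I f := (Rintegral mu setT f).
Local Notation itg := (itg mu).

(** Averages of terms of index at least [n]. Midpoints are what the parallelogram identity uses, and
    they spare convex coefficients. *)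
Inductive mid_hull (s_ : nat -> T -> R) (n : nat) : (T -> R) -> Prop :=
| mid_hull_base k : (n <= k)%N -> mid_hull s_ n (s_ k)
| mid_hull_mid f f' : mid_hull s_ n f -> mid_hull s_ n f' ->
    mid_hull s_ n (fun x => (f x + f' x) / 2).

Lemma mid_hullS s_ n m f : (n <= m)%N -> mid_hull s_ m f -> mid_hull s_ n f.
Proof.
move=> nm; elim=> [k mk|f1 f2 _ h1 _ h2]; last exact: mid_hull_mid.
by apply: mid_hull_base; exact: leq_trans mk.
Qed.

Let itg_half f f' : itg f -> itg f' -> itg (fun x => (f x + f' x) / 2).
Proof.
by move=> h1 h2; under eq_fun do rewrite mulrC; apply: itgZ; exact: itgD.
Qed.

Let I_half f f' : itg f -> itg f' -> I (fun x => (f x + f' x) / 2) = (I f + I f') / 2.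
Proof.
move=> h1 h2; under eq_fun do rewrite mulrC; rewrite IZ; last exact: itgD.
by rewrite ID// mulrC.
Qed.

(* Replaces weak compactness in [L^2]: the elements of nearly minimal norm in the
   decreasing sequence of midpoint hulls of the tails form a Cauchy sequence. *)
Lemma weak_limit (s_ : nat -> T -> R) (C : R) :
  (forall n, itg (s_ n)) -> (forall n x, `|s_ n x| <= 1) ->
  (forall n, I (fun x => `|s_ n x|) <= C) ->
  exists s, [/\ itg s, \forall x \ae mu, `|s x| <= 1 &
    forall (z : T -> R) (l : R), mf z -> itg (fun x => z x ^+ 2) ->
      (fun n => I (fun x => s_ n x * z x)) @ \oo --> l -> I (fun x => s x * z x) = l].
Proof.
move=> is_ s1 sC.
have hull1 n f : mid_hull s_ n f -> [/\ itg f, forall x, `|f x| <= 1 & I (fun x => `|f x|) <= C].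
  elim=> [k _|f1 f2 _ [i1 b1 c1] _ [i2 b2 c2]]; first by split.
  have nf x : `|(f1 x + f2 x) / 2| <= (`|f1 x| + `|f2 x|) / 2.
    rewrite normrM [`|2^-1|]ger0_norm// ler_wpM2r//; exact: ler_normD.
  split; first exact: itg_half.
    by move=> x; apply: le_trans (nf x) _; have := b1 x; have := b2 x; lra.
  apply: (@le_trans _ _ (I (fun x => (`|f1 x| + `|f2 x|) / 2))).
    apply: (I_le cmu); first by apply: aeW => x; exact: nf.
      by apply: itg_norm; exact: itg_half.
    by apply: itg_half; exact: itg_norm.
  by rewrite I_half; [lra|exact: itg_norm|exact: itg_norm].
have sq f : itg f -> (forall x, `|f x| <= 1) -> itg (fun x => f x ^+ 2) /\ I (fun x => f x ^+ 2) <= I (fun x => `|f x|).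
  move=> fi f1; have mff := itg_mf fi.
  have m2 : mf (fun x => f x ^+ 2) by exact: measurable_funX.
  have le x : f x ^+ 2 <= `|f x|.
    rewrite -real_normK ?num_real// expr2 -[leRHS]mul1r ler_wpM2r//.
  have i2 : itg (fun x => f x ^+ 2).
    apply: (itg_le (g := fun x => `|f x|)) => //; last exact: itg_norm.
    by apply: aeW => x; rewrite ger0_norm ?sqr_ge0.
  by split => //; apply: (I_le cmu) => //; [exact: aeW|exact: itg_norm].
pose E n := [set I (fun x => f x ^+ 2) | f in mid_hull s_ n].
have E0 n : has_inf (E n).
  split; first by exists (I (fun x => s_ n x ^+ 2)), (s_ n) => //; exact: mid_hull_base.
  exists 0 => _ [f /hull1[fi f1 _] <-]; apply: (I_ge0 cmu); last exact: itg_mf (sq f fi f1).1.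
  by apply: aeW => x; exact: sqr_ge0.
pose dd n := inf (E n).
have ddE n f : mid_hull s_ n f -> dd n <= I (fun x => f x ^+ 2).
  by move=> hf; apply: ge_inf; [exact: (E0 n).2|exists f].
have ddC n : dd n <= C.
  have hn : mid_hull s_ n (s_ n) by exact: mid_hull_base.
  have [fi f1 fC] := hull1 _ _ hn.
  by apply: le_trans (ddE _ _ hn) _; apply: le_trans fC; exact: (sq _ fi f1).2.
have dd_nd : nondecreasing_seq dd.
  move=> n m nm; apply: lb_le_inf; first exact: (E0 m).1.
  by move=> _ [f hf <-]; apply: ddE; exact: mid_hullS hf.
have dd_cvg : cvgn dd.
  by apply: nondecreasing_is_cvgn => //; exists C => _ [n _ <-].
have /choice[t_ ht_] : forall n, exists f, mid_hull s_ n f /\ I (fun x => f x ^+ 2) < dd n + (1 / 2) ^+ n.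
  move=> n; have e0 : 0 < (1 / 2) ^+ n :> R by rewrite exprn_gt0//; lra.
  by have [_ [f hf <-] ?] := inf_adherent e0 (E0 n); exists f.
pose U_ n : unit -> T -> R := fun _ => t_ n.
pose q (_ : unit) : R := 2.
have q1 i : 1 < q i by rewrite /q; lra.
have it n : itg (t_ n) by have [] := hull1 _ _ (ht_ n).1.
have bt n x : `|t_ n x| <= 1 by have [] := hull1 _ _ (ht_ n).1.
have HU_ n : inLq mu q (U_ n).
  move=> i; split; first exact: itg_mf (it n).
  by under eq_fun do rewrite apow2; exact: (sq _ (it n) (bt n)).1.
have [|phi [U [phi_ge HU cU]]] := mcauchy_fconv cmu q1 HU_.
  move=> e e0; have e4 : 0 < e / 8 by rewrite divr_gt0.
  have /cvgrPdist_le/(_ _ e4)[N1 _ hN1] := dd_cvg.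
  have /cvgrPdist_le/(_ _ e4)[N2 _ hN2] := cvg_half (1 : R).
  exists (maxn N1 N2) => m n Nm Nn i.
  wlog nm : m n Nm Nn / (n <= m)%N.
    move=> h; have [nm|/ltnW mn] := leqP n m; first exact: h.
    under eq_fun do rewrite -opprB apowN.
    exact: h.
  have h1 := hN1 m (leq_trans (leq_maxl _ _) Nm); have h2 := hN1 n (leq_trans (leq_maxl _ _) Nn).
  have h3 := hN2 m (leq_trans (leq_maxr _ _) Nm); have h4 := hN2 n (leq_trans (leq_maxr _ _) Nn).
  move: h1 h2 h3 h4 => /=; rewrite !sub0r !normrN !mul1r.
  rewrite [`|_ ^+ m|]ger0_norm ?[`|_ ^+ n|]ger0_norm ?exprn_ge0// -[2^-1]mul1r.
  rewrite !ler_norml => /andP[h1 h1'] /andP[h2 h2'] h3 h4.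
  have hmid : mid_hull s_ n (fun x => (t_ m x + t_ n x) / 2).
    by apply: mid_hull_mid; [apply: mid_hullS (ht_ m).1|exact: (ht_ n).1].
  have := ddE _ _ hmid; have := (ht_ m).2; have := (ht_ n).2.
  have [im2 _] := sq _ (it m) (bt m); have [in2 _] := sq _ (it n) (bt n).
  have [imid bmid _] := hull1 _ _ hmid; have [imid2 _] := sq _ imid bmid.
  (* Parallelogram identity. The midpoint lies in the hull of index [n], so its squared norm is at
     least [dd n], while both endpoints nearly attain their infima, which converge. *)
  have -> : I (fun x => apow (q i) (U_ m i x - U_ n i x)) =
      2 * I (fun x => t_ m x ^+ 2) + 2 * I (fun x => t_ n x ^+ 2) - 4 * I (fun x => ((t_ m x + t_ n x) / 2) ^+ 2).
    have j1 := itgZ 2 im2; have j2 := itgZ 2 in2; have j3 := itgZ 4 imid2.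
    rewrite -(IZ 2 im2) -(IZ 2 in2) -(IZ 4 imid2) -(ID j1 j2) -(IB (itgD j1 j2) j3).
    by apply: eq_I => x; rewrite /q apow2 /U_; field.
  set X := I _; set Y := I _; set Z := I _; lra.
pose s := U tt.
have cs : \forall x \ae mu, (fun n => t_ (phi n) x) @ \oo --> s x.
  by apply: filterS (fconv_ae q1 cU) => x /(_ tt).
have ms : mf s by have [] := HU tt.
have [ia _] : itg (fun x => `|s x|) /\ I (fun x => `|s x|) <= C.
  apply: (Fatou cmu (F := fun n x => `|t_ (phi n) x|)).
  - by move=> n; exact: itg_norm.
  - by move=> n; apply: aeW => x.
  - by apply: filterS cs => x h; exact: cvg_norm.
  - by move=> n; have [] := hull1 _ _ (ht_ (phi n)).1.
have is0 : itg s by apply: (itg_le (g := fun x => `|s x|)) => //; exact: aeW.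
exists s; split => //.
  apply: filterS cs => x h; have h' : (fun n => `|t_ (phi n) x|) @ \oo --> `|s x| by exact: cvg_norm.
  rewrite -(cvg_lim _ h')//; apply: limr_le; last exact: nearW.
  by apply/cvg_ex; eexists; exact: h'.
move=> z l mz iz zl.
have isz n : itg (fun x => s_ n x * z x).
  apply: (itg_le (g := fun x => `|s_ n x| + z x ^+ 2)).
  - by apply: measurable_funM => //; exact: itg_mf (is_ n).
  - apply: aeW => x; rewrite normrM; have := s1 n x; have := normr_ge0 (s_ n x).
    rewrite -[z x ^+ 2]real_normK ?num_real//; have := normr_ge0 (z x); have := sqr_ge0 (`|z x| - `|s_ n x|).
    set A := `|s_ n x|; set Z := `|z x|; nra.
  - by apply: itgD => //; exact: itg_norm.
(* Closeness of the pairings to [l] along a tail extends to every average of that tail. *)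
have hulll n e f : (forall k, (n <= k)%N -> `|I (fun x => s_ k x * z x) - l| <= e) ->
    mid_hull s_ n f -> itg (fun x => f x * z x) /\ `|I (fun x => f x * z x) - l| <= e.
  move=> hk; elim=> [k nk|f1 f2 _ [i1 b1] _ [i2 b2]]; first by split; [exact: isz|exact: hk].
  have fE : (fun x => (f1 x + f2 x) / 2 * z x) = (fun x => (f1 x * z x + f2 x * z x) / 2).
    by apply/funext => x; ring.
  rewrite fE; split; first exact: itg_half.
  by rewrite I_half//; move: b1 b2; rewrite !ler_norml; set X := I _; set Y := I _; lra.
have UE : U = (fun _ => s) by apply/funext => -[].
rewrite UE in HU cU.
have [|||_ c1] := growth_cvg cmu q1 HU cU ler01 (b := fun x => z x ^+ 2)
  (F := fun n x => t_ (phi n) x * z x) (f := fun x => s x * z x)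
  (fun n => measurable_funM (itg_mf (it (phi n))) mz).
- by apply: filterS cs => x h; apply: cvgM => //; exact: cvg_cst.
- exact: iz.
- apply: aeW => x n; rewrite mul1r.
  have := apow_le_pmod q ((U_ (phi n))^~ x) tt; rewrite {1}/q apow2 /U_.
  set A := t_ _ x; set P := pmod _ _; have := sqr_ge0 (A - z x); have := sqr_ge0 (A + z x).
  have := sqr_ge0 A; have := sqr_ge0 (z x); rewrite ler_norml; nra.
apply/eqP; rewrite -subr_eq0 -normr_le0; apply/ler_addgt0Pr => e e0; rewrite add0r.
have /cvgrPdist_le/(_ _ e0)[N _ hN] := zl.
have c2 : (fun n => `|I (fun x => t_ (phi n) x * z x) - l|) @ \oo --> `|I (fun x => s x * z x) - l|.
  by apply: cvg_norm; apply: cvgB => //; exact: cvg_cst.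
rewrite -(cvg_lim _ c2)//; apply: limr_le; first by apply/cvg_ex; eexists; exact: c2.
exists N => // n Nn; apply: (hulll (phi n) e _ _ (ht_ (phi n)).1).2.
move=> k nk; rewrite distrC; apply: hN; apply: leq_trans nk.
exact: leq_trans Nn (phi_ge n).
Qed.

End weak_limit.

(** * The penalized Dirichlet problem *)

Section dirichlet_problem.
Context d (T : measurableType d) (R : realType).
Variable mu : {measure set T -> \bar R}.
Hypothesis cmu : measure_is_complete mu.
Context (D : finType) (p : R).
Hypothesis p_gt1 : 1 < p.

Let p_gt0 : 0 < p. Proof. exact: lt_trans p_gt1. Qed.
Let p_ge0 : 0 <= p. Proof. exact: ltW. Qed.

Local Notation mf f := (measurable_fun [set: T] f).
Local Notation I f := (Rintegral mu setT f).
Local Notation itg := (itg mu).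
Local Notation J := (option D).
Local Notation w1exp := (@w1exp R D p).
Local Notation gpow := (gpow p).
Local Notation pmod := (pmod w1exp).
Local Notation inLq := (inLq mu w1exp).
Local Notation fconv := (fconv mu w1exp).
Local Notation mconv := (mconv mu w1exp).
Let q1 := @w1exp_gt1 R D p p_gt1.

(** [ws_comp] is the chain rule for [ebump (al * u + be) - ebump be], where the constant makes the
    composition vanish with [u]. It is the one nonlinear operation assumed; every truncation or sign
    of a solution is assembled from it. *)
Record w1_space (W : set (J -> T -> R)) : Prop := W1Space {
  ws_Lq : forall U, W U -> inLq U;
  ws_lin : forall (a b : R) U V, W U -> W V -> W (fun i x => a * U i x + b * V i x);
  ws_closed : forall U_ U, (forall n, W (U_ n)) -> inLq U -> mconv U_ U -> W U;
  ws_0 : W (fun _ _ => 0);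
  ws_comp : forall (al be : R) U, W U -> W (fun i x =>
    if i is Some _ then al * debump (al * U None x + be) * U i x
    else ebump (al * U None x + be) - ebump be) }.

Variables (a : T -> (D -> R) -> D -> R) (B : T -> (D -> R) -> R).
Variables (Ca : R) (ba g kap : T -> R) (lam eta Mg : R) (a2 : T -> R).
Variables (W : set (J -> T -> R)) (Zg : J -> T -> R).
Hypothesis aB : structure_conditions mu p a B Ca ba.
Hypothesis WP : w1_space W.
Hypothesis lam_gt0 : 0 < lam.
Hypothesis eta_gt0 : 0 < eta.
Hypothesis a2_mf : mf a2.
Hypothesis a2_itg : itg (fun x => apow p (a2 x)).
Hypothesis coercive : forall U, W U -> \forall x \ae mu,
  eta * gpow (grad_of U x) <= \sum_i a x (grad_of U x) i * U (Some i) x + a2 x.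
Hypothesis WZg : W Zg.
Hypothesis ZgE : Zg None = g.
Hypothesis g_bounded : forall x, `|g x| <= Mg.
Hypothesis kap_itg : itg kap.
Hypothesis kap2 : forall x, kap x = 0 \/ kap x = 1.
Hypothesis kap_g : forall x, kap x * g x = g x.

Let Mg_ge0 : 0 <= Mg.
Proof. exact: le_trans (normr_ge0 _) (g_bounded point). Qed.

Let g_mf : mf g. Proof. by rewrite -ZgE; have [] := ws_Lq WP WZg None. Qed.

Let g2_itg : itg (fun x => g x ^+ 2).
Proof. by have [_] := ws_Lq WP WZg None; rewrite ZgE; under eq_fun do rewrite apow2. Qed.

Let kap_mf : mf kap. Proof. exact: itg_mf kap_itg. Qed.

Let kap01 x : 0 <= kap x <= 1.
Proof. by case: (kap2 x) => ->; rewrite ?lexx ?ler01. Qed.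

Local Notation chi x := (1 - kap x).

Let chi_g x : chi x * g x = 0.
Proof. by rewrite mulrBl mul1r kap_g subrr. Qed.

Let chi01 x : 0 <= chi x <= 1.
Proof. by have := kap01 x; lra. Qed.

Let chi_mf : mf (fun x => chi x). Proof. exact: measurable_funB. Qed.

Let P eps del (e0 : 0 < eps) (e1 : eps <= 1) (d0 : 0 < del) :=
  energy_integrand p_gt1 aB g_mf g2_itg kap_mf kap01 lam_gt0 e0 e1 d0.

Local Notation en := (energy p B g kap lam).
Local Notation den := (denergy p a g kap lam).
Local Notation F eps del U := (I (fun x => en eps del x (U^~ x))).

Definition is_min (eps del : R) (U : J -> T -> R) : Prop :=
  W U /\ forall V, W V -> F eps del U <= F eps del V.

Let Lq U : W U -> inLq U. Proof. exact: ws_Lq. Qed.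

Lemma is_min_exists eps del : 0 < eps -> eps <= 1 -> 0 < del -> exists U, is_min eps del U.
Proof.
move=> e0 e1 d0.
have [|U WU Umin] := minimizer_exists cmu q1 (ws_Lq WP) (ws_lin WP) (ws_closed WP) (P e0 e1 d0).
  by exists (fun _ _ => 0); exact: ws_0.
by exists U.
Qed.

Lemma u2_itg U : W U -> itg (fun x => U None x ^+ 2).
Proof. by move=> WU; have [_] := Lq WU None; under eq_fun do rewrite apow2. Qed.

Lemma u_mf U i : W U -> mf (U i).
Proof. by move=> WU; have [] := Lq WU i. Qed.

Lemma gpow_itg U : W U -> itg (fun x => gpow (grad_of U x)).
Proof. by move=> WU; apply: itg_sum => i _; have [] := Lq WU (Some i). Qed.

Lemma itg_aU U V : W U -> W V -> itg (fun x => \sum_i a x (grad_of U x) i * V (Some i) x).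
Proof.
move=> WU WV; apply: itg_sum => i _; have [mV iV] := Lq WV (Some i).
apply: (itg_le (g := fun x => Ca * (gpow (grad_of U x) + apow p (V (Some i) x)) + ba x)).
- apply: measurable_funM => //; apply: (sc_a_sup aB i).1 => j; exact: u_mf.
- by apply: filterS (sc_a_growth aB) => x; exact.
- by apply: itgD (sc_ba_itg aB); apply: itgZ; apply: itgD => //; exact: gpow_itg.
Qed.

Lemma itg_B U : W U -> itg (fun x => B x (grad_of U x)).
Proof.
move=> WU; apply: (itg_le (g := fun x => Ca * gpow (grad_of U x) + ba x)).
- by apply: (sc_B_sup aB).1 => j; exact: u_mf.
- by apply: filterS2 (sc_B_ge0 aB) (sc_B_growth aB) => x h0 h; rewrite ger0_norm.
- by apply: itgD (sc_ba_itg aB); apply: itgZ; exact: gpow_itg.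
Qed.

Lemma test_equation eps del U Z : 0 < eps -> eps <= 1 -> 0 < del ->
  is_min eps del U -> W Z ->
  I (fun x => \sum_i den eps del x (U^~ x) i * Z i x) = 0.
Proof.
move=> e0 e1 d0 [WU Umin] WZ.
exact: (euler_lagrange cmu q1 (ws_Lq WP) (ws_lin WP) (P e0 e1 d0)).
Qed.

Lemma test_itg eps del U Z : 0 < eps -> eps <= 1 -> 0 < del ->
  W U -> W Z -> itg (fun x => \sum_i den eps del x (U^~ x) i * Z i x).
Proof.
by move=> e0 e1 d0 WU WZ; exact: (itg_dintegrand (P e0 e1 d0) (Lq WU) (Lq WZ)).
Qed.

(** A test function that is an increasing function of [u] has gradient [c] times that of [u] with
    [c >= 0]. The principal part is then nonnegative, and only zero-order terms remain to be
    estimated. *)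
Lemma den_grad_ge0 eps del U (c : T -> R) : 0 < eps -> (forall x, 0 <= c x) ->
  \forall x \ae mu, 0 <= \sum_(i : D) den eps del x (U^~ x) (Some i) * (c x * U (Some i) x).
Proof.
move=> e0 c0; apply: filterS (a_grad_ge0 aB) => x h.
rewrite (eq_bigr (fun i => c x * (lam * (a x (grad_of U x) i * U (Some i) x) +
   eps * (dpow p (U (Some i) x) * U (Some i) x)))); last by move=> i _; rewrite /denergy /grad_of; ring.
rewrite -mulr_sumr big_split/= -!mulr_sumr mulr_ge0// addr_ge0//.
  by rewrite mulr_ge0 ?(ltW lam_gt0)//; exact: h.
rewrite mulr_ge0 ?(ltW e0)// sumr_ge0// => i _.
by rewrite dpow_mul// mulr_ge0// apow_ge0.
Qed.

(** Weak maximum principle. The test function [h] increases with [u] and lives where $|u| > M_g$.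
    All terms of the equation are nonnegative, so each vanishes a.e., and $(u-g)h = 0$ forces $|u|
    \le M_g$. *)
Lemma is_min_bounded eps del U : 0 < eps -> eps <= 1 -> 0 < del ->
  is_min eps del U -> \forall x \ae mu, `|U None x| <= Mg.
Proof.
move=> e0 e1 d0 mU; have WU := mU.1.
pose Z1 := fun (i : J) (x : T) => if i is Some _ then 1 * debump (1 * U None x + - Mg) * U i x
    else ebump (1 * U None x + - Mg) - ebump (- Mg).
pose Z2 := fun (i : J) (x : T) => if i is Some _ then (-1) * debump ((-1) * U None x + - Mg) * U i x
    else ebump ((-1) * U None x + - Mg) - ebump (- Mg).
have WZ1 : W Z1 by exact: ws_comp.
have WZ2 : W Z2 by exact: ws_comp.
pose Z := fun i x => 1 * Z1 i x + (-1) * Z2 i x.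
have WZ : W Z by exact: ws_lin.
have eb0 (s : R) : s <= 0 -> ebump s = 0 by move=> s0; rewrite /ebump eflat_le0.
(* Since [0 <= Mg], the normalizing constants of [ws_comp] are zero here. *)
have ebM : ebump (- Mg) = 0 by rewrite eb0// oppr_le0.
pose c x := debump (1 * U None x + - Mg) + debump ((-1) * U None x + - Mg).
have c0 x : 0 <= c x by rewrite addr_ge0// debump_ge0.
pose h x := ebump (U None x - Mg) - ebump (- U None x - Mg).
have ZN x : Z None x = h x by rewrite /Z /Z1 /Z2 /h ebM !mul1r !mulN1r; ring.
have ZS i x : Z (Some i) x = c x * U (Some i) x by rewrite /Z /Z1 /Z2 /c; ring.
have hU x : 0 <= U None x * h x.
  have M0 := Mg_ge0; rewrite /h; have [u0|u0] := leP 0 (U None x).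
    rewrite (eb0 (- _ - _)) ?subr0; last lra.
    by rewrite mulr_ge0 ?ebump_ge0.
  rewrite (eb0 (U None x - Mg)) ?sub0r; last lra.
  by rewrite mulrN -mulNr mulr_ge0 ?ebump_ge0//; lra.
have hUg x : 0 <= (U None x - g x) * h x.
  have := g_bounded x; rewrite ler_norml => /andP[g1 g2].
  have M0 := Mg_ge0; rewrite /h; have [u0|u0] := leP 0 (U None x).
    rewrite (eb0 (- _ - _)) ?subr0; last lra.
    have [uM|uM] := leP (U None x) Mg.
      by rewrite eb0 ?mulr0// subr_le0.
    by rewrite mulr_ge0 ?ebump_ge0//; lra.
  rewrite (eb0 (U None x - Mg)) ?sub0r; last lra.
  have [uM|uM] := leP (- Mg) (U None x).
    by rewrite (eb0 (- _ - _)) ?oppr0 ?mulr0//; lra.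
  by rewrite mulrN -mulNr mulr_ge0 ?ebump_ge0//; lra.
have tE : \forall x \ae mu, \sum_i den eps del x (U^~ x) i * Z i x = 0.
  apply: (I_eq0 cmu); last 2 first.
  - exact: test_itg.
  - by rewrite test_equation.
  apply: filterS (den_grad_ge0 del U e0 c0) => x hx.
  rewrite big_option/= ZN.
  rewrite (eq_bigr (fun i => den eps del x (U^~ x) (Some i) * (c x * U (Some i) x))); last first.
    by move=> i _; rewrite ZS.
  rewrite addr_ge0// mulrDl addr_ge0// -mulrA mulr_ge0//; last exact: ssgn_ge0.
  by have [] := andP (chi01 x).
apply: filterS2 tE (den_grad_ge0 del U e0 c0) => x.
rewrite big_option/= ZN.
rewrite (eq_bigr (fun i => den eps del x (U^~ x) (Some i) * (c x * U (Some i) x))); last first.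
  by move=> i _; rewrite ZS.
set S := \sum_i _ => h0 S0.
have hs : 0 <= chi x * (ssgn del (U None x) * h x).
  by rewrite mulr_ge0//; [have [] := andP (chi01 x)|exact: ssgn_ge0].
have hz : (U None x - g x) * h x = 0.
  have := hUg x; move: h0; rewrite mulrDl -[_ * _ * h x]mulrA.
  set X := _ * h x in hs *; set Y := (_ - _) * h x; lra.
have := g_bounded x; rewrite ler_norml => /andP[g1 g2]; have M0 := Mg_ge0.
rewrite leNgt; apply/negP => Mu; move: hz; rewrite /h.
have [u0|u0] := leP 0 (U None x).
  move: Mu; rewrite ger0_norm// => Mu.
  rewrite (eb0 (- _ - _)) ?subr0; last lra.
  have := @ebump_gt0 R (U None x - Mg) (_ : 0 < _); rewrite subr_gt0 => /(_ Mu) eb.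
  have : 0 < (U None x - g x) * ebump (U None x - Mg) by rewrite mulr_gt0//; lra.
  lra.
move: Mu; rewrite ltr0_norm// => Mu.
rewrite (eb0 (U None x - Mg)) ?sub0r; last lra.
have := @ebump_gt0 R (- U None x - Mg) (_ : 0 < _); rewrite subr_gt0 => /(_ Mu) eb.
have : 0 < (g x - U None x) * ebump (- U None x - Mg) by rewrite mulr_gt0//; lra.
lra.
Qed.

Lemma kap_diff_itg U : W U -> itg (fun x => kap x * `|U None x - g x|).
Proof.
move=> WU; have mu' : mf (fun x => U None x - g x) by apply: measurable_funB => //; exact: u_mf.
apply: (itg_le (g := fun x => kap x + (U None x - g x) ^+ 2)).
- by apply: measurable_funM => //; exact: measurableT_comp.
- apply: aeW => x; have [k0 k1] := andP (kap01 x); rewrite ger0_norm ?mulr_ge0//.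
  rewrite -[_ ^+ 2]real_normK ?num_real//; set X := `|_|; have X0 : 0 <= X by exact: normr_ge0.
  case: (kap2 x) => ->; rewrite ?mul0r ?mul1r; have := sqr_ge0 X; have := sqr_ge0 (X - 1); nra.
- apply: itgD => //; have W1 : W (fun i x => 1 * U i x + (-1) * Zg i x) by exact: ws_lin.
  by apply: (eq_itg (u2_itg W1)) => x; rewrite ZgE mul1r mulN1r.
Qed.

(** The test functions are smoothed signs of [u]. Where [kap] is 0, [g] vanishes and the zero-order
    term is nonnegative; where [kap] is 1 it is at least $-|u-g|$. Fatou's lemma then removes the
    smoothing [n] of the sign. *)
Lemma is_min_sign eps del U : 0 < eps -> eps <= 1 -> 0 < del -> is_min eps del U ->
  itg (fun x => chi x * `|ssgn del (U None x)|) /\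
  I (fun x => chi x * `|ssgn del (U None x)|) <= I (fun x => kap x * `|U None x - g x|).
Proof.
move=> e0 e1 d0 mU; have WU := mU.1.
pose G n x := chi x * ssgn del (U None x) * sgbump n (U None x).
have mG n : mf (G n).
  apply: measurable_funM; last first.
    have meb : mf (fun x => 2 ^+ n * U None x) by apply: measurable_funM => //; exact: u_mf.
    have ce := continuous_measurable_fun (@continuous_eflat R 1).
    apply: measurable_funB; apply: (@measurableT_comp _ _ _ _ _ _ (eflat 1)) => //.
    exact: measurableT_comp.
  apply: measurable_funM => //.
  exact: (measurableT_comp (continuous_measurable_fun (@continuous_ssgn R del d0)) (u_mf None WU)).
have GE n : itg (G n) /\ I (G n) <= I (fun x => kap x * `|U None x - g x|).
  pose Z1 := fun (i : J) (x : T) => if i is Some _ then 2 ^+ n * debump (2 ^+ n * U None x + 0) * U i x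
    else ebump (2 ^+ n * U None x + 0) - ebump 0.
  pose Z2 := fun (i : J) (x : T) => if i is Some _ then - 2 ^+ n * debump (- 2 ^+ n * U None x + 0) * U i x
    else ebump (- 2 ^+ n * U None x + 0) - ebump 0.
  have WZ1 : W Z1 by exact: ws_comp.
  have WZ2 : W Z2 by exact: ws_comp.
  pose Z := fun i x => 1 * Z1 i x + (-1) * Z2 i x.
  have WZ : W Z by exact: ws_lin.
  pose c x := 2 ^+ n * debump (2 ^+ n * U None x) + 2 ^+ n * debump (- 2 ^+ n * U None x).
  have c0 x : 0 <= c x by rewrite addr_ge0// mulr_ge0 ?debump_ge0 ?exprn_ge0.
  have ZN x : Z None x = sgbump n (U None x).
    by rewrite /Z /Z1 /Z2 /sgbump /= !addr0 [- 2 ^+ n * _]mulNr; ring.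
  have ZS i x : Z (Some i) x = c x * U (Some i) x by rewrite /Z /Z1 /Z2 /c !addr0; ring.
  have iT := test_itg e0 e1 d0 WU WZ; have IT := test_equation e0 e1 d0 mU WZ.
  have GP x : 0 <= G n x.
    rewrite /G -mulrA mulr_ge0//; first by have [] := andP (chi01 x).
    by apply: ssgn_ge0 => //; exact: sgbump_mul_ge0.
  have key : \forall x \ae mu, G n x <=
      \sum_i den eps del x (U^~ x) i * Z i x + kap x * `|U None x - g x|.
    apply: filterS (den_grad_ge0 del U e0 c0) => x hx.
    rewrite big_option/= ZN.
    rewrite (eq_bigr (fun i => den eps del x (U^~ x) (Some i) * (c x * U (Some i) x))); last first.
      by move=> i _; rewrite ZS.
    set S := \sum_i _ in hx *; rewrite /G.
    set s := sgbump n _; have s1 : `|s| <= 1 by exact: sgbump_le1.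
    have us : 0 <= U None x * s by exact: sgbump_mul_ge0.
    have cg := chi_g x; have ku := kap2 x.
    have h1 : - (kap x * `|U None x - g x|) <= (U None x - g x) * s.
      case: ku => k; rewrite k in cg *.
        move: cg; rewrite subr0 mul1r => g0; rewrite g0 subr0 mul0r oppr0//.
      rewrite mul1r; apply: le_trans (_ : - `|(U None x - g x) * s| <= _).
        rewrite lerN2 normrM -[leRHS]mulr1 ler_wpM2l//.
      by rewrite lerNl -normrN ler_norm.
    rewrite [(_ + chi x * _) * s]mulrDl; set X := chi x * _ * s; set Y := (_ - _) * s in h1 *; lra.
  have iS : itg (fun x => \sum_i den eps del x (U^~ x) i * Z i x + kap x * `|U None x - g x|).
    by apply: itgD => //; exact: kap_diff_itg.
  have iG : itg (G n).
    apply: (itg_le (g := fun x => \sum_i den eps del x (U^~ x) i * Z i x + kap x * `|U None x - g x|)) => //.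
    by apply: filterS key => x; rewrite (ger0_norm (GP x)).
  split => //; apply: (@le_trans _ _ (I (fun x => \sum_i den eps del x (U^~ x) i * Z i x + kap x * `|U None x - g x|))).
    exact: (I_le cmu).
  by rewrite ID// ?IT ?add0r//; exact: kap_diff_itg.
apply: (Fatou cmu (F := G)).
- by move=> n; exact: (GE n).1.
- move=> n; apply: aeW => x; rewrite /G -mulrA mulr_ge0//; first by have [] := andP (chi01 x).
  by apply: ssgn_ge0 => //; exact: sgbump_mul_ge0.
- apply: aeW => x; rewrite /G -(ssgn_sg _ d0) [chi x * (_ * Num.sg _)]mulrA.
  have c : (fun _ : nat => chi x * ssgn del (U None x)) @ \oo --> chi x * ssgn del (U None x).
    exact: cvg_cst.
  set k := chi x * ssgn del (U None x) in c *.
  have h : (fun n => k * sgbump n (U None x)) @ \oo --> k * Num.sg (U None x).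
    by apply: cvgM; [exact: c|exact: sgbump_cvg].
  exact: h.
- by move=> n; exact: (GE n).2.
Qed.

(** The minimizer is its own test function, and $(u-g)u \ge -g^2$ bounds the zero-order term. *)
Lemma is_min_flux eps del U : 0 < eps -> eps <= 1 -> 0 < del -> is_min eps del U ->
  lam * I (fun x => \sum_i a x (grad_of U x) i * U (Some i) x) <= I (fun x => g x ^+ 2).
Proof.
move=> e0 e1 d0 mU; have WU := mU.1.
have iT := test_itg e0 e1 d0 WU WU; have IT := test_equation e0 e1 d0 mU WU.
have ia := itg_aU WU WU.
rewrite -IZ//; apply: (@le_trans _ _ (I (fun x => \sum_i den eps del x (U^~ x) i * U i x + g x ^+ 2))); last first.
  by rewrite ID// IT add0r.
apply: (I_le cmu); [apply: aeW => x|exact: itgZ|exact: itgD].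
rewrite big_option/=.
rewrite [X in _ <= _ + X + _](eq_bigr (fun i => lam * (a x (grad_of U x) i * U (Some i) x) +
   eps * (dpow p (U (Some i) x) * U (Some i) x))); last by move=> i _; rewrite mulrDl !mulrA.
rewrite big_split/= -!mulr_sumr; set S := \sum_i a _ _ _ * _.
have h1 : 0 <= eps * \sum_(i : D) dpow p (U (Some i) x) * U (Some i) x.
  rewrite mulr_ge0 ?(ltW e0)// sumr_ge0// => i _.
  by rewrite dpow_mul// mulr_ge0// apow_ge0.
have h2 : 0 <= chi x * (ssgn del (U None x) * U None x).
  have [c0 _] := andP (chi01 x); rewrite mulr_ge0// ssgn_ge0// -expr2 sqr_ge0//.
set X := eps * _ in h1 *; rewrite mulrDl -[_ * _ * U None x]mulrA.
set Y := _ * (_ * _) in h2 *.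
have := sqr_ge0 (U None x / 2 - g x); have := sqr_ge0 (U None x); nra.
Qed.

Lemma F_le0 eps del U : 0 < eps -> eps <= 1 -> 0 < del -> is_min eps del U -> F eps del U <= 0.
Proof.
move=> e0 e1 d0 [_ /(_ _ (ws_0 WP))]; suff -> : F eps del (fun _ _ => 0) = 0 by [].
rewrite (I_ae cmu (g := fun=> 0)) ?I0//; last first.
  exact: itg_mf (itg_integrand (P e0 e1 d0) (Lq (ws_0 WP))).
apply: filterS (sc_B_0 aB) => x h; rewrite /energy h gpow0// sabs0//.
by rewrite expr0n/= !(mulr0, mul0r, addr0, subr0).
Qed.

Lemma is_min_apow eps del U i : 0 < eps -> eps <= 1 -> 0 < del -> is_min eps del U ->
  I (fun x => apow (w1exp i) (U i x)) <= I (eb ba g lam) / (eps / 4).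
Proof.
move=> e0 e1 d0 mU; apply: le_trans (I_apow_le_pmod cmu i (Lq mU.1)) _.
rewrite ler_pdivlMr ?divr_gt0// mulrC.
apply: le_trans (integrand_coercive cmu (P e0 e1 d0) (Lq mU.1)) _.
by have := F_le0 e0 e1 d0 mU; lra.
Qed.

Lemma F_mono eps del del' U : 0 < eps -> eps <= 1 -> 0 < del' -> del' <= del -> W U ->
  F eps del U <= F eps del' U.
Proof.
move=> e0 e1 d0 dd WU; have d1 := lt_le_trans d0 dd.
apply: (I_le cmu).
- apply: aeW => x; rewrite /energy !lerD2l ler_wpM2l ?sabs_mono//.
  by have [] := andP (chi01 x).
- exact: (itg_integrand (P e0 e1 d1) (Lq WU)).
- exact: (itg_integrand (P e0 e1 d0) (Lq WU)).
Qed.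

(** [U'] competes at the larger parameter [del], where it costs no more than at [del']; its excess
    there is at most the increase of the minimal values. *)
Lemma del_gap eps del del' U U' i : 0 < eps -> eps <= 1 -> 0 < del' -> del' <= del ->
  is_min eps del U -> is_min eps del' U' ->
  eps / 2 * I (fun x => pgap (w1exp i) (U i x) (U' i x)) <= F eps del' U' - F eps del U.
Proof.
move=> e0 e1 d0 dd mU mU'; have d1 := lt_le_trans d0 dd.
have := minimizer_gap cmu q1 (ws_Lq WP) (ws_lin WP) (P e0 e1 d1) i mU.1 mU'.1 mU.2.
have := F_mono e0 e1 d0 dd mU'.1.
have : 0 <= I (fun x => pgap (w1exp i) (U i x) (U' i x)) by apply: (I_pgap_ge0 cmu q1); apply: Lq; [exact: mU.1|exact: mU'.1].
set X := I _ => X0; set A := F eps del U'; set B' := F eps del U; set C := F eps del' U'.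
by case: i @X X0 => [j|] X X0 /=; nra.
Qed.

Lemma F_split eps del U : 0 < eps -> eps <= 1 -> 0 < del -> W U -> forall eps',
  F eps' del U = F eps del U + (eps' - eps) * I (fun x => gpow (grad_of U x)).
Proof.
move=> e0 e1 d0 WU eps'; have iF := itg_integrand (P e0 e1 d0) (Lq WU).
have ig := gpow_itg WU.
rewrite -IZ// -ID//; last exact: itgZ.
by apply: eq_I => x; rewrite /energy /grad_of; ring.
Qed.

(** The functional is affine in [eps]. Comparing the two minimality conditions bounds the excess of
    [U'] by $\varepsilon-\varepsilon'$ times the increase of the gradient term; as
    $\varepsilon-\varepsilon' \le \varepsilon$, the weight [eps] of the gap cancels and the estimate
    does not degenerate. *)
Lemma eps_gap eps eps' del U U' i : 0 < eps' -> eps' < eps -> eps <= 1 -> 0 < del ->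
  is_min eps del U -> is_min eps' del U' ->
  I (fun x => pgap (w1exp i) (U i x) (U' i x)) <=
  I (fun x => gpow (grad_of U' x)) - I (fun x => gpow (grad_of U x)).
Proof.
move=> e'0 ee e1 d0 mU mU'; have e0 := lt_trans e'0 ee; have e'1 := le_trans (ltW ee) e1.
have := minimizer_gap cmu q1 (ws_Lq WP) (ws_lin WP) (P e0 e1 d0) i mU.1 mU'.1 mU.2.
have := mU'.2 _ mU.1.
rewrite (F_split e0 e1 d0 mU.1 eps') (F_split e0 e1 d0 mU'.1 eps').
have : 0 <= I (fun x => pgap (w1exp i) (U i x) (U' i x)) by apply: (I_pgap_ge0 cmu q1); apply: Lq; [exact: mU.1|exact: mU'.1].
set X := I _ => X0; set A := F eps del U'; set B' := F eps del U.
set C := I _; set E := I _ => h1 h2.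
have w0 : 0 <= @ew R D eps i by case: i {X X0 h2} => [j|] /=; lra.
have CE : 0 <= C - E.
  rewrite -(pmulr_rge0 _ (_ : 0 < eps - eps')); last by rewrite subr_gt0.
  have := mulr_ge0 w0 X0; lra.
have {}h2 : @ew R D eps i * X <= (eps - eps') * (C - E) / 2 by lra.
have h3 : (eps - eps') * (C - E) <= eps * (C - E) by rewrite ler_wpM2r//; lra.
have h4 : eps * (C - E) <= C - E by rewrite -[leRHS]mul1r ler_wpM2r.
have h5 : eps * X <= eps * (C - E) -> X <= C - E by rewrite ler_pM2l.
have h6 : 0 <= eps * (C - E) by rewrite mulr_ge0// ltW.
move: h2; case: i {w0} @X X0 h5 => [j|] X X0 h5 /= h2; last lra.
by apply: h5; lra.
Qed.

(** Comparison with [Zg], whose penalty is zero because [g] vanishes wherever [kap] does. *)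
Lemma is_min_close eps del U : 0 < eps -> eps <= 1 -> 0 < del -> is_min eps del U ->
  I (fun x => (U None x - g x) ^+ 2) <=
  2 * (lam * I (fun x => B x (grad_of Zg x)) + eps * I (fun x => gpow (grad_of Zg x))).
Proof.
move=> e0 e1 d0 [WU /(_ _ WZg) Umin].
have iB := itg_B WZg; have ig := gpow_itg WZg.
have iF := itg_integrand (P e0 e1 d0) (Lq WU).
have iFg := itg_integrand (P e0 e1 d0) (Lq WZg).
have W1 : W (fun i x => 1 * U i x + (-1) * Zg i x) by exact: ws_lin.
have id2 : itg (fun x => (U None x - g x) ^+ 2).
  by apply: (eq_itg (u2_itg W1)) => x; rewrite ZgE mul1r mulN1r.
have h1 : I (fun x => (U None x - g x) ^+ 2 / 2) <= F eps del U + I (fun x => g x ^+ 2 / 2).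
  have ig2 : itg (fun x => g x ^+ 2 / 2) by under eq_fun do rewrite mulrC; exact: itgZ.
  rewrite -ID//; apply: (I_le cmu); last exact: itgD; last first.
    by under eq_fun do rewrite mulrC; exact: itgZ.
  apply: filterS (sc_B_ge0 aB) => x hB; rewrite /energy.
  have b0 : 0 <= lam * B x (fun i => U (Some i) x) by rewrite mulr_ge0 ?(ltW lam_gt0)//; exact: hB.
  have g0 : 0 <= eps * gpow (fun i => U (Some i) x) by rewrite mulr_ge0 ?gpow_ge0// ltW.
  have [c0 _] := andP (chi01 x).
  have j0 : 0 <= chi x * sabs del (U None x) by rewrite mulr_ge0// sabs_ge0.
  set X := lam * _ in b0 *; set Y := eps * _ in g0 *; set Z := chi x * _ in j0 *; nra.
have h2 : F eps del Zg + I (fun x => g x ^+ 2 / 2) =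
    lam * I (fun x => B x (grad_of Zg x)) + eps * I (fun x => gpow (grad_of Zg x)).
  have ig2 : itg (fun x => g x ^+ 2 / 2) by under eq_fun do rewrite mulrC; exact: itgZ.
  rewrite -!IZ// -!ID//; [|exact: itgZ|exact: itgZ].
  apply: eq_I => x; rewrite /energy ZgE /grad_of.
  have -> : chi x * sabs del (g x) = 0.
    case: (kap2 x) => k; rewrite k ?subrr ?mul0r// .
    by have := kap_g x; rewrite k mul0r => <-; rewrite sabs0// mulr0.
  by field.
have h3 : I (fun x => (U None x - g x) ^+ 2 / 2) = I (fun x => (U None x - g x) ^+ 2) / 2.
  by under eq_fun do rewrite mulrC; rewrite IZ// mulrC.
move: h1; rewrite h3 -h2; lra.
Qed.

Local Notation hn n := ((1 / 2 : R) ^+ n).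

Let hn_gt0 n : 0 < hn n. Proof. by rewrite exprn_gt0//; lra. Qed.
Let hn_le1 n : hn n <= 1. Proof. by rewrite exprn_ile1//; lra. Qed.
Let hn_le m n : (m <= n)%N -> hn n <= hn m.
Proof.
move=> mn; by rewrite -(subnKC mn) exprD -[leRHS]mulr1 ler_wpM2l ?(ltW (hn_gt0 m)).
Qed.
Let hn_cvg (phi : nat -> nat) : (forall n, (n <= phi n)%N) -> (fun n => hn (phi n)) @ \oo --> (0 : R).
Proof.
move=> h; apply: (cvg_sub (u := fun n => hn n) h).
by have := cvg_half (1 : R); under eq_fun do rewrite mul1r.
Qed.

(** The limit as [del] runs through $2^{-k}$ at fixed [eps]. The approximating minimizers are part
    of the definition, since the estimates are proved for them and then passed to the limit. *)
Definition is_lim eps U : Prop := W U /\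
  exists2 U_ : nat -> J -> T -> R, forall k, is_min eps (hn k) (U_ k) & mconv U_ U.

Lemma cvg_cauchy (u : nat -> R) : cvgn u -> forall e, 0 < e ->
  exists N, forall m n, (N <= m)%N -> (N <= n)%N -> u m - u n <= e.
Proof.
move=> cu e e0; have e2 : 0 < e / 2 by rewrite divr_gt0.
have /cvgrPdist_le/(_ _ e2)[N _ hN] := cu; exists N => m n Nm Nn.
by have := hN m Nm; have := hN n Nn; rewrite /= !ler_norml => /andP[? ?] /andP[? ?]; lra.
Qed.

(** The minimal values increase as [del] decreases and stay below 0, the value at the zero function;
    their convergence and [del_gap] make the minimizers Cauchy. *)
Lemma is_lim_exists eps : 0 < eps -> eps <= 1 -> exists U, is_lim eps U.
Proof.
move=> e0 e1.
have /choice[U_ mU] : forall k, exists U, is_min eps (hn k) U.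
  by move=> k; exact: is_min_exists.
pose m k := F eps (hn k) (U_ k).
have m_nd : nondecreasing_seq m.
  move=> k l kl; apply: le_trans ((mU k).2 _ (mU l).1) _.
  by apply: F_mono => //; [exact: hn_le|exact: (mU l).1].
have m_cvg : cvgn m.
  by apply: nondecreasing_is_cvgn => //; exists 0 => _ [n _ <-]; exact: F_le0.
have HU_ k : inLq (U_ k) by apply: Lq; exact: (mU k).1.
have [|U [HU cU]] := mcauchy_mconv cmu q1 HU_.
  apply: (gap_cauchy cmu q1 HU_ (K := I (eb ba g lam) / (eps / 4))).
    by move=> n i; exact: is_min_apow (mU n).
  move=> e e0'; have e2 : 0 < eps / 2 * e by rewrite mulr_gt0// divr_gt0.
  have [N hN] := cvg_cauchy m_cvg e2.
  exists N => k l Nk Nl i.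
  wlog kl : k l Nk Nl / (k <= l)%N.
    move=> h; have [kl|/ltnW lk] := leqP k l; first exact: h.
    by under eq_fun do rewrite pgapC; exact: h.
  have := del_gap i e0 e1 (hn_gt0 l) (hn_le kl) (mU k) (mU l).
  by move=> /le_trans/(_ (hN l k Nl Nk)); rewrite ler_pM2l// divr_gt0.
exists U; split; last by exists U_.
by apply: (ws_closed WP (U_ := U_)) => // k; exact: (mU k).1.
Qed.

Lemma abs_sg_mf (u : T -> R) : mf u -> mf (fun x => `|Num.sg (u x)|).
Proof.
move=> mu0; apply: (mf_cvg cmu (F := fun n x => `|sgbump n (u x)|)).
  move=> n; apply: measurableT_comp => //.
  have meb : mf (fun x => 2 ^+ n * u x) by exact: measurable_funM.
  have ce := continuous_measurable_fun (@continuous_eflat R 1).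
  apply: measurable_funB; apply: (@measurableT_comp _ _ _ _ _ _ (eflat 1)) => //.
  exact: measurableT_comp.
by apply: aeW => x; apply: cvg_norm; exact: sgbump_cvg.
Qed.

Lemma abs_sg01 (s : R) : 0 <= `|Num.sg s| <= 1.
Proof. by rewrite normr_sg; case: (_ != _); rewrite ?ler01 ?lexx. Qed.

Lemma W_sub U V : W U -> W V -> W (fun i x => U i x - V i x).
Proof.
move=> WU WV; have := ws_lin WP 1 (-1) WU WV.
by under eq_fun => i do under eq_fun => x do rewrite mul1r mulN1r.
Qed.

Lemma diff2_itg U : W U -> itg (fun x => (U None x - g x) ^+ 2).
Proof. by move=> WU; have := u2_itg (W_sub WU WZg); rewrite ZgE. Qed.

Lemma fconv_diff V_ U : (forall k, W (V_ k)) -> W U -> fconv V_ U ->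
  (fun k => I (fun x => (V_ k None x - g x) ^+ 2)) @ \oo --> I (fun x => (U None x - g x) ^+ 2).
Proof.
move=> WV WU cU.
have [||| //] := growth_cvg cmu q1 (Lq WU) cU (ler0n R 2) (b := fun x => 2 * g x ^+ 2)
  (F := fun k x => (V_ k None x - g x) ^+ 2) (f := fun x => (U None x - g x) ^+ 2)
  (fun k => itg_mf (diff2_itg (WV k))).
- apply: filterS (fconv_ae q1 cU) => x /(_ None) h.
  under eq_fun do rewrite expr2; rewrite expr2.
  by apply: cvgM; apply: cvgB => //; exact: cvg_cst.
- exact: itgZ.
- apply: aeW => x k; rewrite ger0_norm ?sqr_ge0// pmodE.
  have := gpow_ge0 p (fun i => V_ k (Some i) x); have := sqr_ge0 (V_ k None x + g x); nra.
Qed.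

Lemma fconv_kap_diff V_ U : (forall k, W (V_ k)) -> W U -> fconv V_ U ->
  (fun k => I (fun x => kap x * `|V_ k None x - g x|)) @ \oo --> I (fun x => kap x * `|U None x - g x|).
Proof.
move=> WV WU cU.
have [||| //] := growth_cvg cmu q1 (Lq WU) cU (ler0n R 2) (b := fun x => kap x + 2 * g x ^+ 2)
  (F := fun k x => kap x * `|V_ k None x - g x|) (f := fun x => kap x * `|U None x - g x|)
  (fun k => itg_mf (kap_diff_itg (WV k))).
- apply: filterS (fconv_ae q1 cU) => x /(_ None) h.
  have c : (fun k => `|V_ k None x - g x|) @ \oo --> `|U None x - g x|.
    by apply: cvg_norm; apply: cvgB => //; exact: cvg_cst.
  by apply: cvgM c; exact: cvg_cst.
- by apply: itgD => //; exact: itgZ.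
- apply: aeW => x k; have [k0 k1] := andP (kap01 x); rewrite ger0_norm ?mulr_ge0// pmodE.
  have := gpow_ge0 p (fun i => V_ k (Some i) x); have := sqr_ge0 (V_ k None x + g x).
  have h : kap x * `|V_ k None x - g x| <= kap x + (V_ k None x - g x) ^+ 2.
    rewrite -[_ ^+ 2]real_normK ?num_real//; set X := `|_|; have X0 : 0 <= X by exact: normr_ge0.
    case: (kap2 x) => ->; rewrite ?mul0r ?mul1r; have := sqr_ge0 X; have := sqr_ge0 (X - 1); nra.
  set X := kap x * _ in h *; nra.
Qed.

(** * Estimates and equations along fast sequences of minimizers *)

Section limit_of_minimizers.
Variables (eps_ del_ : nat -> R) (V_ : nat -> J -> T -> R) (U : J -> T -> R).
Hypothesis eps_gt0 : forall k, 0 < eps_ k.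
Hypothesis eps_le1 : forall k, eps_ k <= 1.
Hypothesis del_gt0 : forall k, 0 < del_ k.
Hypothesis del_cvg : del_ @ \oo --> (0 : R).
Hypothesis minV : forall k, is_min (eps_ k) (del_ k) (V_ k).
Hypothesis WU : W U.
Hypothesis cU : fconv V_ U.

Let WV k : W (V_ k) := (minV k).1.

Lemma limit_bounded : \forall x \ae mu, `|U None x| <= Mg.
Proof.
have hV : \forall x \ae mu, forall k, `|V_ k None x| <= Mg.
  by apply: ae_foralln => k; exact: is_min_bounded (minV k).
apply: filterS2 hV (fconv_ae q1 cU) => x h /(_ None) c.
have c' : (fun k => `|V_ k None x|) @ \oo --> `|U None x| by exact: cvg_norm.
rewrite -(cvg_lim _ c')//; apply: limr_le; last exact: nearW.
by apply/cvg_ex; eexists; exact: c'.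
Qed.

(** The smoothed signs tend to 1 in modulus where [U] is nonzero; the factor [Num.sg] suppresses the
    remaining points before Fatou's lemma is applied. *)
Lemma limit_support :
  itg (fun x => chi x * `|Num.sg (U None x)|) /\
  I (fun x => chi x * `|Num.sg (U None x)|) <= I (fun x => kap x * `|U None x - g x|).
Proof.
set K := I (fun x => kap x * _).
(* Fatou's lemma asks for one bound valid for all indices, so the sequence is shifted by an [N]
   beyond which the right-hand sides are within [e] of their limit. *)
suff key e : 0 < e -> itg (fun x => chi x * `|Num.sg (U None x)|) /\
    I (fun x => chi x * `|Num.sg (U None x)|) <= K + e.
  split; first exact: (key 1 ltr01).1.
  by apply/ler_addgt0Pr => e e0; exact: (key e e0).2.
move=> e0; have /cvgrPdist_le/(_ _ e0)[N _ hN] := fconv_kap_diff WV WU cU.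
have msg := abs_sg_mf (u_mf None WU).
have shift : forall n, (n <= n + N)%N by move=> n; exact: leq_addr.
pose G k x := chi x * `|ssgn (del_ (k + N)%N) (V_ (k + N)%N None x)| * `|Num.sg (U None x)|.
have GE k : itg (G k) /\ I (G k) <= K + e.
  have [i1 i2] := is_min_sign (eps_gt0 _) (eps_le1 _) (del_gt0 _) (minV (k + N)).
  have G0 x : 0 <= G k x by rewrite !mulr_ge0//; have [] := andP (chi01 x).
  have Gle x : G k x <= chi x * `|ssgn (del_ (k + N)%N) (V_ (k + N)%N None x)|.
    rewrite /G -[leRHS]mulr1 ler_wpM2l ?(andP (abs_sg01 _)).2// mulr_ge0//.
    by have [] := andP (chi01 x).
  have iG : itg (G k).
    apply: (itg_le _ _ i1); first exact: measurable_funM (itg_mf i1) msg.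
    by apply: aeW => x; rewrite ger0_norm.
  split => //; apply: (@le_trans _ _ (I (fun x => chi x * `|ssgn (del_ (k + N)%N) (V_ (k + N)%N None x)|))).
    by apply: (I_le cmu) => //; exact: aeW.
  apply: le_trans i2 _; have := hN (k + N)%N (leq_addl _ _).
  by rewrite /= -/K ler_norml => /andP[h _]; lra.
apply: (Fatou cmu (F := G)).
- by move=> k; exact: (GE k).1.
- by move=> k; apply: aeW => x; rewrite !mulr_ge0//; have [] := andP (chi01 x).
- apply: filterS (fconv_ae q1 cU) => x /(_ None) c.
  have [u0|u0] := eqVneq (U None x) 0.
    rewrite u0 sgr0 normr0 mulr0 /G u0; under eq_fun do rewrite sgr0 normr0 mulr0.
    exact: cvg_cst.
  have h : (fun k => `|ssgn (del_ (k + N)%N) (V_ (k + N)%N None x)|) @ \oo --> (1 : R).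
    apply: (ssgn_cvg (s := U None x)) => //.
      exact: (cvg_sub shift del_cvg).
    exact: (cvg_sub (u := fun k => V_ k None x) shift c).
  have h2 : (fun k => chi x * `|ssgn (del_ (k + N)%N) (V_ (k + N)%N None x)|) @ \oo --> chi x * 1.
    by apply: cvgM h; exact: cvg_cst.
  have h3 : (fun k => G k x) @ \oo --> chi x * 1 * `|Num.sg (U None x)|.
    by apply: cvgM h2 _; exact: cvg_cst.
  by move: h3; rewrite mulr1.
- by move=> k; exact: (GE k).2.
Qed.

Lemma limit_diff_bound : I (fun x => kap x * `|U None x - g x|) <= 2 * Mg * I kap.
Proof.
rewrite -IZ//; apply: (I_le cmu); [|exact: kap_diff_itg|exact: itgZ].
apply: filterS limit_bounded => x h; rewrite mulrC ler_wpM2r//.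
  by have [] := andP (kap01 x).
by apply: le_trans (ler_normB _ _) _; have := g_bounded x; lra.
Qed.

Lemma limit_flux : I (fun x => \sum_i a x (grad_of U x) i * U (Some i) x) <= I (fun x => g x ^+ 2) / lam.
Proof.
apply: (proj2 (Fatou cmu (F := fun k x => \sum_i a x (grad_of (V_ k) x) i * V_ k (Some i) x) _ _ _ _)).
- by move=> k; exact: itg_aU.
- by move=> k; apply: filterS (a_grad_ge0 aB) => x h; exact: h.
- have hsup : \forall x \ae mu, forall i, forall (xi_ : nat -> D -> R) xi,
      (forall i, (fun n => xi_ n i) @ \oo --> xi i) ->
      (fun n => a x (xi_ n) i) @ \oo --> a x xi i.
    by apply: filter_forall => i; exact: (sc_a_sup aB i).2.
  apply: filterS2 hsup (fconv_ae q1 cU) => x h c.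
  apply: cvg_sumr => i; apply: cvgM; last exact: (c (Some i)).
  by apply: (h i (fun k => grad_of (V_ k) x)) => j; exact: (c (Some j)).
- move=> k; rewrite ler_pdivlMr// mulrC; exact: is_min_flux (minV k).
Qed.

(** The limit parameter is left free: a constant [eps_] serves the limit in [del], and [eps0 = 0]
    removes the regularization at the end. *)
Lemma limit_gradient_term (eps0 : R) Z : W Z -> eps_ @ \oo --> eps0 ->
  (fun k => I (fun x => \sum_i (lam * a x (grad_of (V_ k) x) i + eps_ k * dpow p (V_ k (Some i) x)) * Z (Some i) x)) @ \oo -->
  I (fun x => \sum_i (lam * a x (grad_of U x) i + eps0 * dpow p (U (Some i) x)) * Z (Some i) x).
Proof.
move=> WZ ce; have lC : 0 <= lam * Ca + p by rewrite addr_ge0// mulr_ge0 ?(ltW lam_gt0)//; exact: sc_Ca_ge0 aB.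
have [||||//] := growth_cvg cmu q1 (Lq WU) cU (mulr_ge0 (ler0n R #|D|) lC)
  (b := fun x => (lam * Ca + p) * gpow (grad_of Z x) + #|D|%:R * (lam * ba x))
  (F := fun k x => \sum_i (lam * a x (grad_of (V_ k) x) i + eps_ k * dpow p (V_ k (Some i) x)) * Z (Some i) x)
  (f := fun x => \sum_i (lam * a x (grad_of U x) i + eps0 * dpow p (U (Some i) x)) * Z (Some i) x).
- move=> k; apply: measurable_sum => i; apply: measurable_funM; last exact: u_mf.
  apply: measurable_funD; apply: measurable_funM => //.
    by apply: (sc_a_sup aB i).1 => j; exact: u_mf.
  by apply: (measurableT_comp (continuous_measurable_fun (continuous_dpow p_gt1))); exact: u_mf.
- have hsup : \forall x \ae mu, forall i, forall (xi_ : nat -> D -> R) xi,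
      (forall i, (fun n => xi_ n i) @ \oo --> xi i) ->
      (fun n => a x (xi_ n) i) @ \oo --> a x xi i.
    by apply: filter_forall => i; exact: (sc_a_sup aB i).2.
  apply: filterS2 hsup (fconv_ae q1 cU) => x h c.
  apply: cvg_sumr => i; apply: cvgM; last exact: cvg_cst.
  apply: cvgD.
    apply: cvgM; first exact: cvg_cst.
    by apply: (h i (fun k => grad_of (V_ k) x)) => j; exact: (c (Some j)).
  apply: cvgM => //.
  apply: (cvg_comp (fun k => V_ k (Some i) x) (dpow p)); first exact: (c (Some i)).
  exact: continuous_dpow.
- by apply: itgD; apply: itgZ; [exact: gpow_itg|apply: itgZ; exact: sc_ba_itg aB].
- apply: filterS2 (sc_a_growth aB) (ba_ge0 p_gt1 aB) => x h hb k.
  apply: le_trans (ler_norm_sum _ _ _) _.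
  apply: (@le_trans _ _ (\sum_i ((lam * Ca + p) * pmod ((V_ k)^~ x) + (lam * Ca + p) * apow p (Z (Some i) x) + lam * ba x))).
    apply: ler_sum => i _.
    have h1 := h (grad_of (V_ k) x) i (Z (Some i) x).
    have h2 := dpow_growth (V_ k (Some i) x) (Z (Some i) x) p_gt1.
    have h3 : apow p (V_ k (Some i) x) <= gpow (grad_of (V_ k) x).
      exact: (apow_le_gpow p (grad_of (V_ k) x) i).
    have h4 := gpow_le_pmod p ((V_ k)^~ x).
    rewrite mulrDl; apply: le_trans (ler_normD _ _) _.
    rewrite -[lam * _ * _]mulrA -[eps_ k * _ * _]mulrA [`|lam * _|]normrM [`|eps_ k * _|]normrM.
    rewrite (gtr0_norm lam_gt0) (gtr0_norm (eps_gt0 k)).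
    set A := `|a _ _ _ * _| in h1 *; set E := `|dpow _ _ * _| in h2 *.
    set X := apow p (Z _ _) in h1 h2 *; set G := gpow (grad_of (V_ k) x) in h1 h3.
    set Mo := pmod _; set Y := apow p (V_ _ _ _) in h2 h3.
    have h4' : G <= Mo by exact: h4.
    have {}h1 := ler_wpM2l (ltW lam_gt0) h1.
    have h5 : eps_ k * E <= E by rewrite -[leRHS]mul1r ler_wpM2r//; exact: normr_ge0.
    have C0 := mulr_ge0 (ltW lam_gt0) (sc_Ca_ge0 aB).
    have h6 : lam * Ca * G <= lam * Ca * Mo by rewrite ler_wpM2l.
    have h7 : p * Y <= p * Mo by rewrite ler_wpM2l// (le_trans h3).
    move: h1; rewrite mulrDr mulrA mulrDr => h1.
    have h8 : p * (Y + X) <= p * Mo + p * X by rewrite mulrDr lerD2r.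
    rewrite !mulrDl; lra.
  set Mo := pmod _; set Lb := lam * ba x; set K := lam * Ca + p.
  rewrite !big_split/= !sumr_const -mulr_sumr.
  by rewrite -(mulr_natl (K * Mo)) -(mulr_natl Lb) mulrA addrA.
Qed.

End limit_of_minimizers.

(* The pair (0, 1_{u = 0} G) is a limit of tau (e(u / tau + 1) - e(1)), tau -> 0. *)
Lemma W_zero_part U : W U -> W (fun i x =>
  if i is Some _ then (1 - `|Num.sg (U None x)|) * U i x else 0).
Proof.
move=> WU; set Z := (X in W X).
(* On the zero set of [U] the rescaled factor in front of the gradient is [debump 1]; [c] normalizes
   it to 1. *)
pose c := (debump 1 : R)^-1.
have c0 : 0 < c by rewrite invr_gt0 debump_gt0.
pose Zb n := fun (i : J) (x : T) => if i is Some _ then 2 ^+ n * debump (2 ^+ n * U None x + 1) * U i x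
    else ebump (2 ^+ n * U None x + 1) - ebump 1.
have WZb n : W (Zb n) by exact: ws_comp.
pose Z_ n := fun i x => c * hn n * Zb n i x + 0 * Zb n i x.
have WZ_ n : W (Z_ n) by exact: ws_lin.
have e2 n : hn n * 2 ^+ n = 1.
  by rewrite -exprMn (_ : 1 / 2 * 2 = 1) ?expr1n//; field.
have ZN n x : Z_ n None x = c * hn n * (ebump (2 ^+ n * U None x + 1) - ebump 1).
  by rewrite /Z_ /Zb mul0r addr0.
have ZS n i x : Z_ n (Some i) x = c * debump (2 ^+ n * U None x + 1) * U (Some i) x.
  by rewrite /Z_ /Zb mul0r addr0 -[LHS]mul1r -{1}(e2 n); have := e2 n; set A := hn n; set A2 := 2 ^+ n => AE; ring: AE.
have msg := abs_sg_mf (u_mf None WU).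
have HZ : inLq Z.
  move=> [i|]; rewrite /Z; split.
  - apply: measurable_funM; last exact: u_mf.
    exact: measurable_funB.
  - have [mUi iUi] := Lq WU (Some i).
    apply: (itg_le _ _ iUi).
      apply: mf_apow; apply: measurable_funM; last exact: mUi.
      exact: measurable_funB.
    apply: aeW => x; rewrite (ger0_norm (apow_ge0 _ _)).
    rewrite apowM -[leRHS]mul1r ler_wpM2r ?apow_ge0//.
    have /andP[s0 s1] := abs_sg01 (U None x).
    have p1 : 1 `^ w1exp (Some i) = 1 by rewrite powR1.
    rewrite -[leRHS]p1 ge0_ler_powR ?nnegrE//.
    by have := s0; have := s1; set z := `|_|; move=> z1 z0; rewrite ger0_norm; lra.
  - exact: measurable_cst.
  - by under eq_fun do rewrite apow0 ?gt_eqF//; exact: itg0.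
have [L L0 hL] := @ebump_lipschitz R.
have [K K0 hK] := @eflat_bounded R ('X ^+ 2).
have hK' y : 0 <= debump y <= K by rewrite debump_ge0/= (le_trans _ (hK y))// ler_norm.
apply: (ws_closed WP (U_ := Z_)) => //.
case=> [i|]; rewrite /=.
- have [mUi iUi] := Lq WU (Some i).
  have zero : (fun n => I (fun x => apow p (Z_ n (Some i) x - Z (Some i) x))) @ \oo --> I (fun=> 0 : R).
    apply: (proj2 (DCT cmu (g := fun x => apow p (c * K + 1) * apow p (U (Some i) x)) _ _ _ _)).
    + move=> n; apply: mf_apow; apply: measurable_funB; first exact: u_mf.
      by have [] := HZ (Some i).
    + apply: aeW => x.
      have h : (fun n => Z_ n (Some i) x - Z (Some i) x) @ \oo --> (0 : R).
        have hc : (fun n => c * debump (2 ^+ n * U None x + 1) - (1 - `|Num.sg (U None x)|)) @ \oo --> (0 : R).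
          have [->|u0] := eqVneq (U None x) 0.
            under eq_fun do rewrite mulr0 add0r.
            rewrite sgr0 normr0 subr0 mulVf ?subrr; last by rewrite gt_eqF ?debump_gt0.
            exact: cvg_cst.
          rewrite normr_sg u0 subrr; under eq_fun do rewrite subr0.
          have hd := cvgM (cvg_cst c) (debump_vanish u0); rewrite mulr0 in hd; exact: hd.
        rewrite /Z; under eq_fun do rewrite ZS -mulrBl.
        have hcu := cvgM hc (cvg_cst (U (Some i) x)); rewrite mul0r in hcu; exact: hcu.
      rewrite -(apow0 (q := p)) ?gt_eqF//.
      by apply: (cvg_comp (fun n => Z_ n (Some i) x - Z (Some i) x) (apow p) h); exact: continuous_apow.
    + exact: itgZ.
    + apply: aeW => x n; rewrite ger0_norm ?apow_ge0// ZS /Z -mulrBl apowM.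
      rewrite ler_wpM2r ?apow_ge0//; apply: le_apow => //.
      have /andP[s0 s1] := abs_sg01 (U None x).
      have /andP[d0 d1] := hK' (2 ^+ n * U None x + 1).
      have cK : 0 <= c * debump (2 ^+ n * U None x + 1) <= c * K.
        by rewrite mulr_ge0 ?(ltW c0)//= ler_wpM2l// ltW.
      by rewrite [leRHS]ger0_norm ?ler_norml; lra.
  by move: zero; rewrite I0.
- have i2 := u2_itg WU.
  have zero : (fun n => I (fun x => apow 2 (Z_ n None x - Z None x))) @ \oo --> I (fun=> 0 : R).
    apply: (proj2 (DCT cmu (g := fun x => (c * L) ^+ 2 * U None x ^+ 2) _ _ _ _)).
    + move=> n; apply: mf_apow; apply: measurable_funB; first exact: u_mf.
      by have [] := HZ None.
    + apply: aeW => x.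
      have h : (fun n => Z_ n None x - Z None x) @ \oo --> (0 : R).
        rewrite /Z; under eq_fun do rewrite ZN subr0.
        apply/cvgr0Pnorm_le => e e0; have ec : 0 < e / c by rewrite divr_gt0.
        have /cvgr0Pnorm_le/(_ _ ec) := hn_cvg (fun n => leqnn n).
        apply: filterS => n; rewrite !normrM (gtr0_norm c0) => h.
        apply: (@le_trans _ _ (c * `|hn n| * 1)).
          rewrite ler_wpM2l ?mulr_ge0 ?(ltW c0)// ler_norml.
          have := ebump_ge0 (2 ^+ n * U None x + 1); have := ebump_le1 (2 ^+ n * U None x + 1).
          have := @ebump_ge0 R 1; have := @ebump_le1 R 1; lra.
        by rewrite mulr1 mulrC -ler_pdivlMr.
      rewrite -(apow0 (q := 2)) ?gt_eqF//.
      by apply: (cvg_comp (fun n => Z_ n None x - Z None x) (apow 2) h); exact: continuous_apow.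
    + exact: itgZ.
    + apply: aeW => x n; rewrite ger0_norm ?apow_ge0// ZN /Z subr0 apow2 -exprMn.
      rewrite -[leLHS]real_normK ?num_real// -[leRHS]real_normK ?num_real//.
      rewrite ler_pXn2r ?nnegrE//.
      rewrite !normrM (gtr0_norm c0) (gtr0_norm (hn_gt0 n)) (ger0_norm L0) -!mulrA ler_wpM2l ?(ltW c0)//.
      apply: (@le_trans _ _ (hn n * (L * `|2 ^+ n * U None x + 1 - 1|))).
        by rewrite ler_wpM2l ?(ltW (hn_gt0 n)).
      rewrite addrK normrM ger0_norm ?exprn_ge0// mulrCA [hn n * _]mulrA e2 mul1r//.
  by move: zero; rewrite I0.
Qed.

Lemma is_lim_fconv eps U : is_lim eps U ->
  exists (phi : nat -> nat) (V_ : nat -> J -> T -> R), [/\ forall k, (k <= phi k)%N,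
    forall k, is_min eps (hn (phi k)) (V_ k) & fconv V_ U].
Proof.
move=> [WU [U_ mU cU]].
have [phi phi_ge fU] := mconv_fconv q1 (fun n => Lq (mU n).1) (Lq WU) cU.
by exists phi, (U_ \o phi); split => // k; exact: mU.
Qed.

(** Stands in for the theorem that weak gradients vanish a.e. on level sets, and is drawn from the
    equation. The test pair of [W_zero_part] removes the zero-order terms, so the nonnegative flux
    term and $\varepsilon p|\nabla u|^p$ integrate to zero over the zero set. *)
Lemma is_lim_zero eps U : 0 < eps -> eps <= 1 -> is_lim eps U ->
  \forall x \ae mu, U None x = 0 -> gpow (grad_of U x) = 0.
Proof.
move=> e0 e1 lU; have WU := lU.1; have [phi [V_ [phi_ge mV fV]]] := is_lim_fconv lU.
have WZ := W_zero_part WU; set Z := (X in W X) in WZ.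
have ce : (fun _ : nat => eps) @ \oo --> eps by exact: cvg_cst.
have lim := limit_gradient_term (fun=> e0) (fun=> e1) mV WU fV WZ ce.
have V0 k : I (fun x => \sum_i (lam * a x (grad_of (V_ k) x) i + eps * dpow p (V_ k (Some i) x)) * Z (Some i) x) = 0.
  apply: etrans (test_equation e0 e1 (hn_gt0 (phi k)) (mV k) WZ).
  by apply: eq_I => x; rewrite [in RHS]big_option/= mulr0 add0r.
have I0' : I (fun x => \sum_i (lam * a x (grad_of U x) i + eps * dpow p (U (Some i) x)) * Z (Some i) x) = 0.
  apply/esym; apply: (cvg_unique _ (cvg_cst (0 : R) : (fun=> 0) @ \oo --> 0)) => //.
  by move: lim; rewrite (funext V0 : (fun k => I _) = fun=> 0).
pose c x := 1 - `|Num.sg (U None x)|.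
have c0 x : 0 <= c x by have := abs_sg01 (U None x); rewrite /c; lra.
(* The value of [del] is arbitrary here, as the component [None] of [Z] is zero. *)
have iT := test_itg e0 e1 (hn_gt0 0) WU WZ.
have itE : (fun x => \sum_i den eps (hn 0) x (U^~ x) i * Z i x) =
   (fun x => \sum_i (lam * a x (grad_of U x) i + eps * dpow p (U (Some i) x)) * Z (Some i) x).
  by apply/funext => x; rewrite big_option/= mulr0 add0r.
rewrite itE in iT.
have := I_eq0 cmu (den_grad_ge0 (hn 0) U e0 c0) iT (_ : _ <= 0).
rewrite I0' => /(_ (lexx _)); apply: filterS2 (a_grad_ge0 aB) => x hA h u0.
have cx : c x = 1 by rewrite /c u0 sgr0 normr0 subr0.
move: h; rewrite (eq_bigr (fun i => lam * (a x (grad_of U x) i * U (Some i) x) + eps * (dpow p (U (Some i) x) * U (Some i) x))); last first.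
  by move=> i _; rewrite cx mul1r /denergy /grad_of; ring.
rewrite big_split/= -!mulr_sumr.
rewrite [X in _ + eps * X](eq_bigr (fun i => p * apow p (U (Some i) x))); last by move=> i _; rewrite dpow_mul.
rewrite -mulr_sumr -/(gpow (grad_of U x)).
have h1 : 0 <= lam * \sum_i a x (grad_of U x) i * U (Some i) x by rewrite mulr_ge0 ?(ltW lam_gt0)//; exact: hA.
have h2 : 0 <= gpow (grad_of U x) by exact: gpow_ge0.
set G := gpow _ in h2 *; set A := lam * _ in h1 * => h.
have : eps * (p * G) <= 0 by lra.
by rewrite !pmulr_rle0// => h3; apply/eqP; rewrite eq_le h2 h3.
Qed.

(** Coercivity is used only where [U] is nonzero, with $a_2 \le 1 + |a_2|^p$; on the zero set the
    gradient vanishes. The nonzero set has measure at most $(1+2M_g)\int\kappa$, so the bound does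
    not involve [eps]. *)
Lemma is_lim_gradient_bound eps U : 0 < eps -> eps <= 1 -> is_lim eps U ->
  eta * I (fun x => gpow (grad_of U x)) <=
  I (fun x => g x ^+ 2) / lam + I (fun x => apow p (a2 x)) + (1 + 2 * Mg) * I kap.
Proof.
move=> e0 e1 lU; have WU := lU.1; have [phi [V_ [phi_ge mV fV]]] := is_lim_fconv lU.
have dcv := hn_cvg phi_ge.
have [is1 is2] := limit_support (fun=> e0) (fun=> e1) (fun k => hn_gt0 (phi k)) dcv mV WU fV.
have lb := limit_bounded (fun=> e0) (fun=> e1) (fun k => hn_gt0 (phi k)) mV fV.
have ld := limit_diff_bound (fun=> e0) (fun=> e1) (fun k => hn_gt0 (phi k)) mV WU fV.
have lf := limit_flux (fun=> e0) (fun=> e1) (fun k => hn_gt0 (phi k)) mV fV.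
have ig := gpow_itg WU; have ia := itg_aU WU WU.
rewrite -IZ//.
apply: (@le_trans _ _ (I (fun x => \sum_i a x (grad_of U x) i * U (Some i) x +
    apow p (a2 x) + (kap x + chi x * `|Num.sg (U None x)|)))).
  apply: (I_le cmu); [|exact: itgZ|by apply: itgD; exact: itgD].
  apply: filterS3 (is_lim_zero e0 e1 lU) (coercive WU) (a_grad_ge0 aB) => x h0 hc hA.
  have A0 : 0 <= \sum_i a x (grad_of U x) i * U (Some i) x by exact: hA.
  have P0 := apow_ge0 p (a2 x).
  have [k0 k1] := andP (kap01 x); have [c0 c1] := andP (chi01 x).
  have [u0|u0] := eqVneq (U None x) 0.
    rewrite h0// mulr0 !addr_ge0// mulr_ge0//.
  rewrite normr_sg u0 mulr1.
  apply: le_trans hc _; rewrite -addrA lerD2l.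
  have -> : kap x + (1 - kap x) = 1 by ring.
  have [a1|a1] := leP `|a2 x| 1.
    by apply: le_trans (ler_norm _) _; lra.
  apply: le_trans (ler_norm _) _; apply: (@le_trans _ _ (apow p (a2 x))); last lra.
  have p1 := p_gt1; rewrite /apow -[leLHS]powRr1//; apply: ler_powR; lra.
rewrite !ID//; [|exact: itgD|exact: itgD].
have := le_trans is2 ld; set X := I _ in lf *; set Y := I _; lra.
Qed.

(** [eps_gap] compares minimizers with the same [del]. Two successive extractions, applied to both
    sequences, keep the parameters equal while both converge fast. *)
Lemma lim_gap eps eps' U U' i : 0 < eps' -> eps' < eps -> eps <= 1 ->
  is_lim eps U -> is_lim eps' U' ->
  I (fun x => pgap (w1exp i) (U i x) (U' i x)) <=
  I (fun x => gpow (grad_of U' x)) - I (fun x => gpow (grad_of U x)).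
Proof.
move=> e'0 ee e1 [WU [U_ mU cU]] [WU' [U'_ mU' cU']].
have [phi phi_ge fU] := mconv_fconv q1 (fun n => Lq (mU n).1) (Lq WU) cU.
have cU2 := mconv_sub phi_ge cU'.
have [psi psi_ge fU'] := mconv_fconv q1 (fun n => Lq (mU' (phi n)).1) (Lq WU') cU2.
have {}fU := fconv_sub psi_ge fU.
pose V_ := U_ \o (phi \o psi); pose V'_ := U'_ \o (phi \o psi).
have mV k : is_min eps (hn (phi (psi k))) (V_ k) by exact: mU.
have mV' k : is_min eps' (hn (phi (psi k))) (V'_ k) by exact: mU'.
have gcv (X_ : nat -> J -> T -> R) X : (forall k, W (X_ k)) -> W X -> fconv X_ X ->
    (fun k => I (fun x => gpow (grad_of (X_ k) x))) @ \oo --> I (fun x => gpow (grad_of X x)).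
  move=> WX_ WX fX.
  have [||//] := growth_cvg cmu q1 (Lq WX) fX (ler01 : 0 <= 1 :> R) (b := fun=> 0)
    (F := fun k x => gpow (grad_of (X_ k) x)) (f := fun x => gpow (grad_of X x))
    (fun k => itg_mf (gpow_itg (WX_ k))) _ (itg0 mu).
    apply: filterS (fconv_ae q1 fX) => x c; apply: cvg_sumr => j.
    by apply: (cvg_comp (fun k => X_ k (Some j) x) (apow p)); [exact: (c (Some j))|exact: continuous_apow].
  by apply: aeW => x k; rewrite ger0_norm ?gpow_ge0// mul1r addr0; exact: (gpow_le_pmod p ((X_ k)^~ x)).
have c1 := gcv V_ U (fun k => (mV k).1) WU fU.
have c2 := gcv V'_ U' (fun k => (mV' k).1) WU' fU'.
have c3 : (fun k => I (fun x => gpow (grad_of (V'_ k) x)) - I (fun x => gpow (grad_of (V_ k) x))) @ \oo -->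
  I (fun x => gpow (grad_of U' x)) - I (fun x => gpow (grad_of U x)) .
  exact: (cvgB c2 c1).
set L := I _ - I _; rewrite -/L in c3.
apply/ler_addgt0Pr => e ep; have /cvgrPdist_le/(_ _ ep)[N _ hN] := c3.
apply: (proj2 (Fatou cmu (F := fun k x => pgap (w1exp i) (V_ (k + N)%N i x) (V'_ (k + N)%N i x)) _ _ _ _)).
- by move=> k; apply: (itg_pgap q1); [exact: Lq (mV _).1|exact: Lq (mV' _).1].
- by move=> k; apply: aeW => x; exact: pgap_ge0.
- apply: filterS2 (fconv_ae q1 fU) (fconv_ae q1 fU') => x h h'.
  have shift : forall n, (n <= n + N)%N by move=> n; exact: leq_addr.
  have {}h := cvg_sub (u := fun n => V_ n i x) shift (h i).
  have {}h' := cvg_sub (u := fun n => V'_ n i x) shift (h' i).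
  have qi : 0 < w1exp i by exact: lt_trans (q1 i).
  apply: cvgB.
    apply: cvgM; last exact: cvg_cst.
    apply: cvgD.
      by apply: (cvg_comp (fun k => V_ (k + N)%N i x) (apow (w1exp i)) h); exact: continuous_apow.
    by apply: (cvg_comp (fun k => V'_ (k + N)%N i x) (apow (w1exp i)) h'); exact: continuous_apow.
  have c : (fun k => (V_ (k + N)%N i x + V'_ (k + N)%N i x) / 2) @ \oo --> (U i x + U' i x) / 2.
    by apply: cvgM; [exact: cvgD|exact: cvg_cst].
  by apply: (cvg_comp _ (apow (w1exp i)) c); exact: continuous_apow.
- move=> k; apply: le_trans (eps_gap i e'0 ee e1 (hn_gt0 (phi (psi (k + N)%N))) (mV _) (mV' _)) _.
  have := hN (k + N)%N (leq_addl _ _); rewrite /= ler_norml => /andP[h _].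
  by rewrite -lerBlDl; move: h; rewrite lerNl opprB.
Qed.

Lemma is_lim_L2 eps U : 0 < eps -> eps <= 1 -> is_lim eps U ->
  I (fun x => U None x ^+ 2) <= 4 * (lam * I (fun x => B x (grad_of Zg x)) +
    I (fun x => gpow (grad_of Zg x))) + 2 * I (fun x => g x ^+ 2).
Proof.
move=> e0 e1 lU; have WU := lU.1; have [phi [V_ [phi_ge mV fV]]] := is_lim_fconv lU.
have c := fconv_diff (fun k => (mV k).1) WU fV.
have h : I (fun x => (U None x - g x) ^+ 2) <= 2 * (lam * I (fun x => B x (grad_of Zg x)) +
    I (fun x => gpow (grad_of Zg x))).
  rewrite -(cvg_lim _ c)//; apply: limr_le; first by apply/cvg_ex; eexists; exact: c.
  apply: nearW => k; apply: le_trans (is_min_close e0 e1 (hn_gt0 (phi k)) (mV k)) _.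
  rewrite ler_wpM2l// lerD2l -[leRHS]mul1r ler_wpM2r//.
  apply: (I_ge0 cmu); last exact: itg_mf (gpow_itg WZg).
  by apply: aeW => x; exact: gpow_ge0.
apply: (@le_trans _ _ (I (fun x => 2 * (U None x - g x) ^+ 2 + 2 * g x ^+ 2))).
  apply: (I_le cmu); [apply: aeW => x|exact: u2_itg|by apply: itgD; apply: itgZ => //; exact: diff2_itg].
  have := sqr_ge0 (U None x - 2 * g x); nra.
rewrite ID; [|by apply: itgZ; exact: diff2_itg|exact: itgZ].
rewrite !IZ//; [lra|exact: diff2_itg].
Qed.

(** [X_ n] is a limit of minimizers and has no Euler-Lagrange equation with a positive [del] of its
    own; it is replaced by a minimizer within $2^{-n}$ of it whose [del] is small as well. *)
Lemma diagonal : exists (V_ : nat -> J -> T -> R) (n_ k_ : nat -> nat) U,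
  [/\ forall j, is_min (hn (n_ j)) (hn (k_ j)) (V_ j),
      forall j, (j <= n_ j)%N, forall j, (j <= k_ j)%N, W U & fconv V_ U].
Proof.
have /choice[X_ lX] : forall n, exists U, is_lim (hn n) U.
  by move=> n; exact: is_lim_exists.
have HX n : inLq (X_ n) by apply: Lq; exact: (lX n).1.
pose ph n := I (fun x => gpow (grad_of (X_ n) x)).
pose C1 := (I (fun x => g x ^+ 2) / lam + I (fun x => apow p (a2 x)) + (1 + 2 * Mg) * I kap) / eta.
pose C2 := 4 * (lam * I (fun x => B x (grad_of Zg x)) +
    I (fun x => gpow (grad_of Zg x))) + 2 * I (fun x => g x ^+ 2).
have phC n : ph n <= C1.
  by rewrite ler_pdivlMr// mulrC; exact: is_lim_gradient_bound (lX n).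
have gap n m i : (n < m)%N ->
    I (fun x => pgap (w1exp i) (X_ n i x) (X_ m i x)) <= ph m - ph n.
  move=> nm; apply: (lim_gap i (hn_gt0 m) _ (hn_le1 n) (lX n) (lX m)).
  apply: (@le_lt_trans _ _ (hn n.+1)); first exact: hn_le.
  by rewrite exprS; have := hn_gt0 n; lra.
have ph_nd : nondecreasing_seq ph.
  move=> n m; rewrite leq_eqVlt => /predU1P[->//|nm].
  rewrite -subr_ge0; apply: le_trans (gap n m None nm).
  exact: (I_pgap_ge0 cmu q1).
have ph_cvg : cvgn ph by apply: nondecreasing_is_cvgn => //; exists C1 => _ [n _ <-].
have [|U [HU cU]] := mcauchy_mconv cmu q1 HX.
  (* [C1] bounds the gradient components and [C2] the function component, both uniformly in
     [eps]. *)
  apply: (gap_cauchy cmu q1 HX (K := Num.max C1 C2)).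
    move=> n [i|] /=; rewrite le_max; apply/orP; [left|right].
      apply: le_trans (phC n); apply: (I_le cmu); [|by have [] := HX n (Some i)|exact: gpow_itg (lX n).1].
      by apply: aeW => x; exact: (apow_le_gpow p (grad_of (X_ n) x) i).
    by under eq_fun do rewrite apow2; exact: is_lim_L2 (lX n).
  move=> e e0; have [N hN] := cvg_cauchy ph_cvg e0; exists N => m n Nm Nn i.
  wlog mn : m n Nm Nn / (m <= n)%N.
    move=> h; have [mn|/ltnW nm] := leqP m n; first exact: h.
    by under eq_fun do rewrite pgapC; exact: h.
  move: mn; rewrite leq_eqVlt => /predU1P[->|mn].
    rewrite (@eq_I _ _ _ mu _ (fun=> 0)) ?I0 ?(ltW e0)// => x.
    rewrite /pgap (_ : (X_ n i x + X_ n i x) / 2 = X_ n i x); last by field.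
    by field.
  by apply: le_trans (gap m n i mn) _; exact: hN.
have WU : W U by apply: (ws_closed WP (U_ := X_)) => // n; exact: (lX n).1.
have /choice[Y_ hY] : forall j, exists Yk : (J -> T -> R) * nat,
    [/\ is_min (hn j) (hn Yk.2) Yk.1, (j <= Yk.2)%N &
        forall i, I (fun x => apow (w1exp i) (Yk.1 i x - X_ j i x)) <= hn j].
  move=> j; have [_ [V mV cV]] := lX j.
  have h i : exists N, forall k, (N <= k)%N -> I (fun x => apow (w1exp i) (V k i x - X_ j i x)) <= hn j.
    have /cvgrPdist_le/(_ _ (hn_gt0 j))[N _ hN] := cV i; exists N => k Nk.
    have := hN k Nk; rewrite /= sub0r normrN; apply: le_trans; exact: ler_norm.
  have [N hN] := choice h.
  pose k := (\max_(i : J) N i + j)%N; exists (V k, k); split => //=; first exact: leq_addl.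
  move=> i; apply: hN; apply: leq_trans (leq_addr _ _).
  exact: leq_bigmax.
have HY j : inLq (Y_ j).1 by apply: Lq; have [[]] := hY j.
have cY : mconv (fun j => (Y_ j).1) U.
  move=> i; apply: (@squeeze_cvgr _ _ _ _ (cst 0)
    (fun j => 2 `^ w1exp i * (hn j + I (fun x => apow (w1exp i) (X_ j i x - U i x))))); last 2 first.
  - exact: cvg_cst.
  - rewrite -[X in _ --> X](mulr0 (2 `^ w1exp i)); apply: cvgM; first exact: cvg_cst.
    rewrite -[X in _ --> X](addr0 0); apply: cvgD; last exact: cU.
    exact: (hn_cvg (fun n => leqnn n)).
  apply: nearW => j; apply/andP; split.
    by apply: (I_apow_ge0 cmu); have [] := inLqB q1 (HY j) HU i.
  apply: le_trans (I_apow_triangle cmu q1 i (HY j) (HX j) HU) _.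
  by rewrite ler_wpM2l ?powR_ge0// lerD2r; have [] := hY j.
have [phi phi_ge fY] := mconv_fconv q1 HY HU cY.
exists ((fun j => (Y_ j).1) \o phi), phi, (fun j => (Y_ (phi j)).2), U; split => //.
- by move=> j; have [] := hY (phi j).
- by move=> j; apply: leq_trans (phi_ge j) _; have [] := hY (phi j).
Qed.

(** [v] is $(g-u-s)/\lambda$ with [s] a weak limit of the derivatives of the penalty; the bound $|s|
    \le 1$ and the integrability of [s] pass to [v]. *)
Theorem resolvent_approximation : exists U v, [/\ W U, itg v,
  exists C, \forall x \ae mu, `|v x| <= C,
  forall Z, W Z -> I (fun x => \sum_i a x (grad_of U x) i * Z (Some i) x) = I (fun x => v x * Z None x) &
  [/\ \forall x \ae mu, `|U None x| <= Mg,
    itg (fun x => chi x * `|Num.sg (U None x)|),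
    I (fun x => chi x * `|Num.sg (U None x)|) <= I (fun x => kap x * `|U None x - g x|) &
    I (fun x => (U None x - g x) ^+ 2) <= 2 * lam * I (fun x => B x (grad_of Zg x))]].
Proof.
have [V_ [n_ [k_ [U [mV n_ge k_ge WU fV]]]]] := diagonal.
have ecv := hn_cvg n_ge; have dcv := hn_cvg k_ge.
have e0 j := hn_gt0 (n_ j); have e1 j := hn_le1 (n_ j); have d0 j := hn_gt0 (k_ j).
have lb := limit_bounded e0 e1 d0 mV fV.
have [is1 is2] := limit_support e0 e1 d0 dcv mV WU fV.
have WV j := (mV j).1.
pose s_ j x := chi x * ssgn (hn (k_ j)) (V_ j None x).
have ms j : mf (s_ j).
  apply: measurable_funM => //.
  exact: (measurableT_comp (continuous_measurable_fun (@continuous_ssgn R _ (d0 j))) (u_mf None (WV j))).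
have sE j x : `|s_ j x| = chi x * `|ssgn (hn (k_ j)) (V_ j None x)|.
  by rewrite normrM ger0_norm//; have [] := andP (chi01 x).
have sI j : itg (s_ j) /\ I (fun x => `|s_ j x|) <= I (fun x => kap x * `|V_ j None x - g x|).
  have [i1 i2] := is_min_sign (e0 j) (e1 j) (d0 j) (mV j).
  split; last by rewrite (eq_I mu (sE j)).
  by apply: (itg_le _ _ i1) => //; apply: aeW => x; rewrite sE.
have s1' j x : `|s_ j x| <= 1.
  by rewrite sE; have [c0 c1] := andP (chi01 x); rewrite -[leRHS]mulr1; apply: ler_pM => //; exact: ssgn_le1.
have sC j : I (fun x => `|s_ j x|) <= I (fun x => (2 * Mg) * kap x).
  apply: le_trans (sI j).2 _; apply: (I_le cmu); [|exact: kap_diff_itg|exact: itgZ].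
  apply: filterS (is_min_bounded (e0 j) (e1 j) (d0 j) (mV j)) => x h; rewrite mulrC ler_wpM2r//.
    by have [] := andP (kap01 x).
  by apply: le_trans (ler_normB _ _) _; have := g_bounded x; lra.
have [s [is_ s1 sl]] := weak_limit cmu (fun j => (sI j).1) s1' sC.
pose v x := lam^-1 * (g x - U None x - s x).
(* [U None] is bounded by [Mg] and vanishes off a set of finite measure. *)
have iu : itg (U None).
  apply: (itg_le (g := fun x => Mg * (kap x + chi x * `|Num.sg (U None x)|))).
  - exact: u_mf.
  - apply: filterS lb => x h; have [u0|u0] := eqVneq (U None x) 0.
      have [c0 _] := andP (chi01 x); have [k0 _] := andP (kap01 x).
      by rewrite u0 normr0 mulr_ge0// addr_ge0// mulr_ge0.
    by rewrite normr_sg u0 mulr1 addrC subrK mulr1.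
  - by apply: itgZ; exact: itgD.
have ig : itg g.
  apply: (itg_le (g := fun x => Mg * kap x)) => //; last exact: itgZ.
  apply: aeW => x; have [k0 _] := andP (kap01 x).
  rewrite -[in leLHS]kap_g normrM mulrC (ger0_norm k0).
  by rewrite ler_wpM2r//; have [] := andP (kap01 x).
have iv : itg v by apply: itgZ; apply: itgB => //; exact: itgB.
exists U, v; split => //.
- exists (lam^-1 * (2 * Mg + 1)); apply: filterS2 lb s1 => x h h'.
  rewrite normrM gtr0_norm ?invr_gt0// ler_wpM2l ?invr_ge0 ?(ltW lam_gt0)//.
  apply: le_trans (ler_normB _ _) _; apply: lerD h'.
  by apply: le_trans (ler_normB _ _) _; have := g_bounded x; lra.
- move=> Z WZ.
  have mz := u_mf None WZ; have iz2 := u2_itg WZ.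
  have izz (f : T -> R) : mf f -> itg (fun x => f x ^+ 2) -> itg (fun x => f x * Z None x).
    move=> mff if2; apply: (itg_le (g := fun x => f x ^+ 2 + Z None x ^+ 2)).
    - exact: measurable_funM.
    - apply: aeW => x; rewrite ler_norml; have := sqr_ge0 (f x - Z None x); have := sqr_ge0 (f x + Z None x).
      have := sqr_ge0 (f x); have := sqr_ge0 (Z None x); nra.
    - exact: itgD.
  have id2 := diff2_itg WU.
  have is2' : itg (fun x => s x ^+ 2).
    apply: (itg_le (g := fun x => `|s x|)); last exact: itg_norm.
    - by apply: measurable_funX; exact: (itg_mf is_).
    - apply: filterS s1 => x h; rewrite ger0_norm ?sqr_ge0// -real_normK ?num_real// expr2 -[leRHS]mul1r.
      by rewrite ler_wpM2r.
  have i1 := itg_aU WU WZ.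
  have i2 : itg (fun x => (U None x - g x) * Z None x).
    by apply: izz => //; apply: measurable_funB => //; exact: u_mf.
  have i3 : itg (fun x => s x * Z None x) by apply: izz => //; exact: (itg_mf is_).
  have lg := limit_gradient_term e0 e1 mV WU fV WZ ecv.
  have ld : (fun j => I (fun x => (V_ j None x - g x) * Z None x)) @ \oo --> I (fun x => (U None x - g x) * Z None x).
    have [|||//] := growth_cvg cmu q1 (Lq WU) fV (ler0n R 2) (b := fun x => 2 * g x ^+ 2 + Z None x ^+ 2)
      (F := fun j x => (V_ j None x - g x) * Z None x) (f := fun x => (U None x - g x) * Z None x)
      (fun j => measurable_funM (measurable_funB (u_mf None (WV j)) g_mf) mz).
    - apply: filterS (fconv_ae q1 fV) => x /(_ None) h.
      by apply: cvgM; [apply: cvgB => //|]; exact: cvg_cst.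
    - by apply: itgD => //; exact: itgZ.
    - apply: aeW => x j; rewrite pmodE.
      have := gpow_ge0 p (fun i => V_ j (Some i) x).
      set G := gpow _; set u := V_ j None x; set z := Z None x; rewrite ler_norml.
      have := sqr_ge0 (u - g x - z); have := sqr_ge0 (u - g x + z); have := sqr_ge0 (u + g x); have := sqr_ge0 z.
      have := sqr_ge0 (u - g x); nra.
  have E j : I (fun x => s_ j x * Z None x) =
      - I (fun x => \sum_i (lam * a x (grad_of (V_ j) x) i + hn (n_ j) * dpow p (V_ j (Some i) x)) * Z (Some i) x)
      - I (fun x => (V_ j None x - g x) * Z None x).
    have is_j : itg (fun x => s_ j x * Z None x).
      apply: izz => //; apply: (itg_le (g := fun x => `|s_ j x|)).
      - exact: measurable_funX.
      - apply: aeW => x; rewrite ger0_norm ?sqr_ge0// -real_normK ?num_real// expr2 -[leRHS]mul1r ler_wpM2r//.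
      - by apply: itg_norm; exact: (sI j).1.
    have idj : itg (fun x => (V_ j None x - g x) * Z None x).
      apply: izz; last exact: diff2_itg.
      by apply: measurable_funB => //; exact: u_mf.
    have tE := test_equation (e0 j) (e1 j) (d0 j) (mV j) WZ.
    have tI := test_itg (e0 j) (e1 j) (d0 j) (WV j) WZ.
    have gI : itg (fun x => \sum_i (lam * a x (grad_of (V_ j) x) i + hn (n_ j) * dpow p (V_ j (Some i) x)) * Z (Some i) x).
      apply: (eq_itg (itgB (itgB tI idj) is_j)) => x.
      by rewrite big_option/= /s_; set S := \sum_i _; ring.
    move: tE; rewrite (@eq_I _ _ _ mu _ (fun x => (\sum_i (lam * a x (grad_of (V_ j) x) i + hn (n_ j) * dpow p (V_ j (Some i) x)) * Z (Some i) x +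
      (V_ j None x - g x) * Z None x) + s_ j x * Z None x)).
      rewrite ID//; last exact: itgD.
      rewrite ID//; lra.
    by move=> x; rewrite big_option/= /s_; set S := \sum_i _; ring.
  (* The convergence that [weak_limit] asks for is read off the equation, all of whose other terms
     converge. *)
  have cs : (fun j => I (fun x => s_ j x * Z None x)) @ \oo -->
      - I (fun x => \sum_i (lam * a x (grad_of U x) i + 0 * dpow p (U (Some i) x)) * Z (Some i) x)
      - I (fun x => (U None x - g x) * Z None x).
    by under eq_fun do rewrite E; apply: cvgB => //; exact: cvgN.
  have sE' := sl _ _ mz iz2 cs.
  have gE : I (fun x => \sum_i (lam * a x (grad_of U x) i + 0 * dpow p (U (Some i) x)) * Z (Some i) x) =
      lam * I (fun x => \sum_i a x (grad_of U x) i * Z (Some i) x).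
    rewrite -IZ//; apply: eq_I => x; rewrite mulr_sumr; apply: eq_bigr => i _; ring.
  have vE : I (fun x => v x * Z None x) =
      lam^-1 * (- I (fun x => (U None x - g x) * Z None x) - I (fun x => s x * Z None x)).
    rewrite -[X in _ * (X - _)]mulN1r -IZ// -IB//; last exact: itgZ.
    rewrite -IZ; last by apply: itgB => //; exact: itgZ.
    by apply: eq_I => x; rewrite /v; ring.
  rewrite vE sE' gE; field; rewrite gt_eqF//.
- split => //.
  have c := fconv_diff WV WU fV.
  have c2 : (fun j => 2 * (lam * I (fun x => B x (grad_of Zg x)) + hn (n_ j) * I (fun x => gpow (grad_of Zg x)))) @ \oo -->
      2 * (lam * I (fun x => B x (grad_of Zg x)) + 0 * I (fun x => gpow (grad_of Zg x))).
    apply: cvgM; first exact: cvg_cst.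
    apply: cvgD; first exact: cvg_cst.
    by apply: cvgM => //; exact: cvg_cst.
  rewrite mul0r addr0 mulrA in c2.
  rewrite -(cvg_lim _ c)// -(cvg_lim _ c2)//; apply: ler_lim.
  - by apply/cvg_ex; eexists; exact: c.
  - by apply/cvg_ex; eexists; exact: c2.
  - by apply: nearW => j; exact: is_min_close (mV j).
Qed.

End dirichlet_problem.

(** * Lebesgue measure *)

Section lebesgue_measure_facts.
Context (R : realType) (d : nat).
Local Notation V := 'rV[R]_d.+1.
Local Notation L := (lebRV R d).
Local Notation leb := (@leb R d).

Lemma leb_complete : measure_is_complete leb.
Proof. exact: measure_is_complete_caratheodory. Qed.

Lemma box_vol_ge0 (u v : V) : 0 <= box_vol u v.
Proof. by apply: prodr_ge0 => i _; rewrite le_max lexx. Qed.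

Lemma leb_box (u v : V) : (leb (box u v) <= (box_vol u v)%:E)%E.
Proof.
(* The cover is padded with [box 0 0], which is empty and has volume 0. *)
pose ab k : V * V := if k is 0%N then (u, v) else (0, 0).
apply: ereal_inf_lbound; exists ab; first by move=> x hx; exists 0%N.
rewrite (nneseries_split 0%N 1%N); last by move=> k _; rewrite lee_fin box_vol_ge0.
rewrite big_nat1 /= eseries0 ?adde0// => -[//|k] _ _ /=.
by rewrite /box_vol big_ord_recl subrr maxxx mul0r.
Qed.

Lemma box_vol_split (i : 'I_d.+1) (c : R) (u v : V) :
  box_vol u (\row_j if j == i then Num.min (v 0 j) c else v 0 j) +
  box_vol (\row_j if j == i then Num.max (u 0 j) c else u 0 j) v = box_vol u v.
Proof.
rewrite /box_vol (bigD1 i)//= [in X in _ + X = _](bigD1 i)//= [in RHS](bigD1 i)//= !mxE eqxx.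
rewrite (eq_bigr (fun j => Num.max 0 (v 0 j - u 0 j))); last by move=> j ji; rewrite !mxE (negbTE ji).
rewrite [in X in _ + X = _](eq_bigr (fun j => Num.max 0 (v 0 j - u 0 j))); last by move=> j ji; rewrite !mxE (negbTE ji).
rewrite -mulrDl; congr (_ * _); move: (v 0 i) (u 0 i) => s t.
case: (ltP s c) => h1; case: (ltP t c) => h2; repeat (case: (ltP 0) => ?); lra.
Qed.

(** Caratheodory's criterion: the hyperplane cuts every box of a cover into two boxes whose volumes
    add up. *)
Lemma measurable_half_space (i : 'I_d.+1) (c : R) : measurable ([set x | x 0 i < c] : set L).
Proof.
apply: le_caratheodory_measurable => X.
apply: le_ereal_inf_tmp => _ [ab Xab <-].
pose ab1 k : V * V := ((ab k).1, \row_j if j == i then Num.min ((ab k).2 0 j) c else (ab k).2 0 j).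
pose ab2 k : V * V := (\row_j if j == i then Num.max ((ab k).1 0 j) c else (ab k).1 0 j, (ab k).2).
rewrite (eq_eseriesr (g := fun k => (box_vol (ab1 k).1 (ab1 k).2)%:E + (box_vol (ab2 k).1 (ab2 k).2)%:E)%E); last first.
  by move=> k _; rewrite -EFinD box_vol_split.
rewrite nneseriesD//; last 2 first.
- by move=> k _ _; rewrite lee_fin box_vol_ge0.
- by move=> k _ _; rewrite lee_fin box_vol_ge0.
apply: leeD; apply: ereal_inf_lbound.
- exists ab1 => // x [Xx /= xc]; have [k _ bk] := Xab x Xx; exists k => // j.
  have /andP[h1 h2] := bk j; rewrite /ab1/= mxE h1/=; case: eqP => // ->.
  by rewrite lt_min xc andbT; have /andP[] := bk i.
- exists ab2 => // x [Xx /= xc]; have [k _ bk] := Xab x Xx; exists k => // j.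
  have /andP[h1 h2] := bk j; rewrite /ab2/= mxE h2 andbT; case: eqP => // ->.
  by rewrite ge_max; have /andP[-> _] := bk i; move/negP: xc; rewrite -leNgt.
Qed.

Lemma measurable_box (u v : V) : measurable (box u v : set L).
Proof.
rewrite (_ : box u v = \bigcap_(i in [set: 'I_d.+1]) ((~` [set x : V | x 0 i < u 0 i]) `&` [set x | x 0 i < v 0 i])).
  apply: fin_bigcap_measurable => // i _.
  by apply: measurableI; [apply: measurableC|]; exact: measurable_half_space.
apply/seteqP; split=> x h.
  by move=> i _; have /andP[h1 h2] := h i; split => //=; apply/negP; rewrite -leNgt.
by move=> i; have [/negP h1 h2] := h i Logic.I; rewrite leNgt h1.
Qed.

Definition cbox (u v : V) : set V := [set x | forall i, u 0 i <= x 0 i <= v 0 i].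

(** For [c = -1] and [c = 1], the lower and upper corners of the cube with rational center [rn.1]
    and half-side [1 / (rn.2 + 1)]. These cubes are indexed by a countable type. *)
Definition rational_cube_end (c : R) (rn : 'rV[rat]_d.+1 * nat) : V :=
  \row_j (ratr (rn.1 0 j) + c * rn.2.+1%:R^-1).

Lemma rational_cube (U : set V) (x : V) : open U -> U x -> exists rn,
  (forall j, rational_cube_end (-1) rn 0 j < x 0 j < rational_cube_end 1 rn 0 j) /\
  cbox (rational_cube_end (-1) rn) (rational_cube_end 1 rn) `<=` U.
Proof.
move=> oU Ux; have := oU; rewrite openE => /(_ x Ux) /nbhs_ballP[e /= e0 he].
have e2 : 0 < e / 2 by rewrite divr_gt0.
pose n := Num.truncn (e / 2)^-1.
have n0 : 0 < n.+1%:R^-1 :> R by [].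
have ne : n.+1%:R^-1 < e / 2.
  rewrite -[ltRHS]invrK ltf_pV2 ?posrE ?invr_gt0//; exact: truncnS_gt.
have hr j : exists r : rat, x 0 j - n.+1%:R^-1 < ratr r < x 0 j + n.+1%:R^-1.
  have /rat_in_itvoo[r] : x 0 j - n.+1%:R^-1 < x 0 j + n.+1%:R^-1.
    by move: (n.+1%:R^-1) n0 => w w0; lra.
  by rewrite in_itv; exists r.
have [r rP] := choice hr.
exists (\row_j r j, n); split.
  move=> j; rewrite !mxE /=; have /andP[h3 h4] := rP j.
  move: (n.+1%:R^-1) n0 ne h3 h4 => w w0 ne h3 h4; apply/andP; split; lra.
move=> y hy; apply: he; split => // i j; rewrite (ord1 i) /ball/=.
have := hy j; rewrite !mxE => /andP[h1 h2]; have /andP[h3 h4] := rP j.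
move: h1 h2; rewrite /= => h1 h2.
move: (n.+1%:R^-1) n0 ne h1 h2 h3 h4 => w w0 ne h1 h2 h3 h4.
by rewrite ltr_norml; apply/andP; split; lra.
Qed.

Lemma measurable_open (U : set V) : open U -> measurable (U : set L).
Proof.
move=> oU.
pose Bx rn := box (rational_cube_end (-1) rn) (rational_cube_end 1 rn).
pose Q rn : set L := if `[< Bx rn `<=` U >] then Bx rn else set0.
rewrite (_ : U = \bigcup_rn Q rn); first last.
  apply/seteqP; split => x; last by move=> [rn _]; rewrite /Q; case: asboolP => // h /h.
  move=> Ux; have [rn [rx rU]] := rational_cube oU Ux.
  exists rn => //; rewrite /Q.
  have -> : `[< Bx rn `<=` U >].
    by apply/asboolP => y hy; apply: rU => j; have /andP[-> /ltW ->] := hy j.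
  by move=> j; have /andP[/ltW -> ->] := rx j.
apply: countable_bigcupT_measurable; first exact: countableP.
move=> rn; rewrite /Q; case: asboolP => _ //; exact: measurable_box.
Qed.

Lemma continuous_measurable_leb (f : V -> R) : continuous f -> measurable_fun setT (f : L -> R).
Proof.
move=> cf; apply: (measurability (RGenOpens.G (R := R))).
  exact: RGenOpens.measurableE.
move=> _ [_ [a [b ->]] <-]; rewrite setTI; apply: measurable_open.
by apply: open_comp => // x _; exact: cf.
Qed.

End lebesgue_measure_facts.

(** * Smooth functions of compact support *)

Section smooth_functions.
Context {R : realType} {d : nat}.
Local Notation V := 'rV[R]_d.+1.
Implicit Types (f g : V -> R) (Omega : set V) (i : 'I_d.+1).

(** Reduces directional derivatives to derivatives in one real variable, where the chain rule is
    applied. *)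
Lemma derive_line f (x v : V) : 'D_v f x = 'D_1 (fun h : R => f (h *: v + x)) (0 : R).
Proof.
have E : (fun h : R => h^-1 *: ((f \o shift x) (h *: v) - f x)) = (fun h : R =>
    h^-1 *: (((fun t : R => f (t *: v + x)) \o shift (0 : R)) (h *: (1 : R)) - f ((0 : R) *: v + x))).
  by apply/funext => t /=; rewrite addr0 scale0r add0r /GRing.scale/= mulr1.
by rewrite /derive E.
Qed.

Lemma is_derive_line f (x v : V) (df : R) :
  is_derive (0 : R) (1 : R) (fun h : R => f (h *: v + x)) df -> is_derive x v f df.
Proof. by move=> [h <-]; apply: DeriveDef; [exact: (proj2 (derivable1P f x v))|exact: derive_line]. Qed.

Lemma line_is_derive f (x v : V) : derivable f x v ->
  is_derive (0 : R) (1 : R) (fun h : R => f (h *: v + x)) ('D_v f x).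
Proof.
move=> h; apply: DeriveDef; [exact: (proj1 (derivable1P f x v))|exact/esym/derive_line].
Qed.

Lemma is_derive_comp_line (h : R -> R) (dh : R) f (x v : V) : is_derive (f x) (1 : R) h dh ->
  derivable f x v -> is_derive x v (fun y => h (f y)) (dh * 'D_v f x).
Proof.
move=> hd /line_is_derive fd; apply: is_derive_line.
apply: (@is_derive1_comp _ h (fun t : R => f (t *: v + x)) 0 dh) => //.
by rewrite scale0r add0r.
Qed.

Lemma is_derive_coord i (x v : V) : is_derive x v (fun y : V => y 0 i) (v 0 i).
Proof.
apply: is_derive_line.
rewrite (_ : (fun h : R => _) = (fun h => h * v 0 i + x 0 i)); last by apply/funext => h; rewrite !mxE.
by apply: is_derive_eq; rewrite addr0 ?scaler0 ?add0r /GRing.scale/= mulr1.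
Qed.

Lemma continuous_row_coord i : continuous (fun y : V => y 0 i).
Proof. exact: coord_continuous. Qed.

(** A class that contains its own partial derivatives, so that smoothness, a statement about
    iterated partials, follows by induction. [SmoothEflat] ranges over all polynomials because
    differentiation changes [q]. *)
Inductive smooth_expr : (V -> R) -> Prop :=
| SmoothFun f : smooth f -> smooth_expr f
| SmoothCst c : smooth_expr (fun=> c)
| SmoothCoord i : smooth_expr (fun x => x 0 i)
| SmoothAdd f g : smooth_expr f -> smooth_expr g -> smooth_expr (fun x => f x + g x)
| SmoothMul f g : smooth_expr f -> smooth_expr g -> smooth_expr (fun x => f x * g x)
| SmoothEflat q f : smooth_expr f -> smooth_expr (fun x => eflat q (f x)).

Lemma smooth_partial i f : smooth f -> smooth (partial i f).
Proof. by move=> sf s; have := sf (rcons s i); rewrite foldr_rcons. Qed.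

Lemma smooth_expr_step f : smooth_expr f -> [/\ continuous f,
  forall x i, derivable f x (delta_mx 0 i) & forall i, smooth_expr (partial i f)].
Proof.
elim=> {f} [f sf|c|i|f g _ [cf df pf] _ [cg dg pg]|f g ef [cf df pf] eg [cg dg pg]|q f ef [cf df pf]].
- have [cf df] := sf [::]; split => // i; apply: SmoothFun; exact: smooth_partial.
- split=> [x|x i|i]; [exact: cst_continuous|exact: derivable_cst|].
  rewrite (_ : partial i _ = fun=> 0); first exact: SmoothCst.
  by apply/funext => x; rewrite /partial derive_cst.
- split=> [|x j|j]; first exact: continuous_row_coord.
    by have [] := is_derive_coord i x (delta_mx 0 j).
  rewrite (_ : partial j _ = fun=> (delta_mx 0 j : V) 0 i); first exact: SmoothCst.
  by apply/funext => x; have [_] := is_derive_coord i x (delta_mx 0 j).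
- split=> [x|x i|i]; [exact: (cvgD (cf x) (cg x))|exact: derivableD|].
  rewrite (_ : partial i _ = fun x => partial i f x + partial i g x); first exact: SmoothAdd.
  by apply/funext => x; rewrite /partial deriveD.
- split=> [x|x i|i]; [exact: (cvgM (cf x) (cg x))|exact: derivableM|].
  rewrite (_ : partial i _ = fun x => f x * partial i g x + g x * partial i f x).
    by apply: SmoothAdd; apply: SmoothMul.
  by apply/funext => x; rewrite /partial deriveM.
- have dc x i := is_derive_comp_line (is_derive_eflat q (f x)) (df x i).
  split=> [x|x i|i].
  + by apply: (cvg_comp f (eflat q) (cf x)); exact: continuous_eflat.
  + by have [] := dc x i.
  rewrite (_ : partial i _ = fun x => eflat (eflat' q) (f x) * partial i f x).
    by apply: SmoothMul => //; exact: SmoothEflat.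
  by apply/funext => x; have [_] := dc x i.
Qed.

Lemma smooth_exprP f : smooth_expr f -> smooth f.
Proof.
move=> ef s; have : smooth_expr (foldr partial f s).
  by elim: s => //= i s /smooth_expr_step[_ _ ]; exact.
by move=> /smooth_expr_step[].
Qed.

Lemma smooth_continuous f : smooth f -> continuous f.
Proof. by move=> /(_ [::])[]. Qed.

Lemma partial_comp (h : R -> R) (dh : R -> R) f i : (forall s, is_derive s (1 : R) h (dh s)) ->
  smooth f -> partial i (fun x => h (f x)) = fun x => dh (f x) * partial i f x.
Proof.
move=> hd sf; apply/funext => x; have [_ df] := sf [::].
by have [_] := is_derive_comp_line (hd (f x)) (df x i).
Qed.

Lemma partial_lin (a b : R) f g i : smooth f -> smooth g ->
  partial i (fun x => a * f x + b * g x) = fun x => a * partial i f x + b * partial i g x.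
Proof.
move=> sf sg; apply/funext => x; have [_ df] := sf [::]; have [_ dg] := sg [::].
by rewrite /partial deriveD; [rewrite !deriveZ|apply: derivableZ|apply: derivableZ].
Qed.

Lemma Cc_infty_sub Omega f h : Cc_infty Omega f -> smooth h ->
  [set x | h x != 0] `<=` [set x | f x != 0] -> Cc_infty Omega h.
Proof.
move=> [sf cf fO] sh hf; have hf' := closure_subset hf; split => //.
  by apply: subclosed_compact cf hf' => //; exact: closed_closure.
exact: subset_trans fO.
Qed.

Lemma Cc_infty0 Omega : Cc_infty Omega (fun=> 0).
Proof.
have E : [set x : V | (0 : R) != 0] = set0 by apply/seteqP; split => x //=; rewrite eqxx.
split; first exact/smooth_exprP/SmoothCst.
- by rewrite E closure0; exact: compact0.
- by rewrite E closure0.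
Qed.

Lemma Cc_infty_lin Omega (a b : R) f g : Cc_infty Omega f -> Cc_infty Omega g ->
  Cc_infty Omega (fun x => a * f x + b * g x).
Proof.
move=> [sf cf fO] [sg cg gO].
have sub : closure [set x | a * f x + b * g x != 0] `<=` closure [set x | f x != 0] `|` closure [set x | g x != 0].
  rewrite -closureU; apply: closure_subset => x /=; apply: contraNP => /not_orP[/negP f0 /negP g0].
  by move: f0 g0; rewrite !negbK => /eqP -> /eqP ->; rewrite !mulr0 addr0.
split.
- by apply: smooth_exprP; apply: SmoothAdd; apply: SmoothMul; (exact: SmoothCst || exact: SmoothFun).
- by apply: (subclosed_compact (B := closure [set x | f x != 0] `|` closure [set x | g x != 0])) sub; [exact: closed_closure|exact: compactU].
- by move=> x /sub[/fO|/gO].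
Qed.

Lemma Cc_infty_partial Omega i f : Cc_infty Omega f -> Cc_infty Omega (partial i f).
Proof.
move=> [sf cf fO].
have sub : closure [set x | partial i f x != 0] `<=` closure [set x | f x != 0].
  rewrite [X in _ `<=` X](proj1 (closure_id _) (@closed_closure _ _)).
  apply: closure_subset => x; apply: contraPP => xf.
  have : nbhs x (~` closure [set x | f x != 0]).
    by apply: open_nbhs_nbhs; split => //; apply: closed_openC; exact: closed_closure.
  move=> nx /=; apply/negP; rewrite negbK; apply/eqP.
  rewrite /partial (near_eq_derive (g := cst 0)) ?derive_cst//.
  apply: filterS nx => y /= yf; apply/eqP; apply: contra_notT yf => fy; exact: subset_closure.
split; [exact: smooth_partial| |exact: subset_trans fO].
by apply: subclosed_compact cf sub; exact: closed_closure.
Qed.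

End smooth_functions.

(** * Bump functions and exhaustion of open sets *)

Section bump_functions.
Context {R : realType} {d : nat}.
Local Notation V := 'rV[R]_d.+1.
Local Notation L := (lebRV R d).
Local Notation leb := (@leb R d).
Local Notation I f := (Rintegral leb setT (f : L -> R)).
Local Notation itg f := (@itg _ L R leb f).
Local Notation mf f := (measurable_fun [set: L] (f : L -> R)).
Local Notation cmu := (@leb_complete R d).
Implicit Types (f g : V -> R) (Omega : set V) (i : 'I_d.+1).

Lemma itg_indic (A : set V) : measurable (A : set L) -> (leb A < +oo)%E -> itg \1_A.
Proof.
move=> mA lA; apply/integrableP; split.
  by apply/measurable_EFinP; exact: measurable_indic.
under eq_integral do rewrite gee0_abs ?lee_fin//.
by rewrite integral_indic// setIT.
Qed.

Lemma I_indic (A : set V) : measurable (A : set L) -> I \1_A = fine (leb A).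
Proof. by move=> mA; rewrite /Rintegral integral_indic// setIT. Qed.

Lemma itg_bounded_support (f : V -> R) (A : set V) (M : R) : mf f ->
  measurable (A : set L) -> (leb A < +oo)%E ->
  (forall x, `|f x| <= M) -> (forall x, ~ A x -> f x = 0) -> itg f.
Proof.
move=> mf mA lA fM fA.
apply: (@itg_le _ L R leb f (fun x : L => M * \1_A x)) => //.
  apply: aeW => x; rewrite indicE; have [xA|xA] := boolP (x \in A).
    by rewrite mulr1.
  by rewrite mulr0 fA ?normr0// => h; move/negP: xA; apply; rewrite inE.
by apply: itgZ; exact: itg_indic.
Qed.

Lemma compact_image_bounded (K : set V) (f : V -> R) : compact K -> continuous f ->
  exists2 M, 0 <= M & forall x, K x -> `|f x| <= M.
Proof.
move=> cK cf.
have /compact_bounded[M [_ hM]] : compact (f @` K).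
  by apply: continuous_compact => //; exact: continuous_subspaceT.
exists (`|M| + 1) => [|x Kx]; first by rewrite addr_ge0.
by apply: hM; [rewrite (le_lt_trans (ler_norm M))// ltrDl|exists x].
Qed.

Lemma compact_cbox (u v : V) : compact (cbox u v).
Proof.
have := @rV_compact R d.+1 (fun i => `[u 0 i, v 0 i]%classic) (fun i => @segment_compact R _ _).
congr compact; apply/seteqP; split => x /= h i; by have := h i; rewrite ?in_itv/=.
Qed.

Lemma closed_cbox (u v : V) : closed (cbox u v).
Proof. by apply: compact_closed; [exact: norm_hausdorff|exact: compact_cbox]. Qed.

Lemma compact_sub_box (K : set V) : compact K -> exists u v : V, K `<=` box u v.
Proof.
move=> cK.
have h i : exists M, forall x, K x -> `|x 0 i| <= M.
  by have [M _ hM] := compact_image_bounded cK (@continuous_row_coord R d i); exists M.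
have [M hM] := choice h.
exists (\row_i (- M i)), (\row_i (M i + 1)) => x Kx i; rewrite !mxE.
by have := hM i x Kx; rewrite ler_norml => /andP[-> h2]; rewrite (le_lt_trans h2)// ltrDl.
Qed.

Lemma leb_box_fin (u v : V) : (leb (box u v) < +oo)%E.
Proof. by apply: le_lt_trans (leb_box u v) _; rewrite ltry. Qed.

Lemma Cc_infty_cbox Omega f (u v : V) : smooth f -> (forall x, f x != 0 -> cbox u v x) ->
  cbox u v `<=` Omega -> Cc_infty Omega f.
Proof.
move=> sf fuv uvO.
have sub : closure [set x | f x != 0] `<=` cbox u v.
  by rewrite [X in _ `<=` X](proj1 (closure_id _) (@closed_cbox u v)); apply: closure_subset.
split => //; last exact: subset_trans uvO.
by apply: subclosed_compact sub; [exact: closed_closure|exact: compact_cbox].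
Qed.

Lemma Cc_infty_off Omega f x : Cc_infty Omega f -> ~ Omega x -> f x = 0.
Proof.
move=> [_ _ fO] xO; apply/eqP; apply: contra_notT xO => fx.
by apply: fO; exact: subset_closure.
Qed.

Lemma Cc_infty_bounds Omega f : Cc_infty Omega f ->
  exists (M : R) (u v : V), [/\ 0 <= M, forall x, `|f x| <= M & forall x, ~ box u v x -> f x = 0].
Proof.
move=> [sf cf fO]; have [M M0 hM] := compact_image_bounded cf (smooth_continuous sf).
have [u [v uv]] := compact_sub_box cf; exists M, u, v; split => // x.
  have [->|fx] := eqVneq (f x) 0; first by rewrite normr0.
  by apply: hM; exact: subset_closure.
move=> xb; apply/eqP; apply: contra_notT xb => fx.
by apply: uv; exact: subset_closure.
Qed.

Lemma Cc_infty_mf Omega f : Cc_infty Omega f -> mf f.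
Proof. by move=> [sf _ _]; apply: continuous_measurable_leb; exact: smooth_continuous. Qed.

Lemma Cc_infty_apow Omega f q : 0 < q -> Cc_infty Omega f -> itg (fun x => apow q (f x)).
Proof.
move=> q0 cf; have [M [u [v [M0 fM fb]]]] := Cc_infty_bounds cf.
apply: (@itg_bounded_support _ (box u v) (apow q M)).
- exact: mf_apow (Cc_infty_mf cf).
- exact: measurable_box.
- exact: leb_box_fin.
- by move=> x; rewrite ger0_norm ?apow_ge0// le_apow ?(ltW q0)// (ger0_norm M0).
- by move=> x xb; rewrite fb// apow0 ?gt_eqF.
Qed.

Lemma smooth_prod (s : seq 'I_d.+1) (F : 'I_d.+1 -> V -> R) :
  (forall i, smooth_expr (F i)) -> smooth_expr (fun x => \prod_(i <- s) F i x).
Proof.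
move=> sF; elim: s => [|i s IH].
  by under eq_fun do rewrite big_nil; exact: SmoothCst.
by under eq_fun do rewrite big_cons; exact: SmoothMul.
Qed.

Lemma cvg_prodr (s : seq 'I_d.+1) (F : 'I_d.+1 -> nat -> R) (l : 'I_d.+1 -> R) :
  (forall i, F i @ \oo --> l i) -> (fun n => \prod_(i <- s) F i n) @ \oo --> \prod_(i <- s) l i.
Proof.
move=> h; elim: s => [|i s IH].
  by rewrite big_nil; under eq_fun do rewrite big_nil; exact: cvg_cst.
by rewrite big_cons; under eq_fun do rewrite big_cons; apply: cvgM.
Qed.

Lemma ebump_mono : {homo (@ebump R) : x y / x <= y}.
Proof.
move=> x y xy; have [x0|x0] := leP x 0; first by rewrite [leLHS]eflat_le0// ebump_ge0.
have y0 : 0 < y by exact: lt_le_trans xy.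
by rewrite !ebumpE// ler_expR lerN2 lef_pV2 ?posrE.
Qed.

Lemma ebump0 x : x <= 0 -> ebump x = 0 :> R.
Proof. exact: eflat_le0. Qed.

Lemma ebump_neq0 x : ebump x != 0 :> R -> 0 < x.
Proof. by move=> h; rewrite ltNge; apply/negP => /ebump0 h'; rewrite h' eqxx in h. Qed.

Lemma ebump_cvg_ge (u : nat -> R) c : 0 < c -> (\forall n \near \oo, 2 ^+ n * c <= u n) ->
  (fun n => ebump (u n)) @ \oo --> (1 : R).
Proof.
move=> c0 h; apply: (@squeeze_cvgr _ _ _ _ (fun n => ebump (2 ^+ n * c)) (cst 1)).
- by apply: filterS h => n hn; rewrite ebump_le1 ebump_mono.
- exact: ebump_cvg1.
- exact: cvg_cst.
Qed.

(** The shift by 1 keeps the argument positive at [s = 0], while for [s < 0] it is eventually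
    nonpositive; the limit is the indicator of the closed half-line. *)
Lemma step_cvg (s : R) : (fun n => ebump (2 ^+ n * (2 ^+ n * s + 1))) @ \oo --> ((0 <= s)%R%:R : R).
Proof.
have [s0|s0] := leP 0 s.
  apply: (ebump_cvg_ge ltr01); apply: nearW => n.
  by rewrite mulr1 ler_peMr ?exprn_ge0// lerDr mulr_ge0 ?exprn_ge0.
have h := cvg_half s^-1.
have /cvgrPdist_le/(_ 1 ltr01) := h; rewrite /= => hN.
apply: cvg_near_cst; apply: filterS hN => n /=.
rewrite sub0r normrN normrM ltr0_norm ?invr_lt0// (ger0_norm (exprn_ge0 _ _))// => hn.
apply: ebump0; rewrite pmulr_rle0 ?exprn_gt0//.
have e2 : 2 ^+ n * (1 / 2) ^+ n = 1 :> R.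
  by rewrite -exprMn (_ : 2 * (1 / 2) = 1 :> R) ?expr1n//; field.
move: hn e2; set t := (1 / 2) ^+ n => hn e2.
have h3 : t <= - s.
  have : - s * (- s^-1 * t) <= - s * 1 by rewrite ler_wpM2l// lerNr oppr0 ltW.
  by rewrite mulrA mulrNN mulfV ?lt_eqF// mul1r mulr1.
have : 2 ^+ n * t <= 2 ^+ n * - s by rewrite ler_wpM2l ?exprn_ge0.
rewrite e2 mulrN; lra.
Qed.

(** The two factors differ because [box] is closed at its lower faces and open at its upper ones. *)
Definition box_bump n (u v : V) (x : V) : R :=
  \prod_i (ebump (2 ^+ n * (2 ^+ n * (x 0 i - u 0 i) + 1)) * ebump (2 ^+ n * (v 0 i - x 0 i))).

Lemma box_bump_smooth n u v : smooth_expr (box_bump n u v).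
Proof.
apply: smooth_prod => i; apply: SmoothMul; apply: SmoothEflat.
  apply: SmoothMul; first exact: SmoothCst.
  apply: SmoothAdd; last exact: SmoothCst.
  apply: SmoothMul; first exact: SmoothCst.
  by apply: SmoothAdd; [exact: SmoothCoord|exact: SmoothCst].
apply: SmoothMul; first exact: SmoothCst.
rewrite (_ : (fun x : V => _) = fun x : V => v 0 i + (-1) * x 0 i); last by apply/funext => x; rewrite mulN1r.
by apply: SmoothAdd; [exact: SmoothCst|apply: SmoothMul; [exact: SmoothCst|exact: SmoothCoord]].
Qed.

Lemma box_bump01 n u v x : 0 <= box_bump n u v x <= 1.
Proof.
rewrite /box_bump.
elim/big_ind: _ => [|s t /andP[s0 s1] /andP[t0 t1]|i _]; first by rewrite ler01 lexx.
  by rewrite mulr_ge0//= mulr_ile1.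
by rewrite mulr_ge0 ?ebump_ge0//= mulr_ile1 ?ebump_ge0 ?ebump_le1.
Qed.

Lemma box_bump_support n u v x : box_bump n u v x != 0 -> cbox (\row_i (u 0 i - 1)) v x.
Proof.
move=> h i; rewrite mxE; move: h; rewrite /box_bump (bigD1 i)//= !mulf_eq0 !negb_or.
move=> /andP[/andP[/ebump_neq0 h1 /ebump_neq0 h2] _]; move: h1 h2.
rewrite !pmulr_rgt0 ?exprn_gt0// => h1 h2.
have p2 : 1 <= 2 ^+ n :> R by rewrite exprn_ege1// ler1n.
apply/andP; split; last by lra.
rewrite leNgt; apply/negP => h3.
have : 2 ^+ n * (x 0 i - u 0 i) <= 1 * (x 0 i - u 0 i) by rewrite ler_wnM2r//; lra.
lra.
Qed.

Lemma box_bump_cvg u v x : (fun n => box_bump n u v x) @ \oo --> (\1_(box u v) x : R).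
Proof.
have -> : \1_(box u v) x = \prod_i ((0 <= x 0 i - u 0 i)%R%:R * (0 < v 0 i - x 0 i)%R%:R) :> R.
  rewrite indicE; have [|] := boolP (x \in box u v).
    rewrite inE => h; rewrite big1 => [|i _]; first by rewrite mulr1n.
    by have /andP[h1 h2] := h i; rewrite subr_ge0 h1 subr_gt0 h2 mulr1.
  rewrite notin_setE => /existsNP[i hi]; rewrite (bigD1 i)//= subr_ge0 subr_gt0.
  by have := hi; case: (u 0 i <= _); case: (_ < v 0 i) => //; rewrite ?mul0r ?mulr0 ?mul0r.
apply: cvg_prodr => i; apply: cvgM; first exact: step_cvg.
have [s0|s0] := ltP 0 (v 0 i - x 0 i); first exact: ebump_cvg1.
by under eq_fun do rewrite ebump0 ?pmulr_rle0 ?exprn_gt0//; exact: cvg_cst.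
Qed.

(** [bj] enumerates bumps on the rational cubes contained in [Omega], with 0 at the other codes.
    Each point of [Omega] lies in the interior of such a cube, so $2^m S_m$ tends to infinity there
    and [ebump] of it to 1. *)
Lemma Cc_exhaustion Omega : open Omega -> exists th : nat -> V -> R,
  [/\ forall m, Cc_infty Omega (th m), forall m x, 0 <= th m x <= 1 &
      forall x, Omega x -> th ^~ x @ \oo --> (1 : R)].
Proof.
move=> oO; pose lo := @rational_cube_end R d (-1); pose hi := @rational_cube_end R d 1.
pose be rn (x : V) := \prod_i (ebump (x 0 i - lo rn 0 i) * ebump (hi rn 0 i - x 0 i)).
have sbe rn : smooth_expr (be rn).
  apply: smooth_prod => i; apply: SmoothMul; apply: SmoothEflat.
    by apply: SmoothAdd; [exact: SmoothCoord|exact: SmoothCst].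
  rewrite (_ : (fun x : V => _) = fun x : V => hi rn 0 i + (-1) * x 0 i); last by apply/funext => x; rewrite mulN1r.
  by apply: SmoothAdd; [exact: SmoothCst|apply: SmoothMul; [exact: SmoothCst|exact: SmoothCoord]].
have be_ge0 rn x : 0 <= be rn x by apply: prodr_ge0 => i _; rewrite mulr_ge0 ?ebump_ge0.
pose bj j x := if unpickle j is Some rn then
    if `[< cbox (lo rn) (hi rn) `<=` Omega >] then be rn x else 0 else 0.
have bj_ge0 j x : 0 <= bj j x.
  by rewrite /bj; case: unpickle => // rn; case: asboolP.
have Cbj j : Cc_infty Omega (bj j).
  rewrite /bj; case: unpickle => [rn|]; last exact: Cc_infty0.
  case: asboolP => rO; last exact: Cc_infty0.
  apply: (Cc_infty_cbox (smooth_exprP (sbe rn)) _ rO) => x h i.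
  move: h; rewrite /be (bigD1 i)//= !mulf_eq0 !negb_or => /andP[/andP[/ebump_neq0 h1 /ebump_neq0 h2] _].
  by rewrite -subr_ge0 (ltW h1)/= -subr_ge0 ltW.
pose S m x := \sum_(0 <= j < m) bj j x.
have CS m : Cc_infty Omega (S m).
  elim: m => [|m IH].
    rewrite (_ : S 0%N = fun=> 0); first exact: Cc_infty0.
    by apply/funext => x; rewrite /S big_geq.
  rewrite (_ : S m.+1 = fun x => 1 * S m x + 1 * bj m x); first exact: Cc_infty_lin.
  by apply/funext => x; rewrite /S big_nat_recr//= !mul1r.
exists (fun m x => ebump (2 ^+ m * S m x)); split.
- move=> m; apply: (Cc_infty_sub (CS m)).
    apply: smooth_exprP; apply: SmoothEflat; apply: SmoothMul; first exact: SmoothCst.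
    by apply: SmoothFun; have [] := CS m.
  by move=> x /=; apply: contraNneq => ->; rewrite mulr0 ebump0.
- by move=> m x; rewrite ebump_ge0 ebump_le1.
- move=> x Ox; have [rn [rx rO]] := rational_cube oO Ox.
  have bx : 0 < bj (pickle rn) x.
    rewrite /bj pickleK; case: asboolP => // _; apply: prodr_gt0 => i _.
    by have /andP[h1 h2] := rx i; rewrite mulr_gt0 ?ebump_gt0 ?subr_gt0.
  apply: (ebump_cvg_ge bx); exists (pickle rn).+1 => // m /= hm.
  rewrite ler_wpM2l ?exprn_ge0// /S (big_cat_nat _ hm)//= big_nat_recr//=.
  by rewrite -addrA addrCA lerDl addr_ge0// sumr_ge0.
Qed.

End bump_functions.

(** * Density *)

Section smooth_density.
Context {R : realType} {d : nat}.
Local Notation V := 'rV[R]_d.+1.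
Local Notation L := (lebRV R d).
Local Notation leb := (@leb R d).
Local Notation I f := (Rintegral leb setT (f : L -> R)).
Local Notation itg f := (@itg _ L R leb f).
Local Notation mf f := (measurable_fun [set: L] (f : L -> R)).
Let cmu := @leb_complete R d.
Implicit Types (f g h z : V -> R).
Variable Omega : set V.
Hypothesis Omega_open : open Omega.

Definition L2_limit g : Prop := [/\ mf g, itg (fun x => g x ^+ 2) &
  forall eps, 0 < eps -> exists2 z, Cc_infty Omega z & I (fun x => (z x - g x) ^+ 2) <= eps].

Lemma itg_sqrB f g : mf f -> mf g -> itg (fun x => f x ^+ 2) -> itg (fun x => g x ^+ 2) ->
  itg (fun x => (f x - g x) ^+ 2).
Proof.
move=> mf mg if2 ig2.
apply: (@itg_le _ L R leb _ (fun x : L => 2 * (f x ^+ 2 + g x ^+ 2))).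
- by apply: measurable_funX; exact: measurable_funB.
- by apply: aeW => x; rewrite ger0_norm ?sqr_ge0//; have := sqr_ge0 (f x + g x); nra.
- by apply: itgZ; exact: itgD.
Qed.

Lemma Cc_infty_sqr z : Cc_infty Omega z -> itg (fun x => z x ^+ 2).
Proof. by move=> Cz; have := Cc_infty_apow (ltr0n R 2) Cz; under eq_fun do rewrite apow2. Qed.

Lemma L2_limit_closed g : mf g -> itg (fun x => g x ^+ 2) ->
  (forall eps, 0 < eps -> exists2 h, L2_limit h & I (fun x => (h x - g x) ^+ 2) <= eps) ->
  L2_limit g.
Proof.
move=> mg ig2 hg; split => // eps e0; have e4 : 0 < eps / 4 by rewrite divr_gt0.
have [h [mh ih2 hh] hgh] := hg _ e4; have [z Cz zh] := hh _ e4; exists z => //.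
have mz := Cc_infty_mf Cz; have iz2 := Cc_infty_sqr Cz.
apply: (@le_trans _ _ (I (fun x => 2 * ((z x - h x) ^+ 2 + (h x - g x) ^+ 2)))).
  apply: (I_le cmu).
  - by apply: aeW => x; have := sqr_ge0 ((z x - h x) - (h x - g x)); nra.
  - exact: itg_sqrB.
  - by apply: itgZ; apply: itgD; exact: itg_sqrB.
rewrite IZ ?ID; [lra|exact: itg_sqrB|exact: itg_sqrB|by apply: itgD; exact: itg_sqrB].
Qed.

Lemma L2_limit_Cc z : Cc_infty Omega z -> L2_limit z.
Proof.
move=> Cz; split; [exact: Cc_infty_mf Cz|exact: Cc_infty_sqr|] => eps e0; exists z => //.
rewrite (@eq_I _ _ _ leb _ (fun=> 0)); first by rewrite I0 ltW.
by move=> x; rewrite subrr expr0n.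
Qed.

Lemma L2_limit_lin (a b : R) f g : L2_limit f -> L2_limit g -> L2_limit (fun x => a * f x + b * g x).
Proof.
move=> [mff if2 hf] [mg ig2 hg].
have m1 : mf (fun x => a * f x + b * g x) by apply: measurable_funD; exact: measurable_funM.
have dom s t : (a * s + b * t) ^+ 2 <= 2 * (a ^+ 2 * s ^+ 2 + b ^+ 2 * t ^+ 2).
  by have := sqr_ge0 (a * s - b * t); nra.
split => //.
  apply: (@itg_le _ L R leb _ (fun x : L => 2 * (a ^+ 2 * f x ^+ 2 + b ^+ 2 * g x ^+ 2))).
  - exact: measurable_funX.
  - by apply: aeW => x; rewrite ger0_norm ?sqr_ge0.
  - by apply: itgZ; apply: itgD; exact: itgZ.
move=> eps e0.
pose k := 2 * (a ^+ 2 + b ^+ 2) + 1.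
have k0 : 0 < k by rewrite ltr_wpDl// mulr_ge0// addr_ge0// sqr_ge0.
have ek : 0 < eps / k by rewrite divr_gt0.
have [y Cy yf] := hf _ ek; have [z Cz zg] := hg _ ek.
exists (fun x => a * y x + b * z x); first exact: Cc_infty_lin.
have my := Cc_infty_mf Cy; have iy2 := Cc_infty_sqr Cy.
have mz := Cc_infty_mf Cz; have iz2 := Cc_infty_sqr Cz.
have i1 := itg_sqrB my mff iy2 if2; have i2 := itg_sqrB mz mg iz2 ig2.
apply: (@le_trans _ _ (I (fun x => 2 * (a ^+ 2 * (y x - f x) ^+ 2 + b ^+ 2 * (z x - g x) ^+ 2)))).
  apply: (I_le cmu).
  - by apply: aeW => x; rewrite (_ : _ - _ = a * (y x - f x) + b * (z x - g x)) ?dom//; ring.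
  - have Cl := Cc_infty_lin a b Cy Cz.
    apply: itg_sqrB; [exact: Cc_infty_mf Cl|exact: m1|exact: Cc_infty_sqr Cl|].
    apply: (@itg_le _ L R leb _ (fun x : L => 2 * (a ^+ 2 * f x ^+ 2 + b ^+ 2 * g x ^+ 2))).
    + exact: measurable_funX.
    + by apply: aeW => x; rewrite ger0_norm ?sqr_ge0.
    + by apply: itgZ; apply: itgD; exact: itgZ.
  - by apply: itgZ; apply: itgD; exact: itgZ.
rewrite IZ; last by apply: itgD; exact: itgZ.
rewrite ID ?IZ//; [|exact: itgZ|exact: itgZ].
have h1 : a ^+ 2 * I (fun x => (y x - f x) ^+ 2) <= a ^+ 2 * (eps / k) by rewrite ler_wpM2l ?sqr_ge0.
have h2 : b ^+ 2 * I (fun x => (z x - g x) ^+ 2) <= b ^+ 2 * (eps / k) by rewrite ler_wpM2l ?sqr_ge0.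
have h3 : k * (eps / k) = eps by rewrite mulrC divfK ?gt_eqF.
apply: (@le_trans _ _ (2 * (a ^+ 2 * (eps / k) + b ^+ 2 * (eps / k)))); first by rewrite ler_wpM2l// lerD.
have w0 := ltW ek; move: h3; move: (eps / k) w0 => w w0; rewrite /k => <-.
by rewrite -subr_ge0 (_ : _ - _ = w)//; ring.
Qed.

Lemma L2_limit_sum (A : Type) (s : seq A) (c : A -> R) (F : A -> V -> R) :
  (forall k, L2_limit (F k)) -> L2_limit (fun x => \sum_(k <- s) c k * F k x).
Proof.
move=> hF; elim: s => [|k s IH].
  by under eq_fun do rewrite big_nil; apply: L2_limit_Cc; exact: Cc_infty0.
under eq_fun do rewrite big_cons.
by have := L2_limit_lin (c k) 1 (hF k) IH; under eq_fun do rewrite mul1r.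
Qed.

(** A common integrable majorant of the squares turns pointwise limits into limits in $L^2$. *)
Lemma L2_limit_dominated (h_ : nat -> V -> R) g (K : V -> R) : (forall n, L2_limit (h_ n)) ->
  (forall x, h_ ^~ x @ \oo --> g x) -> itg K -> (forall n x, h_ n x ^+ 2 <= K x) ->
  L2_limit g.
Proof.
move=> hh cg iK hK.
have mg : mf g by apply: (mf_cvg cmu (F := h_)) => [n|]; [have [] := hh n|exact: aeW].
have gK x : g x ^+ 2 <= K x.
  have c : (fun n => h_ n x * h_ n x) @ \oo --> g x * g x by apply: cvgM; exact: cg.
  rewrite expr2 -(cvg_lim _ c)//; apply: limr_le; first by apply/cvg_ex; eexists; exact: c.
  by apply: nearW => n; have := hK n x; rewrite expr2.
have ig2 : itg (fun x => g x ^+ 2).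
  apply: (@itg_le _ L R leb _ K); [exact: measurable_funX| |exact: iK].
  by apply: aeW => x; rewrite ger0_norm ?sqr_ge0.
apply: L2_limit_closed => // eps e0.
have [_ c] : itg (fun=> 0 : R) /\ (fun n => I (fun x => (h_ n x - g x) ^+ 2)) @ \oo --> I (fun=> 0 : R).
  apply: (DCT cmu (g := fun x => 4 * K x)).
  - by move=> n; apply: measurable_funX; apply: measurable_funB => //; have [] := hh n.
  - apply: aeW => x.
    have c : (fun n => h_ n x - g x) @ \oo --> (0 : R).
      by rewrite -(subrr (g x)); apply: cvgB; [exact: cg|exact: cvg_cst].
    by rewrite -(mulr0 (0 : R)); apply: cvgM.
  - exact: itgZ.
  - apply: aeW => x n; rewrite ger0_norm ?sqr_ge0//.
    by have := hK n x; have := gK x; have := sqr_ge0 (h_ n x + g x); nra.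
move: c; rewrite I0 => /cvgrPdist_le/(_ _ e0)[N _ hN]; exists (h_ N); first exact: hh.
by have := hN N (leqnn N); rewrite /= sub0r normrN; apply: le_trans; exact: ler_norm.
Qed.

Lemma L2_limit_restrict h : Cc_infty setT h -> L2_limit (fun x => h x * \1_Omega x).
Proof.
move=> Ch; have [th [Cth th01 thc]] := Cc_exhaustion Omega_open.
apply: (L2_limit_dominated (h_ := fun m x => h x * th m x) (K := fun x => h x ^+ 2)).
- move=> m; apply: L2_limit_Cc; apply: (Cc_infty_sub (Cth m)).
    by apply: smooth_exprP; apply: SmoothMul; apply: SmoothFun; [have [] := Ch|have [] := Cth m].
  by move=> x /=; apply: contraNneq => ->; rewrite mulr0.
- move=> x; apply: cvgM; first exact: cvg_cst.
  rewrite indicE; have [|] := boolP (x \in Omega); rewrite ?notin_setE.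
    by rewrite inE; exact: thc.
  by move=> xO; under eq_fun do rewrite (Cc_infty_off (Cth _) xO); exact: cvg_cst.
- by have := Cc_infty_apow (ltr0n R 2) Ch; under eq_fun do rewrite apow2.
- move=> n x; rewrite exprMn ler_piMr ?sqr_ge0//; have /andP[t0 t1] := th01 n x.
  by rewrite expr_le1.
Qed.

(** Inclusion-exclusion: $b + h - bh$ stays in $[0,1]$ and takes approximations of two indicators to
    one of the indicator of the union. The approximants live on the whole space; [L2_limit_restrict]
    brings in [Omega] afterwards. *)
Lemma box_union_approx (s : seq (V * V)) : exists (h_ : nat -> V -> R) (K : V -> R),
  [/\ forall n, Cc_infty setT (h_ n), forall n x, 0 <= h_ n x <= 1,
      itg K, forall n x, h_ n x <= K x &
      forall x, h_ ^~ x @ \oo --> (\1_(\big[setU/set0]_(uv <- s) box uv.1 uv.2) x : R)].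
Proof.
elim: s => [|[u v] s [h_ [K [Ch h01 iK hK ch]]]].
  exists (fun _ _ => 0), (fun=> 0); split => //.
  - by move=> n; exact: Cc_infty0.
  - by move=> n x; rewrite lexx ler01.
  - exact: itg0.
  - by move=> x; rewrite big_nil indicE in_set0; exact: cvg_cst.
pose b n := box_bump n u v.
have Cb n : Cc_infty setT (b n).
  by apply: (Cc_infty_cbox (smooth_exprP (box_bump_smooth n u v)) (v := v)) => // x; exact: box_bump_support.
pose v1 : V := \row_i (v 0 i + 1).
have bK n x : b n x <= \1_(box (\row_i (u 0 i - 1)) v1) x.
  rewrite indicE; have [|] := boolP (x \in box _ _); first by have /andP[] := box_bump01 n u v x.
  rewrite notin_setE => xb; have [->//|bx] := eqVneq (b n x) 0.
  exfalso; apply: xb => i; have /andP[-> h] := box_bump_support bx i.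
  by rewrite mxE (le_lt_trans h)// ltrDl.
exists (fun n x => b n x + h_ n x - b n x * h_ n x).
exists (fun x => \1_(box (\row_i (u 0 i - 1)) v1) x + K x); split.
- move=> n; apply: (Cc_infty_sub (Cc_infty_lin 1 1 (Cb n) (Ch n))).
    have sb : smooth_expr (b n) by exact: box_bump_smooth.
    have sh : smooth_expr (h_ n) by apply: SmoothFun; have [] := Ch n.
    rewrite (_ : (fun x => _) = fun x => (b n x + h_ n x) + (-1) * (b n x * h_ n x)); last first.
      by apply/funext => x; rewrite mulN1r.
    apply: smooth_exprP; apply: SmoothAdd; first exact: SmoothAdd.
    by apply: SmoothMul; [exact: SmoothCst|exact: SmoothMul].
  move=> x /=; apply: contraNneq; rewrite !mul1r => /eqP.
  have /andP[b0 _] := box_bump01 n u v x; have /andP[h0 _] := h01 n x.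
  by rewrite paddr_eq0// => /andP[/eqP -> /eqP ->]; rewrite mul0r addr0 subr0.
- move=> n x; have /andP[b0 b1] := box_bump01 n u v x; have /andP[h0 h1] := h01 n x.
  rewrite -/(b n) in b0 b1; move: (b n x) (h_ n x) b0 b1 h0 h1 => t w t0 t1 w0 w1.
  have : 0 <= (1 - t) * (1 - w) by rewrite mulr_ge0// subr_ge0.
  have : 0 <= t * (1 - w) by rewrite mulr_ge0// subr_ge0.
  by move=> h2 h3; apply/andP; split; lra.
- apply: itgD; last exact: iK.
  by apply: itg_indic; [exact: measurable_box|exact: leb_box_fin].
- move=> n x; apply: (@le_trans _ _ (b n x + h_ n x)); last by rewrite lerD.
  have /andP[b0 _] := box_bump01 n u v x; have /andP[h0 _] := h01 n x.
  by rewrite gerBl mulr_ge0.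
- move=> x; rewrite big_cons /=.
  set U := \big[setU/set0]_(_ <- _) _ in ch *.
  have -> : \1_(box u v `|` U) x = \1_(box u v) x + \1_U x - \1_(box u v) x * \1_U x :> R.
    by rewrite !indicE in_setU; case: (x \in box u v); case: (x \in U); rewrite /= ?mulr1n ?mulr0n; ring.
  have cb : (fun n => b n x) @ \oo --> (\1_(box u v) x : R) by exact: box_bump_cvg.
  apply: cvgB; first by apply: cvgD; [exact: cb|exact: ch].
  by apply: cvgM; [exact: cb|exact: ch].
Qed.

Lemma L2_limit_boxes (s : seq (V * V)) :
  L2_limit (fun x => \1_(\big[setU/set0]_(uv <- s) box uv.1 uv.2) x * \1_Omega x).
Proof.
have [h_ [K [Ch h01 iK hK ch]]] := box_union_approx s.
apply: (L2_limit_dominated (h_ := fun n x => h_ n x * \1_Omega x) (K := K)).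
- by move=> n; exact: L2_limit_restrict.
- by move=> x; apply: cvgM; [exact: ch|exact: cvg_cst].
- exact: iK.
- move=> n x; apply: le_trans (hK n x); have /andP[h0 h1] := h01 n x.
  rewrite indicE; case: (x \in Omega); rewrite ?mulr0 ?mulr1 ?expr0n//=.
  by rewrite expr2 ler_piMr.
Qed.

(** By definition of the outer measure, countably many boxes cover [E] with excess at most [eps].
    Finite subunions approximate their union, and multiplying by the indicator of [Omega] loses no
    point of [E]. *)
Lemma L2_limit_indic (E : set V) : measurable (E : set L) -> (leb E < +oo)%E -> E `<=` Omega ->
  L2_limit \1_E.
Proof.
move=> mE lE EO; have mO : measurable (Omega : set L) by exact: measurable_open.
have sqr_indic (A : set V) (x : V) : \1_A x ^+ 2 = \1_A x :> R.
  by rewrite indicE; case: (x \in A); rewrite ?expr1n ?expr0n.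
apply: L2_limit_closed => [||eps e0].
- exact: measurable_indic.
- by under eq_fun do rewrite sqr_indic; exact: itg_indic.
have lEfin : leb E \is a fin_num by rewrite ge0_fin_numE//; exact: measure_ge0.
have [_ [ab Eab <-] hab] := lb_ereal_inf_adherent e0 lEfin.
pose O := \bigcup_k box (ab k).1 (ab k).2.
have mB k : measurable (box (ab k).1 (ab k).2 : set L) by exact: measurable_box.
have mOO : measurable (O : set L) by exact: bigcup_measurable.
have lO : (leb O <= leb E + eps%:E)%E.
  apply: le_trans (ltW hab); apply: le_trans (generalized_Boole_inequality leb mB mOO) _.
  by apply: lee_nneseries => k *; [exact: (measure_ge0 leb)|exact: leb_box].
have lOfin : (leb O < +oo)%E.
  by apply: le_lt_trans lO _; rewrite lte_add_pinfty// ltry.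
pose ON N := \bigcup_(k < N) box (ab k).1 (ab k).2.
have LN N : L2_limit (fun x => \1_(ON N) x * \1_Omega x).
  have := L2_limit_boxes [seq ab k | k <- index_iota 0 N].
  by rewrite big_map big_mkord /ON bigcup_mkord.
exists (fun x => \1_O x * \1_Omega x).
  apply: (L2_limit_dominated (K := \1_O) (h_ := fun N x => \1_(ON N) x * \1_Omega x)).
  - exact: LN.
  - move=> x; apply: cvgM; last exact: cvg_cst.
    rewrite [X in _ --> X]indicE; have [|] := boolP (x \in O).
      rewrite inE => -[k _ xk]; apply: cvg_near_cst; exists k.+1 => // N /= kN.
      by rewrite indicE mem_set//; exists k.
    rewrite notin_setE => xO; apply: cvg_near_cst; apply: nearW => N.
    by rewrite indicE memNset// => -[k _ xk]; apply: xO; exists k.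
  - exact: itg_indic.
  - move=> N x; rewrite !indicE; have [|] := boolP (x \in ON N); last by rewrite mul0r expr0n.
    rewrite inE => -[k _ xk]; rewrite (_ : x \in O); last by rewrite inE; exists k.
    by case: (x \in Omega); rewrite ?mulr1 ?mulr0 ?expr1n ?expr0n.
rewrite (@eq_I _ _ _ leb _ \1_((O `&` Omega) `\` E)); last first.
  move=> x; rewrite !indicE in_setD in_setI; have [|] := boolP (x \in E).
    rewrite inE => xE; rewrite andbF !mem_set//; [by rewrite mulr1 subrr expr0n|exact: EO|exact: Eab].
  by move=> _; case: (x \in O); case: (x \in Omega); rewrite /= ?mulr1 ?mulr0 ?mul0r subr0 ?expr1n ?expr0n.
have mOE : measurable (((O `&` Omega) `\` E) : set L) by apply: measurableD => //; exact: measurableI.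
rewrite I_indic//.
have : (leb ((O `&` Omega) `\` E) <= eps%:E)%E.
  apply: (@le_trans _ _ (leb (O `\` E))).
    by apply: le_measure; rewrite ?inE//; [exact: measurableD|move=> x [[xO _] xE]].
  rewrite measureD// (_ : O `&` E = E) ?leeBlDl//.
  apply/seteqP; split=> x; first by case.
  by move=> xE; split => //; exact: Eab.
by move=> h; rewrite -lee_fin fineK// ge0_fin_numE ?(le_lt_trans h) ?ltry//; exact: measure_ge0.
Qed.

Lemma sum_le_truncn (K : nat) (y : R) : y <= K%:R ->
  \sum_(0 <= k < K) ((k.+1%:R <= y)%R%:R : R) = (Num.truncn y)%:R.
Proof.
move=> yK; under eq_bigr do rewrite -truncn_gt_nat.
have tK : (Num.truncn y <= K)%N.
  by rewrite leqNgt; apply/negP; rewrite truncn_gt_nat => h; have := le_trans h yK; rewrite ler_nat ltnn.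
rewrite (big_cat_nat _ tK)//= [X in _ + X]big_nat_cond [X in _ + X]big1 ?addr0; last first.
  by move=> k /andP[/andP[h _] _]; rewrite ltnNge h.
rewrite big_nat_cond (eq_bigr (fun=> 1)); last by move=> k /andP[/andP[_ ->] _].
by rewrite -big_nat_cond big_const_nat subn0 iter_addr_0.
Qed.

(** Layer-cake approximation: counting the levels [k.+1] below $(n+1)(g+M)$ rounds that number down
    to an integer, an error of at most $1/(n+1)$ after division. As $0 \le g+M \le 2M$, there are at
    most $2M(n+1)$ levels. *)
Lemma L2_limit_bounded (g : V -> R) (A : set V) (M : nat) : mf g ->
  measurable (A : set L) -> (leb A < +oo)%E -> A `<=` Omega ->
  (forall x, `|g x| <= M%:R) -> (forall x, ~ A x -> g x = 0) -> L2_limit g.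
Proof.
move=> mg mA lA AO gM gA.
pose E (n k : nat) : set V := A `&` [set x | k.+1%:R <= n.+1%:R * (g x + M%:R)].
have mE n k : measurable (E n k : set L).
  have m2 : mf (fun x => n.+1%:R * (g x + M%:R)).
    by apply: measurable_funM; [exact: measurable_cst|apply: measurable_funD; [exact: mg|exact: measurable_cst]].
  exact: (@measurable_fun_le _ L R A (fun=> k.+1%:R) _ mA (measurable_cst _) (measurable_funTS m2)).
have LE n k : L2_limit \1_(E n k).
  apply: L2_limit_indic => //.
    by apply: le_lt_trans lA; apply: le_measure; rewrite ?inE// => x [].
  by move=> x [/AO].
have LA : L2_limit \1_A by exact: L2_limit_indic.
pose h n x : R := 1 * (\sum_(0 <= k < n.+1 * (2 * M)) n.+1%:R^-1 * \1_(E n k) x) + (- M%:R) * \1_A x.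
have Lh n : L2_limit (h n) by apply: L2_limit_lin LA; exact: (L2_limit_sum _ (fun=> n.+1%:R^-1) (LE n)).
have hg n x : `|h n x - g x| <= n.+1%:R^-1 * \1_A x.
  have [xA|xA] := boolP (x \in A); last first.
    have nA : ~ A x by move=> /mem_set h'; rewrite h' in xA.
    rewrite /h indicE (negbTE xA) !mulr0 addr0 gA// subr0 mul1r big1 ?normr0// => k _.
    by rewrite indicE /E in_setI (negbTE xA) mulr0.
  have n0 : 0 < n.+1%:R :> R by [].
  have := gM x; rewrite ler_norml => /andP[g1 g2].
  pose y := n.+1%:R * (g x + M%:R).
  have y0 : 0 <= y by rewrite mulr_ge0// -lerBlDr sub0r.
  have yK : y <= (n.+1 * (2 * M))%:R.
    by rewrite natrM ler_pM2l// natrM; lra.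
  rewrite /h indicE xA mulr1 mul1r -mulr_sumr mulr1.
  rewrite (eq_bigr (fun k => (k.+1%:R <= y)%R%:R)); last first.
    move=> k _; rewrite indicE in_setI xA /=; congr (nat_of_bool _)%:R.
    by apply/idP/idP; rewrite inE.
  rewrite (sum_le_truncn yK); have /andP[t1 t2] := truncn_itv y0.
  rewrite (_ : _ - _ = n.+1%:R^-1 * ((Num.truncn y)%:R - y)); last by rewrite /y; field; rewrite addrC natr1.
  rewrite normrM gtr0_norm ?invr_gt0// ler_piMr ?invr_ge0// ler_norml.
  by move: t2; rewrite -natr1 => t2; apply/andP; split; lra.
apply: (L2_limit_dominated (h_ := h) (K := fun x => (1 + M%:R) ^+ 2 * \1_A x)).
- exact: Lh.
- move=> x; have c0 : (fun n => n.+1%:R^-1 * \1_A x) @ \oo --> (0 : R).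
    rewrite -(mul0r (\1_A x)); apply: cvgM; last exact: cvg_cst.
    exact: cvg_harmonic.
  have c1 : (fun n => h n x - g x) @ \oo --> (0 : R).
    apply/cvgr0Pnorm_le => e e0; have /cvgr0Pnorm_le/(_ _ e0) := c0; apply: filterS => n /= hn.
    by apply: le_trans (hg n x) (le_trans (ler_norm _) hn).
  suff : (fun n => (h n x - g x) + g x) @ \oo --> 0 + g x by rewrite add0r; under eq_fun do rewrite subrK.
  by apply: cvgD; [exact: c1|exact: cvg_cst].
- by apply: itgZ; exact: itg_indic.
- move=> n x; have := hg n x; have := gM x; rewrite indicE; have [xA|xA] := boolP (x \in A); last first.
    have nA : ~ A x by move=> /mem_set h'; rewrite h' in xA.
    by rewrite gA// subr0 !mulr0 normr_le0 => _ /eqP ->; rewrite expr0n.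
  rewrite !mulr1 => h1 h2; rewrite -[leLHS]real_normK ?num_real//.
  rewrite ler_sqr ?nnegrE//.
  have n1 : n.+1%:R^-1 <= 1 :> R by rewrite invf_le1// ler1n.
  have := lerB_dist (h n x) (g x); move: (n.+1%:R^-1) n1 h2 => w w1 h2; lra.
Qed.

End smooth_density.

Lemma mf_norm d (T : measurableType d) (R : realType) (f : T -> R) :
  measurable_fun setT f -> measurable_fun setT (fun x => `|f x|).
Proof. by move=> m; exact: measurableT_comp. Qed.

Lemma ler_dist_add3 (R : realDomainType) (a b c e : R) : `|a - e| <= `|a - b| + `|b - c| + `|c - e|.
Proof. by apply: le_trans (ler_distD c a e) _; rewrite lerD2r ler_distD. Qed.

(** * Smooth cutoff of small and large values *)

Section cutoff.
Context {R : realType}.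

Lemma pow2_ge (c K : R) : 0 < c -> \forall n \near \oo, K <= 2 ^+ n * c.
Proof.
move=> c0; have /cvgr0Pnorm_le/(_ _ c0) := cvg_half K; apply: filterS => n /= hn.
have p2 : 0 < 2 ^+ n :> R by rewrite exprn_gt0.
have e2 : 2 ^+ n * (1 / 2) ^+ n = 1 :> R.
  by rewrite -exprMn (_ : 2 * (1 / 2) = 1 :> R) ?expr1n//; field.
have := le_trans (ler_norm _) hn; rewrite -(ler_pM2l p2) mulrCA e2 mulr1; exact.
Qed.

(** Vanishes for $s^2 \le 2^{-n}$ and for $s^2 \ge 2^n$, and tends to [s]. Small values are removed
    because [psi] is merely continuous at 0: [psi (cutoff n s)] then has a quadratic bound in
    [s]. *)
Definition cutoff n (s : R) : R :=
  s * (ebump (2 ^+ n * (2 ^+ n * s ^+ 2 - 1)) * ebump (2 ^+ n - s ^+ 2)).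

Lemma cutoff_factor01 n (s : R) :
  0 <= ebump (2 ^+ n * (2 ^+ n * s ^+ 2 - 1)) * ebump (2 ^+ n - s ^+ 2) <= 1.
Proof. by rewrite mulr_ge0 ?ebump_ge0// mulr_ile1 ?ebump_ge0 ?ebump_le1. Qed.

Lemma cutoff_le n s : `|cutoff n s| <= `|s|.
Proof.
have /andP[c0 c1] := cutoff_factor01 n s.
by rewrite normrM (ger0_norm c0) ler_piMr.
Qed.

Lemma cutoff0 n : cutoff n 0 = 0 :> R.
Proof. by rewrite /cutoff mul0r. Qed.

Lemma cutoff_neq0 n s : cutoff n s != 0 -> 1 <= 2 ^+ n * s ^+ 2 /\ s ^+ 2 <= 2 ^+ n.
Proof.
rewrite /cutoff !mulf_eq0 !negb_or => /and3P[_ /ebump_neq0 h1 /ebump_neq0 h2].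
by split; [rewrite -subr_ge0 ltW// -(pmulr_rgt0 _ (_ : 0 < 2 ^+ n)) ?exprn_gt0|rewrite -subr_ge0 ltW].
Qed.

Lemma cutoff_cvg s : (fun n => cutoff n s) @ \oo --> s.
Proof.
have [->|s0] := eqVneq s 0; first by under eq_fun do rewrite cutoff0; exact: cvg_cst.
have s2 : 0 < s ^+ 2 by rewrite exprn_even_gt0.
suff : (fun n => cutoff n s) @ \oo --> s * (1 * 1) by rewrite !mulr1.
apply: cvgM; first exact: cvg_cst.
apply: cvgM.
  apply: (ebump_cvg_ge ltr01); apply: filterS (pow2_ge 2 s2) => n h.
  by rewrite ler_wpM2l ?exprn_ge0//; lra.
have h2 : 0 < 1 / 2 :> R by [].
apply: (ebump_cvg_ge h2); apply: filterS (pow2_ge (s ^+ 2) h2) => n h; lra.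
Qed.

Lemma continuous_cutoff n : continuous (cutoff n).
Proof.
have ce : continuous (@ebump R) by exact: continuous_eflat.
have csq (s : R) : (fun t : R => t ^+ 2) @ s --> s ^+ 2 by exact: exprn_continuous.
move=> s; apply: cvgM; first exact: cvg_id.
apply: cvgM.
  apply: (cvg_comp (fun t : R => 2 ^+ n * (2 ^+ n * t ^+ 2 - 1)) (@ebump R)); last exact: ce.
  apply: cvgM; first exact: cvg_cst.
  apply: cvgB; last exact: cvg_cst.
  by apply: cvgM; [exact: cvg_cst|exact: csq].
apply: (cvg_comp (fun t : R => 2 ^+ n - t ^+ 2) (@ebump R)); last exact: ce.
by apply: cvgB; [exact: cvg_cst|exact: csq].
Qed.

Lemma Cc_infty_cutoff d (Omega : set 'rV[R]_d.+1) n f : Cc_infty Omega f ->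
  Cc_infty Omega (fun x => cutoff n (f x)).
Proof.
move=> Cf; apply: (Cc_infty_sub Cf); last by move=> x /=; apply: contraNneq => ->; rewrite cutoff0.
have sf : smooth_expr f by apply: SmoothFun; have [] := Cf.
have sf2 : smooth_expr (fun x => f x ^+ 2) by exact: (SmoothMul sf sf).
apply: smooth_exprP; apply: SmoothMul => //; apply: SmoothMul; apply: SmoothEflat.
  apply: SmoothMul; first exact: SmoothCst.
  by apply: SmoothAdd; [apply: SmoothMul; [exact: SmoothCst|]|exact: SmoothCst].
rewrite (_ : (fun x => _) = fun x => 2 ^+ n + (-1) * f x ^+ 2); last by apply/funext => x; rewrite mulN1r.
by apply: SmoothAdd; [exact: SmoothCst|apply: SmoothMul; [exact: SmoothCst|]].
Qed.

End cutoff.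

(** * Density in $L^1$ of images of test functions *)

Section density_of_images.
Context {R : realType} {d : nat}.
Local Notation V := 'rV[R]_d.+1.
Local Notation L := (lebRV R d).
Local Notation leb := (@leb R d).
Local Notation I f := (Rintegral leb setT (f : L -> R)).
Local Notation itg f := (@itg _ L R leb f).
Local Notation mf f := (measurable_fun [set: L] (f : L -> R)).
Let cmu := @leb_complete R d.
Variable Omega : set V.
Hypothesis Omega_open : open Omega.
Variables phi psi : R -> R.
Hypothesis phi_cont : continuous phi.
Hypothesis psi_cont : continuous psi.
Hypothesis phi0 : phi 0 = 0.
Hypothesis phiK : cancel phi psi.

Let psi0 : psi 0 = 0. Proof. by rewrite -phi0 phiK. Qed.

Let mpsi : measurable_fun setT psi. Proof. exact: continuous_measurable_fun. Qed.
Let mphi : measurable_fun setT phi. Proof. exact: continuous_measurable_fun. Qed.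

Lemma continuous_bounded_on (h : R -> R) M : continuous h -> exists2 C, 0 <= C &
  forall s, `|s| <= M -> `|h s| <= C.
Proof.
move=> ch; have : compact (h @` `[- M, M]).
  by apply: continuous_compact; [exact: continuous_subspaceT|exact: segment_compact].
move=> /compact_bounded[C [_ hC]]; exists (`|C| + 1); first by rewrite addr_ge0.
move=> s sM; apply: hC; first by rewrite (le_lt_trans (ler_norm C))// ltrDl.
by exists s => //=; rewrite in_itv/= -ler_norml.
Qed.

(** The cutoff of an integrable function is bounded and lives where $2^N f^2 \ge 1$, a set of finite
    measure by Chebyshev's inequality. *)
Lemma bounded_truncation_approx (f : V -> R) eps : itg f -> (forall x, ~ Omega x -> f x = 0) -> 0 < eps ->
  exists f1, [/\ mf f1, I (fun x => `|f x - f1 x|) <= eps,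
    exists M : R, forall x, `|f1 x| <= M,
    exists A : set V, [/\ measurable (A : set L), (leb A < +oo)%E, A `<=` Omega & forall x, ~ A x -> f1 x = 0] & itg f1].
Proof.
move=> iF fO e0; have mF := itg_mf iF.
pose f_ n x := cutoff n (f x).
have m_ n : mf (f_ n).
  exact: (measurableT_comp (continuous_measurable_fun (@continuous_cutoff R n)) mF).
have [_ c] : itg (fun=> 0 : R) /\ (fun n => I (fun x => `|f x - f_ n x|)) @ \oo --> I (fun=> 0 : R).
  apply: (DCT cmu (g := fun x => 2 * `|f x|)).
  - by move=> n; apply: mf_norm; apply: measurable_funB; [exact: mF|exact: m_].
  - apply: aeW => x; rewrite -[X in _ --> X](normr0 R) -(subrr (f x)).
    by apply: cvg_norm; apply: cvgB; [exact: cvg_cst|exact: cutoff_cvg].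
  - by apply: itgZ; exact: itg_norm.
  - apply: aeW => x n; rewrite normr_id; apply: le_trans (ler_normB _ _) _.
    by have := cutoff_le n (f x); rewrite /f_; lra.
move: c; rewrite I0 => /cvgrPdist_le/(_ _ e0)[N _ hN].
have p2 : 0 < 2 ^+ N :> R by rewrite exprn_gt0.
exists (f_ N); split.
- exact: m_.
- by have := hN N (leqnn N); rewrite /= sub0r normrN; apply: le_trans; exact: ler_norm.
- exists (1 + 2 ^+ N) => x; have [->|h] := eqVneq (f_ N x) 0; first by rewrite normr0 addr_ge0// ltW.
  apply: le_trans (cutoff_le N (f x)) _; have [_] := cutoff_neq0 h.
  rewrite -real_normK ?num_real//; move: `|f x| (normr_ge0 (f x)) => s s0 h2.
  have := sqr_ge0 (s - 1); nra.
- pose A : set V := [set x | 1 <= 2 ^+ N * f x ^+ 2].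
  have m2 : mf (fun x => 2 ^+ N * f x ^+ 2).
    by apply: measurable_funM; [exact: measurable_cst|exact: measurable_funX].
  have mA : measurable (A : set L).
    by have := @measurable_fun_le _ L R setT (fun=> 1) _ measurableT (measurable_cst _) m2; rewrite setTI.
  have iA : itg \1_A.
    (* On [A], $|f| \ge 2^{-N/2} \ge 2^{-N}$. *)
    apply: (@itg_le _ L R leb _ (fun x : L => 2 ^+ N * `|f x|)).
    + exact: measurable_indic.
    + apply: aeW => x; rewrite indicE; have [|] := boolP (x \in A); last by rewrite normr0 mulr_ge0// ltW.
      rewrite inE /A/= normr1 -real_normK ?num_real//; move: `|f x| (normr_ge0 (f x)) => s s0 h.
      have p1 : 1 <= 2 ^+ N :> R by rewrite exprn_ege1// ler1n.
      rewrite leNgt; apply/negP => h2.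
      have : (2 ^+ N * s) * (2 ^+ N * s) < 1 by rewrite mulr_ilt1// mulr_ge0// ltW.
      have : 2 ^+ N * s ^+ 2 <= 2 ^+ N * (2 ^+ N * s ^+ 2) by rewrite ler_peMl// mulr_ge0 ?sqr_ge0// ltW.
      by rewrite expr2 in h *; nra.
    + by apply: itgZ; exact: itg_norm.
  exists A; split => //.
  + have /integrableP[_] := iA; under eq_integral do rewrite gee0_abs ?lee_fin//.
    by rewrite integral_indic// setIT.
  + move=> x; apply: contraPP => xO; rewrite /A/= fO// expr0n mulr0 => h; have := @ltr01 R; lra.
  + move=> x xA; apply/eqP; apply: contra_notT xA => /cutoff_neq0[]//.
- apply: (@itg_le _ L R leb _ (fun x : L => `|f x|)); [exact: m_| |exact: itg_norm].
  by apply: aeW => x; exact: cutoff_le.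
Qed.

(** Three approximations: [f] by a bounded [f1] living on a set of finite measure, [f1 = psi g] by
    [psi] of a cutoff of [g], and [g] by test functions in $L^2$. The cutoff is kept in the last
    one, so that $L^2$ convergence of the arguments controls $L^1$ convergence of the images. *)
Lemma image_density (f : V -> R) eps : itg f -> (forall x, ~ Omega x -> f x = 0) -> 0 < eps ->
  exists2 z, Cc_infty Omega z & itg (fun x => psi (z x)) /\ I (fun x => `|f x - psi (z x)|) <= eps.
Proof.
move=> iF fO e0; have e3 : 0 < eps / 3 by rewrite divr_gt0.
have [f1 [m1 h1 [M fM] [A [mA lA AO fA]] i1]] := bounded_truncation_approx iF fO e3.
pose g x := phi (f1 x).
have mg : mf g by exact: (measurableT_comp mphi m1).
have [Cg Cg0 hg] := continuous_bounded_on M phi_cont.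
have gC x : `|g x| <= Cg by exact: hg.
have gA x : ~ A x -> g x = 0 by move=> /fA h; rewrite /g h phi0.
have [Cp Cp0 hp] := continuous_bounded_on Cg psi_cont.
have Lg : L2_limit Omega g.
  apply: (L2_limit_bounded Omega_open (M := (Num.truncn Cg).+1) mg mA lA AO) => // x.
  by apply: le_trans (gC x) _; exact/ltW/truncnS_gt.
have [_ c1] : itg (fun=> 0 : R) /\ (fun n => I (fun x => `|f1 x - psi (cutoff n (g x))|)) @ \oo --> I (fun=> 0 : R).
  apply: (DCT cmu (g := fun x => `|f1 x| + Cp * \1_A x)).
  - move=> n; apply: mf_norm; apply: measurable_funB; first exact: m1.
    apply: (measurableT_comp mpsi).
    exact: (measurableT_comp (continuous_measurable_fun (@continuous_cutoff R n)) mg).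
  - apply: aeW => x; rewrite -[X in _ --> X](normr0 R) -(subrr (f1 x)).
    apply: cvg_norm; apply: cvgB; first exact: cvg_cst.
    rewrite -[X in _ --> X](phiK (f1 x)).
    apply: (cvg_comp (fun n => cutoff n (g x)) psi (@cutoff_cvg _ _)); exact: psi_cont.
  - by apply: itgD; [exact: itg_norm|apply: itgZ; exact: itg_indic].
  - apply: aeW => x n; rewrite normr_id; apply: le_trans (ler_normB _ _) _; rewrite lerD2l.
    rewrite indicE; have [xA|xA] := boolP (x \in A).
      by rewrite mulr1; apply: hp; apply: le_trans (cutoff_le _ _) _.
    rewrite gA ?cutoff0 ?psi0 ?normr0 ?mulr0//.
    by move=> /mem_set h; rewrite h in xA.
move: c1; rewrite I0 => /cvgrPdist_le/(_ _ e3)[n _ hn].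
have h2 : I (fun x => `|f1 x - psi (cutoff n (g x))|) <= eps / 3.
  by have := hn n (leqnn n); rewrite /= sub0r normrN; apply: le_trans; exact: ler_norm.
pose q := fun _ : unit => 2 : R.
have q1 (i : unit) : 1 < q i by rewrite /q; lra.
have [_ ig2 happ] := Lg.
have /choice[z hz] : forall k : nat, exists z, Cc_infty Omega z /\ I (fun x => (z x - g x) ^+ 2) <= (1 / 2) ^+ k.
  by move=> k; have [|z Cz h] := happ ((1 / 2) ^+ k); [exact: exprn_gt0|exists z].
pose U_ k := fun (_ : unit) (x : L) => z k x.
pose U := fun (_ : unit) (x : L) => g x.
have HU_ k : inLq leb q (U_ k).
  move=> i; split; first exact: Cc_infty_mf (hz k).1.
  exact: (Cc_infty_apow (ltr0n R 2) (hz k).1).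
have HU : inLq leb q U by move=> i; split; [exact: mg|rewrite /q; under eq_fun do rewrite apow2].
have cU : mconv leb q U_ U.
  move=> i; apply: (@squeeze_cvgr _ _ _ _ (cst 0) (fun k => 1 * (1 / 2) ^+ k)).
  - apply: nearW => k; apply/andP; split.
      by apply: (I_apow_ge0 cmu); have [] := inLqB q1 (HU_ k) HU i.
    by rewrite mul1r /q; under eq_fun do rewrite apow2; exact: (hz k).2.
  - exact: cvg_cst.
  - exact: cvg_half.
have [ph _ fU] := mconv_fconv q1 HU_ HU cU.
have p2 : 0 < 2 ^+ n :> R by rewrite exprn_gt0.
have [Cn Cn0 hCn] := continuous_bounded_on (1 + 2 ^+ n) psi_cont.
(* Where the cutoff is nonzero, $2^n s^2 \ge 1$, so a constant bound is also a quadratic one. *)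
have psi_growth s : `|psi (cutoff n s)| <= Cn * (2 ^+ n * s ^+ 2).
  have [->|h] := eqVneq (cutoff n s) 0.
    by rewrite psi0 normr0 mulr_ge0// mulr_ge0 ?sqr_ge0// ltW.
  have [h3 h4] := cutoff_neq0 h; apply: (@le_trans _ _ (Cn * 1)); last by rewrite ler_wpM2l.
  rewrite mulr1; apply: hCn; apply: le_trans (cutoff_le _ _) _; move: h4.
  rewrite -real_normK ?num_real//; move: `|s| (normr_ge0 s) => t t0 h4.
  have := sqr_ge0 (t - 1); nra.
have mc (y : V -> R) : mf y -> mf (fun x => psi (cutoff n (y x))).
  move=> my; apply: (measurableT_comp mpsi).
  exact: (measurableT_comp (continuous_measurable_fun (@continuous_cutoff R n)) my).
have ipc (y : V -> R) : mf y -> itg (fun x => y x ^+ 2) -> itg (fun x => psi (cutoff n (y x))).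
  move=> my iy2; apply: (@itg_le _ L R leb _ (fun x : L => Cn * (2 ^+ n * y x ^+ 2))).
  - exact: mc.
  - by apply: aeW => x; exact: psi_growth.
  - by apply: itgZ; exact: itgZ.
have iz k : itg (fun x => psi (cutoff n (z (ph k) x))).
  by apply: ipc; [exact: Cc_infty_mf (hz _).1|exact: Cc_infty_sqr (hz _).1].
have ig := ipc g mg ig2.
have c3 : (fun k => I (fun x => `|psi (cutoff n (g x)) - psi (cutoff n (z (ph k) x))|)) @ \oo --> (0 : R).
  have [|k||||_ c] := growth_cvg cmu q1 HU fU (C := Cn * 2 ^+ n) (b := fun x => `|psi (cutoff n (g x))|)
    (F := fun k x => `|psi (cutoff n (g x)) - psi (cutoff n (z (ph k) x))|) (f := fun=> 0).
  - by rewrite mulr_ge0// ltW.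
  - apply: mf_norm; apply: measurable_funB; apply: mc; first exact: mg.
    exact: Cc_infty_mf (hz _).1.
  - apply: filterS (fconv_ae q1 fU) => x /(_ tt) c.
    rewrite -[X in _ --> X](normr0 R) -(subrr (psi (cutoff n (g x)))).
    apply: cvg_norm; apply: cvgB; first exact: cvg_cst.
    apply: (cvg_comp (fun k => cutoff n (z (ph k) x)) psi); last exact: psi_cont.
    by apply: (cvg_comp (fun k => z (ph k) x) (cutoff n) c); exact: continuous_cutoff.
  - exact: itg_norm.
  - apply: aeW => x k; rewrite normr_id; apply: le_trans (ler_normB _ _) _.
    rewrite addrC lerD2r; apply: le_trans (psi_growth _) _.
    have := apow_le_pmod q (((U_ \o ph) k)^~ x) tt; rewrite /q apow2 => h.
    by rewrite mulrA ler_wpM2l// mulr_ge0// ltW.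
  by move: c; rewrite I0.
move: c3 => /cvgrPdist_le/(_ _ e3)[k _ hk].
have h3 : I (fun x => `|psi (cutoff n (g x)) - psi (cutoff n (z (ph k) x))|) <= eps / 3.
  by have := hk k (leqnn k); rewrite /= sub0r normrN; apply: le_trans; exact: ler_norm.
exists (fun x => cutoff n (z (ph k) x)); first exact: Cc_infty_cutoff (hz _).1.
split; first exact: iz.
have j1 : itg (fun x => `|f x - f1 x|) by apply: itg_norm; exact: itgB.
have j2 : itg (fun x => `|f1 x - psi (cutoff n (g x))|) by apply: itg_norm; exact: itgB.
have j3 : itg (fun x => `|psi (cutoff n (g x)) - psi (cutoff n (z (ph k) x))|).
  by apply: itg_norm; apply: itgB; [exact: ig|exact: iz].
apply: (@le_trans _ _ (I (fun x => (`|f x - f1 x| + `|f1 x - psi (cutoff n (g x))|) +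
    `|psi (cutoff n (g x)) - psi (cutoff n (z (ph k) x))|))).
  apply: (I_le cmu); [apply: aeW => x|by apply: itg_norm; apply: itgB; [exact: iF|exact: iz]|].
    exact: ler_dist_add3.
  by apply: itgD j3; exact: itgD j1 j2.
rewrite ID; [|exact: itgD j1 j2|exact: j3].
rewrite ID; [|exact: j1|exact: j2].
rewrite (_ : eps = eps / 3 + eps / 3 + eps / 3); last by field.
by apply: lerD h3; exact: lerD h1 h2.
Qed.

End density_of_images.

(** * The Sobolev space *)

Section lebesgue_norms.
Context d (T : measurableType d) (R : realType).
Variable mu : {measure set T -> \bar R}.
Local Notation I f := (Rintegral mu setT f).
Local Notation itg := (itg mu).
Local Notation mf f := (measurable_fun [set: T] f).

Lemma LfunE (q : R) (f : T -> R) : 1 <= q ->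
  f \in Lfun mu q%:E <-> mf f /\ itg (fun x => apow q (f x)).
Proof.
move=> q1; have q0 : q != 0 by rewrite gt_eqF// (lt_le_trans ltr01).
split.
  move=> /[dup] h /(Lfun_integrable q1) i; split => //.
  by move: h; rewrite inE => /andP[/[!inE]].
move=> [m i]; apply/andP; split; rewrite inE//=.
have : ('N[mu]_q%:E[EFin \o f] `^ q < +oo)%E.
  rewrite poweR_Lnorm//; have /integrableP[_] := i; apply: le_lt_trans.
  rewrite le_eqVlt; apply/orP; left; apply/eqP; apply: eq_integral => x _.
  rewrite -[LHS]/(`|f x|%:E `^ q)%E poweR_EFin.
  by rewrite -[RHS]/(`|apow q (f x)|%:E) (ger0_norm (apow_ge0 _ _)).
by rewrite /finite_norm; case: ('N[mu]_ _ [_])%E => // [r|]; rewrite ?ltry// poweRyr.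
Qed.

Lemma LnormE (q : R) (f : T -> R) : itg (fun x => apow q (f x)) ->
  ('N[mu]_q%:E[EFin \o f] = (I (fun x => apow q (f x)) `^ q^-1)%:E)%E.
Proof.
move=> i; rewrite unlock -poweR_EFin /Rintegral fineK; last exact: integrable_fin_num.
by congr (_ `^ _)%E; apply: eq_integral => x _; rewrite /= poweR_EFin.
Qed.

Lemma Lnorm_cvg0 (q : R) (h : nat -> T -> R) : 0 < q -> (forall n, mf (h n)) ->
  (forall n, itg (fun x => apow q (h n x))) ->
  (fun n => 'N[mu]_q%:E[EFin \o h n])%E @ \oo --> 0%E <->
  (fun n => I (fun x => apow q (h n x))) @ \oo --> (0 : R).
Proof.
move=> q0 mh ih.
have -> : (fun n => 'N[mu]_q%:E[EFin \o h n])%E = EFin \o (fun n => I (fun x => apow q (h n x)) `^ q^-1).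
  by apply/funext => n; rewrite LnormE.
have I0 n : 0 <= I (fun x => apow q (h n x)) by apply: Rintegral_ge0 => x _; exact: apow_ge0.
have E n : apow q (I (fun x => apow q (h n x)) `^ q^-1) = I (fun x => apow q (h n x)).
  rewrite {1}/apow ger0_norm ?powR_ge0// -powRrM mulVf ?gt_eqF//.
  by rewrite powRr1; [|exact: I0].
split.
  move=> /fine_cvgP[_] /= c.
  rewrite (_ : (fun n => I _) = (fun n => apow q (I (fun x => apow q (h n x)) `^ q^-1))); last first.
    by apply/funext => n; rewrite E.
  rewrite -(apow0 (q := q)) ?gt_eqF//.
  by apply: (cvg_comp _ (apow q) c); exact: continuous_apow.
move=> c; apply: cvg_EFin; first exact: nearW.
apply: (apow_cvg0 q0); under eq_fun do rewrite /= E.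
exact: c.
Qed.

End lebesgue_norms.

(** * Linear combinations and diagonal sequences of modular limits *)

Section modular_limits.
Context d (T : measurableType d) (R : realType).
Variable mu : {measure set T -> \bar R}.
Hypothesis cmu : measure_is_complete mu.
Context (J : finType) (q : J -> R).
Hypothesis q_gt1 : forall i, 1 < q i.
Local Notation I f := (Rintegral mu setT f).
Local Notation itg := (itg mu).
Local Notation inLq := (inLq mu q).
Local Notation mconv := (mconv mu q).

Let q_gt0 i : 0 < q i. Proof. exact: lt_trans (q_gt1 i). Qed.

Lemma mconv_lin (a b : R) (U_ V_ : nat -> J -> T -> R) U V :
  (forall n, inLq (U_ n)) -> inLq U -> (forall n, inLq (V_ n)) -> inLq V ->
  mconv U_ U -> mconv V_ V ->
  mconv (fun n i x => a * U_ n i x + b * V_ n i x) (fun i x => a * U i x + b * V i x).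
Proof.
move=> HU_ HU HV_ HV cU cV i.
pose X n x := U_ n i x - U i x; pose Y n x := V_ n i x - V i x.
have [HX HY] : (forall n, measurable_fun setT (X n) /\ itg (fun x => apow (q i) (X n x))) /\
    (forall n, measurable_fun setT (Y n) /\ itg (fun x => apow (q i) (Y n x))).
  by split=> n; [exact: (inLqB q_gt1 (HU_ n) HU i)|exact: (inLqB q_gt1 (HV_ n) HV i)].
apply: (@squeeze_cvgr _ _ _ _ (cst 0) (fun n => 2 `^ q i *
    (apow (q i) a * I (fun x => apow (q i) (X n x)) + apow (q i) b * I (fun x => apow (q i) (Y n x))))).
- apply: nearW => n; have [mX iX] := HX n; have [mY iY] := HY n; apply/andP; split.
    by apply: (I_apow_ge0 cmu); have [] := inLqB q_gt1 (inLq_lin q_gt1 a b (HU_ n) (HV_ n)) (inLq_lin q_gt1 a b HU HV) i.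
  rewrite -!IZ// -ID; [|exact: itgZ|exact: itgZ].
  rewrite -IZ; last by apply: itgD; exact: itgZ.
  apply: (I_le cmu).
  + apply: aeW => x; rewrite (_ : _ - _ = a * X n x + b * Y n x); last by rewrite /X /Y; ring.
    by rewrite -!apowM; apply: apowD; exact: ltW.
  + by have [] := inLqB q_gt1 (inLq_lin q_gt1 a b (HU_ n) (HV_ n)) (inLq_lin q_gt1 a b HU HV) i.
  + by apply: itgZ; apply: itgD; exact: itgZ.
- exact: cvg_cst.
- rewrite -[X in _ --> X](mulr0 (2 `^ q i)); apply: cvgM; first exact: cvg_cst.
  rewrite -[X in _ --> X](addr0 0); apply: cvgD.
    rewrite -[X in _ --> X](mulr0 (apow (q i) a)); apply: cvgM; [exact: cvg_cst|exact: cU].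
  rewrite -[X in _ --> X](mulr0 (apow (q i) b)); apply: cvgM; [exact: cvg_cst|exact: cV].
Qed.

Lemma mconv_diagonal (F_ : nat -> nat -> J -> T -> R) (U_ : nat -> J -> T -> R) U :
  (forall n k, inLq (F_ n k)) -> (forall n, inLq (U_ n)) -> inLq U ->
  (forall n, mconv (F_ n) (U_ n)) -> mconv U_ U ->
  exists k_ : nat -> nat, mconv (fun n => F_ n (k_ n)) U.
Proof.
move=> HF HU_ HU cF cU.
have /choice[k_ hk] : forall n, exists k, forall i,
    I (fun x => apow (q i) (F_ n k i x - U_ n i x)) <= (1 / 2) ^+ n.
  move=> n.
  have h i : exists N, forall k, (N <= k)%N -> I (fun x => apow (q i) (F_ n k i x - U_ n i x)) <= (1 / 2) ^+ n.
    have e0 : 0 < (1 / 2) ^+ n :> R by rewrite exprn_gt0.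
    have /cvgrPdist_le/(_ _ e0)[N _ hN] := cF n i; exists N => k Nk.
    by have := hN k Nk; rewrite /= sub0r normrN; apply: le_trans; exact: ler_norm.
  have [N hN] := choice h; exists (\max_i N i)%N => i; apply: hN; exact: leq_bigmax.
exists k_ => i; apply: (@squeeze_cvgr _ _ _ _ (cst 0) (fun n => 2 `^ q i *
    (1 * (1 / 2) ^+ n + I (fun x => apow (q i) (U_ n i x - U i x))))).
- apply: nearW => n; apply/andP; split.
    by apply: (I_apow_ge0 cmu); have [] := inLqB q_gt1 (HF n (k_ n)) HU i.
  apply: le_trans (I_apow_triangle cmu q_gt1 i (HF n (k_ n)) (HU_ n) HU) _.
  by rewrite ler_wpM2l ?powR_ge0// lerD2r mul1r; exact: hk.
- exact: cvg_cst.
- rewrite -[X in _ --> X](mulr0 (2 `^ q i)); apply: cvgM; first exact: cvg_cst.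
  rewrite -[X in _ --> X](addr0 0); apply: cvgD; [exact: cvg_half|exact: cU].
Qed.

End modular_limits.

(** * The closure of the jets of test functions *)

Section sobolev_space.
Context {R : realType} {d : nat}.
Local Notation V := 'rV[R]_d.+1.
Local Notation L := (lebRV R d).
Local Notation leb := (@leb R d).
Local Notation I f := (Rintegral leb setT (f : L -> R)).
Local Notation itg f := (@itg _ L R leb f).
Local Notation mf f := (measurable_fun [set: L] (f : L -> R)).
Let cmu := @leb_complete R d.
Variables (Omega : set V) (p : R).
Hypothesis p_gt1 : 1 < p.
Local Notation D := 'I_d.+1.
Local Notation q := (@w1exp R D p).
Local Notation inLq := (inLq leb q).
Local Notation mconv := (mconv leb q).
Let q1 := @w1exp_gt1 R D p p_gt1.
Let q0 i : 0 < q i. Proof. exact: lt_trans (q1 i). Qed.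

Definition jet (f : V -> R) : option D -> L -> R :=
  fun i => if i is Some j then partial j f else f.

(** The closure is taken over the whole space: test functions and their derivatives vanish off
    [Omega], hence so do the elements, almost everywhere, and integrals over [Omega] become
    integrals over the space. *)
Definition sobolev : set (option D -> L -> R) := [set U | inLq U /\
  exists2 f_, (forall n, Cc_infty Omega (f_ n)) & mconv (fun n => jet (f_ n)) U].

Lemma jet_inLq f : Cc_infty Omega f -> inLq (jet f).
Proof.
move=> Cf [j|]; rewrite /jet /=; split.
- exact: Cc_infty_mf (Cc_infty_partial j Cf).
- exact: Cc_infty_apow (q0 (Some j)) (Cc_infty_partial j Cf).
- exact: Cc_infty_mf Cf.
- exact: Cc_infty_apow (q0 None) Cf.
Qed.

Lemma sobolev_jet f : Cc_infty Omega f -> sobolev (jet f).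
Proof.
move=> Cf; split; first exact: jet_inLq.
exists (fun=> f) => // i; rewrite (_ : (fun n => _) = fun=> 0); first exact: cvg_cst.
apply/funext => n; rewrite (@eq_I _ _ _ leb _ (fun=> 0)) ?I0// => x.
by rewrite subrr apow0// gt_eqF.
Qed.

Lemma sobolev_lin (a b : R) U U' : sobolev U -> sobolev U' ->
  sobolev (fun i x => a * U i x + b * U' i x).
Proof.
move=> [HU [f_ Cf cU]] [HU' [g_ Cg cU']]; split; first exact: inLq_lin.
exists (fun n x => a * f_ n x + b * g_ n x); first by move=> n; exact: Cc_infty_lin.
have E n : jet (fun x => a * f_ n x + b * g_ n x) = fun i x => a * jet (f_ n) i x + b * jet (g_ n) i x.
  apply/funext => -[j|]; last by [].
  by rewrite /jet; apply: partial_lin; [have [] := Cf n|have [] := Cg n].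
rewrite (funext E : (fun n => jet _) = _).
exact: (mconv_lin cmu q1 a b (fun n => jet_inLq (Cf n)) HU (fun n => jet_inLq (Cg n)) HU' cU cU').
Qed.

Lemma sobolev_closed U_ U : (forall n, sobolev (U_ n)) -> inLq U -> mconv U_ U -> sobolev U.
Proof.
move=> sU HU cU; split => //.
have /choice[F_ hF] : forall n, exists f_ : nat -> V -> R,
    (forall k, Cc_infty Omega (f_ k)) /\ mconv (fun k => jet (f_ k)) (U_ n).
  by move=> n; have [_ [f_ h1 h2]] := sU n; exists f_.
have [k_ h] := mconv_diagonal cmu q1 (F_ := fun n k => jet (F_ n k))
  (fun n k => jet_inLq ((hF n).1 k)) (fun n => (sU n).1) HU (fun n => (hF n).2) cU.
by exists (fun n => F_ n (k_ n)) => // n; exact: (hF n).1.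
Qed.

Lemma Cc_infty_ebump (al be : R) f : Cc_infty Omega f ->
  Cc_infty Omega (fun x => ebump (al * f x + be) - ebump be).
Proof.
move=> Cf; apply: (Cc_infty_sub Cf); last first.
  by move=> x /=; apply: contraNneq => ->; rewrite mulr0 add0r subrr.
have sf : smooth_expr f by apply: SmoothFun; have [] := Cf.
apply: smooth_exprP; apply: SmoothAdd; last exact: SmoothCst.
apply: SmoothEflat; apply: SmoothAdd; last exact: SmoothCst.
by apply: SmoothMul; [exact: SmoothCst|].
Qed.

Definition bump_jet (al be : R) (X : option D -> L -> R) : option D -> L -> R :=
  fun i x => if i is Some _ then al * debump (al * X None x + be) * X i x
    else ebump (al * X None x + be) - ebump be.

Lemma jet_ebump (al be : R) f i : Cc_infty Omega f ->
  jet (fun x => ebump (al * f x + be) - ebump be) i =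
  bump_jet al be (jet f) i.
Proof.
move=> [sf _ _]; case: i => [j|]//=.
have hd (s : R) : is_derive s (1 : R) (fun t : R => ebump (al * t + be) - ebump be) (al * debump (al * s + be)).
  have d1 : is_derive s (1 : R) (fun t : R => al * t + be) al.
    by apply: is_derive_eq; rewrite addr0 ?scaler0 ?add0r /GRing.scale/= mulr1.
  have d2 := @is_derive1_comp R (@ebump R) (fun t : R => al * t + be) s _ _ (is_derive_ebump (al * s + be)) d1.
  apply: is_derive_eq (is_deriveB d2 (is_derive_cst (ebump be) s 1)) _.
  by rewrite subr0 mulrC.
by rewrite (partial_comp j hd sf).
Qed.

(** The chain rule holds for the approximating test functions. Fast convergence, and the bound of
    each component of [bump_jet] by a multiple of the same component of its argument, carry it to
    the limit. *)
Lemma sobolev_comp (al be : R) U : sobolev U -> sobolev (bump_jet al be U).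
Proof.
move=> [HU [g_ Cg cU]].
have [ph _ fU'] := mconv_fconv q1 (fun n => jet_inLq (Cg n)) HU cU.
pose f_ n := g_ (ph n).
have Cf n : Cc_infty Omega (f_ n) by exact: Cg.
pose F_ n := jet (f_ n).
have HF n : inLq (F_ n) by exact: jet_inLq.
have fU : fconv leb q F_ U by exact: fU'.
have [K K0 hK] := @eflat_bounded R ('X ^+ 2).
have [Lp Lp0 hL] := @ebump_lipschitz R.
have caff : continuous (fun t : R => al * t + be).
  by move=> s; apply: cvgD; [apply: cvgM; [exact: cvg_cst|exact: cvg_id]|exact: cvg_cst].
have ced : continuous (fun s : R => debump (al * s + be)).
  by move=> s; apply: (cvg_comp (fun t : R => al * t + be) (@debump R) (caff s)); exact: continuous_eflat.
have ceb : continuous (fun s : R => ebump (al * s + be)).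
  by move=> s; apply: (cvg_comp (fun t : R => al * t + be) (@ebump R) (caff s)); exact: continuous_eflat.
(* [K] bounds [debump] and handles the derivatives; [Lp] is the Lipschitz constant of [ebump] and
   handles the function itself. *)
pose c := al * (K + Lp).
have bS X i x : `|bump_jet al be X i x| <= `|c * X i x|.
  rewrite /c !normrM (ger0_norm (addr_ge0 K0 Lp0)); case: i => [j|] /=.
    rewrite !normrM; apply: ler_wpM2r => //; apply: ler_wpM2l => //.
    by apply: (le_trans (hK _)); rewrite lerDl.
  apply: le_trans (hL _ _) _; rewrite addrK normrM mulrCA -mulrA; apply: ler_wpM2l => //.
  by apply: ler_wpM2r => //; rewrite lerDr.
have mB X i : inLq X -> mf (bump_jet al be X i).
  move=> HX; have mX j : mf (X j) by have [] := HX j.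
  case: i => [j|]; rewrite /bump_jet.
    apply: measurable_funM (mX _); apply: measurable_funM; first exact: measurable_cst.
    exact: (measurableT_comp (continuous_measurable_fun ced) (mX None)).
  apply: measurable_funB; last exact: measurable_cst.
  exact: (measurableT_comp (continuous_measurable_fun ceb) (mX None)).
have HB X : inLq X -> inLq (bump_jet al be X).
  move=> HX i; split; first exact: mB.
  apply: (@itg_le _ L R leb _ (fun x : L => apow (q i) (c * X i x))).
  - exact: mf_apow (mB _ _ HX).
  - apply: aeW => x; rewrite (ger0_norm (apow_ge0 _ _)); apply: le_apow (bS _ _ _).
    exact/ltW/q0.
  - by apply: itg_apowZ; have [] := HX i.
split; first exact: HB.
exists (fun n x => ebump (al * f_ n x + be) - ebump be).
  by move=> n; exact: Cc_infty_ebump.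
rewrite (_ : (fun n => jet _) = fun n => bump_jet al be (F_ n)); last first.
  by apply/funext => n; apply/funext => i; exact: jet_ebump.
move=> i.
have [|n||||_ lim] := growth_cvg cmu q1 HU fU (C := 2 `^ q i * apow (q i) c)
   (b := fun x => 2 `^ q i * apow (q i) (bump_jet al be U i x))
   (F := fun n x => apow (q i) (bump_jet al be (F_ n) i x - bump_jet al be U i x)) (f := fun=> 0).
- by apply: mulr_ge0; [exact: powR_ge0|exact: apow_ge0].
- by apply: mf_apow; apply: measurable_funB; exact: mB.
- apply: filterS (fconv_ae q1 fU) => x h.
  have h1 : (fun n => bump_jet al be (F_ n) i x) @ \oo --> bump_jet al be U i x.
    rewrite /bump_jet; case: i => [j|].
      apply: cvgM; last exact: (h (Some j)).
      apply: cvgM; first exact: cvg_cst.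
      by apply: (cvg_comp _ (fun s : R => debump (al * s + be)) (h None)); exact: ced.
    apply: cvgB; last exact: cvg_cst.
    by apply: (cvg_comp _ (fun s : R => ebump (al * s + be)) (h None)); exact: ceb.
  have h2 : (fun n => bump_jet al be (F_ n) i x - bump_jet al be U i x) @ \oo --> (0 : R).
    by rewrite -(subrr (bump_jet al be U i x)); apply: cvgB => //; exact: cvg_cst.
  rewrite -(apow0 (q := q i)) ?gt_eqF//.
  by apply: (cvg_comp _ (apow (q i)) h2); exact: continuous_apow.
- by apply: itgZ; have [] := HB _ HU i.
- apply: aeW => x n; rewrite (ger0_norm (apow_ge0 _ _)).
  apply: le_trans (apowD _ _ (ltW (q0 i))) _; rewrite apowN mulrDr lerD2r -mulrA.
  apply: ler_wpM2l; first exact: powR_ge0.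
  apply: (@le_trans _ _ (apow (q i) (c * F_ n i x))); first exact: le_apow (ltW (q0 i)) (bS _ _ _).
  rewrite apowM; apply: ler_wpM2l; first exact: apow_ge0.
  exact: (apow_le_pmod q ((F_ n)^~ x) i).
by move: lim; rewrite I0.
Qed.

Lemma sobolev0 : sobolev (fun _ _ => 0).
Proof.
have := sobolev_jet (@Cc_infty0 R d Omega); congr (sobolev _); apply/funext => -[j|] //=.
by apply/funext => x; rewrite /partial derive_cst.
Qed.

Lemma sobolev_w1_space : w1_space leb p sobolev.
Proof.
split.
- by move=> U [].
- by move=> a b U U'; exact: sobolev_lin.
- exact: sobolev_closed.
- exact: sobolev0.
- by move=> al be U; exact: sobolev_comp.
Qed.

End sobolev_space.

(** * Euclidean length against sums of powers of coordinates *)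

Section euclidean_norm.
Context {R : realType} {d : nat}.
Local Notation V := 'rV[R]_d.+1.
Implicit Types v : V.

Lemma dot_ge0 v : 0 <= dot v v.
Proof. by apply: sumr_ge0 => i _; rewrite -expr2 sqr_ge0. Qed.

Lemma enorm_ge0 v : 0 <= enorm v. Proof. exact: sqrtr_ge0. Qed.

Lemma le_enorm v i : `|v 0 i| <= enorm v.
Proof.
rewrite -sqrtr_sqr ler_sqrt ?dot_ge0// /dot (bigD1 i)//= -expr2 lerDl.
by apply: sumr_ge0 => j _; rewrite -expr2 sqr_ge0.
Qed.

Lemma enorm_max v : exists i, enorm v <= d.+1%:R * `|v 0 i|.
Proof.
have [i _ hi] := @arg_maxP _ _ _ (ord0 : 'I_d.+1) xpredT (fun i => `|v 0 i|) isT.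
exists i; rewrite -(@ger0_norm _ (d.+1%:R * _)) ?mulr_ge0// -sqrtr_sqr ler_sqrt ?sqr_ge0//.
apply: (@le_trans _ _ (\sum_(j < d.+1) `|v 0 i| ^+ 2)).
  apply: ler_sum => j _; rewrite -expr2 -real_normK ?num_real// ler_sqr ?nnegrE//.
  exact: hi.
rewrite sumr_const card_ord -[leLHS]mulr_natl exprMn ler_wpM2r ?sqr_ge0//.
by rewrite expr2 ler_peMl ?ler1n.
Qed.

Lemma enorm_powR p v : 0 < p -> enorm v `^ p <= d.+1%:R `^ p * gpow p (fun i => v 0 i).
Proof.
move=> p0; have [i hi] := enorm_max v.
apply: (@le_trans _ _ ((d.+1%:R * `|v 0 i|) `^ p)).
  by rewrite ge0_ler_powR ?(ltW p0)// ?nnegrE ?enorm_ge0 ?mulr_ge0.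
rewrite powRM//; apply: ler_wpM2l; first exact: powR_ge0.
exact: (apow_le_gpow p (fun i => v 0 i) i).
Qed.

Lemma gpow_le_enorm p v : 0 < p -> gpow p (fun i => v 0 i) <= d.+1%:R * enorm v `^ p.
Proof.
move=> p0; apply: (@le_trans _ _ (\sum_(j < d.+1) enorm v `^ p)).
  apply: ler_sum => j _; rewrite /apow ge0_ler_powR ?(ltW p0)// ?nnegrE ?enorm_ge0//.
  exact: le_enorm.
by rewrite sumr_const card_ord -[leLHS]mulr_natl.
Qed.

Lemma mf_enorm dT (T : measurableType dT) (D : set T) (F : T -> V) :
  (forall i, measurable_fun D (fun x => F x 0 i)) -> measurable_fun D (fun x => enorm (F x)).
Proof.
move=> mF; apply: (measurableT_comp (continuous_measurable_fun (@sqrt_continuous R))).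
by apply: measurable_sum => i; apply: measurable_funM.
Qed.

End euclidean_norm.

(** * Identification of the closure of jets with $W^{1,(2,p)}_0$ *)

Section sobolev_W0.
Context {R : realType} {d : nat}.
Local Notation V := 'rV[R]_d.+1.
Local Notation L := (lebRV R d).
Local Notation leb := (@leb R d).
Local Notation I f := (Rintegral leb setT (f : L -> R)).
Local Notation itg f := (@itg _ L R leb f).
Local Notation mf f := (measurable_fun [set: L] (f : L -> R)).
Let cmu := @leb_complete R d.
Variables (Omega : set V) (p : R).
Hypothesis p_gt1 : 1 < p.
Hypothesis mOmega : measurable (Omega : set L).
Local Notation D := 'I_d.+1.
Local Notation q := (@w1exp R D p).
Let q1 := @w1exp_gt1 R D p p_gt1.
Let q0 i : 0 < q i. Proof. exact: lt_trans (q1 i). Qed.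
Let p0 : 0 < p. Proof. exact: lt_trans p_gt1. Qed.

Lemma patch_in (f : V -> R) x : Omega x -> (f \_ Omega) x = f x.
Proof. by move=> Ox; rewrite patchE mem_set. Qed.

Lemma patch_out (f : V -> R) x : ~ Omega x -> (f \_ Omega) x = 0.
Proof. by move=> Ox; rewrite patchE memNset. Qed.

Lemma patch_le (f : V -> R) x : `|(f \_ Omega) x| <= `|f x|.
Proof. by rewrite patchE; case: ifP => // _; rewrite normr0. Qed.

Lemma mf_patch (f : V -> R) : measurable_fun (Omega : set L) f <-> mf (f \_ Omega).
Proof. exact: measurable_restrictT. Qed.

Lemma inLpE (r : R) (f : V -> R) : 1 <= r ->
  inLp Omega r%:E f <-> mf (f \_ Omega) /\ itg (fun x => apow r ((f \_ Omega) x)).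
Proof. by move=> r1; exact: LfunE. Qed.

(** Euclidean lengths of gradient differences are bounded by the coordinates at the cost of a factor
    $(d+1)^p$, and restriction to [Omega] only decreases the integrals. *)
Lemma sobolev_W0 U : sobolev Omega p U -> W0_grad Omega p (U None) (fun x => \row_j U (Some j) x).
Proof.
move=> [HU [f_ Cf cU]].
have mU i : mf (U i) by have [] := HU i.
have iU i : itg (fun x => apow (q i) (U i x)) by have [] := HU i.
have Hf n := jet_inLq p_gt1 (Cf n).
have HB n := inLqB q1 (Hf n) HU.
have patch_itg (r : R) (f g : V -> R) : 0 <= r -> mf (f \_ Omega) -> itg (fun x => apow r (g x)) ->
    (forall x, `|f x| <= `|g x|) -> itg (fun x => apow r ((f \_ Omega) x)).
  move=> r0 mff ig fg; apply: (@itg_le _ L R leb _ (fun x : L => apow r (g x))).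
  - exact: mf_apow.
  - apply: aeW => x; rewrite (ger0_norm (apow_ge0 _ _)); apply: le_apow => //.
    exact: le_trans (patch_le f x) (fg x).
  - exact: ig.
have menorm (F : V -> V) : (forall i, mf (fun x => F x 0 i)) -> mf ((fun x => enorm (F x)) \_ Omega).
  by move=> mF; apply/mf_patch; apply: mf_enorm => i; apply: measurable_funTS; exact: mF.
have enorm_itg (F : V -> V) : (forall i, mf (fun x => F x 0 i)) ->
    (forall i, itg (fun x => apow p (F x 0 i))) ->
    itg (fun x => apow p (((fun x => enorm (F x)) \_ Omega) x)).
  move=> mF iF; apply: (@itg_le _ L R leb _ (fun x : L => d.+1%:R `^ p * gpow p (fun i => F x 0 i))).
  - exact: mf_apow (menorm F mF).
  - apply: aeW => x; rewrite (ger0_norm (apow_ge0 _ _)); apply: le_trans (enorm_powR _ p0).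
    rewrite -[leRHS]/(enorm (F x) `^ p) -[X in X `^ p](ger0_norm (enorm_ge0 _)).
    exact: le_apow (ltW p0) (patch_le _ x).
  - by apply: itgZ; apply: itg_sum => i _; exact: iF.
have enorm_I (F : V -> V) : (forall i, mf (fun x => F x 0 i)) ->
    (forall i, itg (fun x => apow p (F x 0 i))) ->
    I (fun x => apow p (((fun x => enorm (F x)) \_ Omega) x)) <=
    d.+1%:R `^ p * \sum_i I (fun x => apow p (F x 0 i)).
  move=> mF iF; rewrite -I_sum; last by move=> i _; exact: iF.
  rewrite -IZ; last by apply: itg_sum => i _; exact: iF.
  apply: (I_le cmu).
  - apply: aeW => x; apply: le_trans (enorm_powR _ p0).
    rewrite -[leRHS]/(enorm (F x) `^ p) -[X in X `^ p](ger0_norm (enorm_ge0 _)).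
    exact: le_apow (ltW p0) (patch_le _ x).
  - exact: enorm_itg.
  - by apply: itgZ; apply: itg_sum => i _; exact: iF.
split.
- apply/inLpE; first lra.
  have m1 : mf (U None \_ Omega) by apply/mf_patch; apply: measurable_funTS; exact: mU.
  split; first exact: m1.
  by apply: (patch_itg _ _ (U None)) => //; exact: (iU None).
- split.
    move=> i; under eq_fun do rewrite mxE; apply: measurable_funTS; exact: mU.
  apply/inLpE; first exact: ltW.
  have m1 i : mf (fun x => (\row_j U (Some j) x) 0 i) by under eq_fun do rewrite mxE; exact: mU.
  split; first exact: menorm.
  by apply: enorm_itg => // i; under eq_fun do rewrite mxE; exact: (iU (Some i)).
- exists f_; split => //.
    have m1 n : mf ((U None \- f_ n) \_ Omega).
      apply/mf_patch; apply: measurable_funTS; apply: measurable_funB; first exact: mU.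
      exact: Cc_infty_mf (Cf n).
    have E n (x : V) : `|(U None \- f_ n) x| <= `|jet (f_ n) None x - U None x| by rewrite distrC.
    have i1 n : itg (fun x => apow 2 (((U None \- f_ n) \_ Omega) x)).
      by apply: (patch_itg _ _ (fun x => jet (f_ n) None x - U None x)) => //; have [] := HB n None.
    apply/(Lnorm_cvg0 (ltr0n R 2) m1 i1).
    apply: (@squeeze_cvgr _ _ _ _ (cst 0) (fun n => I (fun x => apow 2 (jet (f_ n) None x - U None x)))).
    + apply: nearW => n; apply/andP; split; first exact: (I_apow_ge0 cmu).
      apply: (I_le cmu); [apply: aeW => x|exact: i1|by have [] := HB n None].
      by apply: le_apow => //; exact: le_trans (patch_le _ x) (E n x).
    + exact: cvg_cst.
    + exact: (cU None).
  pose F n (x : V) : V := \row_j U (Some j) x - gradient (f_ n) x.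
  have FE n i : (fun x => F n x 0 i) = (fun x => -1 * (jet (f_ n) (Some i) x - U (Some i) x)).
    by apply/funext => x; rewrite /F !mxE /=; ring.
  have mF n i : mf (fun x => F n x 0 i).
    by rewrite FE; apply: measurable_funM; [exact: measurable_cst|have [] := HB n (Some i)].
  have FE2 n i : (fun x => apow p (F n x 0 i)) = (fun x => apow p (jet (f_ n) (Some i) x - U (Some i) x)).
    by apply/funext => x; rewrite -[F n x 0 i]/((fun x => F n x 0 i) x) FE mulN1r apowN.
  have iF n i : itg (fun x => apow p (F n x 0 i)) by rewrite FE2; have [] := HB n (Some i).
  apply/(Lnorm_cvg0 p0 (fun n => menorm _ (mF n)) (fun n => enorm_itg _ (mF n) (iF n))).
  apply: (@squeeze_cvgr _ _ _ _ (cst 0) (fun n => d.+1%:R `^ p * \sum_i I (fun x => apow p (F n x 0 i)))).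
  + apply: nearW => n; apply/andP; split; last exact: enorm_I.
    by apply: (I_apow_ge0 cmu); exact: menorm.
  + exact: cvg_cst.
  + rewrite -[X in _ --> X](mulr0 (d.+1%:R `^ p)); apply: cvgM; first exact: cvg_cst.
    rewrite -[X in _ --> X](@big1 R 0 +%R _ (index_enum D) xpredT (fun=> 0))//.
    apply: cvg_sumr => i; under eq_fun do rewrite FE2; exact: (cU (Some i)).
Qed.

(** Extension by zero. The approximating functions vanish off [Omega], so the distances over the
    whole space are controlled by the norms on [Omega]. *)
Lemma W0_sobolev u (G : V -> V) : W0_grad Omega p u G ->
  sobolev Omega p (fun i => if i is Some j then (fun x => G x 0 j) \_ Omega else u \_ Omega).
Proof.
move=> [Lu [mG LG] [f_ [Cf cu cG]]]; set U := (X in sobolev _ _ X).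
have [|mu iu] := proj1 (inLpE u _) Lu; first lra.
have [mE iE] := proj1 (inLpE _ (ltW p_gt1)) LG.
have mU i : mf (U i) by case: i => [j|]; [apply/mf_patch; exact: mG|exact: mu].
have HU : inLq leb q U.
  move=> i; split; first exact: mU.
  case: i => [j|]; last exact: iu.
  apply: (@itg_le _ L R leb _ (fun x : L => apow p (((fun x => enorm (G x)) \_ Omega) x))).
  - exact: mf_apow (mU (Some j)).
  - apply: aeW => x; rewrite (ger0_norm (apow_ge0 _ _)); apply: le_apow (ltW p0) _.
    rewrite /U !patchE; case: ifP => // _; rewrite (ger0_norm (enorm_ge0 _)); exact: le_enorm.
  - exact: iE.
split => //; exists f_ => //.
have Hf n := jet_inLq p_gt1 (Cf n).
have HB n := inLqB q1 (Hf n) HU.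
case=> [j|].
- pose h n : V -> R := (fun x => enorm (G x - gradient (f_ n) x)) \_ Omega.
  have mh n : mf (h n).
    apply/mf_patch; apply: mf_enorm => i; under eq_fun do rewrite !mxE.
    apply: measurable_funB; first exact: mG.
    by apply: measurable_funTS; exact: Cc_infty_mf (Cc_infty_partial i (Cf n)).
  have ih n : itg (fun x => apow p (h n x)).
    apply: (@itg_le _ L R leb _ (fun x : L => d.+1%:R `^ p * \sum_i apow p (jet (f_ n) (Some i) x - U (Some i) x))).
    + exact: mf_apow (mh n).
    + apply: aeW => x; rewrite (ger0_norm (apow_ge0 _ _)) /h patchE.
      have S0 : 0 <= \sum_i apow p (jet (f_ n) (Some i) x - U (Some i) x) by apply: sumr_ge0 => i _; exact: apow_ge0.
      case: ifPn => [/set_mem Ox|_]; last by rewrite apow0 ?gt_eqF// mulr_ge0// powR_ge0.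
      rewrite /apow (ger0_norm (enorm_ge0 _)); apply: le_trans (enorm_powR _ p0) _.
      apply: ler_wpM2l; first exact: powR_ge0.
      rewrite le_eqVlt; apply/orP; left; apply/eqP; apply: eq_bigr => i _.
      by rewrite !mxE -apowN opprB /U patch_in.
    + by apply: itgZ; apply: itg_sum => i _; have [] := HB n (Some i).
  have ch := proj1 (Lnorm_cvg0 p0 mh ih) cG.
  apply: (@squeeze_cvgr _ _ _ _ (cst 0) (fun n => I (fun x => apow p (h n x)))).
  + apply: nearW => n; apply/andP; split.
      by apply: (I_apow_ge0 cmu); have [] := HB n (Some j).
    apply: (I_le cmu); [apply: aeW => x|by have [] := HB n (Some j)|exact: ih].
    apply: le_apow (ltW p0) _; rewrite /h /U; have [Ox|Ox] := pselect (Omega x).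
      rewrite !patch_in// distrC (ger0_norm (enorm_ge0 _)).
      by have := le_enorm (G x - gradient (f_ n) x) j; rewrite !mxE.
    by rewrite !patch_out// /jet (Cc_infty_off (Cc_infty_partial j (Cf n)) Ox) subrr.
  + exact: cvg_cst.
  + exact: ch.
- have E n (x : V) : ((u \- f_ n) \_ Omega) x = - (jet (f_ n) None x - U None x).
    rewrite /U /jet; have [Ox|Ox] := pselect (Omega x); first by rewrite !patch_in//=; ring.
    by rewrite !patch_out// (Cc_infty_off (Cf n) Ox) subrr oppr0.
  have E2 n : (fun x => apow 2 (((u \- f_ n) \_ Omega) x)) = (fun x => apow 2 (jet (f_ n) None x - U None x)).
    by apply/funext => x; rewrite E apowN.
  have m1 n : mf ((u \- f_ n) \_ Omega).
    rewrite (funext (E n) : (u \- f_ n) \_ Omega = _).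
    by apply: measurable_funN; have [] := HB n None.
  have i1 n : itg (fun x => apow 2 (((u \- f_ n) \_ Omega) x)) by rewrite E2; have [] := HB n None.
  have := proj1 (Lnorm_cvg0 (ltr0n R 2) m1 i1) cu.
  by under eq_fun do rewrite E2.
Qed.

End sobolev_W0.

(** * Essentially bounded functions *)

Section essentially_bounded.
Context d (T : measurableType d) (R : realType).
Variable mu : {measure set T -> \bar R}.

Lemma Lfun_ooP (f : T -> R) : f \in Lfun mu +oo%E <->
  measurable_fun setT f /\ exists M : R, \forall x \ae mu, `|f x| <= M.
Proof.
rewrite inE; split.
  move=> /andP[/[!inE]/= mff]; rewrite /finite_norm unlock /Lnorm => h; split => //.
  move: h; case: ifPn => mu0 h.
    have [M hM] := ess_sup_inf.ess_supr_bounded (f := fun x => `|f x|) h.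
    by exists M.
  (* If the space itself is null, the exceptional set may be everything. *)
  exists 0; exists setT; split => //; apply/eqP; rewrite eq_le measure_ge0 andbT.
  by rewrite leNgt.
move=> [mff [M hM]]; apply/andP; split; rewrite inE//= /finite_norm unlock /Lnorm.
case: ifPn => // mu0; apply: (@le_lt_trans _ _ M%:E); last exact: ltry.
by apply/ess_sup_inf.ess_supP; apply: filterS hM => x; rewrite /= lee_fin.
Qed.

End essentially_bounded.

(** * Caratheodory integrands *)

Section caratheodory_functions.
Context {R : realType} {d : nat}.
Local Notation V := 'rV[R]_d.+1.
Local Notation L := (lebRV R d).
Local Notation leb := (@leb R d).
Local Notation mf f := (measurable_fun [set: L] (f : L -> R)).
Let cmu := @leb_complete R d.
Local Notation D := 'I_d.+1.
Variable Omega : set V.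
Hypothesis mOmega : measurable (Omega : set L).

Lemma cvg_row (xi_ : nat -> D -> R) (xi : D -> R) :
  (forall i, (fun n => xi_ n i) @ \oo --> xi i) ->
  (fun n => (\row_i xi_ n i : V)) @ \oo --> (\row_i xi i : V).
Proof.
move=> h; apply/cvg_ballP => e e0.
have : \forall n \near \oo, forall i, ball (xi i) e (xi_ n i).
  by apply: filter_forall => i; have /cvg_ballP/(_ _ e0) := h i.
by apply: filterS => n hn; split => // i j; rewrite !mxE.
Qed.

(** Extension by 0 in [x], with coordinate functions in place of row vectors, as the abstract part
    of the proof expects. *)
Definition zero_ext (h : V -> V -> R) : L -> (D -> R) -> R :=
  fun x xi => if x \in Omega then h x (\row_i xi i) else 0.

Lemma dyadic_floor_cvg (t : R) : (fun n => (Num.floor (n.+1%:R * t))%:~R / n.+1%:R) @ \oo --> t.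
Proof.
apply: (@squeeze_cvgr _ _ _ _ (fun n => t - n.+1%:R^-1) (cst t)).
- apply: nearW => n; have n0 : 0 < n.+1%:R :> R by [].
  have /andP[h1 h2] := floor_itv (n.+1%:R * t); move: h2; rewrite intrD => h2.
  apply/andP; split; last by rewrite /= ler_pdivrMr// [t * _]mulrC.
  rewrite ler_pdivlMr// mulrBl mulVf ?gt_eqF// [t * _]mulrC lerBlDr; exact: ltW.
- rewrite -[X in _ --> X]subr0; apply: cvgB; [exact: cvg_cst|exact: cvg_harmonic].
- exact: cvg_cst.
Qed.

(** Rounding the coordinates of [U] down to multiples of $1/(n+1)$ leaves countably many values, and
    on each piece the composition is a section [h ^~ xi], measurable by hypothesis. Continuity in
    the second variable and completeness of the measure give the limit. *)
Lemma caratheodory_superposable (h : V -> V -> R) : caratheodory_fun Omega h ->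
  superposable leb (zero_ext h).
Proof.
move=> [mh ch].
have seq : \forall x \ae leb, forall (xi_ : nat -> D -> R) xi,
    (forall i, (fun n => xi_ n i) @ \oo --> xi i) ->
    (fun n => zero_ext h x (xi_ n)) @ \oo --> zero_ext h x xi.
  apply: filterS ch => x cx xi_ xi hxi; rewrite /zero_ext.
  case: ifPn => [/set_mem Ox|_]; last exact: cvg_cst.
  by apply: (cvg_comp _ (h x) (cvg_row hxi)); exact: cx.
split; last exact: seq.
move=> U mU.
pose fl n x i := Num.floor (n.+1%:R * U i x).
pose step n x i : R := (fl n x i)%:~R / n.+1%:R.
have mstep n : mf (fun x => zero_ext h x (step n x)).
  move=> _ Y mY; rewrite setTI.
  pose P (z : 'rV[int]_d.+1) : set L := [set x | forall i, fl n x i = z 0 i].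
  pose Q (z : 'rV[int]_d.+1) : V := \row_i ((z 0 i)%:~R / n.+1%:R).
  have -> : (fun x => zero_ext h x (step n x)) @^-1` Y =
      \bigcup_z (P z `&` ((h ^~ (Q z)) \_ Omega @^-1` Y)).
    have E x z : P z x -> zero_ext h x (step n x) = ((h ^~ (Q z)) \_ Omega) x.
      move=> Pz; rewrite /zero_ext patchE; case: ifP => // _; congr (h x _).
      by apply/rowP => i; rewrite !mxE /step Pz.
    apply/seteqP; split => x.
      move=> Yx; have Px : P (\row_i fl n x i) x by move=> i; rewrite mxE.
      by exists (\row_i fl n x i) => //; split => //; rewrite /preimage/= -(E _ _ Px).
    by move=> [z _ [Pz Yz]]; rewrite /preimage/= (E _ _ Pz).
  apply: countable_bigcupT_measurable; first exact: countableP.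
  move=> z; apply: measurableI.
    rewrite (_ : P z = \bigcap_(i in [set: D]) [set x | fl n x i = z 0 i]); last first.
      by apply/seteqP; split => x hx i; [move=> _|]; apply: hx.
    apply: fin_bigcap_measurable => // i _.
    have m1 : mf (fun x => n.+1%:R * U i x) by apply: measurable_funM; [exact: measurable_cst|exact: mU].
    have := m1 measurableT _ (measurable_itv `[(z 0 i)%:~R, (z 0 i + 1)%:~R[); rewrite setTI.
    congr measurable; apply/seteqP; split => x /=; rewrite in_itv/=.
      by move=> /floor_def.
    by move=> <-; exact: floor_itv.
  have /(mf_patch mOmega) m1 := mh (Q z).
  by have := m1 measurableT Y mY; rewrite setTI.
apply: (mf_cvg cmu mstep).
by apply: filterS seq => x; apply => i; exact: dyadic_floor_cvg.
Qed.

End caratheodory_functions.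

(** * Structure conditions for the extended flux and potential *)

Section structure.
Context {R : realType} {d : nat}.
Local Notation V := 'rV[R]_d.+1.
Local Notation L := (lebRV R d).
Local Notation leb := (@leb R d).
Local Notation I f := (Rintegral leb setT (f : L -> R)).
Local Notation itg f := (@itg _ L R leb f).
Local Notation mf f := (measurable_fun [set: L] (f : L -> R)).
Let cmu := @leb_complete R d.
Local Notation D := 'I_d.+1.

Lemma dotBl (u v w : V) : dot (u - v) w = dot u w - dot v w.
Proof. by rewrite /dot -sumrB; apply: eq_bigr => i _; rewrite !mxE mulrBl. Qed.

Lemma dotZr (c : R) (u v : V) : dot u (c *: v) = c * dot u v.
Proof. by rewrite /dot mulr_sumr; apply: eq_bigr => i _; rewrite !mxE mulrCA. Qed.

(** Mean value theorem on the segment: by monotonicity, the slope at an intermediate point dominates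
    the slope at [xi]. *)
Lemma monotone_gradient_convex (F : V -> R) (f : V -> V) :
  (forall xi, differentiable F xi /\ forall h, 'd F xi h = dot (f xi) h) ->
  (forall xi1 xi2, 0 <= dot (f xi1 - f xi2) (xi1 - xi2)) ->
  forall xi zeta, F xi + dot (f xi) (zeta - xi) <= F zeta.
Proof.
move=> dF mono xi zeta; pose h := zeta - xi.
pose g (s : R) := F (s *: h + xi).
have dg (s : R) : is_derive s (1 : R) g (dot (f (s *: h + xi)) h).
  have [dfs dE] := dF (s *: h + xi).
  have d1 : derivable F (s *: h + xi) h by exact: diff_derivable.
  have d2 : is_derive (0 : R) (1 : R) (fun t : R => F (t *: h + (s *: h + xi))) (dot (f (s *: h + xi)) h).
    by have := line_is_derive d1; rewrite (deriveE h dfs) dE.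
  have d3 : is_derive s (1 : R) (fun t : R => t - s) 1.
    by apply: is_derive_eq; rewrite subr0.
  have := @is_derive1_comp R (fun t : R => F (t *: h + (s *: h + xi))) (fun t : R => t - s) s (dot (f (s *: h + xi)) h) 1.
  rewrite subrr mulr1 => /(_ d2 d3); congr is_derive.
  by apply/funext => t; rewrite /g /= addrA -scalerDl subrK.
have cg : {within `[0, 1], continuous g}.
  by apply: derivable_within_continuous => s _; have [] := dg s.
have [c] := MVT (ltr01 : 0 < 1 :> R) (fun s _ => dg s) cg.
rewrite in_itv/= => /andP[c0 c1]; rewrite subr0 mulr1 /g scale1r scale0r add0r subrK => E.
have := mono (c *: h + xi) xi; rewrite addrK dotZr pmulr_rge0// dotBl -E -/h; lra.
Qed.

Section conditions.
Variables (Omega : set V) (p : R) (a : V -> V -> V) (calA : V -> V -> R).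
Variables (a0 a1 a2 : V -> R) (eta : R).
Hypothesis Omega_open : open Omega.
Hypothesis p_gt1 : 1 < p.
Hypothesis a_carath : forall i, caratheodory_fun Omega (fun x xi => a x xi 0 i).
Hypothesis calA_carath : caratheodory_fun Omega calA.
Hypothesis a0_Loo : inLp Omega +oo%E a0.
Hypothesis a1_Lp' : inLp Omega (p / (p - 1))%:E a1.
Hypothesis a2_Lp : inLp Omega p%:E a2.
Hypothesis eta_gt0 : 0 < eta.
Hypothesis a_zero : {ae leb, forall x : lebRV R d, Omega x -> a x 0 = 0}.
Hypothesis a_growth : {ae leb, forall x : lebRV R d, Omega x -> forall xi,
  enorm (a x xi) <= a0 x * enorm xi `^ (p - 1) + a1 x}.
Hypothesis a_coercive : {ae leb, forall x : lebRV R d, Omega x -> forall xi,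
  eta * enorm xi `^ p - a2 x <= dot (a x xi) xi}.
Hypothesis a_monotone : {ae leb, forall x : lebRV R d, Omega x -> forall xi1 xi2,
  0 <= dot (a x xi1 - a x xi2) (xi1 - xi2)}.
Hypothesis calA_gradient : {ae leb, forall x : lebRV R d, Omega x -> forall xi,
  differentiable (calA x) xi /\ forall h, 'd (calA x) xi h = dot (a x xi) h}.

Let p_gt0 : 0 < p. Proof. exact: lt_trans p_gt1. Qed.
Let mOmega : measurable (Omega : set L). Proof. exact: measurable_open. Qed.

Definition flux_ext : L -> (D -> R) -> D -> R :=
  fun x xi i => zero_ext Omega (fun x xi => a x xi 0 i) x xi.

(** No integrability is given for [calA] itself; after subtraction of its value at 0, convexity
    bounds it by the growth of the flux. *)
Definition energy_ext : L -> (D -> R) -> R :=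
  zero_ext Omega (fun x xi => calA x xi - calA x 0).

Lemma flux_in x xi i : Omega x -> flux_ext x xi i = a x (\row_j xi j) 0 i.
Proof. by move=> Ox; rewrite /flux_ext /zero_ext mem_set. Qed.

Lemma flux_out x xi i : ~ Omega x -> flux_ext x xi i = 0.
Proof. by move=> Ox; rewrite /flux_ext /zero_ext memNset. Qed.

Lemma energy_in x xi : Omega x -> energy_ext x xi = calA x (\row_j xi j) - calA x 0.
Proof. by move=> Ox; rewrite /energy_ext /zero_ext mem_set. Qed.

Lemma energy_out x xi : ~ Omega x -> energy_ext x xi = 0.
Proof. by move=> Ox; rewrite /energy_ext /zero_ext memNset. Qed.

Lemma calA_convex : {ae leb, forall x : lebRV R d, Omega x -> forall xi zeta,
  calA x xi + dot (a x xi) (zeta - xi) <= calA x zeta}.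
Proof.
apply: filterS2 a_monotone calA_gradient => x hm hg Ox.
exact: (monotone_gradient_convex (hg Ox) (hm Ox)).
Qed.

Lemma row0 : (\row_(j < d.+1) 0 : V) = 0.
Proof. by apply/rowP => i; rewrite !mxE. Qed.

Lemma energy_convex : \forall x \ae leb, forall xi zeta,
  energy_ext x xi + \sum_i flux_ext x xi i * (zeta i - xi i) <= energy_ext x zeta.
Proof.
apply: filterS calA_convex => x h xi zeta; have [Ox|Ox] := pselect (Omega x).
  rewrite !energy_in//; have := h Ox (\row_j xi j) (\row_j zeta j).
  rewrite /dot (eq_bigr (fun i => flux_ext x xi i * (zeta i - xi i))); last first.
    by move=> i _; rewrite flux_in// !mxE.
  set S := \sum_i _; lra.
by rewrite !energy_out// add0r big1// => i _; rewrite flux_out// mul0r.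
Qed.

Lemma energy_0 x : energy_ext x (fun=> 0) = 0.
Proof.
have [Ox|Ox] := pselect (Omega x); last exact: energy_out.
by rewrite energy_in// row0 subrr.
Qed.

Lemma energy_ge0 : \forall x \ae leb, forall xi, 0 <= energy_ext x xi.
Proof.
apply: filterS2 energy_convex a_zero => x h h0 xi.
have := h (fun=> 0) xi; rewrite energy_0 add0r big1//= => i _.
have [Ox|Ox] := pselect (Omega x); last by rewrite flux_out// mul0r.
by rewrite flux_in// row0 h0// mxE mul0r.
Qed.

Lemma a0_bounded : exists2 A0 : R, 0 <= A0 & {ae leb, forall x : lebRV R d, Omega x -> a0 x <= A0}.
Proof.
have [_ [M hM]] := proj1 (Lfun_ooP _ _) a0_Loo.
exists `|M| => //; apply: filterS hM => x h Ox; apply: le_trans (ler_norm M).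
by apply: le_trans h; rewrite patch_in//; exact: ler_norm.
Qed.

Local Notation p' := (p / (p - 1)).

Let p'_ge1 : 1 <= p'.
Proof. have p1 := p_gt1; rewrite ler_pdivlMr ?subr_gt0// mul1r; lra. Qed.

Lemma a1_itg : itg (fun x => apow p' ((a1 \_ Omega) x)).
Proof. by have [] := proj1 (inLpE _ _ p'_ge1) a1_Lp'. Qed.

(** Young's inequality with exponents [p'] and [p] separates [a1] from [t]; the power term is split
    according to which of $|\xi|$ and $|t|$ is larger. *)
Lemma flux_growth : exists2 C, 0 <= C & \forall x \ae leb, forall xi i t,
  `|flux_ext x xi i * t| <= C * (gpow p xi + apow p t) + apow p' ((a1 \_ Omega) x).
Proof.
have [A0 A00 hA0] := a0_bounded; have p1 := p_gt1.
pose K := d.+1%:R `^ p; have K0 : 0 <= K by exact: powR_ge0.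
exists (A0 * K + A0 + 1); first by rewrite !addr_ge0// mulr_ge0.
apply: filterS2 hA0 a_growth => x h0 hg xi i t.
have G0 := gpow_ge0 p xi; have t0 := apow_ge0 p t; have b0 := apow_ge0 p' ((a1 \_ Omega) x).
have [Ox|Ox] := pselect (Omega x); last first.
  rewrite flux_out// mul0r normr0 addr_ge0// mulr_ge0 ?addr_ge0// mulr_ge0//.
rewrite flux_in// normrM; set z := \row_j xi j.
have ez : enorm z `^ p <= K * gpow p xi.
  have := enorm_powR z p_gt0; congr (_ <= _ * _); apply: eq_bigr => j _.
  by rewrite mxE.
have h1 : `|a x z 0 i| <= A0 * enorm z `^ (p - 1) + `|a1 x|.
  apply: le_trans (le_enorm _ _) (le_trans (hg Ox z) _); apply: lerD; last exact: ler_norm.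
  by apply: ler_wpM2r; [exact: powR_ge0|exact: h0].
have h2 : enorm z `^ (p - 1) * `|t| <= enorm z `^ p + apow p t.
  have e0 := enorm_ge0 z.
  have powS (s : R) : 0 <= s -> s `^ (p - 1) * s = s `^ p.
    move=> s0; rewrite -[X in _ * X](powRr1 s0) -powRD ?subrK//.
    by apply/implyP => /eqP h; have := p_gt0; rewrite h ltxx.
  have [et|et] := leP (enorm z) `|t|.
    apply: (@le_trans _ _ (apow p t)); last by rewrite lerDr powR_ge0.
    rewrite /apow -(powS `|t|)//; apply: ler_wpM2r => //.
    by rewrite ge0_ler_powR ?nnegrE//; lra.
  apply: (@le_trans _ _ (enorm z `^ p)); last by rewrite lerDl.
  rewrite -(powS (enorm z))//; apply: ler_wpM2l; [exact: powR_ge0|exact: ltW].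
have h3 : `|a1 x| * `|t| <= apow p' ((a1 \_ Omega) x) + apow p t.
  have pp : 0 < p' by exact: lt_le_trans p'_ge1.
  have := @conjugate_powR R `|a1 x| `|t| p' p (normr_ge0 _) (normr_ge0 _) pp p_gt0.
  have -> : p'^-1 + p^-1 = 1 by field; apply/andP; split; rewrite gt_eqF//; lra.
  move=> /(_ erefl) /le_trans; apply; rewrite patch_in//; apply: lerD.
    by rewrite ler_piMr ?powR_ge0// invf_le1.
  by rewrite ler_piMr ?powR_ge0// invf_le1// ltW.
apply: (@le_trans _ _ ((A0 * enorm z `^ (p - 1) + `|a1 x|) * `|t|)); first exact: ler_wpM2r.
rewrite mulrDl -mulrA.
have h4 : A0 * (enorm z `^ (p - 1) * `|t|) <= A0 * (K * gpow p xi + apow p t).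
  by apply: ler_wpM2l => //; apply: le_trans h2 _; rewrite lerD2r.
have h5 : 0 <= A0 * K * apow p t by rewrite mulr_ge0// mulr_ge0.
have h6 : 0 <= A0 * gpow p xi by rewrite mulr_ge0.
move: h3 h4 h5 h6 G0 t0 b0.
set X := A0 * (_ * _); set Y := _ * `|t|; set g := gpow p xi; set w := apow p t; set b := apow p' _.
rewrite !mulrDl !mulrDr mul1r; lra.
Qed.

(** The growth of the potential comes from convexity: the tangent at [xi], evaluated at 0, gives
    $B(\xi) \le a(\xi)\cdot\xi$. Taking [t = xi i] and summing over the coordinates produces the
    factors 2 and [d.+1]. *)
Lemma structure_conditions_ext : exists C ba, structure_conditions leb p flux_ext energy_ext C ba.
Proof.
have [C C0 hC] := flux_growth; have ia1 := a1_itg.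
have n1 : 1 <= d.+1%:R :> R by rewrite ler1n.
exists (d.+1%:R * (2 * C)), (fun x => d.+1%:R * apow p' ((a1 \_ Omega) x)); split.
- by move=> i; exact: caratheodory_superposable.
- apply: caratheodory_superposable; first exact: mOmega.
  have [mA cA] := calA_carath; split.
    by move=> xi; apply: measurable_funB.
  apply: filterS cA => x cx Ox xi; exact: (cvgB (cx Ox xi) (cvg_cst _)).
- exact: energy_convex.
- exact: energy_ge0.
- by apply: aeW => x; exact: energy_0.
- by rewrite !mulr_ge0.
- exact: itgZ.
- apply: filterS hC => x h xi i t; apply: le_trans (h xi i t) _.
  have G0 : 0 <= gpow p xi + apow p t by rewrite addr_ge0 ?gpow_ge0 ?apow_ge0.
  apply: lerD; last by rewrite ler_peMl// apow_ge0.
  apply: ler_wpM2r => //; apply: (@le_trans _ _ (2 * C)); first by rewrite ler_peMl// ler1n.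
  by rewrite ler_peMl// mulr_ge0.
- apply: filterS2 hC energy_convex => x h hc xi.
  have := hc xi (fun=> 0); rewrite energy_0.
  have : - (\sum_i flux_ext x xi i * (0 - xi i)) <= \sum_(i < d.+1) (2 * C * gpow p xi + apow p' ((a1 \_ Omega) x)).
    rewrite -sumrN; apply: ler_sum => i _; rewrite sub0r mulrN opprK.
    apply: le_trans (ler_norm _) (le_trans (h xi i (xi i)) _); rewrite lerD2r.
    rewrite [2 * C]mulrC -mulrA; apply: ler_wpM2l => //.
    have := apow_le_gpow p xi i; lra.
  rewrite sumr_const card_ord -[X in _ <= X]mulr_natl mulrDr mulrA.
  set S := \sum_i _; set X := d.+1%:R * (2 * C) * _; set Y := d.+1%:R * _; lra.
Qed.

(** Off [Omega] the extended flux is zero, and the inequality rests on the vanishing of the gradient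
    component, a limit of derivatives of test functions. The factor $1/(d+1)$ compares [gpow] with
    the Euclidean length. *)
Lemma coercive_ext U : sobolev Omega p U -> \forall x \ae leb,
  eta / d.+1%:R * gpow p (grad_of U x) <=
  \sum_i flux_ext x (grad_of U x) i * U (Some i) x + (a2 \_ Omega) x.
Proof.
move=> [HU [f_ Cf cU]].
have [ph _ fU] := mconv_fconv (w1exp_gt1 p_gt1) (fun n => jet_inLq p_gt1 (Cf n)) HU cU.
apply: filterS2 (fconv_ae (w1exp_gt1 p_gt1) fU) a_coercive => x hU ha.
have n0 : 0 < d.+1%:R :> R by [].
have [Ox|Ox] := pselect (Omega x).
  have := ha Ox (\row_j U (Some j) x); rewrite /dot patch_in//.
  rewrite (eq_bigr (fun i => flux_ext x (grad_of U x) i * U (Some i) x)); last first.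
    by move=> i _; rewrite flux_in// mxE.
  have : eta / d.+1%:R * gpow p (grad_of U x) <= eta * enorm (\row_j U (Some j) x) `^ p.
    rewrite -mulrA; apply: ler_wpM2l; first exact: ltW.
    rewrite ler_pdivrMl//; have := gpow_le_enorm (\row_j U (Some j) x) p_gt0.
    by congr (_ <= _); apply: eq_bigr => i _; rewrite mxE.
  set S := \sum_i _; set X := eta * _; lra.
rewrite patch_out// addr0 (_ : gpow p _ = 0) ?mulr0.
  by rewrite sumr_ge0// => i _; rewrite flux_out// mul0r.
rewrite /gpow big1// => i _; rewrite (_ : grad_of U x i = 0) ?apow0 ?gt_eqF//.
apply/esym/(cvg_unique _ _ (hU (Some i))) => //.
rewrite (_ : (fun n => _) = fun=> 0); first exact: cvg_cst.
apply/funext => n; exact: (Cc_infty_off (Cc_infty_partial i (Cf _)) Ox).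
Qed.

End conditions.

End structure.

(** * Increasing bijections of the real line *)

Lemma increasing_inverse_continuous (R : realType) (h k : R -> R) :
  {homo h : s t / s < t} -> {homo k : s t / s < t} -> cancel h k -> cancel k h -> continuous h.
Proof.
move=> hh hk hK kK s; apply/cvgrPdist_lt => e e0.
(* The preimage under [h] of an interval around [h s] is the interval between the images of its ends
   under [k]. *)
have sI : s \in `](k (h s - e)), (k (h s + e))[.
  rewrite in_itv/= -{2 3}[s]hK; apply/andP; split; apply: hk; first by rewrite ltrBlDr ltrDl.
  by rewrite ltrDl.
apply: filterS (near_in_itvoo sI) => y; rewrite in_itv/= => /andP[h1 h2].
have := hh _ _ h1; have := hh _ _ h2; rewrite !kK => h3 h4.
by rewrite ltr_norml; apply/andP; split; lra.
Qed.

Lemma increasing_inverse (R : realType) (phi : R -> R) : {homo phi : s t / s < t} ->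
  (forall t, exists s, phi s = t) -> exists psi, [/\ cancel phi psi, cancel psi phi,
    continuous phi & continuous psi].
Proof.
move=> inc surj; have [psi hpsi] := choice surj.
have mono : {mono phi : s t / s < t}.
  by move=> s t; have [st|st|->] := ltgtP s t; [exact: inc|apply: lt_gtF; exact: inc|rewrite ltxx].
have inj : injective phi.
  by move=> s t st; apply: le_anti; rewrite !leNgt -[s < t]mono -[t < s]mono st ltxx.
have phiK : cancel phi psi by move=> s; apply: inj; rewrite hpsi.
have inc' : {homo psi : s t / s < t} by move=> s t st; rewrite -mono !hpsi.
exists psi; split => //; first exact: increasing_inverse_continuous inc inc' phiK hpsi.
exact: increasing_inverse_continuous inc' inc hpsi phiK.
Qed.

(** * Approximation from within the domain of the operator *)

Section resolvent_density.
Context {R : realType} {d : nat}.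
Local Notation V := 'rV[R]_d.+1.
Local Notation L := (lebRV R d).
Local Notation leb := (@leb R d).
Local Notation I f := (Rintegral leb setT (f : L -> R)).
Local Notation itg f := (@itg _ L R leb f).
Local Notation mf f := (measurable_fun [set: L] (f : L -> R)).
Let cmu := @leb_complete R d.
Local Notation D := 'I_d.+1.
Variables (Omega : set V) (p : R) (a : V -> V -> V) (calA : V -> V -> R).
Variables (a0 a1 a2 : V -> R) (eta : R) (phi psi : R -> R).
Hypothesis Omega_open : open Omega.
Hypothesis p_gt1 : 1 < p.
Hypothesis a_carath : forall i, caratheodory_fun Omega (fun x xi => a x xi 0 i).
Hypothesis calA_carath : caratheodory_fun Omega calA.
Hypothesis a0_Loo : inLp Omega +oo%E a0.
Hypothesis a1_Lp' : inLp Omega (p / (p - 1))%:E a1.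
Hypothesis a2_Lp : inLp Omega p%:E a2.
Hypothesis eta_gt0 : 0 < eta.
Hypothesis a_zero : {ae leb, forall x : lebRV R d, Omega x -> a x 0 = 0}.
Hypothesis a_growth : {ae leb, forall x : lebRV R d, Omega x -> forall xi,
  enorm (a x xi) <= a0 x * enorm xi `^ (p - 1) + a1 x}.
Hypothesis a_coercive : {ae leb, forall x : lebRV R d, Omega x -> forall xi,
  eta * enorm xi `^ p - a2 x <= dot (a x xi) xi}.
Hypothesis a_monotone : {ae leb, forall x : lebRV R d, Omega x -> forall xi1 xi2,
  0 <= dot (a x xi1 - a x xi2) (xi1 - xi2)}.
Hypothesis calA_gradient : {ae leb, forall x : lebRV R d, Omega x -> forall xi,
  differentiable (calA x) xi /\ forall h, 'd (calA x) xi h = dot (a x xi) h}.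
Hypothesis phiK : cancel phi psi.
Hypothesis psiK : cancel psi phi.
Hypothesis phi_cont : continuous phi.
Hypothesis psi_cont : continuous psi.
Hypothesis phi0 : phi 0 = 0.

Let psi0 : psi 0 = 0. Proof. by rewrite -phi0 phiK. Qed.
Let mOmega : measurable (Omega : set L). Proof. exact: measurable_open. Qed.
Let mpsi : measurable_fun setT psi. Proof. exact: continuous_measurable_fun. Qed.

Lemma itg_inLp1 (f : V -> R) : itg f -> inLp Omega 1%E f.
Proof.
move=> i; apply/(inLpE Omega _ (lexx 1)); have m : mf (f \_ Omega).
  by apply/(mf_patch mOmega); apply: measurable_funTS; exact: itg_mf i.
split; first exact: m.
apply: (@itg_le _ L R leb _ (fun x : L => `|f x|)); [exact: mf_apow| |exact: itg_norm].
apply: aeW => x; rewrite /apow powRr1 ?normr_ge0// normr_id; exact: patch_le.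
Qed.

Lemma bounded_inLoo (f : L -> R) (M : R) : mf f -> (\forall x \ae leb, `|f x| <= M) -> inLp Omega +oo%E f.
Proof.
move=> m h; apply/Lfun_ooP; split.
  by apply/(mf_patch mOmega); apply: measurable_funTS; exact: m.
by exists M; apply: filterS h => x; apply: le_trans; exact: patch_le.
Qed.

Lemma bounded_inL2 (f : L -> R) (M : R) : itg f -> (\forall x \ae leb, `|f x| <= M) -> inLp Omega 2%:E f.
Proof.
move=> i h; apply/(inLpE Omega); first lra.
have m : mf (f \_ Omega).
  by apply/(mf_patch mOmega); apply: measurable_funTS; exact: itg_mf i.
split; first exact: m.
apply: (@itg_le _ L R leb _ (fun x : L => M * `|f x|)); [exact: mf_apow| |by apply: itgZ; exact: itg_norm].
apply: filterS h => x h; rewrite (ger0_norm (apow_ge0 _ _)).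
apply: (@le_trans _ _ (apow 2 (f x))); first by apply: le_apow => //; exact: patch_le.
by rewrite apow2 -real_normK ?num_real// expr2 ler_wpM2r.
Qed.

Lemma weak_solution_subgrad U (v : V -> R) : sobolev Omega p U -> inLp Omega 2%:E v ->
  (forall Z, sobolev Omega p Z ->
    I (fun x => \sum_i flux_ext Omega a x (grad_of U x) i * Z (Some i) x) = I (fun x => v x * Z None x)) ->
  subgrad Omega p a (U None) v.
Proof.
move=> WU v2 hU; exists (fun x => \row_j U (Some j) x); split.
- exact: (sobolev_W0 p_gt1 mOmega).
- exact: v2.
move=> z H /(W0_sobolev p_gt1 mOmega) /hU E.
rewrite (@Rintegral_mkcond _ L R leb Omega) [RHS](@Rintegral_mkcond _ L R leb Omega).
apply: etrans (etrans E _); apply: eq_I => x; have [Ox|Ox] := pselect (Omega x).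
- rewrite patch_in// /dot; apply: eq_bigr => i _; rewrite flux_in// patch_in//.
- by rewrite patch_out// big1// => i _; rewrite patch_out// mulr0.
- by rewrite !patch_in.
- by rewrite !patch_out// mulr0.
Qed.

(** The witness is [u = psi w], where [w] approximates the resolvent of [z] at the parameter
    $2^{-n}$, so that [phi u = w]. On $K$, of finite measure, dominated convergence applies along an
    a.e. convergent subsequence; off $K$, $|\psi(w)| \le C 1_{w\ne0}$, and the measure of that set
    is at most $\int_K |w-z|$. *)
Lemma domain_approx z eps : Cc_infty Omega z -> 0 < eps ->
  exists2 u, dom_Aphi Omega p a phi u &
    itg u /\ I (fun x => `|psi (z x) - u x|) <= eps.
Proof.
move=> Cz e0.
have [Ca [ba aB]] := structure_conditions_ext Omega_open p_gt1 a_carath calA_carath a0_Loo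
  a1_Lp' a_zero a_growth a_monotone calA_gradient.
have WP := @sobolev_w1_space R d Omega p p_gt1.
have n0 : 0 < d.+1%:R :> R by [].
have eta0 : 0 < eta / d.+1%:R by rewrite divr_gt0.
have [_ ia2] := proj1 (inLpE Omega _ (ltW p_gt1)) a2_Lp.
have co := coercive_ext p_gt1 eta_gt0 a_coercive.
have [Mg [bu [bv [Mg0 zM zb]]]] := Cc_infty_bounds Cz.
have mz := Cc_infty_mf Cz.
pose K : set V := [set x | z x != 0].
have mK : measurable (K : set L).
  apply: measurable_open; rewrite (_ : K = z @^-1` [set t | t != 0]) //.
  apply: open_comp; last exact: open_neq.
  by move=> x _; apply: smooth_continuous; have [] := Cz.
have lK : (leb K < +oo)%E.
  apply: le_lt_trans (leb_box_fin bu bv); apply: le_measure; rewrite ?inE//; first exact: measurable_box.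
  by move=> x zx; apply: contrapT => /zb zx0; move: zx; rewrite /K /= zx0 eqxx.
pose kap : V -> R := \1_K.
have kap_itg : itg kap by exact: itg_indic.
have kap2 x : kap x = 0 \/ kap x = 1.
  by rewrite /kap indicE; case: (x \in K); [right|left].
have kap_z x : kap x * z x = z x.
  rewrite /kap indicE; have [|xK] := boolP (x \in K); first by rewrite mul1r.
  by rewrite mul0r; apply/esym/eqP; move: xK; rewrite notin_setE /K /= => /negP; rewrite negbK.
have kap_off x : kap x = 0 -> z x = 0 by move=> k0; rewrite -kap_z k0 mul0r.
have [C C0 hC] := continuous_bounded_on Mg psi_cont.
have /choice[Uv hUv] : forall n : nat, exists Uv, [/\ sobolev Omega p Uv.1, itg Uv.2,
  exists C, \forall x \ae leb, `|Uv.2 x| <= C,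
  forall Z, sobolev Omega p Z -> I (fun x => \sum_i flux_ext Omega a x (grad_of Uv.1 x) i * Z (Some i) x) = I (fun x => Uv.2 x * Z None x) &
  [/\ \forall x \ae leb, `|Uv.1 None x| <= Mg,
    itg (fun x => (1 - kap x) * `|Num.sg (Uv.1 None x)|),
    I (fun x => (1 - kap x) * `|Num.sg (Uv.1 None x)|) <= I (fun x => kap x * `|Uv.1 None x - z x|) &
    I (fun x => (Uv.1 None x - z x) ^+ 2) <= 2 * (1 / 2) ^+ n * I (fun x => energy_ext Omega calA x (grad_of (jet z) x))]].
  move=> n; have l0 : 0 < (1 / 2) ^+ n :> R by exact: exprn_gt0.
  have [U [v h]] := resolvent_approximation cmu p_gt1 aB WP l0 eta0 ia2 co (sobolev_jet p_gt1 Cz)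
    (erefl z) zM kap_itg kap2 kap_z.
  by exists (U, v).
pose w n : L -> R := (Uv n).1 None.
have Hw n : mf (w n) /\ itg (fun x => w n x ^+ 2).
  have [WU _ _ _ _] := hUv n; have [m i] := ws_Lq WP WU None; split; first exact: m.
  by move: i; under eq_fun do rewrite apow2.
pose q := fun _ : unit => 2 : R.
have q1 (i : unit) : 1 < q i by rewrite /q; lra.
have HU_ n : inLq leb q (fun _ => w n).
  by move=> i; split; [exact: (Hw n).1|rewrite /q; under eq_fun do rewrite apow2; exact: (Hw n).2].
have HU : inLq leb q (fun _ => z).
  by move=> i; split; [exact: mz|exact: (Cc_infty_apow (ltr0n R 2) Cz)].
have cU : mconv leb q (fun n _ => w n) (fun _ => z).
  move=> i; rewrite /q; apply: (@squeeze_cvgr _ _ _ _ (cst 0)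
     (fun n => (2 * I (fun x => energy_ext Omega calA x (grad_of (jet z) x))) * (1 / 2) ^+ n)).
  - apply: nearW => n; apply/andP; split.
      by apply: (I_apow_ge0 cmu); have [] := inLqB q1 (HU_ n) HU i.
    have [_ _ _ _ [_ _ _ h]] := hUv n; under eq_fun do rewrite apow2.
    by rewrite mulrAC; exact: h.
  - exact: cvg_cst.
  - exact: cvg_half.
have [ph _ fU] := mconv_fconv q1 HU_ HU cU.
have cw : \forall x \ae leb, (fun k => w (ph k) x) @ \oo --> z x.
  by apply: filterS (fconv_ae q1 fU) => x /(_ tt).
have bw : \forall x \ae leb, forall k, `|w (ph k) x| <= Mg.
  by apply: ae_foralln => k; have [_ _ _ _ []] := hUv (ph k).
have mkap : mf kap by exact: itg_mf kap_itg.
have kap0 x : 0 <= kap x by case: (kap2 x) => ->.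
have [_ c1] : itg (fun=> 0 : R) /\ (fun k => I (fun x => kap x * `|w (ph k) x - z x|)) @ \oo --> I (fun=> 0 : R).
  apply: (DCT cmu (g := fun x => 2 * Mg * kap x)).
  - by move=> k; apply: measurable_funM mkap _; apply: mf_norm; apply: measurable_funB (Hw _).1 mz.
  - apply: filterS cw => x c; rewrite -[X in _ --> X](mulr0 (kap x)); apply: cvgM; first exact: cvg_cst.
    rewrite -[X in _ --> X](normr0 R) -(subrr (z x)); apply: cvg_norm; apply: cvgB; [exact: c|exact: cvg_cst].
  - by apply: itgZ.
  - apply: filterS bw => x h k; rewrite normrM normr_id (ger0_norm (kap0 x)) mulrC ler_wpM2r//.
    by apply: le_trans (ler_normB _ _) _; have := h k; have := zM x; lra.
have [_ c2] : itg (fun=> 0 : R) /\ (fun k => I (fun x => kap x * `|psi (z x) - psi (w (ph k) x)|)) @ \oo --> I (fun=> 0 : R).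
  apply: (DCT cmu (g := fun x => 2 * C * kap x)).
  - move=> k; apply: measurable_funM mkap _; apply: mf_norm; apply: measurable_funB.
      exact: (measurableT_comp mpsi mz).
    exact: (measurableT_comp mpsi (Hw _).1).
  - apply: filterS cw => x c; rewrite -[X in _ --> X](mulr0 (kap x)); apply: cvgM; first exact: cvg_cst.
    rewrite -[X in _ --> X](normr0 R) -(subrr (psi (z x))); apply: cvg_norm; apply: cvgB; first exact: cvg_cst.
    by apply: (cvg_comp _ psi c); exact: psi_cont.
  - by apply: itgZ.
  - apply: filterS bw => x h k; rewrite normrM normr_id (ger0_norm (kap0 x)) mulrC ler_wpM2r//.
    by apply: le_trans (ler_normB _ _) _; have := hC _ (h k); have := hC _ (zM x); lra.
have C1 : 0 < C + 1 by rewrite ltr_wpDl.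
have e2 : 0 < eps / 2 by rewrite divr_gt0.
(* Division by [C + 1] instead of [C] allows [C = 0]. *)
have eC : 0 < eps / 2 / (C + 1) by rewrite divr_gt0.
move: c1 c2; rewrite !I0 => /cvgrPdist_le/(_ _ eC) n1 /cvgrPdist_le/(_ _ e2) n2.
have [k [h1 h2]] := filter_ex (filterI n1 n2).
have {}h1 : I (fun x => kap x * `|w (ph k) x - z x|) <= eps / 2 / (C + 1).
  by move: h1; rewrite /= sub0r normrN; apply: le_trans; exact: ler_norm.
have {}h2 : I (fun x => kap x * `|psi (z x) - psi (w (ph k) x)|) <= eps / 2.
  by move: h2; rewrite /= sub0r normrN; apply: le_trans; exact: ler_norm.
have {}bw : \forall x \ae leb, `|w (ph k) x| <= Mg by apply: filterS bw => x; exact.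
move: (hUv (ph k)) (Hw (ph k)) h1 h2 bw; rewrite /w; case: (Uv (ph k)) => U v /=.
move=> [WU iv [Cv vC] hU [_ isg sgle _]] [mw _] h1 h2 bw.
(* The indicator of $K \cup \{U \ne 0\}$: an integrable majorant, up to a constant, for bounded
   functions of [U] that vanish with it. *)
pose S x := kap x + (1 - kap x) * `|Num.sg (U None x)|.
have iS : itg S by exact: itgD kap_itg isg.
have sup_bound (h : R -> R) (M : R) : 0 <= M -> h 0 = 0 -> measurable_fun setT h ->
    (forall s, `|s| <= Mg -> `|h s| <= M) -> itg (fun x => h (U None x)).
  move=> M0 h00 mh hM; apply: (@itg_le _ L R leb _ (fun x : L => M * S x)).
  - exact: (measurableT_comp mh mw).
  - apply: filterS bw => x hx; rewrite /S normr_sg; have [->|u0] := eqVneq (U None x) 0.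
      by rewrite h00 normr0 mulr0 addr0 mulr_ge0.
    by rewrite mulr1 addrC subrK mulr1; exact: hM.
  - exact: itgZ.
have iu : itg (fun x => psi (U None x)) by exact: sup_bound C0 psi0 mpsi hC.
have iw : itg (U None) by exact: (sup_bound id Mg Mg0 erefl (@measurable_id _ _ _) (fun s h => h)).
exists (fun x => psi (U None x)).
  exists v; split; [exact: itg_inLp1|exact: itg_inLp1|].
  rewrite (_ : phi \o _ = U None); last by apply/funext => x /=; rewrite psiK.
  split.
  - by split; [exact: itg_inLp1|exact: bounded_inLoo bw].
  - by split; [exact: itg_inLp1|exact: (bounded_inLoo (itg_mf iv) vC)].
  - by apply: weak_solution_subgrad hU; [exact: WU|exact: bounded_inL2 iv vC].
split; first exact: iu.
have ipz : itg (fun x => psi (z x)).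
  apply: (@itg_le _ L R leb _ (fun x : L => C * kap x)).
  - exact: (measurableT_comp mpsi mz).
  - apply: aeW => x; case: (kap2 x) => kx; rewrite kx; last by rewrite mulr1; exact: hC.
    by rewrite kap_off// psi0 normr0 mulr0.
  - exact: itgZ.
have i1 : itg (fun x => `|psi (z x) - psi (U None x)|) by apply: itg_norm; exact: itgB ipz iu.
have i2 : itg (fun x => kap x * `|psi (z x) - psi (U None x)|).
  apply: (@itg_le _ L R leb _ (fun x : L => `|psi (z x) - psi (U None x)|)); [|apply: aeW => x|exact: i1].
    exact: measurable_funM mkap (itg_mf i1).
  by rewrite normrM normr_id (ger0_norm (kap0 x)) ler_piMl//; case: (kap2 x) => ->.
apply: (@le_trans _ _ (I (fun x => kap x * `|psi (z x) - psi (U None x)| +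
    C * ((1 - kap x) * `|Num.sg (U None x)|)))).
  apply: (I_le cmu); [|exact: i1|by apply: itgD i2 _; exact: itgZ].
  apply: filterS bw => x hx; case: (kap2 x) => kx; rewrite kx.
    rewrite kap_off// psi0 mul0r subr0 mul1r !add0r normrN normr_sg.
    have [->|u0] := eqVneq (U None x) 0; first by rewrite psi0 normr0 mulr0.
    by rewrite mulr1; exact: hC.
  by rewrite mul1r subrr mul0r mulr0 addr0.
rewrite ID; [|exact: i2|exact: itgZ].
rewrite IZ; last exact: isg.
rewrite [leRHS](splitr eps); apply: lerD h2 _.
apply: (@le_trans _ _ (C * (eps / 2 / (C + 1)))).
  by apply: ler_wpM2l => //; exact: le_trans sgle h1.
rewrite mulrA ler_pdivrMr// [leLHS]mulrC; apply: ler_wpM2l; first exact: ltW.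
by rewrite lerDl.
Qed.

End resolvent_density.

Unset Implicit Arguments.
Theorem theorem3p1 (R : realType) (d : nat) (Omega : set 'rV[R]_d.+1) (p : R)
    (a : 'rV[R]_d.+1 -> 'rV[R]_d.+1 -> 'rV[R]_d.+1)
    (calA : 'rV[R]_d.+1 -> 'rV[R]_d.+1 -> R)
    (a0 a1 a2 : 'rV[R]_d.+1 -> R) (eta : R) (phi : R -> R)
    (Omega_open : open Omega) (p_gt1 : 1 < p)
    (a_carath : forall i, caratheodory_fun Omega (fun x xi => a x xi 0 i))
    (calA_carath : caratheodory_fun Omega calA)
    (a0_Loo : inLp Omega +oo%E a0)
    (a1_Lp' : inLp Omega (p / (p - 1))%:E a1)
    (a2_Lp : inLp Omega p%:E a2)
    (eta_gt0 : 0 < eta)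
    (a_zero : {ae leb, forall x : lebRV R d, Omega x -> a x 0 = 0})
    (a_growth : {ae leb, forall x : lebRV R d, Omega x -> forall xi,
      enorm (a x xi) <= a0 x * enorm xi `^ (p - 1) + a1 x})
    (a_coercive : {ae leb, forall x : lebRV R d, Omega x -> forall xi,
      eta * enorm xi `^ p - a2 x <= dot (a x xi) xi})
    (a_monotone : {ae leb, forall x : lebRV R d, Omega x -> forall xi1 xi2,
      0 <= dot (a x xi1 - a x xi2) (xi1 - xi2)})
    (calA_gradient : {ae leb, forall x : lebRV R d, Omega x -> forall xi,
      differentiable (calA x) xi /\
      forall h, 'd (calA x) xi h = dot (a x xi) h})
    (phi_lip : locally_lipschitz phi)
    (phi_incr : {homo phi : s t / s < t})
    (phi_surj : forall t, exists s, phi s = t)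
    (phi0 : phi 0 = 0) :
  dense_in_L1 Omega (dom_Aphi Omega p a phi).
Proof.
have [psi [phiK psiK phi_cont psi_cont]] := increasing_inverse phi_incr phi_surj.
have mO : measurable (Omega : set (lebRV R d)) by exact: measurable_open.
move=> f fL1 eps eps0; have [mf if1] := proj1 (inLpE Omega f (lexx 1)) fL1.
have iff : itg leb (f \_ Omega).
  apply: (@itg_le _ (lebRV R d) R leb _ (fun x => apow 1 ((f \_ Omega) x))); [exact: mf| |exact: if1].
  by apply: aeW => x; rewrite /apow powRr1.
(* Two errors of [eps / 3] leave room for the strict inequality in the definition of density. *)
have e3 : 0 < eps / 3 by rewrite divr_gt0.
have [|z Cz [iz fz]] := image_density Omega_open phi_cont psi_cont phi0 phiK iff _ e3.
  by move=> x; exact: patch_out.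
have [u Du [iu uz]] := domain_approx Omega_open p_gt1 a_carath calA_carath a0_Loo a1_Lp' a2_Lp
  eta_gt0 a_zero a_growth a_coercive a_monotone calA_gradient phiK psiK psi_cont phi0 Cz e3.
exists u => //.
have m1 : measurable_fun [set: lebRV R d] ((f \- u) \_ Omega).
  apply/(mf_patch mO); apply: measurable_funB; first by apply/(mf_patch mO).
  by apply: measurable_funTS; exact: itg_mf iu.
have i1 : itg leb (fun x => `|(f \_ Omega) x - psi (z x)|) by apply: itg_norm; exact: itgB.
have i2 : itg leb (fun x => `|psi (z x) - u x|) by apply: itg_norm; exact: itgB.
have dom x : `|((f \- u) \_ Omega) x| <= `|(f \_ Omega) x - psi (z x)| + `|psi (z x) - u x|.
  have [Ox|Ox] := pselect (Omega x); last by rewrite (patch_out (f \- u) Ox) normr0 addr_ge0.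
  by rewrite !patch_in//; exact: ler_distD.
have i3 : itg leb ((f \- u) \_ Omega).
  apply: (@itg_le _ (lebRV R d) R leb _ (fun x => `|(f \_ Omega) x - psi (z x)| + `|psi (z x) - u x|)).
  - exact: m1.
  - exact: aeW.
  - exact: itgD.
have i4 := itg_norm i3.
have E : (fun x => apow 1 (((f \- u) \_ Omega) x)) = (fun x => `|((f \- u) \_ Omega) x|).
  by apply/funext => x; rewrite /apow powRr1.
rewrite /Lnorm_on LnormE E// lte_fin invr1 powRr1; last exact: Rintegral_ge0.
apply: (@le_lt_trans _ _ (eps / 3 + eps / 3)); last lra.
apply: le_trans (lerD fz uz); rewrite -ID//.
by apply: (I_le (@leb_complete R d)); [exact: aeW|exact: i4|exact: itgD].
Qed.
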